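(* Let $N\ge2$ be an integer and $E_N=\exp\big(\sum_{\nu=0}^\infty N^{-\nu}z^{N^\nu}\big)$. There is a unique premeasure $\mu\in P(\mathbb T)$ with $w(\mu)=E_N$. We have $\mu\in P^+_{\kappa_1}(\mathbb T)\cap P^-_{\kappa_1}(\mathbb T)$, $N_*\mu=\mu$ and $\mu*\mu=\mu$. The premeasure $\mu$ is atomless and it is not a (signed) measure. Its cumulative mass function and Herglotz transform are $$\hat\mu(\theta)=-\frac1\pi\sum_{\nu=0}^\infty N^{-\nu}\sin(N^\nu\theta)\qquad\text{and}\qquad h_\mu(z)=-2\sum_{\nu=0}^\infty z^{N^\nu}.$$ The function $f_\mu=\exp(-h_\mu)=\prod_{\nu=0}^\infty\exp(2z^{N^\nu})$ is a unit in $\mathcal A_1$ which is not in the Nevanlinna class $\mathcal N$. The $\kappa_1$-singular measure $\mu_s=\sigma_{f_\mu}$ vanishes.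
   Context: $\mathbb T$ is the unit circle, $D$ the open unit disc, $\lambda$ the Haar probability measure on $\mathbb T$, $\varphi_N(\zeta)=\zeta^N$. An arc is a connected subset of $\mathbb T$, $|C|=\lambda(C)$. A premeasure is a function $\mu$ from arcs to $\mathbb R$ with $\mu(\emptyset)=\mu(\mathbb T)=0$, additive on disjoint arcs whose union is an arc, and with $\mu(C_\nu)\to0$ for decreasing sequences of arcs with empty intersection; it extends additively to finite disjoint unions of arcs. $P(\mathbb T)$ is the space of premeasures; it contains the finite real Borel measures of total mass $0$. $\mu$ is atomless if $\mu\{\zeta\}=0$ for all $\zeta\in\mathbb T$. $(N_*\mu)(C)=\mu(\varphi_N^{-1}(C))$. The cumulative mass function is $\hat\mu(\theta)=\mu(\{e^{it}:0\le t<\theta\})$, $0\le\theta<2\pi$. To $\mu$ is attached the real distribution $T_\mu=2\pi\frac{d}{d\theta}(\hat\mu\lambda)$ on $\mathbb T=\mathbb R/2\pi\mathbb Z$, which determines $\mu$; convolution $*$ is convolution of distributions on the group $\mathbb T$, so that an identity between $\mu*\mu$ and a premeasure is an identity of the attached distributions. With $c_\nu(T)=T(e^{-i\nu\theta})$, the Herglotz transform is $h_\mu(z)=c_0(T_\mu)+2\sum_{\nu\ge1}c_\nu(T_\mu)z^\nu$ (here $c_0(T_\mu)=0$); $G_\mu(z)=\frac1{2\pi i}\int_0^zh_\mu(t)\frac{dt}t$; and $w(\mu)=\exp(-\pi iG_\mu)$, viewed as a power series in $1+z\mathbb C[[z]]$. $\kappa_1(x)=x(1+|\log x|)$ on $(0,1]$,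 $\kappa_1(0)=0$. $P^-_{\kappa_1}(\mathbb T)$ is the set of premeasures for which there is $a\ge0$ with $\mu(C)\le a\,\kappa_1(|C|)$ for all arcs $C$; $P^+_{\kappa_1}(\mathbb T)=-P^-_{\kappa_1}(\mathbb T)$. $\mathcal A_1$ is the algebra of analytic $f$ on $D$ with $|f(z)|\le a_f(1-|z|)^{-r_f}$ for some constants $a_f,r_f\ge0$. $\mathcal N$ is the algebra of quotients $g/h$ of bounded analytic functions on $D$ with $h$ zero-free. For finite $\emptyset\ne E\subset\mathbb T$, $\kappa_1(E)=\sum_I\kappa_1(|I|)$ over the components of $\mathbb T\setminus E$, and for closed $E\ne\emptyset$, $\kappa_1(E)=\sup\{\kappa_1(E_1):E_1\subset E\text{ finite}\}$; $\kappa_1(\emptyset)=0$. A $\kappa_1$-Carleson set is a closed $F\subset\mathbb T$ with $\lambda(F)=0$, $\kappa_1(F)<\infty$. For such $F$ put $\mu(F)=-\sum_J\mu(J)$ over the components $J$ of $\mathbb T\setminus F$ (absolutely convergent for $\mu\in P^{\pm}_{\kappa_1}(\mathbb T)$). The $\kappa_1$-singular measure $\mu_s$ is the unique function on the Borel sets with closure a $\kappa_1$-Carleson set which restricts to a finite real measure on the Borel algebra of each $\kappa_1$-Carleson set and satisfies $\mu_s(F)=\mu(F)$ for all $\kappa_1$-Carleson sets $F$. For $\mu\in P^+_{\kappa_1}(\mathbb T)$ and $f=f_\mu=\exp(-h_\mu)$ one also writes $\sigma_f$ for $\mu_s$.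
   Formalization: The identity μ∗μ = μ is replaced by μ∗μ = −μ: with the stated normalizations h_μ = −2Σz^{N^ν} forces the Fourier coefficients of μ at N^ν to be −1, while those of μ∗μ are +1, so the identity as printed has the wrong sign. *)

(* Defs.v *)
From HB Require Import structures.
From mathcomp Require Import all_boot all_order all_algebra.
From mathcomp Require Import complex.
From mathcomp Require Import all_classical all_reals all_analysis.
Import Order.TTheory GRing.Theory Num.Theory numFieldNormedType.Exports.

Set Implicit Arguments.
Unset Strict Implicit.
Unset Printing Implicit Defensive.

Local Open Scope classical_set_scope.
Local Open Scope ring_scope.
Local Open Scope complex_scope.

(* The complex numbers R[i], presented as the carrier of a numClosedFieldType so
   that they receive the norm topology and the normed-module structure over
   themselves.  In particular [derivable f z 1] is complex differentiability. *)
Definition Cx (R : realType) : numClosedFieldType := R[i].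

Definition cis (R : realType) (t : R) : Cx R := cos t +i* sin t.

Definition cexp (R : realType) (z : Cx R) : Cx R :=
  (expR (complex.Re z))%:C * cis (complex.Im z).

Definition cabs (R : realType) (z : Cx R) : R := complex.Re `|z|.

Definition disc (R : realType) : set (Cx R) := [set z | cabs z < 1].
Arguments disc : clear implicits.

Definition circle (R : realType) : set (Cx R) := [set z | cabs z = 1].
Arguments circle : clear implicits.

Definition haar (R : realType) (A : set (Cx R)) : \bar R :=
  (((2 * pi)^-1)%:E *
     lebesgue_measure ([set t : R | (0 <= t < 2 * pi)%R] `&` cis (R:=R) @^-1` A))%E.

Definition is_arc (R : realType) (A : set (Cx R)) : Prop :=
  A `<=` circle R /\ connected A.

Definition arc_length (R : realType) (A : set (Cx R)) : R := fine (haar A).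

Definition components (R : realType) (A : set (Cx R)) : set (set (Cx R)) :=
  [set connected_component A z | z in A].

(* A function on arcs is encoded as a function on all sets that is 0 on sets
   which are not arcs; equality of premeasures is thus equality on arcs. *)
Record premeasure (R : realType) := Premeasure {
  pm_val :> set (Cx R) -> R ;
  pm_off_arcs : forall A, ~ is_arc A -> pm_val A = 0 ;
  pm_set0 : pm_val set0 = 0 ;
  pm_circle : pm_val (circle R) = 0 ;
  pm_additive : forall A B, is_arc A -> is_arc B -> is_arc (A `|` B) ->
    A `&` B = set0 -> pm_val (A `|` B) = pm_val A + pm_val B ;
  pm_continuous : forall A : nat -> set (Cx R),
    (forall n, is_arc (A n)) -> (forall n, A n.+1 `<=` A n) ->
    \bigcap_n A n = set0 -> (fun n => pm_val (A n)) @ \oo --> (0 : R)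
}.

(* Additive extension to finite disjoint unions of arcs; the value does not
   depend on the chosen decomposition. *)
Definition pm_ext (R : realType) (mu : premeasure R) (A : set (Cx R)) : R :=
  xget 0 [set x : R | exists (n : nat) (I : 'I_n -> set (Cx R)),
    [/\ forall i, is_arc (I i), trivIset setT I, \bigcup_i I i = A
      & x = \sum_(i < n) mu (I i)]].

Definition pm_push (R : realType) (N : nat) (mu : premeasure R)
    (A : set (Cx R)) : R :=
  pm_ext mu (circle R `&` [set z | A (z ^+ N)]).

Definition atomless (R : realType) (mu : premeasure R) : Prop :=
  forall z, circle R z -> mu [set z] = 0.

Definition cumul (R : realType) (mu : premeasure R) (theta : R) : R :=
  mu (cis (R:=R) @` [set t : R | 0 <= t < theta]).

Definition borelC (R : realType) := g_sigma_algebraType (@open (Cx R)).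

(* Library charges are finite signed measures; arcs are Borel subsets of C, and
   a Borel measure on the circle is a Borel measure on C read on its subsets. *)
Definition is_signed_measure (R : realType) (mu : premeasure R) : Prop :=
  exists nu : {charge set (borelC R) -> \bar R},
    forall A, is_arc A -> nu A = (mu A)%:E.

(* A real distribution on R/2piZ is represented by its values on real test
   functions, i.e. smooth 2pi-periodic functions on the line. *)
Definition test_function (R : realType) (phi : R -> R) : Prop :=
  (forall n x, derivable (derive1n n phi) x 1) /\
  (forall x, phi (x + 2 * pi) = phi x).

Definition dist_mul_haar (R : realType) (u phi : R -> R) : R :=
  (2 * pi)^-1 *
    (\int[lebesgue_measure]_(t in [set t : R | (0 <= t < 2 * pi)%R])
       (u t * phi t))%R.

Definition dist_deriv (R : realType) (S : (R -> R) -> R) (phi : R -> R) : R :=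
  - S (derive1 phi).

Definition dist_of (R : realType) (mu : premeasure R) (phi : R -> R) : R :=
  2 * pi * dist_deriv (dist_mul_haar (cumul mu)) phi.

Definition dist_conv (R : realType) (S T : (R -> R) -> R) (phi : R -> R) : R :=
  S (fun x => T (fun y => phi (x + y))).

(* The value of the complex-linear extension of T at e^{-i n theta}. *)
Definition fourier (R : realType) (T : (R -> R) -> R) (n : nat) : Cx R :=
  T (fun t => cos (n%:R * t)) -i* T (fun t => sin (n%:R * t)).

Definition herglotz (R : realType) (mu : premeasure R) (z : Cx R) : Cx R :=
  fourier (dist_of mu) 0 +
  2 * limn (fun n => \sum_(1 <= k < n) fourier (dist_of mu) k * z ^+ k).

Definition cintegral (R : realType) (D : set R) (f : R -> Cx R) : Cx R :=
  (\int[lebesgue_measure]_(s in D) complex.Re (f s))%R +i*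
  (\int[lebesgue_measure]_(s in D) complex.Im (f s))%R.

(* Integral along the segment t = s z with 0 <= s <= 1, where dt / t = ds / s. *)
Definition gtransform (R : realType) (mu : premeasure R) (z : Cx R) : Cx R :=
  (2 * pi%:C * 'i)^-1 *
  cintegral [set s : R | 0 <= s <= 1]
    (fun s => herglotz mu (s%:C * z) / s%:C).

Definition wtransform (R : realType) (mu : premeasure R) (z : Cx R) : Cx R :=
  cexp (- (pi%:C * 'i * gtransform mu z)).

Definition has_power_series (R : realType) (f : Cx R -> Cx R)
    (a : nat -> Cx R) : Prop :=
  forall z, disc R z -> series (fun n => a n * z ^+ n) @ \oo --> f z.

(* Exponential of a formal power series with a 0 = 0: the n-th coefficient only
   involves the powers k <= n and the coefficients of index at most n. *)
Definition fps_exp (R : realType) (a : nat -> Cx R) (n : nat) : Cx R :=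
  (\sum_(k < n.+1) (k`!%:R)^-1 *: (\poly_(i < n.+1) a i) ^+ k)`_n.

(* Coefficients of exp (sum_nu N^-nu z^(N^nu)).  For 1 < N one has nu < N ^ nu,
   so only nu <= n can contribute to the coefficient of z^n. *)
Definition EN (R : realType) (N : nat) : nat -> Cx R :=
  fps_exp (fun n => \sum_(nu < n.+1 | n == (N ^ nu)%N) (N%:R ^- nu : Cx R)).

(* At x = 0 this is 0 because of the factor x. *)
Definition kappa1 (R : realType) (x : R) : R := x * (1 + `|ln x|).

Definition kappa_minus (R : realType) (mu : set (Cx R) -> R) : Prop :=
  exists2 a : R, 0 <= a &
    forall A, is_arc A -> mu A <= a * kappa1 (arc_length A).

Definition kappa_plus (R : realType) (mu : set (Cx R) -> R) : Prop :=
  kappa_minus (fun A => - mu A).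

Definition analytic_disc (R : realType) (f : Cx R -> Cx R) : Prop :=
  forall z, disc R z -> derivable f z 1.

Definition in_A1 (R : realType) (f : Cx R -> Cx R) : Prop :=
  analytic_disc f /\
  exists a r : R, [/\ 0 <= a, 0 <= r &
    forall z, disc R z -> cabs (f z) <= a * (1 - cabs z) `^ (- r)].

Definition unit_A1 (R : realType) (f : Cx R -> Cx R) : Prop :=
  in_A1 f /\
  exists2 g, in_A1 g & forall z, disc R z -> f z * g z = 1.

Definition bounded_analytic (R : realType) (f : Cx R -> Cx R) : Prop :=
  analytic_disc f /\ exists M : R, forall z, disc R z -> cabs (f z) <= M.

Definition nevanlinna (R : realType) (f : Cx R -> Cx R) : Prop :=
  exists g h : Cx R -> Cx R,
    [/\ bounded_analytic g, bounded_analytic h,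
        forall z, disc R z -> h z != 0
      & forall z, disc R z -> f z = g z / h z].

Definition fpm (R : realType) (mu : premeasure R) (z : Cx R) : Cx R :=
  cexp (- herglotz mu z).

Definition kappa_fin (R : realType) (E : set (Cx R)) : \bar R :=
  if pselect (E = set0) then 0%E
  else \esum_(I in components (circle R `\` E)) (kappa1 (arc_length I))%:E.

(* The supremum may include the empty subset, which contributes 0; this also
   gives the value 0 for E empty. *)
Definition kappa_set (R : realType) (E : set (Cx R)) : \bar R :=
  ereal_sup [set kappa_fin E1 | E1 in
               [set E1 : set (Cx R) | finite_set E1 /\ E1 `<=` E]].

Definition carleson (R : realType) (F : set (Cx R)) : Prop :=
  [/\ closed F, F `<=` circle R, haar F = 0%E & (kappa_set F < +oo)%E].

(* Sum of an absolutely convergent family, as the difference of the sums of its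
   positive and negative parts. *)
Definition abs_sum (R : realType) (S : set (set (Cx R)))
    (a : set (Cx R) -> R) : R :=
  fine (\esum_(J in S) (Num.max (a J) 0)%:E) -
  fine (\esum_(J in S) (Num.max (- a J) 0)%:E).

Definition pm_closed (R : realType) (mu : premeasure R) (F : set (Cx R)) : R :=
  - abs_sum (components (circle R `\` F)) mu.

Definition singular_domain (R : realType) (B : set (Cx R)) : Prop :=
  measurable (B : set (borelC R)) /\ carleson (closure B).

(* Only the values of m on the sets of [singular_domain] are relevant. *)
Definition is_singular_measure (R : realType) (mu : premeasure R)
    (m : set (Cx R) -> R) : Prop :=
  (forall F, carleson F ->
     exists nu : {charge set (borelC R) -> \bar R},
       forall B : set (borelC R), measurable B -> B `<=` F ->
         nu B = (m B)%:E) /\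
  (forall F, carleson F -> m F = pm_closed mu F).

(* Main.v *)
Require Import Defs.
From HB Require Import structures.
From mathcomp Require Import all_boot all_order all_algebra.
From mathcomp Require Import complex ring lra zify.
From mathcomp Require Import all_classical all_reals all_analysis.
From mathcomp Require Import measurable_realfun.
Import Order.TTheory GRing.Theory Num.Theory numFieldNormedType.Exports.
Set Implicit Arguments.
Unset Strict Implicit.
Unset Printing Implicit Defensive.
Local Open Scope classical_set_scope.
Local Open Scope ring_scope.
Local Open Scope complex_scope.


(** Let S(x) = - (1/pi) sum_k N^-k sin(N^k x) ([weil], with partial sums [wei]); this is to be the
    cumulative mass function. An increment of the k-th term is at most |y - x| and at most 2 N^-k.
    With d = |y - x| / 2 pi, using the first bound for about 2 |log d| terms and the second for the
    others gives |S(y) - S(x)| <= C kappa_1(d), and the same C serves for all tails S - [wei n]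
    ([weil_osc_kappa]). Hence the differences of S define a premeasure [wpm] without atoms and with
    a two-sided kappa_1 bound; its additivity is inherited from the measures with densities
    [dwei n], of which it is the limit on arcs ([mass_sum]).

    The attached distribution has Fourier coefficient -1 at each N^k and 0 at the other positive
    indices ([fcoef_wpm]). This yields the Herglotz transform -2 sum z^(N^k) and the power series of
    w(mu), where the formal exponential is compared with the analytic one by means of nonnegative
    coefficients ([fps_exp_cvg]). Convolution multiplies Fourier coefficients, so the convolution
    square is the negative of mu ([J_weil_conv]). Invariance under z^N says that the sum of S((x + 2
    pi j)/N) over j < N is S(x): the k = 0 term cancels over the N points and the other terms move
    down by one index ([sum_weil_shift]).

    For uniqueness, the exponential is injective near 0, so w(nu) determines the Fourier
    coefficients of the cumulative mass function at all nonzero frequencies ([fcoef_eq]). A bounded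
    function orthogonal to all trigonometric polynomials cannot stay above a positive constant on an
    interval ([trigp_orth_pos]); together with left continuity and the value 0 at 2 pi this
    determines the cumulative mass function everywhere ([cumul_eq]), and with it the premeasure on
    all arcs ([pm_arc_eq]).

    For the growth, exp(x) <= (1 + x)^2 on [0, 1] and a telescoping product give exp|sum z^(N^k)| <=
    (1 - |z|)^-2 ([exp_Lac_le]), so f_mu and its inverse are in A_1. If f_mu were a quotient of
    bounded functions, the positive part of log|f_mu| would have bounded means over circles
    ([jensen_bound], which rests on the mean value property). But the fourth moment of a lacunary
    cosine sum is controlled by the square of its second moment ([J_lac4]), so its L^1 norm is
    bounded below by its L^2 norm ([J_norm_lac]), which is unbounded as the radius tends to 1. The
    same L^1 bound, applied to the increments of S over grids of N^n arcs, shows that the variation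
    of mu is infinite ([J_osc_ge]), so mu is not a signed measure.

    Finally, mu(F) = 0 for every Carleson set F ([pm_closed_wpm]). On finitely many components of
    the complement mu is close to the measure with density [dwei n]; this has total mass 0, and
    almost nothing is left outside enough components because F is null. The components added later
    cost at most C times a tail of the convergent sum of kappa_1(|J|). A charge that vanishes on
    closed sets vanishes ([charge_closed_eq0]), whence mu_s = 0. *)

Notation rint D f := (lebesgue_measure.-integrable D (EFin \o f)).
Notation leb R := (@lebesgue_measure R).

(** * Lebesgue integration on the real line *)

Section RealIntegral.
Context {R : realType}.
Implicit Types (f g F G : R -> R) (a b c k e x df : R) (D : set R).

Lemma twopi_gt0 : 0 < 2 * pi :> R.
Proof. by rewrite mulr_gt0 ?pi_gt0. Qed.

Lemma derivable_cont f x : derivable f x 1 -> {for x, continuous f}.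
Proof. by move=> /derivable1_diffP/differentiable_continuous. Qed.

Lemma is_derive_cont f x df : is_derive x 1 f df -> {for x, continuous f}.
Proof. by move=> [/derivable_cont]. Qed.

Lemma rint_cont f a b : continuous f -> rint `[a, b] f.
Proof.
move=> cf; apply: continuous_compact_integrable; first exact: segment_compact.
exact: continuous_subspaceT.
Qed.

Lemma rint_bnd D f M : measurable D -> (leb R D < +oo)%E ->
  measurable_fun D f -> (forall x, D x -> `|f x| <= M) -> rint D f.
Proof.
move=> mD fD mf bf; apply: measurable_bounded_integrable => //.
exists M; split; first exact: num_real.
by move=> y My x Dx /=; rewrite (le_trans (bf _ Dx))// ltW.
Qed.

Lemma rint_sub D E f : measurable D -> measurable E -> E `<=` D ->
  rint D f -> rint E f.
Proof. by move=> mD mE ED; apply: integrableS. Qed.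

Lemma rintD D f g : measurable D -> rint D f -> rint D g ->
  rint D (fun x => f x + g x).
Proof. by move=> mD fi gi; exact: (@integrableD _ _ _ (leb R) _ mD _ _ fi gi). Qed.

Lemma rintZ D f c : measurable D -> rint D f -> rint D (fun x => c * f x).
Proof. by move=> mD fi; exact: (@integrableZl _ _ _ (leb R) _ mD c _ fi). Qed.

Lemma rintN D f : measurable D -> rint D f -> rint D (fun x => - f x).
Proof. by move=> mD fi; exact: (@integrableN _ _ _ (leb R) _ _ fi). Qed.

Lemma rintB D f g : measurable D -> rint D f -> rint D g ->
  rint D (fun x => f x - g x).
Proof. by move=> mD fi gi; exact: (@integrableB _ _ _ (leb R) _ mD _ _ fi gi). Qed.

Lemma rint_norm D f : measurable D -> rint D f -> rint D (fun x => `|f x|).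
Proof. by move=> mD fi; exact: (@integrable_abse _ _ _ (leb R) _ _ fi). Qed.

Lemma rint_sum D (I : Type) (s : seq I) (f : I -> R -> R) : measurable D ->
  (forall i, rint D (f i)) -> rint D (fun x => \sum_(i <- s) f i x).
Proof.
move=> mD fi; elim: s => [|i s IH].
  have -> : (fun x => \sum_(i <- [::]) f i x) = cst 0.
    by apply/funext => x; rewrite big_nil.
  exact: integrable0.
have -> : (fun x => \sum_(i <- i :: s) f i x) =
    (fun x => f i x + \sum_(i <- s) f i x).
  by apply/funext => x; rewrite big_cons.
exact: rintD.
Qed.

Lemma Rintegral_sum D (I : Type) (s : seq I) (f : I -> R -> R) : measurable D ->
  (forall i, rint D (f i)) ->
  \int[leb R]_(x in D) (\sum_(i <- s) f i x) =
  \sum_(i <- s) \int[leb R]_(x in D) f i x.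
Proof.
move=> mD fi; elim: s => [|i s IH].
  under eq_Rintegral do rewrite big_nil.
  by rewrite big_nil Rintegral_cst// mul0r.
under eq_Rintegral do rewrite big_cons.
by rewrite big_cons RintegralD// ?IH//; exact: rint_sum.
Qed.

Lemma RintegralN D f : measurable D -> rint D f ->
  \int[leb R]_(x in D) (- f x) = - \int[leb R]_(x in D) f x.
Proof.
move=> mD fi; under eq_Rintegral do rewrite -mulN1r.
by rewrite RintegralZl// mulN1r.
Qed.

(* Integrals of functions that are e-close to a constant. *)
Lemma Rintegral_close D f k e : measurable D -> (leb R D < +oo)%E -> rint D f ->
  (forall x, D x -> `|f x - k| <= e) ->
  `|\int[leb R]_(x in D) f x - k * fine (leb R D)| <= e * fine (leb R D).
Proof.
move=> mD fD fi fk.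
have ci r : rint D (cst r).
  by apply: (@rint_bnd _ _ `|r|) => //; exact: measurable_cst.
rewrite -(Rintegral_cst (leb R) mD k) -(Rintegral_cst (leb R) mD e) -RintegralB//.
have fki := rintB mD fi (ci k).
rewrite (le_trans (@le_normr_Rintegral _ _ _ (leb R) _ _ mD fki))// //.
apply: (@le_Rintegral _ _ _ (leb R)) => //; [exact: rint_norm|exact: ci].
exact: (ci k).
Qed.

(** The limit is integrable because it differs from [fn 0] by a bounded measurable function, and the
    integrals differ by at most [e n] times the finite measure of D. *)
Lemma Rintegral_unif D (fn : nat -> R -> R) f (e : nat -> R) :
  measurable D -> (leb R D < +oo)%E -> (forall n, rint D (fn n)) ->
  e @ \oo --> (0 : R) -> (forall n x, D x -> `|fn n x - f x| <= e n) ->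
  rint D f /\ (fun n => \int[leb R]_(x in D) fn n x) @ \oo -->
    \int[leb R]_(x in D) f x.
Proof.
move=> mD fD fni e0 fne.
have mf : measurable_fun D f.
  apply: (measurable_fun_cvg (h := fn)) => //.
    by move=> n; case/integrableP: (fni n) => /measurable_EFinP.
  move=> x Dx; apply/cvgrPdist_le => eps eps0.
  have /cvgrPdist_le /(_ _ eps0)[m _ H] := e0.
  exists m => // n /= mn; rewrite distrC (le_trans (fne n x Dx))//.
  have := H n mn; rewrite sub0r normrN; apply: le_trans; exact: ler_norm.
have fi : rint D f.
  have dint : rint D (fun x => f x - fn 0%N x).
    apply: (@rint_bnd _ _ (e 0%N)) => //.
      apply: measurable_funB => //.
      by case/integrableP: (fni 0%N) => /measurable_EFinP.
    by move=> x Dx; rewrite distrC fne.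
  have := rintD mD dint (fni 0%N).
  by under eq_fun do rewrite subrK.
split => //; apply/cvgrPdist_le => eps eps0.
have e0' : (fun n => e n * fine (leb R D)) @ \oo --> (0 : R).
  by rewrite -[X in _ --> X](mul0r (fine (leb R D))); apply: cvgMr_tmp.
have /cvgrPdist_le /(_ _ eps0)[m _ H] := e0'.
exists m => // n /= mn; rewrite -RintegralB//.
have fki := rintB mD fi (fni n).
have := Rintegral_close (k := 0) (e := e n) mD fD fki.
rewrite mul0r subr0 => /(_ _)/le_trans; apply.
  by move=> x Dx; rewrite subr0 distrC fne.
by have := H n mn; rewrite sub0r normrN; apply: le_trans; exact: ler_norm.
Qed.

Lemma FTC2 f F a b : a <= b -> continuous f ->
  (forall x, is_derive x 1 F (f x)) ->
  \int[leb R]_(x in `[a, b]) f x = F b - F a.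
Proof.
rewrite le_eqVlt => /predU1P[->|ab] cf dF.
  by rewrite set_itv1 Rintegral_set1 subrr.
rewrite /Rintegral (@continuous_FTC2 _ f F)//.
- exact: continuous_subspaceT.
- split.
  + by move=> x _; case: (dF x).
  + by apply: cvg_at_right_filter; apply: is_derive_cont.
  + by apply: cvg_at_left_filter; apply: is_derive_cont.
- by move=> x _; rewrite derive1E; apply: derive_val.
Qed.

Lemma Rintegral_split f a b c : a <= b -> b <= c -> rint `[a, c] f ->
  \int[leb R]_(x in `[a, c]) f x =
  \int[leb R]_(x in `[a, b]) f x + \int[leb R]_(x in `[b, c]) f x.
Proof.
move=> ab bc fi.
have := Rintegral_itvB (x := b) fi; rewrite !bnd_simp => /(_ ab bc) H.
rewrite -[LHS](subrK (\int[leb R]_(x in `[a, b]) f x)) H addrC; congr (_ + _).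
rewrite Rintegral_itv_obnd_cbnd//.
apply: rint_sub fi => //; apply: subset_itv; rewrite bnd_simp//.
Qed.

(** The difference of two integrals in [F] treats both signs of x at once, since one of the two
    intervals is always empty or a point. Near x0 it equals, up to a constant, the integral from a
    base point [a] to the left of both x0 and 0, to which the fundamental theorem applies. *)
Lemma antiderivative f : continuous f ->
  exists F, forall x, is_derive x 1 F (f x).
Proof.
move=> cf.
pose F x := \int[leb R]_(t in `[0, x]) f t - \int[leb R]_(t in `[x, 0]) f t.
exists F => x0.
pose a := - `|x0| - 1.
have a0 : a < 0 by rewrite /a; have := normr_ge0 x0; lra.
have ax0 : a < x0 by rewrite /a; have := ler_norm (- x0); rewrite normrN; lra.
pose u := x0 + 1.
have ri b c := @rint_cont f b c cf.
have FE x : a <= x -> F x =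
    \int[leb R]_(t in `[a, x]) f t - \int[leb R]_(t in `[a, 0]) f t.
  move=> ax; rewrite /F; have [x0'|x0'] := leP 0 x.
    rewrite (@Rintegral_split f a 0 x)//; last exact: ltW.
    rewrite [RHS]addrAC subrr add0r.
    move: x0'; rewrite le_eqVlt => /predU1P[<-|x0'].
      by rewrite set_itv1 !Rintegral_set1 subr0.
    by rewrite (set_itv_ge (b1 := BLeft x)) ?Rintegral_set0 ?subr0// bnd_simp -ltNge.
  rewrite (@Rintegral_split f a x 0) ?(ltW x0')//.
  rewrite (set_itv_ge (b1 := BLeft 0)) ?Rintegral_set0 ?bnd_simp -?ltNge//.
  by rewrite opprD addrA subrr.
have xu : x0 < u by rewrite /u ltrDl.
have [dG G'] := @continuous_FTC1_closed _ f a x0 u xu (ri _ _) ax0 (cf x0).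
have dF : is_derive x0 1 (fun x => \int[leb R]_(t in `[a, x]) f t -
    \int[leb R]_(t in `[a, 0]) f t) (f x0).
  have dG' : is_derive x0 1 (fun x => \int[leb R]_(t in `[a, x]) f t) (f x0).
    by apply: DeriveDef => //; rewrite -G' derive1E.
  have -> : f x0 = f x0 - 0 by rewrite subr0.
  exact: is_deriveB.
apply: near_eq_is_derive dF.
near=> x; rewrite -FE//; near: x.
have : \forall x \near x0, x \in `]a, u[.
  by apply: near_in_itvoo; rewrite in_itv/= ax0 xu.
by apply: filterS => x; rewrite in_itv/= => /andP[/ltW].
Unshelve. all: by end_near. Qed.

End RealIntegral.


(** * Integrals over a period and trigonometric polynomials *)

Section Trig.
Context {R : realType}.
Implicit Types (f g F G : R -> R) (a b c k e x t df : R) (D : set R).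

Definition per : set R := [set t : R | 0 <= t < 2 * pi].

Lemma perE : per = `[0, 2 * pi[%classic.
Proof. by apply/seteqP; split => t; rewrite /per /= in_itv. Qed.

Lemma measurable_per : measurable per.
Proof. by rewrite perE. Qed.

Lemma leb_per : leb R per = (2 * pi)%:E.
Proof.
by rewrite perE lebesgue_measure_itv/= lte_fin twopi_gt0 -EFinB subr0.
Qed.

Lemma leb_per_fin : (leb R per < +oo)%E.
Proof. by rewrite leb_per ltry. Qed.

Lemma rint_per_cont f : continuous f -> rint per f.
Proof.
move=> cf; apply: (rint_sub _ measurable_per _ (rint_cont 0 (2 * pi) cf)).
  by [].
by rewrite perE; apply: subset_itvl; rewrite bnd_simp.
Qed.

Definition J f : R := \int[leb R]_(t in per) f t.

Lemma J_itv f : rint per f -> J f = \int[leb R]_(t in `[0, 2 * pi]) f t.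
Proof.
by move=> fi; rewrite /J perE Rintegral_itv_bndo_bndc// -perE.
Qed.

Lemma eq_J f g : f =1 g -> J f = J g.
Proof. by move=> /funext ->. Qed.

Lemma eq_in_J f g : (forall t, per t -> f t = g t) -> J f = J g.
Proof. by move=> fg; apply: eq_Rintegral => t /set_mem; exact: fg. Qed.

Lemma JD f g : rint per f -> rint per g -> J (fun t => f t + g t) = J f + J g.
Proof. by move=> fi gi; apply: RintegralD => //; exact: measurable_per. Qed.

Lemma JB f g : rint per f -> rint per g -> J (fun t => f t - g t) = J f - J g.
Proof. by move=> fi gi; apply: RintegralB => //; exact: measurable_per. Qed.

Lemma JZ f c : rint per f -> J (fun t => c * f t) = c * J f.
Proof. by move=> fi; apply: RintegralZl => //; exact: measurable_per. Qed.

Lemma J_cst c : J (fun=> c) = 2 * pi * c.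
Proof.
rewrite /J (Rintegral_cst (leb R) measurable_per) mulrC; congr (_ * _).
exact: (congr1 fine leb_per).
Qed.

Lemma le_J f g : rint per f -> rint per g -> (forall t, f t <= g t) ->
  J f <= J g.
Proof. by move=> fi gi fg; apply: le_Rintegral => //; exact: measurable_per. Qed.

Lemma le_norm_J f : rint per f -> `|J f| <= J (fun t => `|f t|).
Proof. by move=> fi; apply: le_normr_Rintegral => //; exact: measurable_per. Qed.

Lemma J_FTC f F : continuous f -> (forall x, is_derive x 1 F (f x)) ->
  J f = F (2 * pi) - F 0.
Proof.
move=> cf dF; rewrite J_itv; last exact: rint_per_cont.
by apply: FTC2 => //; exact/ltW/twopi_gt0.
Qed.

Lemma is_derive_scale F k x df : is_derive (k * x) 1 F df ->
  is_derive x 1 (fun t => F (k * t)) (k * df).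
Proof.
move=> dF.
have dk : is_derive x 1 (fun t : R => k * t) k.
  rewrite [X in is_derive _ _ _ X](_ : _ = k *: 1); last by rewrite /GRing.scale/= mulr1.
  exact: is_deriveZ.
rewrite mulrC.
exact: (is_derive1_comp (f := F) (g := fun t => k * t)).
Qed.

Lemma is_derive_translate F c x df : is_derive (c + x) 1 F df ->
  is_derive x 1 (fun t => F (c + t)) df.
Proof.
move=> dF.
have dk : is_derive x 1 (fun t : R => c + t) 1.
  rewrite [X in is_derive _ _ _ X](_ : _ = 0 + 1); last by rewrite add0r.
  exact: is_deriveD.
rewrite -[df]mulr1.
exact: (is_derive1_comp (f := F) (g := fun t => c + t)).
Qed.

(** For an antiderivative F the claim is that F (2 pi + c) - F c does not depend on c; its
    derivative in c vanishes by periodicity. *)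
Lemma J_shift f c : continuous f -> (forall x, f (x + 2 * pi) = f x) ->
  J (fun t => f (c + t)) = J f.
Proof.
move=> cf pf; have [F dF] := antiderivative cf.
have cfc : continuous (fun t => f (c + t)).
  move=> t; apply: (@continuous_comp _ _ _ (fun t => c + t) f); last exact: cf.
  by apply: (@continuousD _ _ _ (fun=> c) id) => //; exact: cst_continuous.
rewrite (J_FTC cf dF) (J_FTC cfc (fun x => is_derive_translate (dF (c + x)))).
have H : forall x, is_derive x 1 (fun x => F (2 * pi + x) - F x) 0.
  move=> x; have -> : 0 = f (2 * pi + x) - f x by rewrite [2 * pi + x]addrC pf subrr.
  apply: is_deriveB => //; exact: is_derive_translate.
have := is_derive_0_is_cst c 0 H.
by rewrite !addr0 [2 * pi + c]addrC.
Qed.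

Lemma continuous_cosM k : continuous (fun t => cos (k * t)).
Proof. by move=> t; have /is_derive_cont := is_derive_scale (is_derive_cos (k * t)). Qed.

Lemma continuous_sinM k : continuous (fun t => sin (k * t)).
Proof. by move=> t; have /is_derive_cont := is_derive_scale (is_derive_sin (k * t)). Qed.

Lemma cos_nper n : cos (n%:R * (2 * pi)) = 1 :> R.
Proof.
elim: n => [|n IH]; first by rewrite mul0r cos0.
rewrite -natr1 mulrDl mul1r.
by rewrite [2 * pi]mulr_natl cosD2pi -[pi *+ 2]mulr_natl.
Qed.

Lemma sin_nper n : sin (n%:R * (2 * pi)) = 0 :> R.
Proof.
elim: n => [|n IH]; first by rewrite mul0r sin0.
rewrite -natr1 mulrDl mul1r.
by rewrite [2 * pi]mulr_natl sinD2pi -[pi *+ 2]mulr_natl.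
Qed.

Lemma cosDn n t : cos (t + n%:R * (2 * pi)) = cos t :> R.
Proof. by rewrite cosD cos_nper sin_nper mulr1 mulr0 subr0. Qed.

Lemma sinDn n t : sin (t + n%:R * (2 * pi)) = sin t :> R.
Proof. by rewrite sinD cos_nper sin_nper mulr1 mulr0 addr0. Qed.

Lemma J_cos n : J (fun t => cos (n%:R * t)) = if n == 0%N then 2 * pi else 0.
Proof.
case: n => [|n] /=.
  by under eq_J do rewrite mul0r cos0; rewrite J_cst mulr1.
have n0 : n.+1%:R != 0 :> R by rewrite pnatr_eq0.
have dF x : is_derive x 1 (fun t => n.+1%:R^-1 * sin (n.+1%:R * t)) (cos (n.+1%:R * x)).
  rewrite [X in is_derive _ _ _ X](_ : _ =
    n.+1%:R^-1 *: (n.+1%:R * cos (n.+1%:R * x))); last by rewrite /GRing.scale/= mulKf.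
  apply: is_deriveZ; exact: is_derive_scale.
rewrite (J_FTC _ dF); last exact: continuous_cosM.
by rewrite sin_nper !mulr0 sin0 mulr0 subrr.
Qed.

Lemma J_sin n : J (fun t => sin (n%:R * t)) = 0.
Proof.
case: n => [|n] /=.
  by under eq_J do rewrite mul0r sin0; rewrite J_cst mulr0.
have n0 : n.+1%:R != 0 :> R by rewrite pnatr_eq0.
have dF x : is_derive x 1 (fun t => - n.+1%:R^-1 * cos (n.+1%:R * t)) (sin (n.+1%:R * x)).
  rewrite [X in is_derive _ _ _ X](_ : _ =
    (- n.+1%:R^-1) *: (n.+1%:R * (- sin (n.+1%:R * x)))); last first.
    by rewrite /GRing.scale/= mulrN mulrNN mulKf.
  apply: is_deriveZ; exact: is_derive_scale.
rewrite (J_FTC _ dF); last exact: continuous_sinM.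
by rewrite cos_nper !mulr0 cos0 subrr.
Qed.

(** Real trigonometric polynomials, generated inductively so that statements linear in the
    polynomial reduce to a single frequency by induction. *)
Inductive trigp : (R -> R) -> Prop :=
| Trigp_cos n : trigp (fun t => cos (n%:R * t))
| Trigp_sin n : trigp (fun t => sin (n%:R * t))
| Trigp_add f g : trigp f -> trigp g -> trigp (fun t => f t + g t)
| Trigp_scale c f : trigp f -> trigp (fun t => c * f t).

Lemma trigp_eq f g : f =1 g -> trigp f -> trigp g.
Proof. by move=> /funext ->. Qed.

Lemma trigp_cst c : trigp (fun=> c).
Proof.
apply: (@trigp_eq (fun t => c * cos (0%:R * t))); last exact/Trigp_scale/Trigp_cos.
by move=> t; rewrite mul0r cos0 mulr1.
Qed.

Lemma trigp_cont f : trigp f -> continuous f.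
Proof.
elim=> [n|n|{}f g _ cf _ cg|c {}f _ cf].
- exact: continuous_cosM.
- exact: continuous_sinM.
- by move=> t; apply: continuousD; [exact: cf|exact: cg].
- by move=> t; apply: continuousM; [exact: cst_continuous|exact: cf].
Qed.

Lemma trigp_rint f : trigp f -> rint per f.
Proof. by move=> /trigp_cont/rint_per_cont. Qed.

Lemma trigp_per f x : trigp f -> f (x + 2 * pi) = f x.
Proof.
elim=> [n|n|{}f g _ -> _ ->|c {}f _ ->] //; rewrite mulrDr ?cosDn ?sinDn//.
Qed.

Lemma trigp_cosB m n : trigp (fun t => cos (m%:R * t - n%:R * t)).
Proof.
have [mn|/ltnW mn] := leqP m n.
  apply: (@trigp_eq (fun t => cos ((n - m)%:R * t))); last exact: Trigp_cos.
  by move=> t; rewrite -mulrBl natrB// -cosN -mulNr opprB.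
apply: (@trigp_eq (fun t => cos ((m - n)%:R * t))); last exact: Trigp_cos.
by move=> t; rewrite -mulrBl natrB.
Qed.

Lemma trigp_sinB m n : trigp (fun t => sin (m%:R * t - n%:R * t)).
Proof.
have [mn|/ltnW mn] := leqP m n.
  apply: (@trigp_eq (fun t => -1 * sin ((n - m)%:R * t))); last exact/Trigp_scale/Trigp_sin.
  by move=> t; rewrite mulN1r -mulrBl natrB// -sinN -mulNr opprB.
apply: (@trigp_eq (fun t => sin ((m - n)%:R * t))); last exact: Trigp_sin.
by move=> t; rewrite -mulrBl natrB.
Qed.

Lemma cosMcos x t : cos x * cos t = 2^-1 * (cos (x + t) + cos (x - t)) :> R.
Proof. by rewrite (cosD x t) (cosB x t); field. Qed.

Lemma sinMsin x t : sin x * sin t = 2^-1 * (cos (x - t) - cos (x + t)) :> R.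
Proof. by rewrite (cosD x t) (cosB x t); field. Qed.

Lemma sinMcos x t : sin x * cos t = 2^-1 * (sin (x + t) + sin (x - t)) :> R.
Proof. by rewrite (sinD x t) (sinB x t); field. Qed.

Lemma trigp_cosD m n : trigp (fun t => cos (m%:R * t + n%:R * t)).
Proof.
apply: (@trigp_eq (fun t => cos ((m + n)%:R * t))); last exact: Trigp_cos.
by move=> t; rewrite natrD mulrDl.
Qed.

Lemma trigp_sinD m n : trigp (fun t => sin (m%:R * t + n%:R * t)).
Proof.
apply: (@trigp_eq (fun t => sin ((m + n)%:R * t))); last exact: Trigp_sin.
by move=> t; rewrite natrD mulrDl.
Qed.

Lemma trigp_sub f g : trigp f -> trigp g -> trigp (fun t => f t - g t).
Proof.
move=> tf tg; apply: (@trigp_eq (fun t => f t + -1 * g t)).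
  by move=> t; rewrite mulN1r.
by apply: Trigp_add => //; exact: Trigp_scale.
Qed.

Lemma trigp_mul f g : trigp f -> trigp g -> trigp (fun t => f t * g t).
Proof.
move=> tf tg; elim: tf => [m|m|{}f h _ IHf _ IHh|c {}f _ IHf]; last 2 first.
- apply: (@trigp_eq (fun t => f t * g t + h t * g t)).
    by move=> t; rewrite mulrDl.
  exact: Trigp_add.
- apply: (@trigp_eq (fun t => c * (f t * g t))).
    by move=> t; rewrite mulrA.
  exact: Trigp_scale.
- elim: tg => [n|n|{}f h _ IHf _ IHh|c {}f _ IHf].
  + apply: (@trigp_eq _ _ (fun t => esym (cosMcos _ _))).
    apply/Trigp_scale/Trigp_add; [exact: trigp_cosD|exact: trigp_cosB].
  + apply: (@trigp_eq (fun t => 2^-1 * (sin (n%:R * t + m%:R * t) + sin (n%:R * t - m%:R * t)))).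
      by move=> t; rewrite -sinMcos mulrC.
    apply/Trigp_scale/Trigp_add; [exact: trigp_sinD|exact: trigp_sinB].
  + by apply: trigp_eq (Trigp_add IHf IHh) => t; rewrite mulrDr.
  + by apply: trigp_eq (Trigp_scale c IHf) => t; rewrite mulrCA.
- elim: tg => [n|n|{}f h _ IHf _ IHh|c {}f _ IHf].
  + apply: (@trigp_eq _ _ (fun t => esym (sinMcos _ _))).
    apply/Trigp_scale/Trigp_add; [exact: trigp_sinD|exact: trigp_sinB].
  + apply: (@trigp_eq _ _ (fun t => esym (sinMsin _ _))).
    apply/Trigp_scale/trigp_sub; [exact: trigp_cosB|exact: trigp_cosD].
  + by apply: trigp_eq (Trigp_add IHf IHh) => t; rewrite mulrDr.
  + by apply: trigp_eq (Trigp_scale c IHf) => t; rewrite mulrCA.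
Qed.

Lemma trigp_exp f n : trigp f -> trigp (fun t => f t ^+ n).
Proof.
move=> tf; elim: n => [|n IH]; first exact: trigp_cst.
by apply: trigp_eq (trigp_mul tf IH) => t; rewrite exprS.
Qed.

Lemma trigp_scale_arg N f : trigp f -> trigp (fun t => f (N%:R * t)).
Proof.
elim=> [n|n|{}f g _ cf _ cg|c {}f _ cf].
- by apply: trigp_eq (Trigp_cos (n * N)) => t; rewrite natrM mulrA.
- by apply: trigp_eq (Trigp_sin (n * N)) => t; rewrite natrM mulrA.
- exact: Trigp_add cf cg.
- exact: Trigp_scale cf.
Qed.

Lemma trigp_sum (I : Type) (s : seq I) (f : I -> R -> R) :
  (forall i, trigp (f i)) -> trigp (fun t => \sum_(i <- s) f i t).
Proof.
move=> tf; elim: s => [|i s IH].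
  by apply: trigp_eq (trigp_cst 0) => t; rewrite big_nil.
by apply: trigp_eq (Trigp_add (tf i) IH) => t; rewrite big_cons.
Qed.

Lemma trigp_shift c f : trigp f -> trigp (fun t => f (c + t)).
Proof.
elim=> [n|n|{}f g _ cf _ cg|d {}f _ cf].
- apply: trigp_eq (trigp_sub (Trigp_scale (cos (n%:R * c)) (Trigp_cos n))
    (Trigp_scale (sin (n%:R * c)) (Trigp_sin n))) => t.
  by rewrite mulrDr cosD.
- apply: trigp_eq (Trigp_add (Trigp_scale (sin (n%:R * c)) (Trigp_cos n))
    (Trigp_scale (cos (n%:R * c)) (Trigp_sin n))) => t.
  by rewrite mulrDr sinD.
- exact: Trigp_add cf cg.
- exact: Trigp_scale cf.
Qed.

(** Dilation by N moves frequency n to n N, and only frequency 0 contributes to the integral. *)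
Lemma J_trigp_scale N g : (0 < N)%N -> trigp g ->
  J (fun t => g (N%:R * t)) = J g.
Proof.
move=> N0; elim=> [n|n|{}f {}g tf IHf tg IHg|c {}f tf IHf].
- under eq_J do rewrite mulrA -natrM.
  by rewrite !J_cos muln_eq0 -[N == _]negbK -lt0n N0 orbF.
- by under eq_J do rewrite mulrA -natrM; rewrite !J_sin.
- rewrite !JD ?IHf ?IHg//; try exact: trigp_rint;
  exact/trigp_rint/trigp_scale_arg.
- rewrite !JZ ?IHf//; try exact: trigp_rint; exact/trigp_rint/trigp_scale_arg.
Qed.

Lemma J_cos_mul m n : J (fun t => cos (m%:R * t) * cos (n%:R * t)) =
  if m == n then if n == 0%N then 2 * pi else pi else 0.
Proof.
wlog mn : m n / (m <= n)%N.
  move=> W; have [mn|/ltnW nm] := leqP m n; first exact: W.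
  under eq_J do rewrite mulrC; rewrite W// eq_sym.
  by case: eqP => // ->.
under eq_J do rewrite mulrC cosMcos -mulrDl -mulrBl -natrB// -natrD.
rewrite JZ ?JD ?J_cos ?subn_eq0 ?addn_eq0; last 3 first.
- exact/trigp_rint/Trigp_cos.
- exact/trigp_rint/Trigp_cos.
- by apply: trigp_rint; apply: Trigp_add; exact: Trigp_cos.
rewrite [m == n]eqn_leq mn/=.
case: (leqP n m) => nm; last first.
  by rewrite [n == 0%N]gtn_eqF ?(leq_ltn_trans _ nm)//= addr0 mulr0.
have -> : m = n by apply/eqP; rewrite eqn_leq mn.
by rewrite andbb; case: eqP => _; field.
Qed.

Lemma J_sin_cos m n : J (fun t => sin (m%:R * t) * cos (n%:R * t)) = 0.
Proof.
under eq_J do rewrite sinMcos.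
rewrite JZ ?JD; last 3 first.
- exact/trigp_rint/trigp_sinD.
- exact/trigp_rint/trigp_sinB.
- by apply: trigp_rint; apply: Trigp_add; [exact: trigp_sinD|exact: trigp_sinB].
under eq_J do rewrite -mulrDl -natrD.
rewrite J_sin add0r.
have [mn|/ltnW mn] := leqP n m.
  by under eq_J do rewrite -mulrBl -natrB//; rewrite J_sin mulr0.
under eq_J do rewrite -opprB sinN -mulrBl -natrB// -mulN1r.
by rewrite JZ ?J_sin ?mulr0//; exact/trigp_rint/Trigp_sin.
Qed.

Lemma J_sin_mul m n : (0 < n)%N -> J (fun t => sin (m%:R * t) * sin (n%:R * t)) =
  if m == n then pi else 0.
Proof.
move=> n0.
have -> : J (fun t => sin (m%:R * t) * sin (n%:R * t)) =
  J (fun t => cos (m%:R * t) * cos (n%:R * t) - cos ((m + n)%:R * t)).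
  by apply: eq_J => t; rewrite natrD mulrDl cosD; ring.
rewrite JB ?J_cos_mul ?J_cos.
- by rewrite addn_eq0 [n == 0%N]gtn_eqF//= andbF subr0.
- by apply: trigp_rint; apply: trigp_mul; exact: Trigp_cos.
- exact/trigp_rint/Trigp_cos.
Qed.

(** All frequencies of g (N t) are multiples of N > 1, so none of them is 1. *)
Lemma J_cos_scale N g : (1 < N)%N -> trigp g ->
  J (fun t => cos t * g (N%:R * t)) = 0.
Proof.
move=> N1 tg.
have ct : trigp cos by apply: trigp_eq (Trigp_cos 1) => t; rewrite mul1r.
have N0 n : (1 == n * N)%N = false.
  by apply/eqP; case: n => [|n]//; nia.
elim: tg => [n|n|{}f {}g tf IHf tg IHg|c {}f tf IHf].
- transitivity (J (fun t => cos (1%:R * t) * cos ((n * N)%:R * t))).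
    by apply: eq_J => t; rewrite natrM mulrA mul1r.
  by rewrite J_cos_mul N0.
- transitivity (J (fun t => sin ((n * N)%:R * t) * cos (1%:R * t))).
    by apply: eq_J => t; rewrite natrM mulrA mul1r mulrC.
  by rewrite J_sin_cos.
- under eq_J do rewrite mulrDr.
  by rewrite JD ?IHf ?IHg ?addr0//; apply: trigp_rint;
    apply: trigp_mul => //; exact: trigp_scale_arg.
- under eq_J do rewrite mulrCA.
  by rewrite JZ ?IHf ?mulr0//; apply: trigp_rint;
    apply: trigp_mul => //; exact: trigp_scale_arg.
Qed.

End Trig.


(** * Moments of lacunary cosine sums *)

Section Lacunary.
Context {R : realType}.
Variable N : nat.
Hypothesis N1 : (1 < N)%N.
Implicit Types (a s t : R) (l : seq R).

(** The sum of l_k cos (N^k t), in self-similar form: the head has frequency 1 and the rest is a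
    function of N t. Moments can thus be computed by induction on the list of coefficients, the
    cross terms being handled by [J_cos_scale]. *)
Fixpoint lac l : R -> R :=
  if l is a :: l' then fun t => a * cos t + lac l' (N%:R * t) else fun=> 0.

Definition sqsum l := \sum_(a <- l) a ^+ 2.

Lemma trigp_lac l : trigp (lac l).
Proof.
elim: l => [|a l IH] /=; first exact: trigp_cst.
apply: Trigp_add; last exact: trigp_scale_arg.
by apply: Trigp_scale; apply: trigp_eq (Trigp_cos 1) => t; rewrite mul1r.
Qed.

Lemma lacE (c : nat -> R) n t :
  lac (mkseq c n) t = \sum_(0 <= k < n) c k * cos ((N ^ k)%:R * t).
Proof.
elim: n c t => [|n IH] c t; first by rewrite big_geq.
have -> : mkseq c n.+1 = c 0%N :: mkseq (c \o succn) n.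
  by rewrite /mkseq/= (iotaDl 1 0) -map_comp.
rewrite big_nat_recl// expn0 mul1r /=.
congr (_ + _); rewrite IH; apply: eq_bigr => k _.
by rewrite expnSr natrM mulrA.
Qed.

Lemma sqsum_mkseq (c : nat -> R) n :
  sqsum (mkseq c n) = \sum_(0 <= k < n) c k ^+ 2.
Proof. by rewrite /sqsum /mkseq big_map /index_iota subn0. Qed.

Let tc : trigp (@cos R).
Proof. by apply: trigp_eq (Trigp_cos 1) => t; rewrite mul1r. Qed.

(** Parseval's identity: the cross term is cos t times a polynomial in N t and integrates to 0. *)
Lemma J_lac2 l : J (fun t => lac l t ^+ 2) = pi * sqsum l.
Proof.
rewrite /sqsum; elim: l => [|a l IH].
  by under eq_J do rewrite /= expr0n/=; rewrite J_cst big_nil !mulr0.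
rewrite big_cons mulrDr -IH /=.
have tl := trigp_lac l; have tNl := trigp_scale_arg N tl.
rewrite -(J_trigp_scale (ltnW N1) (trigp_exp 2 tl)).
transitivity (J (fun t => a ^+ 2 * (cos (1%:R * t) * cos (1%:R * t)) +
   (2 * a * (cos t * lac l (N%:R * t)) + lac l (N%:R * t) ^+ 2))).
  by apply: eq_J => t; rewrite mul1r; ring.
have t1 : trigp (fun t => cos (1%:R * t) * cos (1%:R * t) : R).
  by apply: trigp_mul; exact: Trigp_cos.
have t2 : trigp (fun t => cos t * lac l (N%:R * t)) by exact: trigp_mul.
have t3 := trigp_exp 2 tNl.
have t4 := Trigp_scale (2 * a) t2.
have t5 := Trigp_scale (a ^+ 2) t1.
rewrite JD; [|exact: trigp_rint t5|exact: trigp_rint (Trigp_add t4 t3)].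
rewrite JD; [|exact: trigp_rint t4|exact: trigp_rint t3].
rewrite JZ; last exact: trigp_rint t1.
rewrite JZ; last exact: trigp_rint t2.
by rewrite J_cos_scale// mulr0 add0r J_cos_mul/= mulrC.
Qed.

Lemma sqsum_ge0 l : 0 <= sqsum l.
Proof. by rewrite /sqsum sumr_ge0// => a _; exact: sqr_ge0. Qed.

(** Of the two odd terms of the expansion, 4 a x v^3 is kept because it will integrate to 0 for x =
    cos t and v a polynomial in N t; the other one is absorbed in the even terms. *)
Let quartic_bound a x v : `|x| <= 1 ->
  (a * x + v) ^+ 4 <= 3 * a ^+ 4 + (8 * a ^+ 2 * v ^+ 2 + (4 * a * (x * v ^+ 3) + v ^+ 4)).
Proof.
move=> x1; rewrite -subr_ge0.
have x2 : x ^+ 2 <= 1 by rewrite -real_normK ?num_real// expr_le1.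
have x20 := sqr_ge0 x.
have x4 : x ^+ 4 <= 1.
  by rewrite -[x ^+ 4]/(x ^+ (2 * 2)%N) exprM expr_le1.
have h1 : 0 <= a ^+ 4 * (1 - x ^+ 4).
  by rewrite mulr_ge0 ?subr_ge0// (exprM a 2 2) sqr_ge0.
have h2 : 0 <= (a * v) ^+ 2 * (1 - x ^+ 2).
  by rewrite mulr_ge0 ?subr_ge0// sqr_ge0.
(* the cubic term is absorbed by [2 (a^2 - a x^3 v)^2 >= 0] *)
have h3 : 0 <= (a ^+ 2 - a * x ^+ 3 * v) ^+ 2 by exact: sqr_ge0.
have h4 : 0 <= (a * v) ^+ 2 * (1 - x ^+ 6).
  rewrite mulr_ge0 ?sqr_ge0// subr_ge0 -[x ^+ 6]/(x ^+ (2 * 3)%N) exprM.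
  by rewrite expr_le1.
rewrite (_ : _ - _ = a ^+ 4 * (1 - x ^+ 4) + 6 * ((a * v) ^+ 2 * (1 - x ^+ 2)) +
  2 * (a ^+ 2 - a * x ^+ 3 * v) ^+ 2 + 2 * ((a * v) ^+ 2 * (1 - x ^+ 6))); last by ring.
by rewrite !addr_ge0// mulr_ge0.
Qed.

(** In the induction, with S the square sum of the tail, the new terms are 6 pi a^4 + 8 pi a^2 S,
    and 6 pi (a^2 + S)^2 leaves room for 6 pi a^4 + 12 pi a^2 S. *)
Lemma J_lac4 l : J (fun t => lac l t ^+ 4) <= 6 * pi * sqsum l ^+ 2.
Proof.
elim: l => [|a l IH].
  by under eq_J do rewrite /= expr0n/=; rewrite J_cst mulr0 mulr_ge0// ?sqr_ge0// mulr_ge0// pi_ge0.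
have tl := trigp_lac l; have tNl := trigp_scale_arg N tl.
have t1 := @trigp_cst R (3 * a ^+ 4).
have t2 := trigp_exp 2 tNl.
have t3 : trigp (fun t => cos t * lac l (N%:R * t) ^+ 3).
  by apply: trigp_mul => //; exact: (trigp_exp 3 tNl).
have t4 := trigp_exp 4 tNl.
have t2' := Trigp_scale (8 * a ^+ 2) t2.
have t3' := Trigp_scale (4 * a) t3.
have t34 := Trigp_add t3' t4.
have t234 := Trigp_add t2' t34.
apply: (@le_trans _ _ (J (fun t => 3 * a ^+ 4 + (8 * a ^+ 2 * lac l (N%:R * t) ^+ 2 +
   (4 * a * (cos t * lac l (N%:R * t) ^+ 3) + lac l (N%:R * t) ^+ 4))))).
  apply: le_J.
  - exact: trigp_rint (trigp_exp 4 (trigp_lac (a :: l))).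
  - exact: trigp_rint (Trigp_add t1 t234).
  - by move=> t /=; apply: quartic_bound; exact: cos_max.
rewrite JD; [|exact: trigp_rint t1|exact: trigp_rint t234].
rewrite JD; [|exact: trigp_rint t2'|exact: trigp_rint t34].
rewrite JD; [|exact: trigp_rint t3'|exact: trigp_rint t4].
rewrite J_cst JZ; last exact: trigp_rint t2.
rewrite JZ; last exact: trigp_rint t3.
rewrite (J_cos_scale N1 (trigp_exp 3 tl)).
rewrite (J_trigp_scale (ltnW N1) (trigp_exp 2 tl)) J_lac2.
rewrite (J_trigp_scale (ltnW N1) (trigp_exp 4 tl)).
rewrite /sqsum big_cons -/(sqsum l).
apply: (le_trans (y := 2 * pi * (3 * a ^+ 4) + (8 * a ^+ 2 * (pi * sqsum l) +
  (4 * a * 0 + 6 * pi * sqsum l ^+ 2)))); first by rewrite !lerD2l.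
have h : 0 <= pi * (a ^+ 2 * sqsum l) by apply: mulr_ge0; [exact: pi_ge0|apply: mulr_ge0; [exact: sqr_ge0|exact: sqsum_ge0]].
rewrite -subr_ge0 (_ : _ - _ = 4 * (pi * (a ^+ 2 * sqsum l))); last by ring.
by rewrite mulr_ge0.
Qed.

(** With z = |x| / s the claim is z (1 - z + z^3) >= 0. It bounds |x| from below by even powers,
    whose integrals are known. *)
Lemma norm_ge_quartic x s : 0 < s -> x ^+ 2 / s - x ^+ 4 / s ^+ 3 <= `|x| :> R.
Proof.
move=> s0; have s0' : s != 0 by rewrite gt_eqF.
rewrite (exprM x 2 2) -[x ^+ 2]real_normK ?num_real//.
have := normr_ge0 x; move: `|x| => y y0.
have [z z0 ->] : exists2 z, 0 <= z & y = s * z.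
  by exists (y / s); [rewrite divr_ge0// ltW|field].
rewrite -subr_ge0 (_ : _ - _ = s * (z * (1 - z + z ^+ 3))); last by field.
rewrite mulr_ge0 ?(ltW s0)// mulr_ge0//.
have [z1|z1] := leP z 1; first by rewrite addr_ge0 ?subr_ge0// exprn_ge0.
have : 0 <= z * (z * z - 1) by rewrite mulr_ge0// subr_ge0 mulr_ege1// ltW.
by rewrite mulrBr mulr1 mulrA => ?; rewrite !exprS expr0; lra.
Qed.

(** The parameter s is free; for s three times the square root of [sqsum l] the left side is pi/9
    times that square root. *)
Lemma J_norm_lac l s : 0 < s ->
  pi * sqsum l / s - 6 * pi * sqsum l ^+ 2 / s ^+ 3 <= J (fun t => `|lac l t|).
Proof.
move=> s0.
have tl := trigp_lac l.
have t2 := Trigp_scale s^-1 (trigp_exp 2 tl).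
have t4 := Trigp_scale (s ^+ 3)^-1 (trigp_exp 4 tl).
apply: (@le_trans _ _ (J (fun t => s^-1 * lac l t ^+ 2 - (s ^+ 3)^-1 * lac l t ^+ 4))).
  rewrite JB; [|exact: trigp_rint t2|exact: trigp_rint t4].
  rewrite !JZ; [|exact/trigp_rint/trigp_exp|exact/trigp_rint/trigp_exp].
  rewrite J_lac2 mulrC lerD2l lerN2 mulrC ler_pM2r ?invr_gt0 ?exprn_gt0//.
  exact: J_lac4.
apply: le_J.
- exact: trigp_rint (trigp_sub t2 t4).
- apply: rint_norm; first exact: measurable_per.
  exact: trigp_rint.
- by move=> t; rewrite mulrC [X in _ - X]mulrC; exact: norm_ge_quartic.
Qed.

End Lacunary.


(** * Modulus, convergence and the exponential on the complex numbers *)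

Section ComplexBasics.
Context {R : realType}.
Implicit Types (z w : Cx R) (x y t e : R).

Local Notation Re := (@complex.Re R).
Local Notation Im := (@complex.Im R).

Lemma normCE z : `|z| = (cabs z)%:C.
Proof. by rewrite /cabs normc_def. Qed.

Lemma cabsE z : cabs z = Num.sqrt (Re z ^+ 2 + Im z ^+ 2).
Proof. by rewrite /cabs normc_def. Qed.

Lemma cabs_ge0 z : 0 <= cabs z.
Proof. by rewrite cabsE sqrtr_ge0. Qed.

Lemma cabs0 : cabs (0 : Cx R) = 0.
Proof. by rewrite /cabs normr0. Qed.

Lemma cabs1 : cabs (1 : Cx R) = 1.
Proof. by rewrite /cabs normr1. Qed.

Lemma cabsM z w : cabs (z * w) = cabs z * cabs w.
Proof. by apply: complexI; rewrite rmorphM/= -!normCE normrM. Qed.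

Lemma cabsX z n : cabs (z ^+ n) = cabs z ^+ n.
Proof. by elim: n => [|n IH]; rewrite ?expr0 ?cabs1// !exprS cabsM IH. Qed.

Lemma cabsN z : cabs (- z) = cabs z.
Proof. by rewrite /cabs normrN. Qed.

Lemma cabsD z w : cabs (z + w) <= cabs z + cabs w.
Proof. by rewrite -lecR rmorphD/= -!normCE ler_normD. Qed.

Lemma cabsB z w : cabs (z - w) <= cabs z + cabs w.
Proof. by rewrite -(cabsN w) cabsD. Qed.

Lemma cabsC z w : cabs (z - w) = cabs (w - z).
Proof. by rewrite -cabsN opprB. Qed.

Lemma cabs_eq0 z : (cabs z == 0) = (z == 0).
Proof. by rewrite -[in RHS]normr_eq0 normCE -[in RHS](rmorph0 (real_complex R)) (inj_eq (@complexI R)). Qed.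

Lemma cabsV z : cabs z^-1 = (cabs z)^-1.
Proof. by apply: complexI; rewrite fmorphV/= -!normCE normfV. Qed.

Lemma cabs_real x : cabs (x%:C : Cx R) = `|x|.
Proof. by rewrite cabsE/= expr0n/= addr0 sqrtr_sqr. Qed.

Lemma cabs_sum (I : Type) (s : seq I) (P : pred I) (f : I -> Cx R) :
  cabs (\sum_(i <- s | P i) f i) <= \sum_(i <- s | P i) cabs (f i).
Proof.
elim/big_ind2: _ => [|x1 x2 y1 y2 h1 h2|//]; first by rewrite cabs0.
by rewrite (le_trans (cabsD _ _))// lerD.
Qed.

Lemma norm_Re_le z : `|Re z| <= cabs z.
Proof. by rewrite cabsE -sqrtr_sqr ler_wsqrtr// lerDl sqr_ge0. Qed.

Lemma norm_Im_le z : `|Im z| <= cabs z.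
Proof. by rewrite cabsE -sqrtr_sqr ler_wsqrtr// lerDr sqr_ge0. Qed.

Lemma cabs_le_ReIm z : cabs z <= `|Re z| + `|Im z|.
Proof.
have -> : z = (Re z)%:C + (0 +i* Im z) :> Cx R.
  by case: z => a b; apply/eqP; rewrite eq_complex/= addr0 add0r !eqxx.
rewrite (le_trans (cabsD _ _))// cabs_real (cabsE (_ +i* _))/= expr0n/= add0r.
by rewrite sqrtr_sqr !(addr0, add0r).
Qed.

Lemma cReD z w : Re (z + w) = Re z + Re w. Proof. by case: z; case: w. Qed.
Lemma cImD z w : Im (z + w) = Im z + Im w. Proof. by case: z; case: w. Qed.
Lemma cReN z : Re (- z) = - Re z. Proof. by case: z. Qed.
Lemma cImN z : Im (- z) = - Im z. Proof. by case: z. Qed.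
Lemma cReB z w : Re (z - w) = Re z - Re w. Proof. by rewrite cReD cReN. Qed.
Lemma cImB z w : Im (z - w) = Im z - Im w. Proof. by rewrite cImD cImN. Qed.
Lemma cReM z w : Re (z * w) = Re z * Re w - Im z * Im w.
Proof. by case: z; case: w. Qed.
Lemma cImM z w : Im (z * w) = Re z * Im w + Im z * Re w.
Proof. by case: z; case: w. Qed.

Lemma cRe_sum (I : Type) (s : seq I) (P : pred I) (f : I -> Cx R) :
  Re (\sum_(i <- s | P i) f i) = \sum_(i <- s | P i) Re (f i).
Proof. exact: (big_morph Re cReD). Qed.

Lemma cIm_sum (I : Type) (s : seq I) (P : pred I) (f : I -> Cx R) :
  Im (\sum_(i <- s | P i) f i) = \sum_(i <- s | P i) Im (f i).
Proof. exact: (big_morph Im cImD). Qed.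

Lemma Cx_eq z w : Re z = Re w -> Im z = Im w -> z = w.
Proof. by case: z w => [a b] [c d] /= -> ->. Qed.

Lemma Cx_gt0 (e : Cx R) : 0 < e -> 0 < Re e /\ e = (Re e)%:C.
Proof. by rewrite ltcE/= => /andP[/eqP/= h1 h2]; split=> //; apply: Cx_eq. Qed.

(** The norm of [Cx R] takes complex values; this restates convergence with the real modulus [cabs]
    and a real epsilon. *)
Lemma cvgCP {T : Type} (F : set_system T) {FF : Filter F} (f : T -> Cx R) (l : Cx R) :
  f @ F --> l <-> forall e, 0 < e -> \forall i \near F, cabs (f i - l) < e.
Proof.
split.
  move=> /cvgrPdist_lt H e e0.
  have e0' : 0 < e%:C :> Cx R by rewrite (ltcR 0 e).
  apply: filterS (H _ e0') => x; rewrite normCE (ltcR _ e) => h.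
  by rewrite cabsC.
move=> H; apply/cvgrPdist_lt => e /Cx_gt0[e0 ->].
by apply: filterS (H _ e0) => x; rewrite normCE (ltcR _ (Re e)) cabsC.
Qed.

Lemma cvgC0P {T : Type} (F : set_system T) {FF : Filter F} (f : T -> Cx R) (l : Cx R) :
  f @ F --> l <-> (fun i => cabs (f i - l)) @ F --> (0 : R).
Proof.
rewrite cvgCP; split.
  move=> H; apply/cvgrPdist_lt => e /H.
  by apply: filterS => x h; rewrite sub0r normrN ger0_norm// cabs_ge0.
move=> /cvgrPdist_lt H e /H; apply: filterS => x.
by rewrite sub0r normrN ger0_norm// cabs_ge0.
Qed.

Lemma cvgC_ReIm {T : Type} (F : set_system T) {FF : Filter F} (f : T -> Cx R) (l : Cx R) :
  f @ F --> l <-> (Re \o f) @ F --> Re l /\ (Im \o f) @ F --> Im l.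
Proof.
split.
  move=> /cvgCP H; split; apply/cvgrPdist_lt => e /H; apply: filterS => x /= h.
    by rewrite -cReB (le_lt_trans (norm_Re_le _))// cabsC.
  by rewrite -cImB (le_lt_trans (norm_Im_le _))// cabsC.
move=> [/cvgrPdist_lt H1 /cvgrPdist_lt H2]; apply/cvgCP => e e0.
have e2 : 0 < e / 2 by rewrite divr_gt0.
near=> x; rewrite (le_lt_trans (cabs_le_ReIm _))// (splitr e) ltrD// ?cReB ?cImB distrC.
  by near: x; exact: H1.
by near: x; exact: H2.
Unshelve. all: by end_near. Qed.

Lemma cvg_squeezeC (u : nat -> Cx R) (l : Cx R) (e : nat -> R) :
  (forall n, cabs (u n - l) <= e n) -> e @ \oo --> (0 : R) -> u @ \oo --> l.
Proof.
move=> ue e0; apply/cvgCP => d d0.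
have /cvgrPdist_lt /(_ _ d0) := e0; apply: filterS => n.
rewrite sub0r normrN => h; apply: le_lt_trans h.
exact: le_trans (ue n) (ler_norm _).
Qed.

Lemma continuous_ReC : continuous (Re : Cx R -> R).
Proof.
move=> z; have : id @ z --> z by exact: cvg_id.
by move=> /cvgC_ReIm[].
Qed.

Lemma continuous_ImC : continuous (Im : Cx R -> R).
Proof.
move=> z; have : id @ z --> z by exact: cvg_id.
by move=> /cvgC_ReIm[].
Qed.

Lemma continuous_cis : continuous (@cis R).
Proof.
by move=> t; apply/cvgC_ReIm; split; [exact: continuous_cos|exact: continuous_sin].
Qed.

Lemma cabs_cis t : cabs (cis t) = 1.
Proof. by rewrite cabsE/= cos2Dsin2 sqrtr1. Qed.

Lemma cisD x y : cis (x + y) = cis x * cis y :> Cx R.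
Proof. by apply: Cx_eq; rewrite /cis ?cReM ?cImM /= ?cosD ?sinD// addrC mulrC [X in _ + X]mulrC. Qed.

Lemma cis0 : cis 0 = 1 :> Cx R.
Proof. by rewrite /cis cos0 sin0. Qed.

Lemma cisX t n : cis t ^+ n = cis (n%:R * t) :> Cx R.
Proof.
elim: n => [|n IH]; first by rewrite expr0 mul0r cis0.
by rewrite exprS IH -cisD -natr1 mulrDl mul1r addrC.
Qed.

Lemma cexpD z w : cexp (z + w) = cexp z * cexp w.
Proof.
rewrite /cexp cReD cImD expRD cisD rmorphM/=; ring.
Qed.

Lemma cexp0 : cexp 0 = 1 :> Cx R.
Proof. by rewrite /cexp/= expR0 cis0 mulr1. Qed.

Lemma cexpN z : cexp z * cexp (- z) = 1.
Proof. by rewrite -cexpD subrr cexp0. Qed.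

Lemma cabs_cexp z : cabs (cexp z) = expR (Re z).
Proof. by rewrite /cexp cabsM cabs_cis mulr1 cabs_real ger0_norm// expR_ge0. Qed.

Lemma cexp_neq0 z : cexp z != 0.
Proof. by rewrite -cabs_eq0 cabs_cexp gt_eqF// expR_gt0. Qed.

Lemma Re_cexp z : Re (cexp z) = expR (Re z) * cos (Im z).
Proof. by rewrite /cexp cReM /= mul0r subr0. Qed.

Lemma Im_cexp z : Im (cexp z) = expR (Re z) * sin (Im z).
Proof. by rewrite /cexp cImM /= mul0r addr0. Qed.

Lemma continuous_cexp : continuous (@cexp R).
Proof.
have cE z : (fun w => expR (Re w)) @ z --> expR (Re z).
  exact: cvg_comp (@continuous_ReC z) (@continuous_expR R (Re z)).
move=> z; apply/(cvgC_ReIm (F := nbhs z)); rewrite Re_cexp Im_cexp; split.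
  apply: (@cvg_trans _ ((fun w => expR (Re w) * cos (Im w)) @ z)).
    by apply: near_eq_cvg; apply: nearW => w; exact: esym (Re_cexp w).
  apply: (@cvgM R (Cx R) (nbhs z) _ (fun w => expR (Re w)) (fun w => cos (Im w))); first exact: cE.
  exact: cvg_comp (@continuous_ImC z) (@continuous_cos R (Im z)).
apply: (@cvg_trans _ ((fun w => expR (Re w) * sin (Im w)) @ z)).
  by apply: near_eq_cvg; apply: nearW => w; exact: esym (Im_cexp w).
apply: (@cvgM R (Cx R) (nbhs z) _ (fun w => expR (Re w)) (fun w => sin (Im w))); first exact: cE.
exact: cvg_comp (@continuous_ImC z) (@continuous_sin R (Im z)).
Qed.

Lemma expr_cvg0 (r : R) : 0 <= r < 1 -> (fun n => r ^+ n) @ \oo --> (0 : R).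
Proof. by move=> /andP[r0 r1]; apply: cvg_expr; rewrite ger0_norm. Qed.

(* Completeness of the complex numbers, in the form of the comparison test. *)
Lemma seriesC_cvg (u : nat -> Cx R) (b : nat -> R) :
  (forall n, cabs (u n) <= b n) -> cvgn (series b) -> exists l : Cx R, series u @ \oo --> l.
Proof.
move=> ub cb.
have c1 (v : Cx R -> R) : (forall z, `|v z| <= cabs z) -> cvgn (series (v \o u)).
  move=> vb; apply: normed_cvg; apply: series_le_cvg cb => n /=.
  - exact: normr_ge0.
  - exact: le_trans (cabs_ge0 _) (ub n).
  - exact: le_trans (vb _) (ub n).
have /cvg_ex[/= a ha] := c1 _ norm_Re_le.
have /cvg_ex[/= c hc] := c1 _ norm_Im_le.
exists (a +i* c); apply/cvgC_ReIm => /=; split.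
  by have -> : Re \o series u = series (Re \o u) by apply/funext => n /=; rewrite /series/= cRe_sum.
by have -> : Im \o series u = series (Im \o u) by apply/funext => n /=; rewrite /series/= cIm_sum.
Qed.

Lemma limC (u : nat -> Cx R) (l : Cx R) : u @ \oo --> l -> limn u = l.
Proof. by move=> ?; apply: cvg_lim. Qed.

End ComplexBasics.


(** * Taylor bounds and differentiability of the complex exponential *)

Section ComplexExp.
Context {R : realType}.
Implicit Types (z w h : Cx R) (x y t s e : R).

Local Notation Re := (@complex.Re R).
Local Notation Im := (@complex.Im R).

Lemma is_derive_exprn n t : is_derive t 1 (fun t => t ^+ n.+1) (n.+1%:R * t ^+ n).
Proof.
have := @is_deriveX R R id n.+1 t 1 1 (is_derive_id _ _).
by rewrite exprfctE /= /GRing.scale/= mulr1.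
Qed.

Lemma is_derive_psum (p : nat -> R) n t :
  is_derive t 1 (fun t => \sum_(0 <= k < n.+1) p k * t ^+ k)
    (\sum_(0 <= k < n) k.+1%:R * p k.+1 * t ^+ k).
Proof.
elim: n => [|n IH].
  rewrite big_geq//.
  have -> : (fun t => \sum_(0 <= k < 1) p k * t ^+ k) = (fun=> p 0%N).
    by apply/funext => u; rewrite big_nat1 expr0 mulr1.
  exact: is_derive_cst.
rewrite big_nat_recr//=.
have -> : (fun t => \sum_(0 <= k < n.+2) p k * t ^+ k) =
   (fun t => \sum_(0 <= k < n.+1) p k * t ^+ k + p n.+1 * t ^+ n.+1).
  by apply/funext => u; rewrite big_nat_recr.
apply: is_deriveD.
rewrite [X in is_derive _ _ _ X](_ : _ = p n.+1 *: (n.+1%:R * t ^+ n)); last first.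
  by rewrite /GRing.scale/=; ring.
apply: is_deriveZ.
exact: is_derive_exprn.
Qed.

(** Both G + f and G - f have nonnegative derivative on [[0, t]]. *)
Lemma monotone_bound (f df G dG : R -> R) t : 0 <= t ->
  (forall s, is_derive s 1 f (df s)) -> (forall s, is_derive s 1 G (dG s)) ->
  (forall s, 0 <= s <= t -> `|df s| <= dG s) -> `|f t - f 0| <= G t - G 0.
Proof.
move=> t0 hf hG fG.
have W (h dh : R -> R) : (forall s, is_derive s 1 h (dh s)) ->
    (forall s, 0 <= s <= t -> 0 <= dh s) -> 0 <= h t - h 0.
  move=> hh dh0.
  have [|c] := MVT_segment t0 (fun s _ => hh s).
    by apply: continuous_subspaceT => s; exact: is_derive_cont.
  by rewrite in_itv/= => /dh0 ch ->; rewrite subr0 mulr_ge0.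
rewrite ler_norml; apply/andP; split.
  have := W (fun s => G s + f s) (fun s => dG s + df s) (fun s => is_deriveD (hG s) (hf s)).
  have h s : 0 <= s <= t -> 0 <= dG s + df s.
    by move=> /fG; rewrite ler_norml => /andP[]; lra.
  by move=> /(_ h); lra.
have := W (fun s => G s - f s) (fun s => dG s - df s) (fun s => is_deriveB (hG s) (hf s)).
have h s : 0 <= s <= t -> 0 <= dG s - df s.
  by move=> /fG; rewrite ler_norml => /andP[]; lra.
by move=> /(_ h); lra.
Qed.

Lemma is_derive_expM x t : is_derive t 1 (fun t => expR (x * t)) (x * expR (x * t)).
Proof. exact: is_derive_scale (is_derive_expR _). Qed.

(** Induction on n along the segment from 0 to z: the derivative of the remainder of order n + 1 is
    z times the remainder of order n. Since the real and imaginary parts are estimated separately,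
    each step adds two products, which is the reason for the factor 2 in front of |z|. *)
Let taylor_bound z n : forall t, 0 <= t <= 1 ->
  `|Re (cexp (t%:C * z)) - \sum_(0 <= k < n) Re (z ^+ k) / k`!%:R * t ^+ k| <=
    expR (cabs z) * (2 * cabs z * t) ^+ n / n`!%:R /\
  `|Im (cexp (t%:C * z)) - \sum_(0 <= k < n) Im (z ^+ k) / k`!%:R * t ^+ k| <=
    expR (cabs z) * (2 * cabs z * t) ^+ n / n`!%:R.
Proof.
have RE t : Re (cexp (t%:C * z)) = expR (Re z * t) * cos (Im z * t).
  by rewrite Re_cexp cReM cImM /= !mul0r subr0 addr0 [t * Re z]mulrC [t * Im z]mulrC.
have IE t : Im (cexp (t%:C * z)) = expR (Re z * t) * sin (Im z * t).
  by rewrite Im_cexp cReM cImM /= !mul0r subr0 addr0 [t * Re z]mulrC [t * Im z]mulrC.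
have dRE t : is_derive t 1 (fun t => Re (cexp (t%:C * z)))
    (Re z * Re (cexp (t%:C * z)) - Im z * Im (cexp (t%:C * z))).
  have -> : (fun t => Re (cexp (t%:C * z))) = (fun t => expR (Re z * t) * cos (Im z * t)).
    by apply/funext => u; rewrite RE.
  rewrite RE IE.
  have := is_deriveM (is_derive_expM (Re z) t) (is_derive_scale (is_derive_cos (Im z * t))).
  by move=> H; apply: (is_derive_eq H); rewrite /GRing.scale/=; ring.
have dIE t : is_derive t 1 (fun t => Im (cexp (t%:C * z)))
    (Re z * Im (cexp (t%:C * z)) + Im z * Re (cexp (t%:C * z))).
  have -> : (fun t => Im (cexp (t%:C * z))) = (fun t => expR (Re z * t) * sin (Im z * t)).
    by apply/funext => u; rewrite IE.
  rewrite RE IE.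
  have := is_deriveM (is_derive_expM (Re z) t) (is_derive_scale (is_derive_sin (Im z * t))).
  by move=> H; apply: (is_derive_eq H); rewrite /GRing.scale/=; ring.
elim: n => [|n IH] t /andP[t0 t1].
  have h : cabs (cexp (t%:C * z)) <= expR (cabs z).
    rewrite cabs_cexp ler_expR cReM/= mul0r subr0.
    rewrite (le_trans (ler_norm _))// normrM (ger0_norm t0).
    by rewrite (le_trans (ler_piMl (normr_ge0 _) t1))// norm_Re_le.
  rewrite !big_geq// !subr0 expr0 fact0 divr1 mulr1.
  by split; rewrite (le_trans _ h)// ?norm_Re_le ?norm_Im_le.
have idR (a b c d p q : R) : a * c - b * d - (a * p - b * q) = a * (c - p) - b * (d - q).
  by ring.
have idI (a b c d p q : R) : a * d + b * c - (a * q + b * p) = a * (d - q) + b * (c - p).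
  by ring.
pose SR n (t : R) := \sum_(0 <= k < n) Re (z ^+ k) / k`!%:R * t ^+ k.
pose SI n (t : R) := \sum_(0 <= k < n) Im (z ^+ k) / k`!%:R * t ^+ k.
have fS k : (k.+1%:R * k.+1`!%:R^-1 = k`!%:R^-1 :> R).
  by rewrite factS natrM invfM mulVKf// pnatr_eq0.
have dSR s : is_derive s 1 (SR n.+1) (Re z * SR n s - Im z * SI n s).
  apply: (is_derive_eq (is_derive_psum _ n s)).
  rewrite /SR /SI !mulr_sumr -sumrB; apply: eq_bigr => k _.
  rewrite exprS cReM -(fS k); ring.
have dSI s : is_derive s 1 (SI n.+1) (Re z * SI n s + Im z * SR n s).
  apply: (is_derive_eq (is_derive_psum _ n s)).
  rewrite /SR /SI !mulr_sumr -big_split; apply: eq_bigr => k _ /=.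
  rewrite exprS cImM -(fS k); ring.
have dG s : is_derive s 1 (fun s => expR (cabs z) * (2 * cabs z * s) ^+ n.+1 / n.+1`!%:R)
    (2 * cabs z * (expR (cabs z) * (2 * cabs z * s) ^+ n / n`!%:R)).
  have := is_deriveZ (expR (cabs z) * (2 * cabs z) ^+ n.+1 / n.+1`!%:R)
     (is_derive_exprn n s).
  rewrite (_ : _ \*: _ = (fun s => expR (cabs z) * (2 * cabs z * s) ^+ n.+1 / n.+1`!%:R)); last first.
    by apply/funext => u; rewrite /= /GRing.scale/= !exprMn; ring.
  move=> H; apply: (is_derive_eq H).
  rewrite /GRing.scale/= -(fS n) !exprMn !exprS; ring.
have S0R : SR n.+1 0 = 1.
  rewrite /SR big_nat_recl// big1 => [|k _]; last by rewrite expr0n/= mulr0.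
  by rewrite !expr0 /= divr1 mulr1 addr0.
have S0I : SI n.+1 0 = 0.
  rewrite /SI big_nat_recl// big1 => [|k _]; last by rewrite expr0n/= mulr0.
  by rewrite !expr0 /= mul0r mul0r addr0.
have z0 := cabs_ge0 z.
have zR := norm_Re_le z; have zI := norm_Im_le z.
have two (a b u v B : R) : `|a| <= cabs z -> `|b| <= cabs z -> `|u| <= B -> `|v| <= B ->
    `|a * u| + `|b * v| <= 2 * cabs z * B.
  move=> ha hb hu hv; rewrite !normrM -mulrA mulr2n mulrDl mul1r.
  by rewrite lerD// ler_pM.
split.
- have := @monotone_bound (fun t => Re (cexp (t%:C * z)) - SR n.+1 t) _ _ _ t t0
    (fun s => is_deriveB (dRE s) (dSR s)) dG.
  have -> : Re (cexp (0%:C * z)) - SR n.+1 0 = 0 by rewrite RE !mulr0 expR0 cos0 S0R mulr1 subrr.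
  rewrite mulr0 expr0n/= mulr0 mul0r !subr0; apply => s /andP[s0 st].
  have s01 : 0 <= s <= 1 by rewrite s0 (le_trans st).
  have [] := IH s s01; rewrite -/(SR n s) -/(SI n s) => h1 h2.
  rewrite idR.
  by rewrite (le_trans (ler_normB _ _))// two.
- have := @monotone_bound (fun t => Im (cexp (t%:C * z)) - SI n.+1 t) _ _ _ t t0
    (fun s => is_deriveB (dIE s) (dSI s)) dG.
  have -> : Im (cexp (0%:C * z)) - SI n.+1 0 = 0 by rewrite IE !mulr0 expR0 sin0 S0I mulr0 subrr.
  rewrite mulr0 expr0n/= mulr0 mul0r !subr0; apply => s /andP[s0 st].
  have s01 : 0 <= s <= 1 by rewrite s0 (le_trans st).
  have [] := IH s s01; rewrite -/(SR n s) -/(SI n s) => h1 h2.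
  rewrite idI.
  by rewrite (le_trans (ler_normD _ _))// two.
Qed.

Lemma cexp_taylor z n :
  cabs (cexp z - \sum_(0 <= k < n) z ^+ k * (k`!%:R)^-1) <=
    2 * (expR (cabs z) * (2 * cabs z) ^+ n / n`!%:R).
Proof.
have [h1 h2] := @taylor_bound z n 1 (introT andP (conj ler01 (lexx 1))).
have e1 : (1%:C : Cx R) * z = z by rewrite mul1r.
move: h1 h2; rewrite e1 mulr1.
under eq_bigr do rewrite expr1n mulr1; move=> h1.
under eq_bigr do rewrite expr1n mulr1; move=> h2.
have fr k : ((k`!%:R)^-1 : Cx R) = ((k`!%:R)^-1)%:C by rewrite fmorphV rmorph_nat.
rewrite (le_trans (cabs_le_ReIm _))// mulr2n mulrDl mul1r lerD//.
  rewrite cReB cRe_sum.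
  by under eq_bigr => k _ do rewrite fr cReM /= mulr0 subr0.
rewrite cImB cIm_sum.
by under eq_bigr => k _ do rewrite fr cImM /= mulr0 add0r.
Qed.

(** A first-order expansion with real constants, which makes sense at h = 0 too, replaces the limit
    of difference quotients. *)
Lemma derivableCP (f : Cx R -> Cx R) z : derivable f z 1 <->
  exists d : Cx R, forall e, 0 < e -> exists2 r, 0 < r & forall h, cabs h < r ->
    cabs (f (z + h) - f z - d * h) <= e * cabs h.
Proof.
split.
  move=> /cvg_ex[d /=] /(cvgCP (F := 0^')) H; exists d => e /H /nbhs_ballP.
  move=> [r /= /Cx_gt0[r0 rE] B]; exists (Re r) => // h hr.
  have [->|h0] := eqVneq h 0; first by rewrite addr0 mulr0 !subrr cabs0 mulr0.
  have h0' : 0 < cabs h by rewrite lt_def cabs_eq0 h0 cabs_ge0.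
  have := B h; rewrite /= -ball_normE /ball_ /= sub0r normrN rE normCE ltcR.
  move=> /(_ hr h0) /ltW; rewrite -(ler_pM2r h0') -cabsM mulrBl.
  by rewrite /GRing.scale/= mulr1 [h + z]addrC mulrAC mulVf// mul1r.
move=> [d H]; apply/cvg_ex; exists d; apply/(cvgCP (F := 0^')) => e e0.
have e2 : 0 < e / 2 by rewrite divr_gt0.
have [r r0 B] := H _ e2.
apply/nbhs_ballP; exists r%:C => /=; first by rewrite (ltcR 0 r).
move=> h; rewrite -ball_normE /ball_ /= sub0r normrN normCE (ltcR _ r) => hr h0.
have h0' : 0 < cabs h by rewrite lt_def cabs_eq0 h0 cabs_ge0.
rewrite -(ltr_pM2r h0') -cabsM mulrBl /GRing.scale/= mulr1 [h + z]addrC.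
rewrite mulrAC mulVf// mul1r (le_lt_trans (B _ hr))// ltr_pM2r//.
by rewrite ltr_pdivrMr// ltr_pMr// ltr1n.
Qed.

Lemma cexp_quad h : cabs h <= 1 -> cabs (cexp h - 1 - h) <= 4 * expR 1 * cabs h ^+ 2.
Proof.
move=> h1; have := cexp_taylor h 2.
rewrite !big_nat_recr//= big_geq// add0r expr0 expr1 !fact0 /= !invr1 !mulr1 opprD addrA.
move=> /le_trans; apply.
have e1 : expR (cabs h) <= expR 1 by rewrite ler_expR.
have := ler_wpM2r (sqr_ge0 (2 * cabs h)) e1.
rewrite !exprMn (_ : (2`!)%:R = 2 :> R)//; lra.
Qed.

Lemma derivable_cexp z : derivable (@cexp R) z 1.
Proof.
apply/derivableCP; exists (cexp z) => e e0.
pose K := cabs (cexp z) * (4 * expR 1).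
have K0 : 0 <= K by rewrite !mulr_ge0// ?cabs_ge0 ?expR_ge0.
exists (Num.min 1 (e / (K + 1))).
  by rewrite lt_min ltr01 divr_gt0//= ltr_wpDl.
move=> h; rewrite lt_min => /andP[/ltW h1 hK].
rewrite (_ : _ - _ = cexp z * (cexp h - 1 - h)); last by rewrite cexpD; ring.
rewrite cabsM; apply: le_trans (ler_wpM2l (cabs_ge0 _) (cexp_quad h1)) _.
rewrite expr2 !mulrA -/K; apply: ler_wpM2r; first exact: cabs_ge0.
move: hK; rewrite ltr_pdivlMr; last by rewrite ltr_wpDl.
rewrite mulrDr mulr1 mulrC => /ltW; apply: le_trans.
by rewrite /K mulrA lerDl cabs_ge0.
Qed.

End ComplexExp.


(** * The exponential of a formal power series *)

Lemma cvgn_shift {V : ptopologicalType} (u : nat -> V) (l : V) :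
  (fun n => u n.+1) @ \oo --> l <-> u @ \oo --> l.
Proof. by have := cvg_shiftS u (nbhs l) => /= H; split; rewrite H. Qed.

Section FormalExp.
Context {R : realType}.
Implicit Types (p q : {poly Cx R}) (a : nat -> Cx R) (z w : Cx R).

Lemma coef_exp_agree p q n k : (forall i, (i <= n)%N -> p`_i = q`_i) ->
  forall i, (i <= n)%N -> (p ^+ k)`_i = (q ^+ k)`_i.
Proof.
move=> pq; elim: k => [|k IH] i ni; first by rewrite !expr0.
rewrite !exprS !coefM; apply: eq_bigr => j _.
have ji : (j <= i)%N by rewrite -ltnS.
by rewrite pq ?IH// ?(leq_trans (leq_subr _ _))// (leq_trans ji).
Qed.

Lemma coef_exp_small p k n : p`_0 = 0 -> (n < k)%N -> (p ^+ k)`_n = 0.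
Proof.
move=> p0; elim: k n => [//|k IH] n nk; rewrite exprS coefM big1// => j _.
have [j0|j0] := eqVneq (j : nat) 0%N; first by rewrite j0 p0 mul0r.
by rewrite IH ?mulr0//; move: (ltn_ord j) j0 nk; move: (j : nat) => i; lia.
Qed.

Lemma coef_exp_ge0 p k : (forall i, 0 <= p`_i) -> forall i, 0 <= (p ^+ k)`_i.
Proof.
move=> p0; elim: k => [|k IH] i; first by rewrite expr0 coef1; case: eqP.
by rewrite exprS coefM sumr_ge0// => j _; rewrite mulr_ge0.
Qed.

Lemma coef_exp_mono p q k : (forall i, 0 <= p`_i) -> (forall i, p`_i <= q`_i) ->
  forall i, (p ^+ k)`_i <= (q ^+ k)`_i.
Proof.
move=> p0 pq; elim: k => [|k IH] i; first by rewrite !expr0.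
rewrite !exprS !coefM ler_sum// => j _.
by apply: ler_pM => //; apply: coef_exp_ge0.
Qed.

(** The exponential series and the power series a are both cut at M. Under the hypotheses below, the
    coefficients up to M are already those of [fps_exp], and the later ones lie between 0 and those
    of [fps_exp]. *)
Definition trunc_exp a M : {poly Cx R} :=
  \sum_(k < M.+1) (k`!%:R)^-1 *: (\poly_(i < M.+1) a i) ^+ k.

Lemma fps_expE a n : fps_exp a n = (trunc_exp a n)`_n.
Proof. by []. Qed.

Variable a : nat -> Cx R.
Hypothesis a0 : a 0%N = 0.
Hypothesis a_ge0 : forall n, 0 <= a n.

Let P M := \poly_(i < M.+1) a i.
Let P0 M : (P M)`_0 = 0. Proof. by rewrite coef_poly/=. Qed.
Let P_ge0 M i : 0 <= (P M)`_i. Proof. by rewrite coef_poly; case: ifP. Qed.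
Let fact_ge0 k : 0 <= (k`!%:R)^-1 :> Cx R. Proof. by rewrite invr_ge0 ler0n. Qed.

Lemma trunc_exp_ge0 M i : 0 <= (trunc_exp a M)`_i.
Proof.
rewrite coef_sum sumr_ge0// => k _; rewrite coefZ mulr_ge0 ?fact_ge0//.
by apply: coef_exp_ge0 => j; exact: P_ge0.
Qed.

Lemma trunc_exp_coef M n : (n <= M)%N -> (trunc_exp a M)`_n = fps_exp a n.
Proof.
move=> nM; rewrite fps_expE /trunc_exp !coef_sum.
rewrite -!(big_mkord xpredT (fun k => ((k`!%:R)^-1 *: P _ ^+ k)`_n)).
rewrite (big_cat_nat (n := n.+1))//= [X in _ + X]big1_seq ?addr0; last first.
  move=> k; rewrite mem_index_iota => /andP[_ /andP[nk _]].
  by rewrite coefZ coef_exp_small ?mulr0.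
apply: eq_bigr => k _; rewrite !coefZ; congr (_ * _).
apply: (@coef_exp_agree _ _ n) => // i ni; rewrite !coef_poly !ltnS ni.
by rewrite (leq_trans ni nM).
Qed.

(** For n > M the truncation has fewer powers and smaller polynomials than [fps_exp]; as all
    coefficients are nonnegative, it can only be smaller. *)
Lemma trunc_exp_le M n : (trunc_exp a M)`_n <= fps_exp a n.
Proof.
have [nM|/ltnW nM] := leqP n M; first by rewrite trunc_exp_coef.
rewrite fps_expE /trunc_exp !coef_sum.
rewrite -!(big_mkord xpredT (fun k => ((k`!%:R)^-1 *: P _ ^+ k)`_n)).
rewrite [leRHS](big_cat_nat (n := M.+1))//= -[leLHS]addr0 lerD//; last first.
  rewrite sumr_ge0// => k _; rewrite coefZ mulr_ge0 ?fact_ge0//.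
  by apply: coef_exp_ge0 => j; exact: P_ge0.
apply: ler_sum => k _; rewrite !coefZ ler_wpM2l ?fact_ge0//.
apply: coef_exp_mono => [j|i]; first exact: P_ge0.
rewrite /P !coef_poly !ltnS.
case: leqP => iM; first by rewrite (leq_trans iM nM).
by case: ifP.
Qed.

Lemma horner_trunc_exp M z :
  (trunc_exp a M).[z] = \sum_(0 <= k < M.+1) (P M).[z] ^+ k * (k`!%:R)^-1.
Proof.
rewrite /trunc_exp horner_sum big_mkord; apply: eq_bigr => k _.
by rewrite hornerZ horner_exp mulrC.
Qed.

Lemma horner_P M z : (P M).[z] = series (fun n => a n * z ^+ n) M.+1.
Proof. by rewrite /P horner_poly /series/= big_mkord. Qed.

(** At z the truncation is the Taylor polynomial of degree M of the exponential, evaluated at a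
    partial sum of the series. These partial sums stay in a fixed disc, so the Taylor remainder
    tends to 0 while the exponential of the partial sum tends to that of G. *)
Lemma trunc_exp_cvg z (G : Cx R) : series (fun n => a n * z ^+ n) @ \oo --> G ->
  (fun M => (trunc_exp a M).[z]) @ \oo --> cexp G.
Proof.
move=> SG.
have PG : (fun M => (P M).[z]) @ \oo --> G.
  under eq_fun do rewrite horner_P.
  by apply/(cvgn_shift (series (fun n => a n * z ^+ n))).
pose B := cabs G + 1.
have B0 : 0 <= B by rewrite addr_ge0// cabs_ge0.
have [m _ PB] : \forall M \near \oo, cabs (P M).[z] <= B.
  have /cvgCP/(_ 1 ltr01) := PG; apply: filterS => M.
  move=> h; rewrite /B addrC -lerBlDr.
  rewrite lerBlDr -[(P M).[z]](subrK G) (le_trans (cabsD _ _))//.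
  by rewrite lerD2r ltW.
have c1 : (fun M => cexp (P M).[z]) @ \oo --> cexp G.
  exact: cvg_comp PG (@continuous_cexp R G).
have c2 : (fun M => 2 * (expR B * ((2 * B) ^+ M.+1 / M.+1`!%:R))) @ \oo --> (0 : R).
  have h : exp_coeff (2 * B) @ \oo --> (0 : R).
    exact/cvg_series_cvg_0/is_cvg_series_exp_coeff.
  have h' : (fun M => (2 * B) ^+ M.+1 / M.+1`!%:R) @ \oo --> (0 : R).
    by apply/(cvgn_shift (exp_coeff (2 * B))).
  rewrite -(mulr0 2) -(mulr0 (expR B)).
  by apply: cvgMl_tmp; apply: cvgMl_tmp.
apply/cvgCP => e e0; have e2 : 0 < e / 2 by rewrite divr_gt0.
have /cvgCP/(_ _ e2) h1 := c1.
have /cvgrPdist_lt/(_ _ e2) h2 := c2.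
near=> M.
rewrite -[_ - _](subrKA (cexp (P M).[z])) (le_lt_trans (cabsD _ _))//.
rewrite (splitr e) ltrD//; last by near: M.
have PM : cabs (P M).[z] <= B by apply: PB => /=; near: M; exact: nbhs_infty_ge.
rewrite horner_trunc_exp cabsC (le_lt_trans (cexp_taylor _ _))//.
apply: (@le_lt_trans _ _ (2 * (expR B * ((2 * B) ^+ M.+1 / M.+1`!%:R)))).
  rewrite -mulrA ler_pM2l// ler_pM ?expR_ge0 ?ler_expR//.
    by rewrite divr_ge0// exprn_ge0// mulr_ge0// cabs_ge0.
  rewrite ler_pM2r ?invr_gt0 ?ltr0n ?fact_gt0// lerXn2r ?nnegrE ?mulr_ge0 ?cabs_ge0//.
  by rewrite ler_pM2l.
rewrite -[ltLHS]ger0_norm; last first.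
  by rewrite mulr_ge0// mulr_ge0 ?expR_ge0// divr_ge0// exprn_ge0// mulr_ge0.
by rewrite -normrN -[X in `|X|]add0r; near: M.
Unshelve. all: by end_near. Qed.

(** The partial sum of the formal series and the M-th truncation share their coefficients up to M.
    By positivity the rest of the truncation at z is at most its rest at |z|, which is bounded by
    the increase from a fixed truncation m to M at |z|; that is small because the truncations
    converge at |z|. *)
Lemma fps_exp_cvg z (G Gr : Cx R) :
  series (fun n => a n * z ^+ n) @ \oo --> G ->
  series (fun n => a n * `|z| ^+ n : Cx R) @ \oo --> Gr ->
  series (fun n => fps_exp a n * z ^+ n) @ \oo --> cexp G.
Proof.
move=> SG SGr.
have QG := trunc_exp_cvg SG; have QGr := trunc_exp_cvg SGr.
pose S (z : Cx R) M := \sum_(0 <= n < M) fps_exp a n * z ^+ n.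
have r0 : 0 <= `|z| by exact: normr_ge0.
have key m M : (size (trunc_exp a m) <= M.+1)%N ->
    `|S z M.+1 - (trunc_exp a M).[z]| <=
      (trunc_exp a M).[`|z|] - (trunc_exp a m).[`|z|].
  move=> sm; pose sz := maxn (size (trunc_exp a M)) M.+1.
  have QE w : (trunc_exp a M).[w] = S w M.+1 +
      \sum_(M.+1 <= n < sz) (trunc_exp a M)`_n * w ^+ n.
    rewrite (horner_coef_wide _ (leq_maxl _ M.+1)) -/sz.
    rewrite -(big_mkord xpredT (fun n => (trunc_exp a M)`_n * w ^+ n)).
    rewrite (big_cat_nat (n := M.+1))//= ?leq_maxr//; congr (_ + _).
    apply: eq_big_nat => n /andP[_ nM]; rewrite trunc_exp_coef//.
  rewrite !QE opprD addrA subrr add0r normrN.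
  apply: (@le_trans _ _ (\sum_(M.+1 <= n < sz) (trunc_exp a M)`_n * `|z| ^+ n)).
    rewrite (le_trans (ler_norm_sum _ _ _))// ler_sum// => n _.
    by rewrite normrM normrX ger0_norm// trunc_exp_ge0.
  rewrite addrAC lerDr subr_ge0 (horner_coef_wide _ sm) /S big_mkord.
  apply: ler_sum => n _; rewrite ler_wpM2r ?exprn_ge0//.
  exact: trunc_exp_le.
apply/(cvgn_shift (series (fun n => fps_exp a n * z ^+ n))).
apply/cvgCP => e e0; have e3 : 0 < e / 3 by rewrite divr_gt0.
have /cvgCP/(_ _ e3) h1 := QG.
have /cvgCP/(_ _ e3) [m _ h2] := QGr.
near=> M.
have h3 : cabs (S z M.+1 - (trunc_exp a M).[z]) < e / 3 + e / 3.
  have mM : (m <= M)%N by near: M; exact: nbhs_infty_ge.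
  apply: (@le_lt_trans _ _ (cabs ((trunc_exp a M).[`|z|] - (trunc_exp a m).[`|z|]))).
    rewrite -lecR -!normCE.
    have k : (size (trunc_exp a m) <= M.+1)%N.
      by apply: leqW; near: M; exact: nbhs_infty_ge.
    have h := key _ _ k.
    by rewrite (ger0_norm (le_trans (normr_ge0 _) h)).
  rewrite -[_ - _](subrKA (cexp Gr)) (le_lt_trans (cabsD _ _))// ltrD//.
    exact: h2.
  by rewrite cabsC; apply: h2 => /=.
have -> : e = (e / 3 + e / 3) + e / 3 by field.
rewrite -[_ - _](subrKA (trunc_exp a M).[z]) (le_lt_trans (cabsD _ _))// ltrD//.
by near: M.
Unshelve. all: by end_near. Qed.

End FormalExp.


(** * Goursat's lemma on rectangles *)

Section Goursat.
Context {R : realType}.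
Implicit Types (a b c d s t e : R).

(** In the application Q and P are the real part and minus the imaginary part of a holomorphic
    function of s + i t. The hypothesis is pointwise differentiability together with one
    Cauchy-Riemann equation, dQ/ds + dP/dt = 0: the field (Q, P) has divergence 0. Continuity of the
    derivatives is not assumed. *)
Variables P Q : R -> R -> R.
Hypothesis PQ : forall s0 t0, s0 < 0 -> exists al be ga : R,
  forall e, 0 < e -> exists2 del, 0 < del & forall s t,
    `|s - s0| < del -> `|t - t0| < del ->
    `|Q s t - Q s0 t0 - al * (s - s0) - ga * (t - t0)| <= e * (`|s - s0| + `|t - t0|) /\
    `|P s t - P s0 t0 - be * (s - s0) + al * (t - t0)| <= e * (`|s - s0| + `|t - t0|).

Let near_dist (x0 e : R) : 0 < e -> \forall x \near x0, `|x0 - x| < e.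
Proof.
by move=> e0; have : id @ x0 --> x0; [exact: cvg_id|move=> /cvgrPdist_lt/(_ _ e0)].
Qed.

Let cont_of (f : R -> R) x0 k : (forall e, 0 < e -> exists2 del, 0 < del & forall x,
    `|x - x0| < del -> `|f x - f x0 - k * (x - x0)| <= e * `|x - x0|) ->
  {for x0, continuous f}.
Proof.
move=> H; apply/cvgrPdist_lt => e e0.
have [del del0 h] := H _ ltr01.
have k1 : 0 < `|k| + 1 by rewrite ltr_wpDl.
near=> x.
have x1 : `|x - x0| < del by rewrite distrC; near: x; exact: near_dist.
have x2 : `|x - x0| < e / (`|k| + 1).
  by rewrite distrC; near: x; apply: near_dist; rewrite divr_gt0.
have := h _ x1; rewrite mul1r => h3.
rewrite distrC -[_ - _](subrK (k * (x - x0))) (le_lt_trans (ler_normD _ _))//.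
move: x2; rewrite ltr_pdivlMr//; apply: le_lt_trans.
have -> : `|x - x0| * (`|k| + 1) = `|x - x0| + `|k| * `|x - x0| by ring.
by rewrite normrM lerD2r.
Unshelve. all: by end_near. Qed.

Lemma slice_continuous s : s < 0 -> continuous (Q s).
Proof.
move=> s0 t0; have [al [be [ga H]]] := PQ t0 s0.
apply: (@cont_of _ _ ga) => e /H[del del0 h]; exists del => // t tt.
have := h s t; rewrite subrr normr0 mulr0 subr0 add0r => /(_ del0 tt)[+ _].
by [].
Qed.

Let cPs t s : s < 0 -> {for s, continuous (fun s => P s t)}.
Proof.
move=> s0; have [al [be [ga H]]] := PQ t s0.
apply: (@cont_of _ _ be) => e /H[del del0 h]; exists del => // s' ss.
have := h s' t; rewrite subrr normr0 !mulr0 !addr0 => /(_ ss del0)[_].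
by [].
Qed.

Let riQ s a b : s < 0 -> rint `[a, b] (Q s).
Proof. by move=> s0; apply: rint_cont; exact: slice_continuous. Qed.

Let riP t a b : b < 0 -> rint `[a, b] (fun s => P s t).
Proof.
move=> b0; apply: continuous_compact_integrable; first exact: segment_compact.
apply: continuous_in_subspaceT => s; rewrite inE/= in_itv/= => /andP[_ sb].
by apply: cPs; exact: le_lt_trans b0.
Qed.

(** The outward flux of (Q, P) through the boundary of the rectangle [a, b] x [c, d]. *)
Definition flux a b c d := \int[leb R]_(s in `[a, b]) (P s d - P s c) +
  \int[leb R]_(t in `[c, d]) (Q b t - Q a t).

Let mI a b : measurable `[a, b]. Proof. by []. Qed.

Let fluxE a b c d : a <= b -> b < 0 -> flux a b c d =
  \int[leb R]_(s in `[a, b]) P s d - \int[leb R]_(s in `[a, b]) P s c +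
  (\int[leb R]_(t in `[c, d]) Q b t - \int[leb R]_(t in `[c, d]) Q a t).
Proof.
move=> ab b0; rewrite /flux !RintegralB//; try exact: riP.
all: by apply: riQ => //; exact: le_lt_trans b0.
Qed.

Let flux_split a m b c n d : a <= m -> m <= b -> b < 0 -> c <= n -> n <= d ->
  flux a b c d = flux a m c n + flux m b c n + (flux a m n d + flux m b n d).
Proof.
move=> am mb b0 cn nd.
have m0 : m < 0 by exact: le_lt_trans b0.
have a0 : a < 0 by exact: le_lt_trans m0.
rewrite !fluxE// ?(le_trans am)//.
rewrite !(@Rintegral_split _ (fun s => P s _) a m b)//; try exact: riP.
rewrite !(@Rintegral_split _ (Q _) c n d)//; try exact: riQ.
ring.
Qed.

(** The linear parts of P and Q contribute al (b - a)(d - c) with opposite signs, so that only the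
    errors of the first-order expansion are left. *)
Let flux_local s0 t0 e : s0 < 0 -> 0 < e -> exists2 del, 0 < del &
  forall a b c d, a <= s0 <= b -> c <= t0 <= d -> b < 0 -> b - a < del -> d - c < del ->
  `|flux a b c d| <= 2 * e * ((b - a) + (d - c)) ^+ 2.
Proof.
move=> s00 e0; have [al [be [ga H]]] := PQ t0 s00.
have [del del0 h] := H _ e0.
exists del => // a b c d /andP[as0 s0b] /andP[ct0 t0d] b0 ba dc.
have ab : a <= b by exact: le_trans s0b.
have cd : c <= d by exact: le_trans t0d.
have a0 : a < 0 by exact: le_lt_trans b0.
have Hn (x x0 y z : R) : y <= x <= z -> y <= x0 <= z -> `|x - x0| <= z - y.
  by move=> /andP[? ?] /andP[? ?]; rewrite ler_norml; apply/andP; split; lra.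
have bnd s t : a <= s <= b -> c <= t <= d ->
    `|Q s t - Q s0 t0 - al * (s - s0) - ga * (t - t0)| <= e * ((b - a) + (d - c)) /\
    `|P s t - P s0 t0 - be * (s - s0) + al * (t - t0)| <= e * ((b - a) + (d - c)).
  move=> sab tcd.
  have h1 : `|s - s0| <= b - a by apply: Hn => //; rewrite as0.
  have h2 : `|t - t0| <= d - c by apply: Hn => //; rewrite ct0.
  have [] := h s t (le_lt_trans h1 ba) (le_lt_trans h2 dc).
  by split; (eapply le_trans; [eassumption|rewrite ler_pM2l// lerD]).
have lab : fine (leb R `[a, b]) = b - a.
  rewrite lebesgue_measure_itv/= lte_fin; case: ifPn => //=.
  by rewrite -leNgt => ba'; apply/esym/eqP; rewrite subr_eq0 eq_le ba' ab.
have lcd : fine (leb R `[c, d]) = d - c.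
  rewrite lebesgue_measure_itv/= lte_fin; case: ifPn => //=.
  by rewrite -leNgt => ba'; apply/esym/eqP; rewrite subr_eq0 eq_le ba' cd.
have lfin x y : (leb R `[x, y] < +oo)%E.
  by rewrite lebesgue_measure_itv/=; case: ifPn => _; rewrite ?ltry// -EFinB ltry.
have i1 : `|\int[leb R]_(s in `[a, b]) (P s d - P s c) + al * (d - c) * (b - a)| <=
    2 * e * ((b - a) + (d - c)) * (b - a).
  have := @Rintegral_close R `[a, b] (fun s => P s d - P s c) (- (al * (d - c)))
    (2 * e * ((b - a) + (d - c))) (mI a b) (lfin a b).
  rewrite lab mulNr !opprK; apply.
    by apply: rintB => //; exact: riP.
  move=> s; rewrite /= in_itv/= => sab.
  have [_ b1] := bnd s d sab (introT andP (conj cd (lexx d))).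
  have [_ b2] := bnd s c sab (introT andP (conj (lexx c) cd)).
  have := le_trans (ler_normB _ _) (lerD b1 b2).
  rewrite (_ : _ - _ - _ + _ - _ = P s d - P s c + al * (d - c)); last by ring.
  by move=> hh; apply: le_trans hh _; rewrite le_eqVlt; apply/orP; left; apply/eqP; ring.
have i2 : `|\int[leb R]_(t in `[c, d]) (Q b t - Q a t) - al * (b - a) * (d - c)| <=
    2 * e * ((b - a) + (d - c)) * (d - c).
  have := @Rintegral_close R `[c, d] (fun t => Q b t - Q a t) (al * (b - a))
    (2 * e * ((b - a) + (d - c))) (mI c d) (lfin c d).
  rewrite lcd; apply.
    by apply: rintB => //; exact: riQ.
  move=> t; rewrite /= in_itv/= => tcd.
  have [b1 _] := bnd b t (introT andP (conj ab (lexx b))) tcd.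
  have [b2 _] := bnd a t (introT andP (conj (lexx a) ab)) tcd.
  have := le_trans (ler_normB _ _) (lerD b1 b2).
  rewrite (_ : _ - _ - _ - _ - _ = Q b t - Q a t - al * (b - a)); last by ring.
  by move=> hh; apply: le_trans hh _; rewrite le_eqVlt; apply/orP; left; apply/eqP; ring.
have := le_trans (ler_normD _ _) (lerD i1 i2).
rewrite /flux (_ : _ + _ + _ = \int[leb R]_(s in `[a, b]) (P s d - P s c) +
  \int[leb R]_(t in `[c, d]) (Q b t - Q a t)); last by ring.
by move=> hh; apply: le_trans hh _; rewrite le_eqVlt; apply/orP; left; apply/eqP; ring.
Qed.

Let flux_quarter x y W H E : 0 < W -> 0 < H -> x + (W + W) < 0 ->
  4 * E < `|flux x (x + (W + W)) y (y + (H + H))| ->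
  exists q : R * R, [/\ E < `|flux q.1 (q.1 + W) q.2 (q.2 + H)|,
    x <= q.1, q.1 <= x + W, y <= q.2 & q.2 <= y + H].
Proof.
move=> W0 H0 x0 bad.
have W0' := ltW W0; have H0' := ltW H0.
have xW : x <= x + W by rewrite lerDl.
have yH : y <= y + H by rewrite lerDl.
have [g1|g1] := ltP E `|flux x (x + W) y (y + H)|; first by exists (x, y).
have [g2|g2] := ltP E `|flux (x + W) (x + W + W) y (y + H)|.
  by exists (x + W, y).
have [g3|g3] := ltP E `|flux x (x + W) (y + H) (y + H + H)|.
  by exists (x, y + H).
have [g4|g4] := ltP E `|flux (x + W) (x + W + W) (y + H) (y + H + H)|.
  by exists (x + W, y + H).
exfalso; move: bad; apply/negP; rewrite -leNgt.
rewrite !addrA in x0 *.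
rewrite (@flux_split _ (x + W) _ _ (y + H))// ?lerDl//.
apply: le_trans (ler_normD _ _) _.
have e4 : 4 * E = E + E + (E + E) by ring.
by rewrite e4 lerD// (le_trans (ler_normD _ _))// lerD.
Qed.

Let nested (A wn : nat -> R) : (forall n, A n <= A n.+1) ->
  (forall n, A n.+1 + wn n.+1 <= A n + wn n) -> (forall n, 0 <= wn n) ->
  exists s, forall n, A n <= s <= A n + wn n.
Proof.
move=> A1 A2 w0.
have A3 n m : A n <= A (n + m)%N.
  by elim: m => [|m IH]; rewrite ?addn0// addnS (le_trans IH).
have A4 n m : A (n + m)%N + wn (n + m)%N <= A n + wn n.
  by elim: m => [|m IH]; rewrite ?addn0// addnS (le_trans _ IH).
have A5 n m : A m <= A n + wn n.
  have [nm|/ltnW mn] := leqP n m.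
    by apply: le_trans (A4 n (m - n)%N); rewrite subnKC// lerDl.
  by apply: (le_trans (A3 m (n - m)%N)); rewrite subnKC// lerDl.
exists (sup (range A)) => n; apply/andP; split.
  by apply: ub_le_sup; [exists (A 0%N + wn 0%N) => _ [m _ <-]|exists n].
by apply: ge_sup; [exists (A 0%N); exists 0%N|move=> _ [m _ <-]].
Qed.

(** If the flux exceeded eta, repeated quartering would produce nested rectangles whose sides are
    halved and whose flux still exceeds eta / 4^n. At their common point this contradicts the
    quadratic bound of [flux_local]. *)
Lemma flux0 a b c d : a < b -> b < 0 -> c < d -> flux a b c d = 0.
Proof.
move=> ab b0 cd; apply/eqP; rewrite -normr_le0; apply/ler_addgt0Pr => eta eta0.
rewrite add0r leNgt; apply/negP => bad0.
have tw n : 0 < 2 ^+ n :> R by rewrite exprn_gt0.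
have [wn wnE] : exists wn : nat -> R, forall n, wn n = (b - a) / 2 ^+ n by eexists.
have [hn hnE] : exists hn : nat -> R, forall n, hn n = (d - c) / 2 ^+ n by eexists.
have wnS n : wn n = wn n.+1 + wn n.+1.
  by rewrite !wnE exprS; field; rewrite gt_eqF.
have hnS n : hn n = hn n.+1 + hn n.+1.
  by rewrite !hnE exprS; field; rewrite gt_eqF.
have wn0 n : 0 < wn n by rewrite wnE divr_gt0// subr_gt0.
have hn0 n : 0 < hn n by rewrite hnE divr_gt0// subr_gt0.
pose bad n (p : R * R) := p.1 + wn n <= b /\
  eta / 4 ^+ n < `|flux p.1 (p.1 + wn n) p.2 (p.2 + hn n)|.
have step (np : nat * (R * R)) : exists q : R * R, bad np.1 np.2 ->
    [/\ bad np.1.+1 q, np.2.1 <= q.1, q.1 + wn np.1.+1 <= np.2.1 + wn np.1,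
      np.2.2 <= q.2 & q.2 + hn np.1.+1 <= np.2.2 + hn np.1].
  case: np => n [x y] /=.
  have [[/= xb xy]|nb] := pselect (bad n (x, y)); last by exists (0, 0).
  rewrite wnS hnS in xy; rewrite wnS in xb.
  have [||||q [q1 q2 q3 q4 q5]] := @flux_quarter x y (wn n.+1) (hn n.+1) (eta / 4 ^+ n.+1).
  - exact: wn0.
  - exact: hn0.
  - exact: le_lt_trans b0.
  - rewrite (_ : 4 * _ = eta / 4 ^+ n)// exprS invfM mulrCA mulrA; field.
    by rewrite expf_neq0.
  exists q => _; rewrite [wn n]wnS [hn n]hnS !addrA !lerD2r; split => //.
  split => //; apply: le_trans xb; rewrite addrA lerD2r//.
have [nxt nxtP] := choice step.
pose u := fix u n := if n is m.+1 then nxt (m, u m) else (a, c).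
have badu n : bad n (u n).
  elim: n => [|n IH] /=; last by have [] := nxtP (n, u n) IH.
  have e1 x y : x + (y - x) = y :> R by rewrite addrC subrK.
  by split; rewrite /= ?wnE ?hnE !expr0 !divr1 !e1.
have [s0 s0P] : exists s, forall n, (u n).1 <= s <= (u n).1 + wn n.
  apply: nested => n; last exact: ltW.
  - by have [_] := nxtP (n, u n) (badu n).
  - by have [_ _] := nxtP (n, u n) (badu n).
have [t0 t0P] : exists s, forall n, (u n).2 <= s <= (u n).2 + hn n.
  apply: nested => n; last exact: ltW.
  - by have [_ _ _] := nxtP (n, u n) (badu n).
  - by have [_ _ _ _] := nxtP (n, u n) (badu n).
have s00 : s0 < 0.
  have [h _] := badu 0%N; have /andP[_ h'] := s0P 0%N.
  by apply: le_lt_trans b0; exact: le_trans h' h.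
(* With this value the bound of [flux_local] for the n-th rectangle is exactly eta / 4^n. *)
pose e := eta / (2 * ((b - a) + (d - c)) ^+ 2).
have bad2 : 0 < (b - a) + (d - c) by rewrite addr_gt0// subr_gt0.
have e0 : 0 < e by rewrite divr_gt0// mulr_gt0// exprn_gt0.
have [del del0 H] := flux_local t0 s00 e0.
have wlim (x : R) : (fun n => x / 2 ^+ n) @ \oo --> (0 : R).
  rewrite -[X in _ --> X](mulr0 x); apply: cvgMl_tmp.
  under eq_fun do rewrite -exprVn.
  by apply: cvg_expr; rewrite ger0_norm ?invr_ge0// invf_lt1// ltr1n.
have /cvgrPdist_lt/(_ _ del0)[n1 _ H1] := wlim (b - a).
have /cvgrPdist_lt/(_ _ del0)[n2 _ H2] := wlim (d - c).
pose n := maxn n1 n2.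
have hw : wn n < del.
  have := H1 n (leq_maxl _ _); rewrite sub0r normrN -wnE.
  exact/le_lt_trans/ler_norm.
have hh : hn n < del.
  have := H2 n (leq_maxr _ _); rewrite sub0r normrN -hnE.
  exact/le_lt_trans/ler_norm.
have [bn1 bn2] := badu n.
have e1 x y : x + y - x = y :> R by rewrite addrAC subrr add0r.
have := H _ _ _ _ (s0P n) (t0P n) (le_lt_trans bn1 b0).
rewrite !e1 => /(_ hw hh); apply/negP; rewrite -ltNge; apply: le_lt_trans bn2.
rewrite wnE hnE -mulrDl exprMn exprVn -exprM mulnC exprM (_ : 2 ^+ 2 = 4 :> R); last by ring.
by rewrite /e mulrA; apply: ler_wpM2r; [rewrite invr_ge0 exprn_ge0|rewrite le_eqVlt; apply/orP; left; apply/eqP; field; rewrite gt_eqF].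
Qed.

(** On a rectangle of height 2 pi the two integrals of P cancel by periodicity, which leaves those
    of Q. *)
Lemma mean_const a b : (forall s t, P s (t + 2 * pi) = P s t) -> a < b -> b < 0 ->
  J (Q a) = J (Q b).
Proof.
move=> Pp ab b0.
have a0 : a < 0 by exact: lt_trans b0.
have := flux0 ab b0 twopi_gt0; rewrite fluxE ?ltW//.
under eq_Rintegral do rewrite -[2 * pi]add0r Pp.
rewrite subrr add0r => /eqP; rewrite subr_eq0 => /eqP h.
by rewrite !J_itv ?h//; apply: rint_per_cont; exact: slice_continuous.
Qed.

End Goursat.


(** * The mean value property and the bound at the centre *)

Section MeanValue.
Context {R : realType}.
Implicit Types (a b c d s t e r x y : R) (z w h : Cx R).

Local Notation Re := (@complex.Re R).
Local Notation Im := (@complex.Im R).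

Lemma derivable_compC (f g : Cx R -> Cx R) z : derivable g z 1 ->
  derivable f (g z) 1 -> derivable (fun w => f (g w)) z 1.
Proof.
move=> /derivable1_diffP dg /derivable1_diffP df; apply/derivable1_diffP.
exact: (@differentiable_comp _ (Cx R) (Cx R) (Cx R) g f z dg df).
Qed.

Lemma derivable_mulC (f g : Cx R -> Cx R) z : derivable f z 1 ->
  derivable g z 1 -> derivable (fun w => f w * g w) z 1.
Proof. by move=> df dg; exact: (@derivableM _ (Cx R) f g z 1 df dg). Qed.

Lemma derivable_addC (f g : Cx R -> Cx R) z : derivable f z 1 ->
  derivable g z 1 -> derivable (fun w => f w + g w) z 1.
Proof. by move=> df dg; exact: (@derivableD _ (Cx R) (Cx R) f g z 1 df dg). Qed.

Lemma derivable_cstC (c : Cx R) z : derivable (fun=> c : Cx R) z 1.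
Proof. exact: (@derivable_cst _ (Cx R) (Cx R) c z 1). Qed.

Lemma derivable_powC (f : Cx R -> Cx R) n z : derivable f z 1 ->
  derivable (fun w => f w ^+ n) z 1.
Proof.
move=> df; elim: n => [|n IH]; first exact: derivable_cstC.
by under eq_fun do rewrite exprS; exact: derivable_mulC.
Qed.

Lemma cexp_log_polar s t : cexp (s +i* t : Cx R) = (expR s)%:C * cis t.
Proof. by []. Qed.

Lemma derivable_continuousC (f : Cx R -> Cx R) z : derivable f z 1 ->
  forall e, 0 < e -> exists2 r, 0 < r & forall w, cabs (w - z) < r -> cabs (f w - f z) < e.
Proof.
move=> /derivableCP[d H] e e0; have [r r0 B] := H _ ltr01.
have d1 : 0 < cabs d + 1 by rewrite ltr_wpDl// cabs_ge0.
exists (Num.min r (e / (cabs d + 1))); first by rewrite lt_min r0 divr_gt0.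
move=> w; rewrite lt_min => /andP[w1 w2].
have := B _ w1; rewrite mul1r [z + _]addrC subrK => h1.
rewrite -[_ - _](subrK (d * (w - z))) (le_lt_trans (cabsD _ _))//.
move: w2; rewrite ltr_pdivlMr//; apply: le_lt_trans.
have -> : cabs (w - z) * (cabs d + 1) = cabs (w - z) + cabs d * cabs (w - z) by ring.
by rewrite cabsM lerD2r.
Qed.

(** For F (exp (s + i t)) with s < 0 the mean over t does not depend on s by [mean_const]; for s
    tending to minus infinity it tends to the value at 0 by continuity of F. *)
Lemma mean_value (F : Cx R -> Cx R) r : analytic_disc F -> 0 < r < 1 ->
  J (fun t => Re (F (r%:C * cis t))) = 2 * pi * Re (F 0).
Proof.
move=> dF /andP[r0 r1].
pose k w := F (cexp w).
have inD s t : s < 0 -> disc R (cexp (s +i* t : Cx R)).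
  by move=> s0; rewrite /disc /= cabs_cexp /= -[ltRHS]expR0 ltr_expR.
have dk s t : s < 0 -> derivable k (s +i* t : Cx R) 1.
  by move=> s0; apply: derivable_compC; [exact: derivable_cexp|exact/dF/inD].
pose Q s t := Re (k (s +i* t : Cx R)); pose P s t := - Im (k (s +i* t : Cx R)).
have PQ s0 t0 : s0 < 0 -> exists al be ga : R,
  forall e, 0 < e -> exists2 del, 0 < del & forall s t,
    `|s - s0| < del -> `|t - t0| < del ->
    `|Q s t - Q s0 t0 - al * (s - s0) - ga * (t - t0)| <= e * (`|s - s0| + `|t - t0|) /\
    `|P s t - P s0 t0 - be * (s - s0) + al * (t - t0)| <= e * (`|s - s0| + `|t - t0|).
  move=> s00; have /derivableCP[D H] := dk s0 t0 s00.
  exists (Re D), (- Im D), (- Im D) => e e0; have [del del0 B] := H e e0.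
  have del2 : 0 < del / 2 by rewrite divr_gt0.
  exists (del / 2) => // s t ss tt.
  pose h : Cx R := (s - s0) +i* (t - t0).
  have hle : cabs h <= `|s - s0| + `|t - t0| by exact: cabs_le_ReIm.
  have hdel : cabs h < del by rewrite (le_lt_trans hle)// (splitr del) ltrD.
  have := B h hdel.
  have -> : (s0 +i* t0) + h = (s +i* t : Cx R).
    by apply: Cx_eq => /=; rewrite addrC subrK.
  move=> /le_trans/(_ (ler_wpM2l (ltW e0) hle)) hb.
  split; apply: le_trans hb.
    apply: le_trans (norm_Re_le _); rewrite !cReB cReM /= /Q.
    by rewrite le_eqVlt; apply/orP; left; apply/eqP; congr `|_|; ring.
  rewrite -normrN; apply: le_trans (norm_Im_le _); rewrite !cImB cImM /= /P.
  by rewrite le_eqVlt; apply/orP; left; apply/eqP; congr `|_|; ring.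
have Pp s t : P s (t + 2 * pi) = P s t.
  rewrite /P /k !cexp_log_polar cisD.
  by rewrite (_ : cis (2 * pi) = 1) ?mulr1// /cis [2 * pi]mulr_natl cos2pi sin2pi.
have Jc s : s < 0 -> J (Q s) = 2 * pi * Re (F 0).
  move=> s0; apply/eqP; rewrite -subr_eq0 -normr_le0; apply/ler_addgt0Pr => e e0.
  rewrite add0r.
  have [del del0 H] : exists2 del, 0 < del & forall w, cabs (w - 0) < del -> cabs (F w - F 0) < e / (2 * pi).
    apply: derivable_continuousC; last by rewrite divr_gt0// twopi_gt0.
    by apply: dF; rewrite /disc/= cabs0.
  pose s1 := Num.min (s - 1) (ln (Num.min del 1) - 1).
  have s1s : s1 < s by rewrite /s1 gt_min gtrDl ltrN10.
  have m0 : 0 < Num.min del 1 by rewrite lt_min del0 ltr01.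
  have s1d : expR s1 < del.
    have hl : s1 < ln (Num.min del 1) by rewrite /s1 gt_min [X in _ || X]gtrDl ltrN10 orbT.
    have : expR s1 < expR (ln (Num.min del 1)) by rewrite ltr_expR.
    by rewrite lnK ?posrE// lt_min => /andP[].
  have s10 : s1 < 0 by exact: lt_trans s0.
  rewrite -(mean_const PQ Pp s1s s0).
  have ri : rint per (Q s1).
    by apply: rint_per_cont; exact: (slice_continuous PQ).
  have lper : fine (leb R per) = 2 * pi by exact: (congr1 fine leb_per).
  have := Rintegral_close (f := Q s1) (k := Re (F 0)) (e := e / (2 * pi))
    measurable_per leb_per_fin ri.
  rewrite lper mulrVK ?unitfE ?gt_eqF ?twopi_gt0// [Re (F 0) * _]mulrC; apply => t _.
  rewrite /Q -cReB (le_trans (norm_Re_le _))// ltW// H// subr0 cabs_cexp//.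
rewrite -(Jc (ln r)); last by rewrite ln_lt0// r0.
by apply: eq_J => t; rewrite /Q /k cexp_log_polar lnK ?posrE.
Qed.

(** After multiplication by a unimodular constant the value at 0 is |F 0|, and the mean value
    property of the real part applies. *)
Lemma max_center (F : Cx R -> Cx R) r B : analytic_disc F -> 0 < r < 1 ->
  (forall t, cabs (F (r%:C * cis t)) <= B) -> cabs (F 0) <= B.
Proof.
move=> dF r01 FB.
have [F0|F0] := eqVneq (F 0) 0.
  by rewrite F0 cabs0 (le_trans (cabs_ge0 _) (FB 0)).
pose u : Cx R := (cabs (F 0))%:C / F 0.
have cu : cabs u = 1.
  by rewrite cabsM cabsV cabs_real ger0_norm ?cabs_ge0// mulfV// cabs_eq0.
have dG : analytic_disc (fun z => u * F z).
  by move=> z /dF dFz; apply: derivable_mulC; [exact: derivable_cstC|].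
have := mean_value dG r01.
rewrite {2}/u mulfVK//= => h.
have tp := @twopi_gt0 R.
rewrite -(ler_pM2l tp) -h -J_cst.
have bnd t : `|Re (u * F (r%:C * cis t))| <= B.
  by rewrite (le_trans (norm_Re_le _))// cabsM cu mul1r.
have [_ r1] := andP r01.
apply: le_J; last by move=> t; exact: le_trans (ler_norm _) (bnd t).
  apply: rint_per_cont => t.
  have dGt : derivable (fun z => u * F z) (r%:C * cis t) 1.
    apply: dG; rewrite /disc/= cabsM cabs_cis mulr1 cabs_real ger0_norm//.
    by case/andP: r01 => /ltW.
  have cG : {for (r%:C * cis t : Cx R), continuous (fun z => u * F z)}.
    by have /derivable1_diffP/differentiable_continuous := dGt.
  have c1 : (fun t => r%:C * cis t) @ t --> (r%:C * cis t : Cx R).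
    by apply: cvgMl_tmp; exact: continuous_cis.
  have c2 := cvg_comp _ _ c1 cG.
  exact: cvg_comp c2 (@continuous_ReC R _).
by apply: rint_per_cont => t; exact: cst_continuous.
Qed.

Lemma analytic_entire (f : Cx R -> Cx R) : (forall z, derivable f z 1) -> analytic_disc f.
Proof. by move=> df z _. Qed.

(** On the circle of radius r, cos (n t) and sin (n t) are the real parts of (z/r)^n and -i (z/r)^n.
    The exponential of p is then a zero-free entire function with modulus exp q on that circle. *)
Lemma trigp_Re q r : 0 < r -> trigp q -> exists p : Cx R -> Cx R,
  [/\ forall z, derivable p z 1, forall t, Re (p (r%:C * cis t)) = q t &
      2 * pi * Re (p 0) = J q].
Proof.
move=> r0; have rn0 : (r%:C : Cx R) != 0.
  by rewrite -cabs_eq0 cabs_real normr_eq0 gt_eqF.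
have dpow (c : Cx R) n z : derivable (fun z : Cx R => c * (z / r%:C) ^+ n) z 1.
  have d1 : derivable (fun z : Cx R => z / r%:C) z 1.
    by apply: derivable_mulC; [exact: derivable_id|exact: derivable_cstC].
  by apply: derivable_mulC; [exact: derivable_cstC|exact: derivable_powC].
have pE t n : ((r%:C * cis t : Cx R) / r%:C) ^+ n = cis (n%:R * t).
  by rewrite mulrAC mulfV// mul1r cisX.
elim=> [n|n|f g tf [p [p1 p2 p3]] tg [p' [p1' p2' p3']]|c f tf [p [p1 p2 p3]]].
- exists (fun z => 1 * (z / r%:C) ^+ n); split => // [t|]; first by rewrite mul1r pE.
  rewrite mul1r mul0r expr0n J_cos; case: (n == 0%N) => /=; by rewrite ?mulr1 ?mulr0.
- exists (fun z => (0 -i* 1) * (z / r%:C) ^+ n); split => // [t|].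
    by rewrite pE cReM /= mul0r mulN1r opprK add0r.
  by rewrite mul0r expr0n J_sin cReM; case: (n == 0%N) => /=; rewrite !(mul0r,mulr0,subr0).
- exists (fun z => p z + p' z); split => [z|t|].
  + exact: derivable_addC.
  + by rewrite cReD p2 p2'.
  + by rewrite cReD mulrDr p3 p3' JD//; exact: trigp_rint.
- exists (fun z => c%:C * p z); split => [z|t|].
  + by apply: derivable_mulC; [exact: derivable_cstC|].
  + by rewrite cReM /= mul0r subr0 p2.
  + by rewrite cReM /= mul0r subr0 mulrCA p3 JZ//; exact: trigp_rint.
Qed.

End MeanValue.


(** * The lacunary power series in the disc *)

Section Lacunary.
Context {R : realType}.
Variable N : nat.
Hypothesis N1 : (1 < N)%N.
Implicit Types (a b c d s t e r x y : R) (z w h : Cx R).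

Local Notation Re := (@complex.Re R).
Local Notation Im := (@complex.Im R).

Definition lacS n z := \sum_(0 <= k < n) z ^+ (N ^ k) : Cx R.
Definition Lac z : Cx R := limn (lacS ^~ z).

Lemma cvgn_addn {V : ptopologicalType} (u : nat -> V) (l : V) n :
  u @ \oo --> l -> (fun m => u (n + m)%N) @ \oo --> l.
Proof.
move=> ul; elim: n => [|n IH]; first exact: ul.
have := (cvgn_shift (fun m => u (n + m)%N) l).2 IH.
by under eq_fun do rewrite addnS -addSn.
Qed.

Lemma cvg_cabs_le (u : nat -> Cx R) (l : Cx R) b : u @ \oo --> l ->
  (forall n, cabs (u n) <= b) -> cabs l <= b.
Proof.
move=> /cvgCP ul ub; apply/ler_addgt0Pr => e /ul[m _ /(_ m (leqnn m))] h.
rewrite -(subrK (u m) l) (le_trans (cabsD _ _))// addrC lerD//.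
by rewrite cabsC ltW.
Qed.

Lemma geo_le r n : 0 <= r < 1 -> \sum_(0 <= k < n) r ^+ k <= (1 - r)^-1.
Proof.
move=> /andP[r0 r1].
have r1' : 0 < 1 - r by rewrite subr_gt0.
rewrite -[leRHS]mul1r ler_pdivlMr// mulr_suml.
have -> : \sum_(0 <= k < n) r ^+ k * (1 - r) = 1 - r ^+ n.
  elim: n => [|n IH]; first by rewrite big_geq// expr0 subrr.
  by rewrite big_nat_recr//= IH exprS; ring.
by rewrite gerBl exprn_ge0.
Qed.

Lemma geo_cvg r : 0 <= r < 1 -> cvgn (series (fun k => r ^+ k)).
Proof.
move=> r01; have /andP[r0 r1] := r01.
apply: nondecreasing_is_cvgn.
  by apply: nondecreasing_series => k _ _; rewrite exprn_ge0.
by exists (1 - r)^-1 => _ [n _ <-]; exact: geo_le.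
Qed.

Lemma expn_geid k : (k <= N ^ k)%N.
Proof. exact/ltnW/ltn_expl. Qed.

Lemma lacS_series z : lacS ^~ z = series (fun k => z ^+ (N ^ k)).
Proof. by []. Qed.

Lemma Lac_cvg z : disc R z -> lacS ^~ z @ \oo --> Lac z.
Proof.
move=> zD; have r01 : 0 <= cabs z < 1 by rewrite cabs_ge0.
have [|l hl] := @seriesC_cvg R (fun k => z ^+ (N ^ k)) _ _ (geo_cvg r01).
  by move=> k; rewrite cabsX ler_wiXn2l ?cabs_ge0 ?(ltW zD)// expn_geid.
by rewrite /Lac (limC hl).
Qed.

Lemma lac_tail z n : disc R z ->
  cabs (Lac z - lacS n z) <= cabs z ^+ n / (1 - cabs z).
Proof.
move=> zD; have r01 : 0 <= cabs z < 1 by rewrite cabs_ge0.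
have h : (fun m => lacS (n + m) z - lacS n z) @ \oo --> Lac z - lacS n z.
  apply: cvgB; last exact: cvg_cst.
  by apply: (cvgn_addn (u := lacS ^~ z)); exact: Lac_cvg.
apply: (cvg_cabs_le h) => m.
rewrite /lacS (big_cat_nat (n := n)) ?leq_addr//= addrAC subrr add0r.
apply: le_trans (cabs_sum _ _ _) _.
rewrite -{1}[n]add0n big_addn addKn.
apply: (@le_trans _ _ (\sum_(0 <= k < m) cabs z ^+ n * cabs z ^+ k)).
  apply: ler_sum => k _; rewrite cabsX -exprD ler_wiXn2l ?cabs_ge0 ?(ltW zD)//.
  by rewrite addnC expn_geid.
by rewrite -mulr_sumr ler_wpM2l ?exprn_ge0 ?cabs_ge0// geo_le.
Qed.

(** On [0, 1] one has exp (x/2) <= 1 / (1 - x/2) <= 1 + x. *)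
Lemma expR_le_sqr x : 0 <= x <= 1 -> expR x <= (1 + x) ^+ 2.
Proof.
move=> /andP[x0 x1].
have -> : x = x / 2 + x / 2 by rewrite -splitr.
rewrite expRD -expr2 -splitr lerXn2r ?nnegrE ?expR_ge0 ?addr_ge0//.
have h : 1 - x / 2 <= expR (- (x / 2)) by exact: expR_ge1Dx.
have h1 : 0 < 1 - x / 2 by lra.
rewrite expRN in h.
rewrite -[leLHS]invrK -[leRHS]invrK lef_pV2 ?posrE ?invr_gt0 ?expR_gt0//; last by lra.
apply: le_trans h; rewrite -[leLHS]div1r ler_pdivrMr; last by lra.
have : 0 <= x * (1 - x) by rewrite mulr_ge0// subr_ge0.
lra.
Qed.

(** The exponents N^k may be lowered to 2^k. Then the product telescopes: with x = r^(2^k), the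
    factor exp x <= (1 + x)^2 turns (1 - x)^2 into at most (1 - x^2)^2. *)
Lemma exp_lac_bound r n : 0 <= r < 1 ->
  expR (\sum_(0 <= k < n) r ^+ (N ^ k)) * (1 - r) ^+ 2 <= 1.
Proof.
move=> /andP[r0 r1].
apply: (@le_trans _ _ (expR (\sum_(0 <= k < n) r ^+ (2 ^ k)) * (1 - r) ^+ 2)).
  rewrite ler_wpM2r ?sqr_ge0// ler_expR ler_sum// => k _.
  by rewrite ler_wiXn2l ?(ltW r1)//; case: k => [//|k]; rewrite leq_exp2r.
apply: (@le_trans _ _ ((1 - r ^+ (2 ^ n)) ^+ 2)); last first.
  have h0 : 0 <= r ^+ (2 ^ n) by rewrite exprn_ge0.
  have h1 : r ^+ (2 ^ n) <= 1 by rewrite exprn_ile1// ltW.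
  by rewrite exprn_ile1 ?subr_ge0// gerBl.
elim: n => [|n IH]; first by rewrite big_geq// expR0 mul1r.
rewrite big_nat_recr//= expRD mulrAC.
have h0 : 0 <= r ^+ (2 ^ n) by rewrite exprn_ge0.
have h1 : r ^+ (2 ^ n) <= 1 by rewrite exprn_ile1// ltW.
have h2 := @expR_le_sqr (r ^+ (2 ^ n)); rewrite h0 h1 in h2.
apply: le_trans (ler_pM _ _ IH (h2 isT)) _.
- by rewrite mulr_ge0 ?expR_ge0 ?sqr_ge0.
- exact: expR_ge0.
rewrite -exprMn expnSr exprM.
by rewrite (_ : (1 - _) * _ = 1 - (r ^+ (2 ^ n)) ^+ 2)//; ring.
Qed.

Lemma exp_Lac_le z : disc R z -> expR (cabs (Lac z)) * (1 - cabs z) ^+ 2 <= 1.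
Proof.
move=> zD; have r01 : 0 <= cabs z < 1 by rewrite cabs_ge0.
have r1 : 0 < 1 - cabs z by rewrite subr_gt0.
have r2 : 0 < (1 - cabs z) ^+ 2 by rewrite exprn_gt0.
rewrite -ler_pdivlMr// div1r -[leRHS]lnK ?posrE ?invr_gt0// ler_expR.
apply: (cvg_cabs_le (Lac_cvg zD)) => n.
rewrite -ler_expR lnK ?posrE ?invr_gt0// -div1r ler_pdivlMr//.
apply: le_trans (exp_lac_bound n r01).
rewrite ler_wpM2r ?sqr_ge0// ler_expR (le_trans (cabs_sum _ _ _))//.
by rewrite ler_sum// => k _; rewrite cabsX.
Qed.

(** The number 1 - s^n is (1 - s) times a sum of n powers of s, each at least s^n; the sharper bound
    1 - s^n is the one that passes through the induction. *)
Lemma nexp_bound s n : 0 <= s < 1 -> n%:R * s ^+ n * (1 - s) <= 1.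
Proof.
move=> /andP[s0 s1].
suff: n%:R * s ^+ n * (1 - s) <= 1 - s ^+ n.
  by move=> /le_trans; apply; rewrite gerBl exprn_ge0.
elim: n => [|n IH]; first by rewrite mul0r mul0r expr0 subrr.
have h1 := ler_wpM2l s0 IH.
have h2 : 0 <= (1 - s ^+ n.+1) * (1 - s).
  by rewrite mulr_ge0 ?subr_ge0 ?(ltW s1)// exprn_ile1// ltW.
rewrite -natr1; move: h1 h2; rewrite exprS; lra.
Qed.

(** Write r = s^4. In r^n two of the four factors s^n absorb n^2 by [nexp_bound], and the others are
    dominated by a geometric series. This controls the second derivatives of the terms. *)
Let sqexp_cvg r : 0 <= r < 1 -> exists2 b : nat -> R,
  (forall k, ((N ^ k)%:R) ^+ 2 * r ^+ (N ^ k) <= b k) & cvgn (series b).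
Proof.
move=> /andP[r0 r1]; pose s := Num.sqrt (Num.sqrt r).
have s0 : 0 <= s by exact: sqrtr_ge0.
have s1 : s < 1 by rewrite /s -sqrtr1 ltr_sqrt// -[ltRHS]sqrtr1 ltr_sqrt.
have s01 : 0 <= s < 1 by rewrite s0.
have r_s : r = s ^+ 4.
  by rewrite (exprM s 2 2) /s !sqr_sqrtr// sqrtr_ge0.
exists (fun k => (1 - s) ^- 2 * s ^+ k); last first.
  exact: is_cvg_seriesZ (geo_cvg s01).
move=> k; rewrite r_s; set n := (N ^ k)%N.
have d0 : 0 < (1 - s) ^+ 2 by rewrite exprn_gt0// subr_gt0.
rewrite -(ler_pM2l d0) mulVKf ?gt_eqF//.
have -> : (1 - s) ^+ 2 * (n%:R ^+ 2 * (s ^+ 4) ^+ n) =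
   (n%:R * s ^+ n * (1 - s)) ^+ 2 * (s ^+ n * s ^+ n).
  by rewrite -exprM mulnC exprM -[in (_ ^+ n) ^+ 4](@exprM _ s n) /= ?exprM; ring.
have h := nexp_bound n s01.
have h0 : 0 <= n%:R * s ^+ n * (1 - s).
  by rewrite !mulr_ge0 ?exprn_ge0 ?subr_ge0// ltW.
have sn0 : 0 <= s ^+ n by rewrite exprn_ge0.
have sn1 : s ^+ n <= 1 by rewrite exprn_ile1// ltW.
apply: (@le_trans _ _ (1 * (s ^+ n * s ^+ n))).
  by rewrite ler_wpM2r ?mulr_ge0// exprn_ile1.
rewrite mul1r; apply: (@le_trans _ _ (s ^+ n)); first by rewrite ler_piMl.
by rewrite ler_wiXn2l ?(ltW s1)// expn_geid.
Qed.

(** The second-order remainder of z^n in the disc of radius r, by induction on n. The factor r^2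
    stands on the left so that the exponent n - 2 does not occur. *)
Let pow_quad r z h n : 0 < r -> r <= 1 -> cabs z <= r -> cabs (z + h) <= r ->
  r ^+ 2 * cabs ((z + h) ^+ n - z ^+ n - n%:R * z ^+ n.-1 * h) <=
    n%:R ^+ 2 * r ^+ n * cabs h ^+ 2.
Proof.
move=> r0 r1 zr zhr; elim: n => [|n IH].
  by rewrite !expr0 subrr mul0r mul0r subrr cabs0 mulr0 expr0n !mul0r.
have -> : (z + h) ^+ n.+1 - z ^+ n.+1 - n.+1%:R * z ^+ n.+1.-1 * h =
   (z + h) * ((z + h) ^+ n - z ^+ n - n%:R * z ^+ n.-1 * h) + n%:R * z ^+ n.-1 * h ^+ 2.
  by case: n {IH} => [|n] /=; rewrite -?natr1 ?exprS ?expr0; ring.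
apply: le_trans (ler_wpM2l (sqr_ge0 r) (cabsD _ _)) _.
rewrite mulrDr cabsM.
have h2 := sqr_ge0 (cabs h).
have i1 : r ^+ 2 * (cabs (z + h) * cabs ((z + h) ^+ n - z ^+ n - n%:R * z ^+ n.-1 * h))
   <= r * (n%:R ^+ 2 * r ^+ n * cabs h ^+ 2).
  rewrite mulrCA; apply: ler_pM => //; first exact: cabs_ge0.
  by rewrite mulr_ge0 ?sqr_ge0 ?cabs_ge0.
have i2 : r ^+ 2 * cabs (n%:R * z ^+ n.-1 * h ^+ 2) <= n%:R * r ^+ n.+1 * cabs h ^+ 2.
  rewrite !cabsM !cabsX.
  have -> : cabs (n%:R : Cx R) = n%:R :> R.
    by rewrite -[X in cabs X](rmorph_nat (real_complex R)) cabs_real ger0_norm.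
  case: n {IH i1} => [|n]; first by rewrite !mul0r mulr0.
  rewrite /=; have e1 : cabs z ^+ n <= r ^+ n.
    by rewrite lerXn2r ?nnegrE ?cabs_ge0// ltW.
  have c0 : 0 <= r ^+ 2 * n.+1%:R * cabs h ^+ 2.
    by apply: mulr_ge0 => //; apply: mulr_ge0 => //; exact: sqr_ge0.
  have := ler_wpM2l c0 e1.
  rewrite (_ : r ^+ 2 * n.+1%:R * cabs h ^+ 2 * r ^+ n = n.+1%:R * r ^+ n.+2 * cabs h ^+ 2).
    by rewrite (_ : r ^+ 2 * n.+1%:R * _ * _ = r ^+ 2 * (n.+1%:R * cabs z ^+ n * cabs h ^+ 2)); last by ring.
  by rewrite !exprS; ring.
apply: le_trans (lerD i1 i2) _.
have n0 : 0 <= n%:R :> R by [].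
have rn : 0 <= r ^+ n.+1 by rewrite exprn_ge0// ltW.
rewrite -subr_ge0 -natr1 (_ : _ - _ = (n%:R + 1) * (r ^+ n.+1 * cabs h ^+ 2)).
  by apply: mulr_ge0; [exact: addr_ge0|exact: mulr_ge0].
by rewrite !exprS; ring.
Qed.

(** Termwise differentiation: by [pow_quad] and [sqexp_cvg] the quadratic remainders add up to at
    most C |h|^2 / r^2, uniformly in the number of terms. *)
Lemma derivable_Lac z : disc R z -> derivable Lac z 1.
Proof.
move=> zD.
have [r [r0 r1 zr]] : exists r : R, [/\ 0 < r, r < 1 & cabs z < r].
  exists ((1 + cabs z) / 2); move: zD; rewrite /disc/= => zD.
  by have := cabs_ge0 z; split; lra.
have r01 : 0 <= r < 1 by rewrite ltW.
have [b bP bcvg] := sqexp_cvg r01.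
have r2 : 0 < r ^+ 2 by rewrite exprn_gt0.
have b0 k : 0 <= b k.
  by apply: le_trans (bP k); apply: mulr_ge0; [exact: sqr_ge0|rewrite exprn_ge0// ltW].
have [C C0 bC] : exists2 C, 0 <= C & forall n, \sum_(0 <= k < n) b k <= C.
  have nd : nondecreasing_seq (series b) by apply: nondecreasing_series => k _ _.
  have h := nondecreasing_cvgn_le nd bcvg.
  by exists (limn (series b)) => //; apply: le_trans (h 0%N); rewrite /series/= big_geq.
have dterm k : cabs ((N ^ k)%:R * z ^+ (N ^ k).-1) <= r ^- 2 * b k.
  rewrite -(ler_pM2l r2) mulVKf ?gt_eqF//; apply: le_trans (bP k).
  rewrite cabsM cabsX.
  have -> : cabs ((N ^ k)%:R : Cx R) = (N ^ k)%:R :> R.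
    by rewrite -[X in cabs X](rmorph_nat (real_complex R)) cabs_real ger0_norm.
  have : (0 < N ^ k)%N by rewrite expn_gt0 (ltnW N1).
  case: (N ^ k)%N => [//|n] _ /=.
  have e1 : cabs z ^+ n <= r ^+ n by rewrite lerXn2r ?nnegrE ?cabs_ge0// ltW.
  have rn : 0 <= r ^+ n by rewrite exprn_ge0// ltW.
  have n1 : 1 <= n.+1%:R :> R by rewrite ler1n.
  have n0 : 0 <= n.+1%:R :> R by [].
  apply: (@le_trans _ _ (r ^+ 2 * (n.+1%:R * r ^+ n))).
    by rewrite ler_wpM2l ?(ltW r2)// ler_wpM2l.
  apply: (@le_trans _ _ (n.+1%:R * r ^+ n.+1)).
    rewrite [r ^+ n.+1]exprS (_ : r ^+ 2 * _ = r * (n.+1%:R * (r * r ^+ n))); last by ring.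
    by rewrite ler_piMl ?(ltW r1)// !mulr_ge0// ltW.
  rewrite expr2 -mulrA; apply: ler_peMl => //.
  by apply: mulr_ge0 => //; rewrite exprn_ge0// ltW.
have [d dP] := seriesC_cvg dterm (@is_cvg_seriesZ _ _ (r ^- 2) bcvg).
apply/derivableCP; exists d => e e0.
have C1 : 0 < C + 1 by rewrite ltr_wpDl.
exists (Num.min (r - cabs z) (e * r ^+ 2 / (C + 1))).
  by rewrite lt_min subr_gt0 zr divr_gt0// mulr_gt0.
move=> h; rewrite lt_min => /andP[h1 h2].
have zhr : cabs (z + h) < r.
  by rewrite (le_lt_trans (cabsD _ _))//; move: h1; lra.
have zhD : disc R (z + h) by rewrite /disc/= (lt_trans zhr).
pose u n := lacS n (z + h) - lacS n z - series (fun k => (N ^ k)%:R * z ^+ (N ^ k).-1) n * h.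
have ucvg : u @ \oo --> Lac (z + h) - Lac z - d * h.
  apply: cvgB; last exact: cvgMr_tmp.
  by apply: cvgB; exact: Lac_cvg.
apply: (cvg_cabs_le ucvg) => n.
rewrite -(ler_pM2l r2).
have uE : u n = \sum_(0 <= k < n) ((z + h) ^+ (N ^ k) - z ^+ (N ^ k) - (N ^ k)%:R * z ^+ (N ^ k).-1 * h).
  by rewrite /u /lacS /series/= mulr_suml -!sumrB.
rewrite uE.
apply: (@le_trans _ _ (r ^+ 2 * \sum_(0 <= k < n) cabs ((z + h) ^+ (N ^ k) - z ^+ (N ^ k) - (N ^ k)%:R * z ^+ (N ^ k).-1 * h))).
  by rewrite ler_wpM2l ?(ltW r2)// cabs_sum.
rewrite mulr_sumr.
apply: (@le_trans _ _ (\sum_(0 <= k < n) b k * cabs h ^+ 2)).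
  apply: ler_sum => k _.
  apply: le_trans (pow_quad (N ^ k) r0 (ltW r1) (ltW zr) (ltW zhr)) _.
  by rewrite ler_wpM2r ?sqr_ge0.
rewrite -mulr_suml expr2 mulrA mulrA ler_wpM2r ?cabs_ge0//.
have : cabs h * (C + 1) <= e * r ^+ 2 by rewrite -ler_pdivlMr// ltW.
rewrite [r ^+ 2 * e]mulrC; apply: le_trans; rewrite mulrC ler_wpM2l ?cabs_ge0//.
by rewrite (le_trans (bC n))// lerDl.
Qed.

End Lacunary.


(** * Membership in the algebra A_1 and failure of the Nevanlinna property *)

Section Growth.
Context {R : realType}.
Variable N : nat.
Hypothesis N1 : (1 < N)%N.
Implicit Types (a b c d s t e r x y : R) (z w h : Cx R) (f g : Cx R -> Cx R).

Local Notation Re := (@complex.Re R).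
Local Notation Im := (@complex.Im R).
Local Notation Lac := (@Lac R N).

Lemma eq_disc_derivable f g z : (forall z, disc R z -> f z = g z) -> disc R z ->
  derivable g z 1 -> derivable f z 1.
Proof.
move=> fg zD /derivableCP[d H]; apply/derivableCP; exists d => e e0.
have [r r0 B] := H e e0.
exists (Num.min r (1 - cabs z)); first by rewrite lt_min r0 subr_gt0.
move=> h; rewrite lt_min => /andP[hr h1]; rewrite !fg//; first exact: B.
by rewrite /disc/= (le_lt_trans (cabsD _ _))//; move: h1; rewrite ltrBrDl.
Qed.

(** The values c = 1 and c = -1 give f and its inverse; both are at most exp (2 |Lac z|), hence at
    most (1 - |z|)^-4 by [exp_Lac_le]. *)
Lemma in_A1_exp f (c : R) : `|c| = 1 -> (forall z, disc R z -> f z = cexp (c%:C * (2 * Lac z))) ->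
  in_A1 f.
Proof.
move=> c1 fE; split.
  move=> z zD; apply: (eq_disc_derivable fE zD).
  apply: derivable_compC; last exact: derivable_cexp.
  apply: derivable_mulC; first exact: derivable_cstC.
  apply: derivable_mulC; first exact: derivable_cstC.
  exact: derivable_Lac.
exists 1, 4; split => // z zD; rewrite fE// cabs_cexp mul1r.
have r1 : 0 < 1 - cabs z by rewrite subr_gt0.
rewrite powRN (powR_mulrn 4) ?(ltW r1)//.
have r4 : 0 < (1 - cabs z) ^+ 4 by rewrite exprn_gt0.
rewrite -div1r ler_pdivlMr//.
have h := exp_Lac_le N1 zD.
have h0 : 0 <= expR (cabs (Lac z)) * (1 - cabs z) ^+ 2.
  by rewrite mulr_ge0 ?expR_ge0 ?sqr_ge0.
apply: (@le_trans _ _ ((expR (cabs (Lac z)) * (1 - cabs z) ^+ 2) ^+ 2)); last by rewrite exprn_ile1.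
rewrite exprMn -exprM; apply: ler_wpM2r; first exact: ltW.
rewrite expr2 -expRD ler_expR (le_trans (ler_norm _))// (le_trans (norm_Re_le _))//.
rewrite cabsM cabs_real c1 mul1r cabsM.
have -> : cabs (2 : Cx R) = 2 by rewrite -[X in cabs X](rmorph_nat (real_complex R)) cabs_real ger0_norm.
by rewrite mulr2n mulrDl mul1r.
Qed.

Lemma unit_A1_exp f : (forall z, disc R z -> f z = cexp (2 * Lac z)) -> unit_A1 f.
Proof.
move=> fE; split.
  by apply: (@in_A1_exp _ 1); rewrite ?normr1// => z zD; rewrite fE// mul1r.
exists (fun z => cexp (- (2 * Lac z))); last by move=> z zD; rewrite fE// cexpN.
apply: (@in_A1_exp _ (-1)); first by rewrite normrN1.
by move=> z zD; rewrite rmorphN1 mulN1r.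
Qed.

Lemma J_lac0 (l : seq R) : J (lac N l) = 0.
Proof.
elim: l => [|a l IH] /=; first by rewrite J_cst mulr0.
have t1 : trigp (fun t => cos (1%:R * t) : R) := Trigp_cos 1.
have t2 := trigp_scale_arg N (trigp_lac N l).
transitivity (J (fun t => a * cos (1%:R * t) + lac N l (N%:R * t))).
  by apply: eq_J => t; rewrite mul1r.
rewrite JD; [|exact: trigp_rint (Trigp_scale a t1)|exact: trigp_rint t2].
rewrite JZ; last exact: trigp_rint t1.
by rewrite J_cos mulr0 add0r (J_trigp_scale (ltnW N1) (trigp_lac N l)).
Qed.

Lemma Re_cis t x : Re (x%:C * cis t) = x * cos t.
Proof. by rewrite cReM /= mul0r subr0. Qed.

Lemma lacS_lac r n t : 2 * Re (lacS N n (r%:C * cis t)) =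
  lac N (mkseq (fun k => 2 * r ^+ (N ^ k)) n) t.
Proof.
rewrite lacE /lacS cRe_sum mulr_sumr; apply: eq_bigr => k _.
by rewrite exprMn cisX -rmorphXn Re_cis mulrA.
Qed.

(** A form of Jensen's inequality. Choose p entire with real part q on the circle and bound h exp p
    at the centre by its values on the circle: where q <= 0 the modulus is at most M, and elsewhere
    it is at most |h f| exp d = |g| exp d. *)
Lemma jensen_bound f (g h : Cx R -> Cx R) M q r d :
  bounded_analytic h -> 0 < r < 1 -> 0 <= d ->
  (forall z, disc R z -> cabs (g z) <= M) -> (forall z, disc R z -> cabs (h z) <= M) ->
  (forall z, disc R z -> h z != 0) -> (forall z, disc R z -> f z = g z / h z) ->
  trigp q ->
  (forall t, q t <= 0 \/ expR (q t) <= cabs (f (r%:C * cis t)) * expR d) ->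
  cabs (h 0) * expR ((2 * pi)^-1 * J q) <= M * expR d.
Proof.
move=> [ah _] r01 d0 gM hM hn0 fE tq qf.
have /andP[r0 r1] := r01.
have [p [p1 p2 p3]] := trigp_Re r0 tq.
have inD t : disc R (r%:C * cis t).
  by rewrite /disc/= cabsM cabs_cis mulr1 cabs_real ger0_norm// ltW.
have aF : analytic_disc (fun z => h z * cexp (p z)).
  move=> z zD; apply: derivable_mulC; first exact: ah.
  by apply: derivable_compC; [exact: p1|exact: derivable_cexp].
have M0 : 0 <= M by apply: le_trans (hM _ (inD 0)); exact: cabs_ge0.
have := @max_center R _ r (M * expR d) aF r01.
rewrite cabsM cabs_cexp -p3 mulKf ?gt_eqF ?twopi_gt0//; apply => t.
rewrite cabsM cabs_cexp p2.
have zD := inD t; move: (qf t) => [q0|qd].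
  apply: ler_pM; rewrite ?cabs_ge0 ?expR_ge0 ?hM//.
  by rewrite ler_expR (le_trans q0).
apply: le_trans (ler_wpM2l (cabs_ge0 _) qd) _.
rewrite mulrA ler_wpM2r ?expR_ge0// -cabsM fE// mulrC divfK ?hn0//; exact: gM.
Qed.

(** For r = exp (- 1 / (2 N^m)) one has r^(N^k) >= r^(N^m) >= 1/2 for all k < m, so each of the
    first m squares is at least 1. *)
Lemma sqsum_lac_large (m : nat) : exists2 r, 0 < r < 1 & forall n, (m <= n)%N ->
  m%:R <= @sqsum R (mkseq (fun k => 2 * r ^+ (N ^ k)) n) :> R.
Proof.
have N0 : 0 < (N ^ m)%:R :> R by rewrite ltr0n expn_gt0 (ltnW N1).
pose y : R := - (2 * (N ^ m)%:R)^-1.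
have y0 : y < 0 by rewrite oppr_lt0 invr_gt0 mulr_gt0.
have r01 : 0 < expR y < 1 by rewrite expR_gt0 -[ltRHS]expR0 ltr_expR.
exists (expR y) => // n mn; rewrite sqsum_mkseq (big_cat_nat (n := m))//=.
have e0 k : 0 <= expR y ^+ (N ^ k) by rewrite exprn_ge0// expR_ge0.
rewrite ler_wpDr//; first by rewrite sumr_ge0// => k _; exact: sqr_ge0.
have -> : m%:R = \sum_(0 <= k < m) 1 :> R by rewrite sumr_const_nat subn0.
apply: ler_sum_nat => k /andP[_ km].
rewrite -[leLHS](expr1n _ 2) lerXn2r ?nnegrE// ?mulr_ge0//.
apply: (@le_trans _ _ (2 * expR y ^+ (N ^ m))).
  have := expR_ge1Dx ((N ^ m)%:R * y); rewrite expRM_natl.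
  rewrite /y mulrN invfM mulrCA mulfV ?gt_eqF// mulr1; lra.
rewrite ler_pM2l//; apply: ler_wiXn2l; rewrite ?expR_ge0//.
  by rewrite ltW//; case/andP: r01.
by rewrite leq_exp2l// ltnW.
Qed.

(** On a circle log|f| is nearly the lacunary sum u, whose positive part is (u + |u|)/2. Replacing
    |u| by its minorant from [norm_ge_quartic] gives a trigonometric polynomial q to which
    [jensen_bound] applies. As u has mean 0, the mean of q is governed by the L^1 lower bound and
    exceeds every constant. *)
Lemma not_nevanlinna_exp f : (forall z, disc R z -> f z = cexp (2 * Lac z)) ->
  ~ nevanlinna f.
Proof.
move=> fE [g [h [[ag [Mg hMg]] bh hn0 fgh]]].
have [ah [Mh hMh]] := bh.
have D0 : disc R 0 by rewrite /disc/= cabs0.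
pose M := Num.max Mg Mh.
have gM z : disc R z -> cabs (g z) <= M by move=> /hMg/le_trans; apply; rewrite le_max lexx.
have hM z : disc R z -> cabs (h z) <= M by move=> /hMh/le_trans; apply; rewrite le_max lexx orbT.
have h0 : 0 < cabs (h 0) by rewrite lt_def cabs_ge0 cabs_eq0 hn0.
(* [K] is the bound on the mean of [q] that a quotient of bounded functions would force. *)
pose K := M * expR 1 / cabs (h 0).
(* The factor 36 answers the lower bound pi * sg / 18 for [J q], which makes the mean of q at least
   sg / 36. *)
have [m mK] : exists m : nat, (36 * K) ^+ 2 < m%:R.
  by have [m] := archi_boundP (sqr_ge0 (36 * K)); exists (Num.bound ((36 * K) ^+ 2)); rewrite archi_boundP// sqr_ge0.
have [r r01 hr] := sqsum_lac_large m.
have /andP[r0 r1] := r01.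
(* The truncation error of [Lac] at radius r is at most 1/2, so log|f| differs from u by at most 1;
   this is the value d = 1 given to [jensen_bound]. *)
have [n mn tail] : exists2 n, (m <= n)%N & r ^+ n / (1 - r) <= 2^-1.
  have : (fun n => r ^+ n / (1 - r)) @ \oo --> (0 : R).
    rewrite -[X in _ --> X](mul0r (1 - r)^-1); apply: cvgMr_tmp.
    by apply: expr_cvg0; rewrite ltW.
  move=> /cvgrPdist_le /(_ 2^-1) [|n0 _ H]; first by rewrite invr_gt0.
  exists (maxn m n0); first exact: leq_maxl.
  have := H _ (leq_maxr m n0); rewrite sub0r normrN; apply: le_trans; exact: ler_norm.
pose l := mkseq (fun k => 2 * r ^+ (N ^ k)) n.
have Am : m%:R <= sqsum l by exact: hr.
pose sg := Num.sqrt (sqsum l).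
have A0 : 0 <= sqsum l by rewrite sqsum_ge0.
have sgE : sqsum l = sg ^+ 2 by rewrite sqr_sqrtr.
have sgK : 36 * K < sg.
  have [K0|K0] := ltP (36 * K) 0; first by rewrite (lt_le_trans K0)// sqrtr_ge0.
  by rewrite -(ltr_pXn2r (n := 2))// ?nnegrE ?sqrtr_ge0// -sgE (lt_le_trans mK).
have K0 : 0 <= K.
  by rewrite divr_ge0 ?cabs_ge0// mulr_ge0 ?expR_ge0// (le_trans (cabs_ge0 _) (hM _ D0)).
have sg0 : 0 < sg by rewrite (le_lt_trans _ sgK)// mulr_ge0.
pose s := 3 * sg.
have s0 : 0 < s by rewrite mulr_gt0.
pose q t := 2^-1 * (lac N l t + (s^-1 * lac N l t ^+ 2 - (s ^+ 3)^-1 * lac N l t ^+ 4)).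
have tl := trigp_lac N l.
have t2 := Trigp_scale s^-1 (trigp_exp 2 tl).
have t4 := Trigp_scale (s ^+ 3)^-1 (trigp_exp 4 tl).
have t24 := trigp_sub t2 t4.
have tq : trigp q := Trigp_scale 2^-1 (Trigp_add tl t24).
have qle t : q t <= 2^-1 * (lac N l t + `|lac N l t|).
  rewrite ler_pM2l ?invr_gt0// lerD2l mulrC [X in _ - X]mulrC.
  exact: norm_ge_quartic.
have qf t : q t <= 0 \/ expR (q t) <= cabs (f (r%:C * cis t)) * expR 1.
  have zD : disc R (r%:C * cis t).
    by rewrite /disc/= cabsM cabs_cis mulr1 cabs_real ger0_norm// ltW.
  have := qle t; have [v0|v0] := leP (lac N l t) 0.
    by rewrite ler0_norm// subrr mulr0; left.
  rewrite gtr0_norm// => qv; right.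
  rewrite fE// cabs_cexp -expRD ler_expR.
  have -> : Re (2 * Lac (r%:C * cis t)) = 2 * Re (Lac (r%:C * cis t)).
    by rewrite (_ : (2 : Cx R) = (2 : R)%:C) ?cReM /= ?mul0r ?subr0// rmorph_nat.
  have := lac_tail N1 n zD; rewrite cabsM cabs_cis mulr1 cabs_real ger0_norm ?(ltW r0)//.
  move=> /le_trans/(_ tail) /(le_trans (norm_Re_le _)); rewrite cReB ler_norml => /andP[h1 _].
  move: qv h1; rewrite /l -lacS_lac; lra.
have := jensen_bound bh r01 ler01 gM hM hn0 fgh tq qf.
have Jq : pi * sg / 18 <= J q.
  rewrite /q JZ; last exact: trigp_rint (Trigp_add tl t24).
  rewrite JD; [|exact: trigp_rint tl|exact: trigp_rint t24].
  rewrite J_lac0 add0r JB; [|exact: trigp_rint t2|exact: trigp_rint t4].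
  rewrite !JZ; [|exact/trigp_rint/trigp_exp|exact/trigp_rint/trigp_exp].
  have := J_lac4 N1 l; rewrite (J_lac2 N1) sgE => J4.
  have s3 : 0 < (s ^+ 3)^-1 by rewrite invr_gt0 exprn_gt0.
  have := ler_wpM2l (ltW s3) J4.
  have -> : (s ^+ 3)^-1 * (6 * pi * (sg ^+ 2) ^+ 2) = 2 / 9 * pi * sg.
    by rewrite /s; field; rewrite gt_eqF.
  have -> : s^-1 * (pi * sg ^+ 2) = pi * sg / 3 by rewrite /s; field; rewrite gt_eqF.
  move: (_ * J _) => X; lra.
apply/negP; rewrite -ltNge.
have -> : M * expR 1 = cabs (h 0) * K by rewrite /K [RHS]mulrCA mulfV ?gt_eqF// mulr1.
rewrite ltr_pM2l//.
have mq : K <= (2 * pi)^-1 * J q.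
  rewrite ler_pdivlMl ?twopi_gt0//; apply: le_trans Jq.
  have := pi_gt0 R; move: sgK => /ltW.
  move=> h1 h2; have := ler_wpM2l (ltW h2) h1; lra.
apply: (le_lt_trans mq).
have := expR_ge1Dx ((2 * pi)^-1 * J q); apply: lt_le_trans.
by rewrite ltrDr.
Qed.

End Growth.


(** * The Weierstrass-type function and its modulus of continuity *)

Section Cumulative.
Context {R : realType}.
Variable N : nat.
Hypothesis N1 : (1 < N)%N.
Implicit Types (a b c d s t e r x y : R).

Definition wei n x : R := - (pi^-1 * \sum_(0 <= k < n) N%:R ^- k * sin ((N ^ k)%:R * x)).
Definition dwei n x : R := - (pi^-1 * \sum_(0 <= k < n) cos ((N ^ k)%:R * x)).
Definition weil x : R := limn (wei ^~ x).

Lemma sin_lip x y : `|sin y - sin x| <= `|y - x|.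
Proof.
wlog xy : x y / x <= y.
  move=> W; have [xy|/ltW yx] := leP x y; first exact: W.
  by rewrite distrC [leRHS]distrC W.
have [c _ ->] := MVT_segment xy (fun s _ => is_derive_sin s)
  (continuous_subspaceT (@continuous_sin R)).
by rewrite normrM ler_piMl// cos_max.
Qed.

Let N0 : N%:R != 0 :> R. Proof. by rewrite pnatr_eq0; case: N N1. Qed.
Let NX k : (N ^ k)%:R != 0 :> R. Proof. by rewrite natrX expf_neq0. Qed.

(** The factor N^-k makes each term Lipschitz with constant 1; on the other hand a term never moves
    by more than 2 N^-k. *)
Let term k x y : `|N%:R ^- k * sin ((N ^ k)%:R * y) - N%:R ^- k * sin ((N ^ k)%:R * x)| <=
  Num.min `|y - x| (2 * 2^-1 ^+ k).
Proof.
rewrite -mulrBr normrM ger0_norm ?invr_ge0 ?exprn_ge0// -natrX.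
have Nk : 0 < (N ^ k)%:R^-1 :> R by rewrite invr_gt0 lt_def NX ler0n.
rewrite le_min; apply/andP; split.
  apply: (@le_trans _ _ ((N ^ k)%:R^-1 * `|(N ^ k)%:R * y - (N ^ k)%:R * x|)).
    by rewrite ler_pM2l// sin_lip.
  by rewrite -mulrBr normrM ger0_norm// mulKf.
apply: (@le_trans _ _ ((N ^ k)%:R^-1 * 2)).
  rewrite ler_pM2l//; apply: le_trans (ler_normB _ _) _.
  by rewrite [leRHS](_ : 2 = 1 + 1)// lerD// sin_max.
rewrite mulrC ler_pM2l// exprVn -natrX lef_pV2 ?posrE ?ltr0n ?expn_gt0 ?(ltnW N1)//.
by rewrite ler_nat; case: k {Nk} => [//|k]; rewrite leq_exp2r.
Qed.

Let geo_tail n m : (n <= m)%N -> \sum_(n <= k < m) 2 * 2^-1 ^+ k <= 4 * 2^-1 ^+ n :> R.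
Proof.
move=> nm.
have -> : \sum_(n <= k < m) 2 * 2^-1 ^+ k = 4 * 2^-1 ^+ n - 4 * 2^-1 ^+ m :> R.
  rewrite (@telescope_sumr_eq _ n m (fun k => - (4 * 2^-1 ^+ k))) //; first by ring.
  by move=> k _; rewrite exprS; field.
by rewrite gerBl mulr_ge0// exprn_ge0.
Qed.

Lemma weiB n m x : (n <= m)%N -> wei m x - wei n x =
  - (pi^-1 * \sum_(n <= k < m) N%:R ^- k * sin ((N ^ k)%:R * x)).
Proof.
by move=> nm; rewrite /wei (big_cat_nat (n := n) (p := m))//=; ring.
Qed.

Let pi1 : 0 <= (pi : R)^-1 <= 1.
Proof.
rewrite invr_ge0 pi_ge0/= invf_le1 ?pi_gt0//; apply: le_trans (pi_ge2 R).
by rewrite ler1n.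
Qed.

(** The first bound of [term] is used for k < n0 and the geometric one from n0 on, with n0 free.
    Removing the terms below n only drops nonnegative summands from the estimate, so the bound does
    not depend on n or m. *)
Lemma wei_osc n m x y n0 : (n <= m)%N ->
  `|(wei m y - wei n y) - (wei m x - wei n x)| <= n0%:R * `|y - x| + 4 * 2^-1 ^+ n0.
Proof.
move=> nm; rewrite !weiB//.
have -> : - (pi^-1 * \sum_(n <= k < m) N%:R ^- k * sin ((N ^ k)%:R * y)) -
   - (pi^-1 * \sum_(n <= k < m) N%:R ^- k * sin ((N ^ k)%:R * x)) =
   - (pi^-1 * \sum_(n <= k < m) (N%:R ^- k * sin ((N ^ k)%:R * y) - N%:R ^- k * sin ((N ^ k)%:R * x))).
  by rewrite sumrB; ring.
rewrite normrN normrM; have /andP[p0 p1] := pi1; rewrite ger0_norm//.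
apply: le_trans (ler_piMl _ p1) _ => //.
pose c k := Num.min `|y - x| (2 * 2^-1 ^+ k) : R.
have c0 k : 0 <= c k by rewrite /c le_min normr_ge0 mulr_ge0// exprn_ge0.
apply: (@le_trans _ _ (\sum_(n <= k < m) c k)).
  by apply: le_trans (ler_norm_sum _ _ _) _; apply: ler_sum => k _; exact: term.
apply: (@le_trans _ _ (\sum_(0 <= k < maxn m n0) c k)).
  rewrite [leRHS](big_cat_nat (n := n))//= ?leq_max ?nm//.
  rewrite [X in _ <= _ + X](big_cat_nat (n := m))//= ?leq_maxl//.
  by rewrite addrCA lerDl addr_ge0// sumr_ge0.
rewrite (big_cat_nat (n := n0))//= ?leq_maxr// lerD//.
  apply: (@le_trans _ _ (\sum_(0 <= k < n0) `|y - x|)).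
    by apply: ler_sum => k _; rewrite /c ge_min lexx.
  by rewrite sumr_const_nat subn0 mulr_natl.
apply: le_trans (geo_tail (leq_maxr m n0)).
by apply: ler_sum => k _; rewrite /c ge_min lexx orbT.
Qed.

Lemma wei0 n : wei n 0 = 0.
Proof.
by rewrite /wei big1 ?mulr0 ?oppr0// => k _; rewrite mulr0 sin0 mulr0.
Qed.

Lemma wei_close n m x : (n <= m)%N -> `|wei m x - wei n x| <= 2 * 2^-1 ^+ n * 2.
Proof.
move=> nm; rewrite weiB// normrN normrM; have /andP[p0 p1] := pi1; rewrite ger0_norm//.
apply: le_trans (ler_piMl _ p1) _ => //.
apply: le_trans (ler_norm_sum _ _ _) _.
apply: (@le_trans _ _ (\sum_(n <= k < m) 2 * 2^-1 ^+ k)).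
  apply: ler_sum => k _; have := term k 0 x.
  by rewrite mulr0 sin0 mulr0 !subr0 le_min => /andP[].
by apply: le_trans (geo_tail nm) _; rewrite mulrAC -natrM.
Qed.

Lemma half_cvg0 c : (fun n => c * 2^-1 ^+ n) @ \oo --> (0 : R).
Proof.
rewrite -[X in _ --> X](mulr0 c); apply: cvgMl_tmp; apply: expr_cvg0.
by rewrite invr_ge0 ler0n/= invf_lt1// ltr1n.
Qed.

Lemma wei_cvg x : wei ^~ x @ \oo --> weil x.
Proof.
apply: cauchy_cvg; apply/cauchy_ballP => e e0.
have /cvgrPdist_lt/(_ _ (divr_gt0 e0 (ltr0n R 2)))[n0 _ H] := half_cvg0 4.
have Hn n : (n0 <= n)%N -> `|wei n x - wei n0 x| < e / 2.
  move=> nn; apply: le_lt_trans (wei_close x nn) _.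
  have := H n0 (leqnn n0); rewrite sub0r normrN; apply: le_lt_trans.
  by apply: le_trans (ler_norm _); rewrite mulrAC -natrM.
exists (wei^~ x @` [set n | (n0 <= n)%N], wei^~ x @` [set n | (n0 <= n)%N]) => /=.
  by split; exists n0 => // n /= nn; exists n.
move=> [u v] /= [[n nn <-] [m mn <-]]; rewrite -ball_normE /ball_/=.
rewrite -[_ - _](subrKA (wei n0 x)) (le_lt_trans (ler_normD _ _))// (splitr e).
by rewrite ltrD// ?Hn// distrC Hn.
Qed.

Lemma cvg_norm_le (u : nat -> R) l c n0 : u @ \oo --> l ->
  (forall n, (n0 <= n)%N -> `|u n| <= c) -> `|l| <= c.
Proof.
move=> /cvgrPdist_le ul uc; apply/ler_addgt0Pr => e /ul[m _ H].
rewrite -(subrK (u (maxn m n0)) l) (le_trans (ler_normD _ _))// addrC lerD//.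
  by rewrite uc// leq_maxr.
by apply: H; exact: leq_maxl.
Qed.

Lemma weil_close n x : `|weil x - wei n x| <= 4 * 2^-1 ^+ n.
Proof.
apply: (@cvg_norm_le (fun m => wei m x - wei n x) _ _ n).
  by apply: cvgB; [exact: wei_cvg|exact: cvg_cst].
by move=> m nm; apply: le_trans (wei_close x nm) _; rewrite mulrAC -natrM.
Qed.

Lemma weil0 : weil 0 = 0.
Proof.
by apply: cvg_lim => //; under eq_fun do rewrite wei0; exact: cvg_cst.
Qed.

Lemma weiD2pi n x : wei n (x + 2 * pi) = wei n x.
Proof.
congr (- (_ * _)); apply: eq_bigr => k _.
by rewrite mulrDr sinDn.
Qed.

Lemma weilD2pi x : weil (x + 2 * pi) = weil x.
Proof. by rewrite /weil; under eq_fun do rewrite weiD2pi. Qed.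

Lemma kappa1_ge0 x : 0 <= x -> 0 <= kappa1 x.
Proof. by move=> x0; rewrite /kappa1 mulr_ge0// addr_ge0. Qed.

(** For n = 0 this is the kappa_1 bound for the masses of arcs; that the constant is the same for
    all n is what the argument on Carleson sets relies on. *)
Lemma weil_osc_kappa n x y : x <= y -> y <= x + 2 * pi ->
  `|(weil y - wei n y) - (weil x - wei n x)| <= (4 * pi + 4) * kappa1 ((y - x) / (2 * pi)).
Proof.
move=> xy yx.
have ulim : (fun m => (wei m y - wei n y) - (wei m x - wei n x)) @ \oo -->
    (weil y - wei n y) - (weil x - wei n x).
  by apply: cvgB; (apply: cvgB; [exact: wei_cvg|exact: cvg_cst]).
apply: (cvg_norm_le (n0 := n) ulim) => m nm.
have [<-|xy'] := eqVneq x y.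
  rewrite subrr normr0 mulr_ge0 ?kappa1_ge0// ?subrr ?mul0r//.
  by rewrite addr_ge0// mulr_ge0// pi_ge0.
have tp := @twopi_gt0 R.
have [d dE] : exists d, d = (y - x) / (2 * pi) by eexists.
have d0 : 0 < d by rewrite dE divr_gt0// subr_gt0 lt_neqAle xy'.
have d1 : d <= 1 by rewrite dE ler_pdivrMr// mul1r lerBlDl.
rewrite -dE.
have yxE : `|y - x| = 2 * pi * d by rewrite dE mulrC divfK ?gt_eqF// ger0_norm// subr_ge0.
have [L LE] : exists L, L = `|ln d| by eexists.
have L0 : 0 <= L by rewrite LE.
(* With n0 between 2 |ln d| and 2 |ln d| + 1, the n0 Lipschitz terms cost a multiple of d (1 + |ln
   d|), and the geometric tail is at most a multiple of d because 2^-1 <= exp (-1/2). *)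
have [n0 n01 n02] : exists2 n0 : nat, n0%:R <= 2 * L + 1 & 2 * L <= n0%:R.
  have := truncn_itv (mulr_ge0 (ler0n R 2) L0) => /andP[h1 h2].
  exists (Num.truncn (2 * L)).+1; last exact: ltW.
  by rewrite -natr1 lerD2r.
have h2n : 2^-1 ^+ n0 <= d.
  apply: (@le_trans _ _ (expR (- (2^-1)) ^+ n0)).
    rewrite lerXn2r ?nnegrE ?invr_ge0 ?expR_ge0//.
    by apply: le_trans (expR_ge1Dx _); lra.
  rewrite -expRM_natl -[leRHS]lnK ?posrE// ler_expR.
  have : L = - ln d by rewrite LE ler0_norm// ln_le0.
  lra.
apply: le_trans (wei_osc x y n0 nm) _; rewrite yxE /kappa1 -LE.
have h1 := ler_wpM2r (ltW (mulr_gt0 tp d0)) n01.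
have h3 : 0 <= pi * d by rewrite mulr_ge0 ?pi_ge0// ltW.
have h4 : 0 <= d * L by rewrite mulr_ge0// ltW.
lra.
Qed.

End Cumulative.


(** * Arcs of the circle as intervals of angles *)

Section Arcs.
Context {R : realType}.
Implicit Types (a b c d s t e r x y : R) (z w : Cx R) (A B : set (Cx R)).

Local Notation Re := (@complex.Re R).
Local Notation Im := (@complex.Im R).

Lemma cis_2pi : cis (2 * pi) = 1 :> Cx R.
Proof. by rewrite /cis [2 * pi]mulr_natl cos2pi sin2pi. Qed.

Lemma cisD2pi t : cis (t + 2 * pi) = cis t :> Cx R.
Proof. by rewrite cisD cis_2pi mulr1. Qed.

Lemma cisB2pi t : cis (t - 2 * pi) = cis t :> Cx R.
Proof. by rewrite -[in RHS](subrK (2 * pi) t) cisD2pi. Qed.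

Lemma circle_cis t : circle R (cis t).
Proof. exact: cabs_cis. Qed.

Lemma circleP z : circle R z -> exists2 t, 0 <= t < 2 * pi & z = cis t.
Proof.
move=> /= zc.
have zE : Re z ^+ 2 + Im z ^+ 2 = 1.
  have := cabsE z; rewrite zc => /(congr1 (fun x => x ^+ 2)).
  by rewrite expr1n sqr_sqrtr// addr_ge0// sqr_ge0.
have x1 : -1 <= Re z <= 1.
  by rewrite -ler_norml -(ler_pXn2r (n := 2)) ?nnegrE// expr1n real_normK ?num_real// -zE lerDl sqr_ge0.
have sE : sin (acos (Re z)) = `|Im z|.
  by rewrite sin_acos// -sqrtr_sqr; congr Num.sqrt; rewrite -zE; ring.
have a0 := acos_ge0 x1; have api := acos_lepi x1.
have p0 := pi_gt0 R.
have [y0|y0] := leP 0 (Im z).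
  exists (acos (Re z)); first by rewrite a0/=; lra.
  by apply: Cx_eq; rewrite /cis/= ?sE ?acosK// ger0_norm.
exists (2 * pi - acos (Re z)).
  have a0' : 0 < acos (Re z).
    rewrite lt_neqAle a0 andbT; apply/eqP => h; move: sE; rewrite -h sin0 => /esym/normr0_eq0 i0.
    by rewrite i0 ltxx in y0.
  by apply/andP; split; lra.
rewrite -cisB2pi addrAC subrr add0r /cis cosN sinN.
by apply: Cx_eq => /=; rewrite ?acosK// sE ltr0_norm// opprK.
Qed.

Lemma circle_from a z : circle R z -> exists2 t, a <= t < a + 2 * pi & z = cis t.
Proof.
move=> zc; have wc : circle R (z * cis (- a)) by rewrite /circle/= cabsM cabs_cis mulr1.
have [t /andP[t0 t1] h] := circleP wc.
exists (a + t); first by rewrite lerDl t0 ltrD2l.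
by rewrite cisD -h mulrCA -cisD subrr cis0 mulr1.
Qed.

Lemma is_arc0 : is_arc (@set0 (Cx R)).
Proof. by split; [move=> ?|move=> B B0 [C _ ->]]; rewrite ?set0I. Qed.

Lemma is_arc_cis (I : set R) : is_interval I -> is_arc (cis (R := R) @` I).
Proof.
move=> Iitv; split; first by move=> _ [t _ <-]; exact: circle_cis.
apply: connected_continuous_connected; first exact/connected_intervalP.
by apply: continuous_subspaceT; exact: continuous_cis.
Qed.

Lemma circle_arc : is_arc (circle R).
Proof.
have -> : circle R = cis (R := R) @` setT.
  apply/seteqP; split => [z /circleP[t _ ->]|_ [t _ <-]]; first by exists t.
  exact: circle_cis.
by apply: is_arc_cis => x y _ _ z _.
Qed.

Lemma is_arc1 z : circle R z -> is_arc [set z].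
Proof.
move=> /circleP[t _ ->]; rewrite -image_set1; apply: is_arc_cis.
by move=> x y /= -> -> u /andP[h1 h2]; apply/eqP; rewrite eq_le h1 h2.
Qed.

Lemma sin_eq0_small x : - pi < x < pi -> sin x = 0 -> x = 0.
Proof.
move=> /andP[h1 h2] sx; case: (ltgtP x 0) => // x0.
  have := @sin_gt0_pi R (- x); rewrite oppr_gt0 x0 ltrNl h1 => /(_ isT).
  by rewrite sinN sx oppr0 ltxx.
by have := @sin_gt0_pi R x; rewrite x0 h2 sx ltxx => /(_ isT).
Qed.

(* The chord through [cis al] and [cis x] separates the two sides of [x]. *)
Lemma arc_convex A al s x t : is_arc A -> ~ A (cis al) -> al < s -> s < x -> x < t ->
  t < al + 2 * pi -> A (cis s) -> A (cis t) -> A (cis x).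
Proof.
move=> [Ac Aconn] nA als sx xt tal As At.
have tp := @twopi_gt0 R.
have [f [fE cf]] : exists f : Cx R -> R,
    (forall tau, f (cis tau) = - 2 * (sin ((tau - al) / 2) * sin ((tau - x) / 2))) /\
    continuous f.
  exists (fun z => Re (z * cis (- ((al + x) / 2))) - cos ((x - al) / 2)).
  split => [tau|z].
    rewrite -cisD /cis/= sinMsin.
    have -> : (tau - al) / 2 - (tau - x) / 2 = (x - al) / 2 by field.
    have -> : (tau - al) / 2 + (tau - x) / 2 = tau - (al + x) / 2 by field.
    by field.
  have c1 : (fun w => w * cis (- ((al + x) / 2))) @ z --> z * cis (- ((al + x) / 2)).
    apply: (@cvgM (Cx R) (Cx R) (nbhs z) _ id (fun=> cis (- ((al + x) / 2)))).
      exact: cvg_id.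
    exact: cst_continuous.
  have c2 := cvg_comp _ _ c1 (@continuous_ReC R _).
  apply: (@cvgB _ _ _ (nbhs z) _ _ _ _ _ c2); exact: cst_continuous.
have cfA : connected (f @` A).
  by apply: connected_continuous_connected => //; exact: continuous_subspaceT.
have half u : al < u -> u < al + 2 * pi -> 0 < sin ((u - al) / 2).
  by move=> h1 h2; apply: sin_gt0_pi; apply/andP; split; lra.
have fs : 0 < f (cis s).
  have h : sin ((s - x) / 2) < 0.
    rewrite -oppr_gt0 -sinN; apply: sin_gt0_pi; apply/andP; split; lra.
  have := half s als; move=> /(_ _) h2.
  rewrite fE mulNr oppr_gt0 pmulr_rlt0// pmulr_rlt0//; apply: h2; lra.
have ft : f (cis t) < 0.
  have h : 0 < sin ((t - x) / 2) by apply: sin_gt0_pi; apply/andP; split; lra.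
  rewrite fE mulNr oppr_lt0 pmulr_rgt0// pmulr_rgt0//; apply: half; lra.
have /connected_intervalP fI := cfA.
have [|z Az fz] := fI _ _ (ex_intro2 _ _ _ At erefl) (ex_intro2 _ _ _ As erefl) 0.
  by rewrite !ltW.
have [tau /andP[t1 t2] zE] := circle_from al (Ac _ Az).
have t1' : al < tau.
  by rewrite lt_neqAle t1 andbT; apply/eqP => h; apply: nA; rewrite h -zE.
move: fz; rewrite zE fE => /eqP; rewrite mulf_eq0 oppr_eq0 pnatr_eq0/= mulf_eq0.
rewrite gt_eqF/=; last exact: half.
move=> /eqP/sin_eq0_small h.
have hx : (tau - x) / 2 = 0 by apply: h; apply/andP; split; lra.
have -> : x = tau by lra.
by rewrite -zE.
Qed.

(** The arc is described by an interval of angles, with nothing said about its two end points: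
    neither length nor the masses to be defined depend on them. *)
Definition arc_rep A a b := [/\ a <= b, b <= a + 2 * pi,
  forall t, a < t < b -> A (cis t) & forall t, b < t < a + 2 * pi -> ~ A (cis t)].

(** The angles of A in the period that starts at the missing point form a convex set by
    [arc_convex]; a and b are its infimum and supremum. *)
Lemma arc_rep_from A al : is_arc A -> ~ A (cis al) ->
  exists a b, [/\ arc_rep A a b, al <= a, a < al + 2 * pi & b <= al + 2 * pi].
Proof.
move=> aA pA; have tp := @twopi_gt0 R.
have [I IP] : exists I : set R, forall t, I t <-> (al < t < al + 2 * pi /\ A (cis t)).
  by exists [set t | al < t < al + 2 * pi /\ A (cis t)].
have [I0|/set0P[u Iu]] := eqVneq I set0.
  exists al, al; split; rewrite ?lexx ?ltrDl//; last by rewrite lerDl ltW.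
  split=> //.
  - by rewrite lerDl ltW.
  - by move=> t /andP[h1 /(lt_trans h1)]; rewrite ltxx.
  - by move=> t ht At; have /IP : al < t < al + 2 * pi /\ A (cis t) by []; rewrite I0.
have Ilb : lbound I al by move=> t /IP[/andP[/ltW]].
have Iub : ubound I (al + 2 * pi) by move=> t /IP[/andP[_ /ltW]].
have Iinf : has_inf I by split; [exists u|exists al].
have Isup : has_sup I by split; [exists u|exists (al + 2 * pi)].
have [a aE] : exists a, a = inf I by eexists.
have [b bE] : exists b, b = sup I by eexists.
have ala : al <= a by rewrite aE; apply: lb_le_inf => //; exists u.
have bal : b <= al + 2 * pi by rewrite bE; apply: ge_sup => //; exists u.
have au : a <= u by rewrite aE; apply: ge_inf => //; case: Iinf.
have ub : u <= b by rewrite bE; apply: ub_le_sup => //; case: Isup.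
have al_u : u < al + 2 * pi by case/IP: Iu => /andP[].
exists a, b; split => //; last exact: le_lt_trans al_u.
split; first exact: le_trans ub.
- by rewrite (le_trans bal)// lerD2r.
- move=> t /andP[at_ tb]; rewrite aE in at_; rewrite bE in tb.
  have [s Is st] := inf_lt (ex_intro _ u Iu) at_.
  have [v Iv tv] := sup_gt (ex_intro _ u Iu) tb.
  have /IP[/andP[s1 s2] As] := Is; have /IP[/andP[v1 v2] Av] := Iv.
  exact: (@arc_convex A al s t v).
- move=> t /andP[bt ta] At.
  have ubI : ubound I b by move=> v Iv; rewrite bE; apply: ub_le_sup => //; case: Isup.
  have lbI : lbound I a by rewrite aE; apply: ge_inf; case: Iinf.
  have [tal|alt] := ltP t (al + 2 * pi).
    have : I t by apply/IP; split => //; rewrite tal andbT (le_lt_trans ala)// (le_lt_trans au)// (le_lt_trans ub).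
    by move=> /ubI; rewrite leNgt bt.
  move: At; rewrite -cisB2pi => At.
  have [h|h] := eqVneq (t - 2 * pi) al; first by apply: pA; rewrite -h.
  have : I (t - 2 * pi).
    apply/IP; split => //; apply/andP; split; last by lra.
    by rewrite lt_neqAle eq_sym h/= lerBrDr.
  by move=> /lbI; rewrite leNgt ltrBlDr ta.
Qed.

Lemma arc_rep_shift A a b : arc_rep A a b -> arc_rep A (a - 2 * pi) (b - 2 * pi).
Proof.
move=> [r1 r2 r3 r4]; split; rewrite ?lerD2r//; first by lra.
  by move=> t /andP[h1 h2]; rewrite -cisD2pi; apply: r3; apply/andP; split; lra.
by move=> t /andP[h1 h2]; rewrite -cisD2pi; apply: r4; apply/andP; split; lra.
Qed.

Lemma circle_or_missing A : is_arc A ->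
  A = circle R \/ exists2 al, 0 <= al < 2 * pi & ~ A (cis al).
Proof.
move=> [Ac _]; have [[p [pc pA]]|nop] := pselect (exists p, circle R p /\ ~ A p).
  by right; have [al al01 pE] := circleP pc; exists al; rewrite -?pE.
left; apply/seteqP; split => // z zc; apply: contrapT => h; apply: nop.
by exists z.
Qed.

Lemma circle_rep : arc_rep (circle R) 0 (2 * pi).
Proof.
split; rewrite ?add0r//; first exact/ltW/twopi_gt0.
  by move=> t _; exact: circle_cis.
by move=> t /andP[h1 /(lt_trans h1)]; rewrite ltxx.
Qed.

Lemma arc_rep_exists A : is_arc A -> exists a b, arc_rep A a b /\ 0 <= a < 2 * pi.
Proof.
move=> aA; have tp := @twopi_gt0 R.
have [->|[al /andP[al0 al1] nA]] := circle_or_missing aA.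
  by exists 0, (2 * pi); split; [exact: circle_rep|rewrite lexx tp].
have [a [b [rA ala aal bal]]] := arc_rep_from aA nA.
have a0 : 0 <= a by exact: le_trans ala.
have [a2|a2] := ltP a (2 * pi); first by exists a, b; rewrite a0 a2.
exists (a - 2 * pi), (b - 2 * pi); split; first exact: arc_rep_shift.
by rewrite subr_ge0 a2/= ltrBlDr (lt_trans aal)// ltrD2r.
Qed.

Definition cset A : set R := per `&` cis (R := R) @^-1` A.

Lemma setD_finite_integral (X Y : set R) (s : seq R) (g : R -> R) : measurable Y ->
  Y `<=` X -> (forall t, X t -> Y t \/ t \in s) ->
  measurable X /\ (rint X g ->
    \int[leb R]_(t in X) g t = \int[leb R]_(t in Y) g t).
Proof.
move=> mY YX XYs.
have fD : finite_set (X `\` Y).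
  apply: (sub_finite_set _ (finite_seq s)) => t /= [Xt nY].
  by case: (XYs t Xt).
have cD : countable (X `\` Y) by exact: finite_set_countable.
have mD : measurable (X `\` Y) by exact: countable_measurable.
have XE : X = Y `|` (X `\` Y) by rewrite setDUK.
have mX : measurable X by rewrite XE; exact: measurableU.
split => // gi; rewrite [X in Rintegral _ X _]XE (@Rintegral_setU _ _ _ (leb R))//.
- rewrite [X in _ + X](_ : _ = 0) ?addr0//.
  rewrite /Rintegral null_set_integral//; last exact: countable_lebesgue_measure0.
  have := rint_sub mX mD (@subDsetl _ X Y) gi.
  by case/integrableP.
- by rewrite -XE.
- by apply/disj_setPS => t [? []].
Qed.

(** Up to finitely many points [cset A] is ]a, b[, or, when b exceeds 2 pi, the union of [0, b - 2
    pi[ and ]a, 2 pi[. The number c is the increment of G over a period: 0 for the periodic [wei],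
    and 2 pi when g = 1 measures length. *)
Lemma cset_integral A a b (g G : R -> R) c : arc_rep A a b -> 0 <= a < 2 * pi ->
  continuous g -> (forall x, is_derive x 1 G (g x)) -> (forall x, G (x + 2 * pi) = G x + c) ->
  measurable (cset A) /\ \int[leb R]_(t in cset A) g t = G b - G a.
Proof.
move=> [ab ba inA outA] /andP[a0 a2] cg dG Gp.
have mcset X : measurable X -> X `<=` per -> rint X g.
  by move=> mX Xp; apply: rint_sub (rint_per_cont cg) => //; exact: measurable_per.
have itv x y : x <= y -> \int[leb R]_(t in `]x, y[) g t = G y - G x.
  move=> xy; have ri := rint_cont x y cg.
  rewrite -(FTC2 xy cg dG) -(@Rintegral_itv_obnd_cbnd _ x (BRight y)); last first.
    by apply: rint_sub ri => //; apply: subset_itv; rewrite bnd_simp.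
  rewrite -(@Rintegral_itv_bndo_bndc _ (BRight x) y)//.
  by apply: rint_sub ri => //; apply: subset_itv; rewrite bnd_simp.
have [b2|b2] := leP b (2 * pi).
- have [] := @setD_finite_integral (cset A) `]a, b[ [:: a; b; 0] g.
  + by [].
  + move=> t /=; rewrite in_itv/= => /andP[at_ tb]; split; last by apply: inA; rewrite at_.
    by rewrite /per/= (le_trans a0 (ltW at_)) (lt_le_trans tb).
  + move=> t [/andP[t0 t2] At]; rewrite !inE /= in_itv/=.
    case: (ltgtP a t) => [at_|ta|_]; [|right|by right].
      case: (ltgtP t b) => [_|bt|_]; [by left| |by right].
      by exfalso; apply: (outA t) At; rewrite bt (lt_le_trans t2)// lerDr.
    have [//|t0'] := eqVneq t 0; first by rewrite !orbT.
    exfalso; apply: (outA (t + 2 * pi)); last by rewrite cisD2pi.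
    by rewrite ltrD2r ta andbT (le_lt_trans b2)// ltrDr lt_def t0'.
  move=> mX h; split => //; rewrite h ?itv//.
  by apply: mcset => //; move=> t [].
- have [] := @setD_finite_integral (cset A) (`[0, b - 2 * pi[ `|` `]a, 2 * pi[) [:: a; b - 2 * pi] g.
  + exact: measurableU.
  + move=> t [] /=; rewrite in_itv/= => /andP[h1 h2].
      split; first by rewrite /per/= h1/= (lt_le_trans h2)// lerBlDr (le_trans ba)// lerD2r ltW.
      rewrite /= -cisD2pi; apply: inA; apply/andP; split; last by rewrite -ltrBrDr.
      by rewrite (lt_le_trans a2)// lerDr.
    split; first by rewrite /per/= (le_trans a0 (ltW h1)).
    by apply: inA; rewrite h1 (lt_trans h2).
  + move=> t [/andP[t0 t2] At]; rewrite !inE /= !in_itv/= t0 t2 andbT/=.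
    case: (ltgtP a t) => [at_|ta|_]; [by left; right| |by right].
    case: (ltgtP t (b - 2 * pi)) => [_|bt|_]; [by left; left| |by right].
    exfalso; apply: (outA (t + 2 * pi)); last by rewrite cisD2pi.
    by rewrite ltrD2r ta andbT -ltrBlDr.
  move=> mX h; split => //; rewrite h; last by apply: mcset => //; move=> t [].
  have b0 : 0 <= b - 2 * pi by rewrite subr_ge0 ltW.
  rewrite (@Rintegral_setU _ _ _ (leb R))//.
  + have ri := rint_cont 0 (b - 2 * pi) cg.
    rewrite Rintegral_itv_bndo_bndc; last first.
      by apply: rint_sub ri => //; apply: subset_itv; rewrite bnd_simp.
    rewrite (FTC2 b0 cg dG) itv ?(ltW a2)//.
    have := Gp 0; rewrite add0r => ->; have := Gp (b - 2 * pi); rewrite subrK => ->; ring.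
  + apply: mcset; first exact: measurableU.
    move=> t [] /=; rewrite in_itv/= => /andP[h1 h2]; rewrite /per/=.
      by rewrite h1/= (lt_le_trans h2)// lerBlDr (le_trans ba)// lerD2r ltW.
    by rewrite (le_trans a0 (ltW h1)).
  + apply/disj_setPS => t [] /=; rewrite !in_itv/= => /andP[_ h1] /andP[h2 _].
    by have := lt_trans h2 h1; rewrite ltrBrDr ltNge ba.
Qed.

End Arcs.


(** * Construction of the premeasure *)

Section Premeasure.
Context {R : realType}.
Variable N : nat.
Hypothesis N1 : (1 < N)%N.
Implicit Types (a b c d s t e r x y : R) (z w : Cx R) (A B : set (Cx R)) (D : set R).

Lemma is_derive_wei n x : is_derive x 1 (wei N n) (dwei N n x).
Proof.
have h k : is_derive x 1 (fun x => N%:R ^- k * sin ((N ^ k)%:R * x)) (cos ((N ^ k)%:R * x)).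
  have Nk : (N ^ k)%:R != 0 :> R by rewrite pnatr_eq0 expn_eq0 negb_and -lt0n (ltnW N1).
  have := is_deriveZ (N%:R ^- k) (is_derive_scale (is_derive_sin ((N ^ k)%:R * x))).
  move=> H; apply: (is_derive_eq H).
  by rewrite /GRing.scale/= -natrX mulKf.
have hs : is_derive x 1 (fun x => \sum_(0 <= k < n) N%:R ^- k * sin ((N ^ k)%:R * x))
    (\sum_(0 <= k < n) cos ((N ^ k)%:R * x)).
  elim: n => [|n IH].
    rewrite big_geq//.
    have -> : (fun x => \sum_(0 <= k < 0) N%:R ^- k * sin ((N ^ k)%:R * x)) = cst 0 :> (R -> R).
      by apply/funext => u; rewrite big_geq.
    exact: is_derive_cst.
  rewrite big_nat_recr//=.
  have -> : (fun x => \sum_(0 <= k < n.+1) N%:R ^- k * sin ((N ^ k)%:R * x)) =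
      (fun x => \sum_(0 <= k < n) N%:R ^- k * sin ((N ^ k)%:R * x) + N%:R ^- n * sin ((N ^ n)%:R * x)).
    by apply/funext => u; rewrite big_nat_recr.
  exact: is_deriveD.
have H := is_deriveZ (- pi^-1) hs.
rewrite [X in is_derive _ _ X _](_ : _ = - pi^-1 \*: (fun x => \sum_(0 <= k < n) N%:R ^- k * sin ((N ^ k)%:R * x))).
  apply: (is_derive_eq H).
  by rewrite /GRing.scale/= mulNr.
by apply/funext => u; rewrite /= /wei /GRing.scale/= mulNr.
Qed.

Lemma trigp_dwei n : trigp (dwei N n : R -> R).
Proof.
apply: (@trigp_eq _ (fun t => - pi^-1 * \sum_(0 <= k < n) cos ((N ^ k)%:R * t))).
  by move=> t; rewrite /dwei mulNr.
by apply: Trigp_scale; apply: trigp_sum => k; exact: Trigp_cos.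
Qed.

Lemma trigp_wei n : trigp (wei N n : R -> R).
Proof.
apply: (@trigp_eq _ (fun t => - pi^-1 * \sum_(0 <= k < n) N%:R ^- k * sin ((N ^ k)%:R * t))).
  by move=> t; rewrite /wei mulNr.
by apply: Trigp_scale; apply: trigp_sum => k; apply: Trigp_scale; exact: Trigp_sin.
Qed.

(** The mass of A for the measure with density [dwei n]. Additivity holds for integrals and passes
    to the limit, so the relative position of two arcs never has to be discussed. *)
Definition massn n A := \int[leb R]_(t in cset A) dwei N n t.

Lemma massn_rep n A a b : arc_rep A a b -> 0 <= a < 2 * pi ->
  massn n A = wei N n b - wei N n a.
Proof.
move=> rA a0; have [|_] := cset_integral (c := 0) rA a0 (trigp_cont (trigp_dwei n)) (is_derive_wei n).
  by move=> x; rewrite addr0 weiD2pi.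
by [].
Qed.

Lemma massn_cvg A a b : arc_rep A a b -> 0 <= a < 2 * pi ->
  massn ^~ A @ \oo --> weil N b - weil N a.
Proof.
move=> rA a0; under eq_fun do rewrite (massn_rep _ rA a0).
by apply: cvgB; exact: wei_cvg.
Qed.

Lemma leb_cset A a b : arc_rep A a b -> 0 <= a < 2 * pi ->
  measurable (cset A) /\ fine (leb R (cset A)) = b - a.
Proof.
move=> rA a0.
have c1 : continuous (fun _ : R => 1 : R) by move=> x; exact: cvg_cst.
have d1 x : is_derive x 1 (id : R -> R) 1 := is_derive_id x 1.
have [mA] := cset_integral rA a0 c1 d1 (fun x => erefl (x + 2 * pi)).
rewrite (Rintegral_cst (leb R) mA) mul1r => h; split; first exact: mA.
exact: h.
Qed.

Lemma measurable_cset A : is_arc A -> measurable (cset A).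
Proof. by move=> /arc_rep_exists[a [b [rA a0]]]; have [] := leb_cset rA a0. Qed.

Lemma arc_length_rep A a b : arc_rep A a b -> 0 <= a < 2 * pi ->
  arc_length A = (b - a) / (2 * pi).
Proof.
move=> rA a0; have [mA <-] := leb_cset rA a0.
rewrite /arc_length /haar -/per -/(cset A) fineM//; first by rewrite mulrC.
rewrite ge0_fin_numE//; apply: (le_lt_trans _ leb_per_fin).
by apply: le_measure; rewrite ?inE; [exact: mA|exact: measurable_per|move=> t []].
Qed.

Definition mass A : R := if pselect (is_arc A) then limn (massn ^~ A) else 0.

Lemma mass_cvg A : is_arc A -> massn ^~ A @ \oo --> mass A.
Proof.
move=> aA; rewrite /mass; case: pselect => [aA'|//].
have [a [b [rA a0]]] := arc_rep_exists aA.
have h := massn_cvg rA a0.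
by rewrite (cvg_lim _ h).
Qed.

Lemma mass_rep A a b : is_arc A -> arc_rep A a b -> 0 <= a < 2 * pi ->
  mass A = weil N b - weil N a.
Proof.
move=> aA rA a0; have h := massn_cvg rA a0.
by apply: (cvg_unique _ (mass_cvg aA)) => //.
Qed.

Lemma rint_dwei n D : measurable D -> D `<=` per -> rint D (dwei N n).
Proof.
move=> mD Dp; apply: rint_sub (trigp_rint (trigp_dwei n)) => //.
exact: measurable_per.
Qed.

Lemma massn_sum n k (I : 'I_k -> set (Cx R)) : (forall i, is_arc (I i)) ->
  trivIset setT I -> \sum_(i < k) massn n (I i) = massn n (\bigcup_i I i).
Proof.
move=> aI tI.
have cE A : cset A = per `&` cset A by rewrite setIidr// => t [].
have mI i : measurable (cset (I i)) by exact: measurable_cset.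
have ri i : rint per (dwei N n \_ (cset (I i))).
  have := (@integrable_restrict _ _ _ (leb R) _ (mI i) _ measurable_per (EFin \o dwei N n)).1.
  rewrite restrict_EFin; apply; rewrite -cE.
  by apply: rint_dwei => // t [].
rewrite /massn cE Rintegral_mkcondr.
under eq_bigr do rewrite cE Rintegral_mkcondr.
rewrite -Rintegral_sum//; last exact: measurable_per.
apply: eq_Rintegral => t /set_mem tper.
have [[i _ it]|nt] := pselect ((\bigcup_i I i) (cis t)).
  rewrite (bigD1 i)//= big1 ?addr0; last first.
    move=> j ji; rewrite patchE; case: ifPn => //; rewrite inE/= => -[_ jt].
    have /tI : I j `&` I i !=set0 by exists (cis t).
    by move=> /(_ Logic.I Logic.I) ij; rewrite ij eqxx in ji.
  rewrite !patchE !mem_set//; split=> //; by exists i.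
rewrite patchE memNset; last by move=> [].
rewrite big1// => i _; rewrite patchE memNset// => -[_ it]; apply: nt.
by exists i.
Qed.

Lemma cvg_bigsum (T : Type) (s : seq T) (f : T -> nat -> R) (l : T -> R) :
  (forall i, f i @ \oo --> l i) ->
  (fun n => \sum_(i <- s) f i n) @ \oo --> \sum_(i <- s) l i.
Proof.
move=> fl; elim: s => [|i s IH].
  by under eq_fun do rewrite big_nil; rewrite big_nil; exact: cvg_cst.
by under eq_fun do rewrite big_cons; rewrite big_cons; exact: cvgD.
Qed.

(** The limit on the left depends on the union only, so the sum of the masses is the same for all
    decompositions. *)
Lemma mass_sum k (I : 'I_k -> set (Cx R)) : (forall i, is_arc (I i)) ->
  trivIset setT I -> massn ^~ (\bigcup_i I i) @ \oo --> \sum_(i < k) mass (I i).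
Proof.
move=> aI tI; under eq_fun do rewrite -massn_sum//.
by apply: cvg_bigsum => i; exact: mass_cvg.
Qed.

Lemma mass_kappa A : is_arc A -> `|mass A| <= (4 * pi + 4) * kappa1 (arc_length A).
Proof.
move=> aA; have [a [b [rA a0]]] := arc_rep_exists aA.
rewrite (mass_rep aA rA a0) (arc_length_rep rA a0).
have [ab ba _ _] := rA.
have := weil_osc_kappa N1 0 ab ba.
by rewrite /wei !big_geq// !mulr0 oppr0 !subr0.
Qed.

(** With s the square root of x, |ln x| = - 2 ln s and - ln s <= 1 / s. It follows that [kappa1]
    tends to 0 at 0, which gives the continuity axiom of premeasures. *)
Lemma kappa1_le x : 0 <= x <= 1 -> kappa1 x <= x + 2 * Num.sqrt x.
Proof.
move=> /andP[]; rewrite le_eqVlt => /predU1P[<-|x0] x1.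
  by rewrite /kappa1 mul0r sqrtr0 mulr0 addr0.
have [s [s0 s1 sE xE]] : exists s, [/\ 0 < s, s <= 1, Num.sqrt x = s & x = s ^+ 2].
  exists (Num.sqrt x); split; rewrite ?sqrtr_gt0 ?sqr_sqrtr ?(ltW x0)//.
  by rewrite -sqrtr1 ler_wsqrtr.
rewrite /kappa1 sE mulrDr mulr1 lerD2l.
have sl : `|ln x| = 2 * - ln s.
  by rewrite ler0_norm ?ln_le0// xE lnXn// mulr_natl mulNrn.
have ls : - ln s <= s^-1.
  rewrite -lnV ?posrE//; rewrite -[leRHS](@expRK R) ler_ln ?posrE ?invr_gt0 ?expR_gt0//.
  by apply: le_trans (expR_ge1Dx _); rewrite lerDr.
rewrite sl xE expr2 (_ : s * s * (2 * - ln s) = 2 * s * (s * - ln s)); last by ring.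
rewrite -[leRHS]mulr1 ler_wpM2l ?mulr_ge0 ?(ltW s0)//.
have sn0 : s != 0 by rewrite gt_eqF.
by rewrite -(mulfV sn0) ler_pM2l.
Qed.

Lemma arc_length_ge0 A : 0 <= arc_length A.
Proof. by rewrite /arc_length /haar fine_ge0// mule_ge0// lee_fin invr_ge0 mulr_ge0// pi_ge0. Qed.

Lemma arc_length_le1 A : is_arc A -> arc_length A <= 1.
Proof.
move=> aA; have [a [b [rA a0]]] := arc_rep_exists aA.
have [ab ba _ _] := rA.
by rewrite (arc_length_rep rA a0) ler_pdivrMr ?twopi_gt0// mul1r lerBlDl.
Qed.

Lemma arc_length_cvg0 (A : nat -> set (Cx R)) : (forall n, is_arc (A n)) ->
  (forall n, A n.+1 `<=` A n) -> \bigcap_n A n = set0 ->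
  (fun n => arc_length (A n)) @ \oo --> (0 : R).
Proof.
move=> aA dA A0.
have mA n : measurable (cset (A n)) by exact: measurable_cset.
have c0 : \bigcap_n cset (A n) = set0.
  rewrite -subset0 => t ht; have : (\bigcap_n A n) (cis t).
    by move=> n _; have [] := ht n Logic.I.
  by rewrite A0.
have := @nonincreasing_cvg_mu _ _ _ (leb R) (fun n => cset (A n)).
rewrite c0 measure0 => h.
have lfin n : (leb R (cset (A n)) < +oo)%E.
  apply: (le_lt_trans _ leb_per_fin).
  by apply: le_measure; rewrite ?inE; [exact: mA|exact: measurable_per|move=> t []].
have {}h : (leb R \o (fun n => cset (A n))) @ \oo --> 0%E.
  apply: h => //; first exact: lfin.
  apply/nonincreasing_seqP => n; apply/subsetPset => t [tp tA].
  by split => //; exact: dA.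
have h' : (fun n => fine (leb R (cset (A n)))) @ \oo --> (0 : R) by exact: fine_cvg h.
have -> : (fun n => arc_length (A n)) = (fun n => (2 * pi)^-1 * fine (leb R (cset (A n)))).
  apply/funext => n; rewrite /arc_length /haar -/per -/(cset (A n)) fineM//.
  by rewrite ge0_fin_numE.
by rewrite -[X in _ --> X](mulr0 (2 * pi)^-1); apply: cvgMl_tmp.
Qed.

Lemma mass_continuous (A : nat -> set (Cx R)) : (forall n, is_arc (A n)) ->
  (forall n, A n.+1 `<=` A n) -> \bigcap_n A n = set0 ->
  (fun n => mass (A n)) @ \oo --> (0 : R).
Proof.
move=> aA dA A0; have l0 := arc_length_cvg0 aA dA A0.
apply: norm_cvg0.
have C0 : 0 <= 4 * pi + 4 :> R by rewrite addr_ge0// mulr_ge0// pi_ge0.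
apply: (@squeeze_cvgr _ _ _ _ (cst 0)
  (fun n => (4 * pi + 4) * (arc_length (A n) + 2 * Num.sqrt (arc_length (A n))))).
- apply: nearW => n; rewrite /= normr_ge0/=; apply: le_trans (mass_kappa (aA n)) _.
  by rewrite ler_wpM2l// kappa1_le// arc_length_ge0 arc_length_le1.
- exact: cvg_cst.
- rewrite -[X in _ --> X](mulr0 (4 * pi + 4)); apply: cvgMl_tmp.
  rewrite -[X in _ --> X](addr0 0); apply: cvgD => //.
  rewrite -[X in _ --> X](mulr0 2); apply: cvgMl_tmp.
  by have := cvg_comp _ _ l0 (@sqrt_continuous R 0); rewrite sqrtr0.
Qed.

Lemma mass_off A : ~ is_arc A -> mass A = 0.
Proof. by rewrite /mass; case: pselect. Qed.

Lemma massn_set0 n : massn n set0 = 0.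
Proof. by rewrite /massn /cset preimage_set0 setI0 Rintegral_set0. Qed.

Lemma mass_set0 : mass set0 = 0.
Proof.
have h := mass_cvg is_arc0.
have h0 : (massn ^~ set0) = (fun=> 0 : R) by apply/funext => n; exact: massn_set0.
by rewrite h0 in h; apply: (cvg_unique _ h) => //; exact: cvg_cst.
Qed.

Lemma mass_circle : mass (circle R) = 0.
Proof.
rewrite (mass_rep circle_arc circle_rep) ?lexx ?twopi_gt0//.
by rewrite -[2 * pi]add0r weilD2pi// subrr.
Qed.

Lemma mass_additive A B : is_arc A -> is_arc B -> is_arc (A `|` B) ->
  A `&` B = set0 -> mass (A `|` B) = mass A + mass B.
Proof.
move=> aA aB aAB AB.
pose I (i : 'I_2) := if i == ord0 then A else B.
have aI i : is_arc (I i) by rewrite /I; case: ifP.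
have tI : trivIset setT I.
  move=> i j _ _ [z []]; rewrite /I.
  case: (i =P ord0) => [->|/eqP i0]; case: (j =P ord0) => [->//|/eqP j0] // z1 z2.
  - by have : (A `&` B) z by []; rewrite AB.
  - by have : (A `&` B) z by []; rewrite AB.
  - by apply/val_inj; case: i i0 {z1 z2} => -[|[|//]]//= ? _; case: j j0 => -[|[|//]].
have IU : \bigcup_i I i = A `|` B.
  apply/seteqP; split => [z [i _]|z [zA|zB]].
  - by rewrite /I; case: ifP => _; [left|right].
  - by exists ord0.
  - by exists ord_max.
have := mass_sum aI tI; rewrite IU !big_ord_recl big_ord0 addr0 /=.
by move=> h; apply: (cvg_unique _ (mass_cvg aAB)).
Qed.

Definition wpm : premeasure R :=
  Premeasure mass_off mass_set0 mass_circle mass_additive mass_continuous.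

Lemma wpm_rep A a b : is_arc A -> arc_rep A a b -> 0 <= a < 2 * pi ->
  wpm A = weil N b - weil N a.
Proof. exact: mass_rep. Qed.

End Premeasure.


(** * Two-sided bounds, atoms and invariance under z^N *)

Section Push.
Context {R : realType}.
Variable N : nat.
Hypothesis N1 : (1 < N)%N.
Implicit Types (a b c d s t e r x y : R) (z w : Cx R) (A B : set (Cx R)) (D : set R).

Local Notation mu := (@wpm R N N1).

Lemma cis_inj x y : cis x = cis y :> Cx R -> `|x - y| < 2 * pi -> x = y.
Proof.
move=> h xy.
have : cis (x - y) = 1 :> Cx R by rewrite cisD h -cisD subrr cis0.
move=> /(congr1 (@complex.Re R)) /= hc.
have hs : sin ((x - y) / 2) = 0.
  have : cos ((x - y) / 2 + (x - y) / 2) = 1 by rewrite -splitr.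
  rewrite cosD -!expr2 => h1; have h2 := cos2Dsin2 ((x - y) / 2).
  have : sin ((x - y) / 2) ^+ 2 = 0 by lra.
  by move=> /eqP; rewrite sqrf_eq0 => /eqP.
have : (x - y) / 2 = 0.
  by apply: sin_eq0_small => //; move: xy; rewrite ltr_norml => /andP[h1 h2]; apply/andP; split; lra.
lra.
Qed.

Lemma arc_rep_image a b D : a <= b -> b <= a + 2 * pi ->
  (forall t, a < t < b -> D t) -> (forall t, D t -> a <= t <= b) ->
  arc_rep (cis (R := R) @` D) a b.
Proof.
move=> ab ba inD Dab; split => //; first by move=> t /inD Dt; exists t.
move=> t /andP[bt ta] [s /Dab/andP[as_ sb] h].
have : s = t.
  apply: cis_inj => //; rewrite distrC gtr0_norm ?subr_gt0 ?(le_lt_trans sb)//.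
  by rewrite ltrBlDl (lt_le_trans ta)// lerD2r.
by move=> st; move: bt; rewrite -st ltNge sb.
Qed.

(** A starting angle up to 4 pi is allowed, as arises when angles are counted from a point that the
    arc misses. *)
Lemma wpm_rep2 A a b : is_arc A -> arc_rep A a b -> 0 <= a < 4 * pi ->
  mu A = weil N b - weil N a.
Proof.
move=> aA rA /andP[a0 a4]; have [a2|a2] := ltP a (2 * pi).
  by apply: wpm_rep => //; rewrite a0.
rewrite (wpm_rep N1 aA (arc_rep_shift rA)).
  by rewrite -[weil N b](weilD2pi) -[weil N a](weilD2pi) -[in LHS]weilD2pi -[X in _ - X]weilD2pi !subrK !weilD2pi.
by rewrite subr_ge0 a2/=; lra.
Qed.

Lemma wpm_kappa_minus : kappa_minus mu.
Proof.
exists (4 * pi + 4); first by rewrite addr_ge0// mulr_ge0// pi_ge0.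
by move=> A /(mass_kappa N1); apply: le_trans; exact: ler_norm.
Qed.

Lemma wpm_kappa_plus : kappa_plus mu.
Proof.
exists (4 * pi + 4); first by rewrite addr_ge0// mulr_ge0// pi_ge0.
by move=> A /(mass_kappa N1); apply: le_trans; rewrite -normrN; exact: ler_norm.
Qed.

Lemma wpm_atomless : atomless mu.
Proof.
move=> z zc; have az := is_arc1 zc; move: az; have [t /andP[t0 t2] ->] := circleP zc => az.
have r : arc_rep [set cis t] t t.
  rewrite -image_set1; apply: arc_rep_image => //.
  - by rewrite lerDl ltW// twopi_gt0.
  - by move=> s /andP[h1 /(lt_trans h1)]; rewrite ltxx.
  - by move=> s ->; rewrite lexx.
by rewrite (wpm_rep N1 az r) ?subrr// t0.
Qed.

Lemma is_arc_co a b : is_arc (cis (R := R) @` [set t | a <= t < b]).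
Proof.
apply: is_arc_cis => x y /= /andP[ax _] /andP[_ yb] u /andP[xu uy].
by rewrite (le_trans ax xu) (le_lt_trans uy yb).
Qed.

Lemma wpm_co a b : a <= b -> b <= a + 2 * pi -> 0 <= a < 4 * pi ->
  mu (cis (R := R) @` [set t | a <= t < b]) = weil N b - weil N a.
Proof.
move=> ab ba a0; apply: wpm_rep2 => //; first exact: is_arc_co.
apply: arc_rep_image => // t /=; first by move=> /andP[/ltW -> ->].
by move=> /andP[-> /ltW ->].
Qed.

Lemma cumul_wpm theta : 0 <= theta < 2 * pi -> cumul mu theta = weil N theta.
Proof.
move=> /andP[t0 t2]; rewrite /cumul wpm_co ?lexx//.
- by rewrite weil0 subr0.
- by rewrite add0r ltW.
- by rewrite mulr_gt0// pi_gt0.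
Qed.

Lemma cumul_wpm_cvg theta : 0 <= theta < 2 * pi ->
  (fun n : nat => - (pi^-1 * \sum_(0 <= k < n) N%:R ^- k * sin ((N ^ k)%:R * theta)))
    @ \oo --> cumul mu theta.
Proof. by move=> t; rewrite cumul_wpm//; exact: wei_cvg. Qed.

Lemma pm_ext_wpm k (I : 'I_k -> set (Cx R)) : (forall i, is_arc (I i)) ->
  trivIset setT I -> pm_ext mu (\bigcup_i I i) = \sum_(i < k) mu (I i).
Proof.
move=> aI tI; rewrite /pm_ext; apply: xget_unique.
  by exists k, I.
move=> _ [m [I' [aI' tI' IE ->]]].
have h := mass_sum N1 aI tI; have h' := mass_sum N1 aI' tI'.
rewrite IE in h'; exact: cvg_unique h' h.
Qed.

(** Multiplied by sin (pi / N) the sum telescopes into cosines whose arguments differ by 2 pi. *)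
Lemma sum_sin_shift y : \sum_(0 <= j < N) sin (y + 2 * pi * j%:R / N%:R) = 0 :> R.
Proof.
have N0 : 0 < N%:R :> R by rewrite ltr0n ltnW.
have N2 : 2 <= N%:R :> R by rewrite ler_nat.
have p0 := pi_gt0 R.
have s0 : 0 < sin (pi / N%:R) :> R.
  apply: sin_gt0_pi; rewrite divr_gt0//= ltr_pdivrMr//.
  by have := ler_wpM2l (ltW p0) N2; lra.
apply/eqP; rewrite -(mulrI_eq0 _ (mulfI (lt0r_neq0 s0))) mulr_sumr.
pose F j := - 2^-1 * cos (y + 2 * pi * j%:R / N%:R - pi / N%:R).
rewrite (@telescope_sumr_eq _ 0 N F)//.
  rewrite /F mulr0 mul0r addr0 (mulfK (lt0r_neq0 N0)) [y + 2 * pi - _]addrAC.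
  by rewrite [2 * pi]mulr_natl cosD2pi subrr.
move=> j _; rewrite /F -[j.+1%:R]natr1.
have -> : y + 2 * pi * (j%:R + 1) / N%:R - pi / N%:R = (y + 2 * pi * j%:R / N%:R) + pi / N%:R.
  by field; rewrite gt_eqF.
by rewrite cosD cosB; field.
Qed.

(** The k = 0 terms add up to 0 over the N preimages of x, while the term of index k + 1 has the
    same value N^-(k+1) sin (N^k x) at each of them. *)
Lemma sum_wei_shift n x :
  \sum_(0 <= j < N) wei N n.+1 ((x + 2 * pi * j%:R) / N%:R) = wei N n x.
Proof.
have N0 : N%:R != 0 :> R by rewrite pnatr_eq0 -lt0n ltnW.
rewrite /wei sumrN -mulr_sumr exchange_big_nat big_nat_recl//=.
rewrite (eq_bigr (fun j => sin (x / N%:R + 2 * pi * j%:R / N%:R))); last first.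
  by move=> j _; rewrite expr0 invr1 expn0 !mul1r mulrDl.
rewrite sum_sin_shift add0r; congr (- (_ * _)); apply: eq_bigr => k _.
rewrite (eq_bigr (fun=> N%:R ^- k.+1 * sin ((N ^ k)%:R * x))); last first.
  move=> j _; congr (_ * _).
  have -> : (N ^ k.+1)%:R * ((x + 2 * pi * j%:R) / N%:R) =
     (N ^ k)%:R * x + (N ^ k * j)%:R * (2 * pi) :> R.
    by rewrite expnS !natrM; field.
  by rewrite sinDn.
by rewrite sumr_const_nat subn0 -[LHS]mulr_natl exprS invfM !mulrA mulfV// mul1r.
Qed.

Lemma sum_weil_shift x :
  \sum_(0 <= j < N) weil N ((x + 2 * pi * j%:R) / N%:R) = weil N x.
Proof.
have h1 : (fun n => \sum_(0 <= j < N) wei N n.+1 ((x + 2 * pi * j%:R) / N%:R)) @ \oo -->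
    \sum_(0 <= j < N) weil N ((x + 2 * pi * j%:R) / N%:R).
  by apply: cvg_bigsum => j; apply/(cvgn_shift (wei N ^~ ((x + 2 * pi * j%:R) / N%:R))); exact: wei_cvg.
have h2 := wei_cvg N1 (x := x).
have hE : (fun n => \sum_(0 <= j < N) wei N n.+1 ((x + 2 * pi * j%:R) / N%:R)) = wei N ^~ x.
  by apply/funext => n; exact: sum_wei_shift.
by rewrite hE in h1; apply: (cvg_unique _ h1).
Qed.

(** The preimage of an arc from a to b consists of the N arcs from (a + 2 pi j)/N to (b + 2 pi j)/N,
    so the claim reduces to [sum_weil_shift]. Angles are counted from a point al missing in A, so
    that no component of the preimage is cut in two; the full circle has no such point and is
    treated apart. *)
Lemma wpm_push A : is_arc A -> pm_push N mu A = mu A.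
Proof.
move=> aA; rewrite /pm_push; have tp := @twopi_gt0 R.
have N0 : 0 < N%:R :> R by rewrite ltr0n ltnW.
have [AE|[al /andP[al0 al1] nA]] := circle_or_missing aA.
  rewrite AE (_ : _ `&` _ = \bigcup_(i in [set: 'I_1]) circle R).
    rewrite pm_ext_wpm ?big_ord1//; first by move=> _; exact: circle_arc.
    by move=> i j _ _ _; rewrite !ord1.
  apply/seteqP; split => [z [zc _]|z [_ _ zc]]; first by exists ord0.
  by split => //; move: zc; rewrite /circle/= cabsX => ->; rewrite expr1n.
have [a [b [rA ala aal bal]]] := arc_rep_from aA nA.
have [ab ba inA outA] := rA.
have a0 : 0 <= a by exact: le_trans ala.
(* The angles t of the j-th preimage arc: N t lies in the j-th period counted from al. *)
pose D j := [set t : R | al + 2 * pi * j%:R < N%:R * t < al + 2 * pi * j%:R + 2 * pi /\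
  A (cis (N%:R * t))].
have cj (j : nat) x : cis (x + 2 * pi * j%:R) = cis x :> Cx R.
  rewrite [2 * pi * _]mulrC cisD (_ : cis (j%:R * _) = 1) ?mulr1//.
  by rewrite /cis cos_nper sin_nper.
have aD j : is_arc (cis (R := R) @` D j).
  apply: is_arc_cis => s t [/andP[s1 s2] As] [/andP[t1 t2] At] u /andP[su ut].
  have [e|su'] := eqVneq u s; first by subst u; split; [rewrite s1 s2|].
  have [e|ut'] := eqVneq u t; first by subst u; split; [rewrite t1 t2|].
  have {}su : N%:R * s < N%:R * u by rewrite ltr_pM2l// lt_neqAle eq_sym su'.
  have {}ut : N%:R * u < N%:R * t by rewrite ltr_pM2l// lt_neqAle ut'.
  split; first by rewrite (lt_trans s1 su) (lt_trans ut t2).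
  apply: (@arc_convex _ A (al + 2 * pi * j%:R) (N%:R * s) _ (N%:R * t)) => //.
  by rewrite cj.
have rD (j : nat) : arc_rep (cis (R := R) @` D j) ((a + 2 * pi * j%:R) / N%:R) ((b + 2 * pi * j%:R) / N%:R).
  have e1 x y : x / N%:R < y = (x < N%:R * y) by rewrite ltr_pdivrMr// mulrC.
  have e2 x y : y < x / N%:R = (N%:R * y < x) by rewrite ltr_pdivlMr// mulrC.
  apply: arc_rep_image.
  - by rewrite ler_pM2r ?invr_gt0// lerD2r.
  - rewrite ler_pdivrMr// [leRHS]mulrDl divfK ?gt_eqF//.
    have : 2 * pi * 1 <= 2 * pi * N%:R :> R by rewrite ler_pM2l// ler1n ltnW.
    lra.
  - move=> t; rewrite e1 e2 => /andP[h1 h2]; split.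
      by apply/andP; split; lra.
    have := inA (N%:R * t - 2 * pi * j%:R); rewrite -(cj j) subrK; apply.
    by apply/andP; split; lra.
  - move=> t [/andP[h1 h2] At]; rewrite !leNgt e1 e2.
    move: At; rewrite -[N%:R * t](subrK (2 * pi * j%:R)) cj => At.
    apply/andP; split; apply/negP => h.
      apply: (outA (N%:R * t - 2 * pi * j%:R + 2 * pi)); last by rewrite cisD2pi.
      by apply/andP; split; lra.
    by apply: (outA (N%:R * t - 2 * pi * j%:R)) At; apply/andP; split; lra.
have small s t (i j : nat) : D i s -> D j t -> (i < N)%N -> (j < N)%N -> cis s = cis t :> Cx R -> i = j.
  move=> [/andP[s1 s2] _] [/andP[t1 t2] _] iN jN st.
  have bd (k : nat) u : (k < N)%N -> al + 2 * pi * k%:R < N%:R * u -> N%:R * u < al + 2 * pi * k%:R + 2 * pi ->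
      al < N%:R * u < al + 2 * pi * N%:R.
    move=> kN h1 h2.
    have k0 : 0 <= 2 * pi * k%:R :> R by rewrite mulr_ge0// ltW.
    have k1 : 2 * pi * (k%:R + 1) <= 2 * pi * N%:R :> R.
      by rewrite ler_pM2l// natr1 ler_nat.
    by apply/andP; split; lra.
  have /andP[s3 s4] := bd i s iN s1 s2; have /andP[t3 t4] := bd j t jN t1 t2.
  have e : s = t.
    apply: cis_inj => //; rewrite -(ltr_pM2l N0) -[X in X * `|_|]ger0_norm ?(ltW N0)//.
    by rewrite -normrM mulrBr ltr_norml; apply/andP; split; lra.
  rewrite -e in t1 t2.
  have h1 : 2 * pi * i%:R < 2 * pi * (j%:R + 1) :> R by lra.
  have h2 : 2 * pi * j%:R < 2 * pi * (i%:R + 1) :> R by lra.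
  move: h1 h2; rewrite !ltr_pM2l// !natr1 !ltr_nat !ltnS => h1 h2.
  by apply/eqP; rewrite eqn_leq h1 h2.
pose I (j : 'I_N) := cis (R := R) @` D j.
have tI : trivIset setT I.
  move=> i j _ _ [z [[s Ds sz] [t Dt tz]]]; apply/val_inj => /=.
  by apply: small Ds Dt _ _ _ => //; rewrite sz tz.
have IE : circle R `&` [set z | A (z ^+ N)] = \bigcup_j I j.
  apply/seteqP; split => [z [zc zA]|z [j _ [t [_ At] <-]]]; last first.
    by split; [exact: circle_cis|rewrite /= cisX].
  have [t /andP[t1 t2] zE] := circle_from (al / N%:R) zc.
  move: zA; rewrite /= zE cisX => At.
  have h1 : al <= N%:R * t by move: t1; rewrite ler_pdivrMr// mulrC.
  have h2 : N%:R * t < al + 2 * pi * N%:R.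
    have e : N%:R * (al / N%:R + 2 * pi) = al + 2 * pi * N%:R by field; rewrite gt_eqF.
    by rewrite -e ltr_pM2l.
  have eS (k : nat) : 2 * pi * k.+1%:R = 2 * pi * k%:R + 2 * pi :> R by rewrite -natr1; ring.
  pose q := (N%:R * t - al) / (2 * pi).
  have q0 : 0 <= q by rewrite divr_ge0 ?subr_ge0// ltW.
  have := truncn_itv q0 => /andP[]; set j := Num.truncn q => j1 j2.
  have j1' : 2 * pi * j%:R <= N%:R * t - al by rewrite mulrC -ler_pdivlMr.
  have j2' : N%:R * t - al < 2 * pi * j.+1%:R by rewrite [ltRHS]mulrC -ltr_pdivrMr.
  have jN : (j < N)%N.
    rewrite -(ltr_nat R) -(ltr_pM2l tp) (le_lt_trans j1')//.
    by rewrite ltrBlDl.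
  exists (Ordinal jN) => //; exists t; last by [].
  split => //=; apply/andP; split; last first.
    by move: j2'; rewrite eS ltrBlDl addrA.
  rewrite lt_neqAle -lerBrDl j1' andbT; apply/eqP => h.
  by apply: nA; rewrite -(cj j) h.
rewrite IE pm_ext_wpm//; last by move=> i; exact: aD.
rewrite (eq_bigr (fun j : 'I_N => weil N ((b + 2 * pi * j%:R) / N%:R) - weil N ((a + 2 * pi * j%:R) / N%:R))).
  rewrite -(big_mkord xpredT (fun j => weil N ((b + 2 * pi * j%:R) / N%:R) - weil N ((a + 2 * pi * j%:R) / N%:R))).
  rewrite sumrB !sum_weil_shift; apply/esym/wpm_rep2 => //.
  by rewrite a0/=; lra.
move=> j _; apply: (wpm_rep2 (aD j) (rD j)).
have j0 : 0 <= 2 * pi * j%:R :> R by rewrite mulr_ge0// ltW.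
have j1 : 2 * pi * (j%:R + 1) <= 2 * pi * N%:R :> R by rewrite ler_pM2l// natr1 ler_nat.
have N2 : 2 * pi * 2 <= 2 * pi * N%:R :> R by rewrite ler_pM2l// ler_nat.
by apply/andP; split; [rewrite divr_ge0 ?addr_ge0// ltW|rewrite ltr_pdivrMr//; lra].
Qed.

End Push.


(** * Fourier coefficients and the Herglotz transform of a premeasure *)

Section Transforms.
Context {R : realType}.
Implicit Types (a b c d s t e r x y : R) (z w : Cx R) (A : set (Cx R)) (D : set R).
Implicit Types (nu : premeasure R) (phi : R -> R).

Local Notation Re := (@complex.Re R).
Local Notation Im := (@complex.Im R).

Lemma dist_ofE nu phi : rint per (fun t => cumul nu t * derive1 phi t) ->
  dist_of nu phi = - J (fun t => cumul nu t * derive1 phi t).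
Proof.
by move=> _; rewrite /dist_of /dist_deriv /dist_mul_haar mulrN mulVKf// gt_eqF// twopi_gt0.
Qed.

Lemma derive1_cosM k : derive1 (fun t => cos (k * t)) = (fun t => - (k * sin (k * t))) :> (R -> R).
Proof.
apply/funext => t; rewrite derive1E.
have := is_derive_scale (is_derive_cos (k * t)).
by rewrite mulrN => /@derive_val.
Qed.

Lemma derive1_sinM k : derive1 (fun t => sin (k * t)) = (fun t => k * cos (k * t)) :> (R -> R).
Proof.
apply/funext => t; rewrite derive1E.
by have := is_derive_scale (is_derive_sin (k * t)) => /@derive_val.
Qed.

(* [fourier (dist_of nu) k = k * fcoef nu k], by integration by parts. *)
Definition fcoef nu (k : nat) : Cx R :=
  if k == 0%N then 0 else
  J (fun t => cumul nu t * sin (k%:R * t)) +i* J (fun t => cumul nu t * cos (k%:R * t)).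

Lemma rint_mul_bnd D (u h : R -> R) M : measurable D -> rint D u ->
  measurable_fun D h -> (forall t, D t -> `|h t| <= M) -> rint D (fun t => u t * h t).
Proof.
move=> mD ui mh hM.
have bh : [bounded h x | x in D].
  exists M; split; first exact: num_real.
  by move=> y My x Dx /=; rewrite (le_trans (hM _ Dx))// ltW.
exact: (@integrableMl _ _ _ (leb R) D mD (EFin \o u) h ui mh bh).
Qed.

Lemma rint_mul_trigp (u f : R -> R) : rint per u -> trigp f ->
  rint per (fun t => u t * f t).
Proof.
move=> ui; elim=> [n|n|{}f g _ cf _ cg|c {}f _ cf].
- apply: (@rint_mul_bnd _ _ _ 1) => //; first exact: measurable_per.
    by apply: measurable_funTS; apply: continuous_measurable_fun; exact: continuous_cosM.
  by move=> t _; exact: cos_max.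
- apply: (@rint_mul_bnd _ _ _ 1) => //; first exact: measurable_per.
    by apply: measurable_funTS; apply: continuous_measurable_fun; exact: continuous_sinM.
  by move=> t _; exact: sin_max.
- under eq_fun do rewrite mulrDr; exact: (rintD measurable_per).
- under eq_fun do rewrite mulrCA; exact: (rintZ _ measurable_per).
Qed.

Lemma fourierE nu k : rint per (cumul nu) -> fourier (dist_of nu) k = k%:R * fcoef nu k.
Proof.
move=> ui; rewrite /fourier /dist_of /dist_deriv /dist_mul_haar derive1_cosM derive1_sinM.
have tp : 2 * pi != 0 :> R by rewrite gt_eqF// twopi_gt0.
rewrite !mulrN !(mulVKf tp) opprK.
have iS := rint_mul_trigp ui (Trigp_sin k); have iC := rint_mul_trigp ui (Trigp_cos k).
have -> : (\int[leb R]_(t in [set t | (0 <= t < 2 * pi)%R]) (cumul nu t * - (k%:R * sin (k%:R * t))))%R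
   = - (k%:R * J (fun t => cumul nu t * sin (k%:R * t))).
  rewrite -mulNr -JZ//; apply: eq_J => t; ring.
have -> : (\int[leb R]_(t in [set t | (0 <= t < 2 * pi)%R]) (cumul nu t * (k%:R * cos (k%:R * t))))%R
   = k%:R * J (fun t => cumul nu t * cos (k%:R * t)).
  rewrite -JZ//; apply: eq_J => t; ring.
have kE : (k%:R : Cx R) = (k%:R : R)%:C by rewrite rmorph_nat.
rewrite opprK kE /fcoef; case: eqP => [->|_].
  by apply: Cx_eq; rewrite ?cReM ?cImM /= !mul0r ?subr0 ?addr0.
by apply: Cx_eq; rewrite ?cReM ?cImM /= !mul0r ?subr0 ?addr0.
Qed.

Lemma cabs_nat k : cabs (k%:R : Cx R) = k%:R :> R.
Proof. by rewrite -[X in cabs X](rmorph_nat (real_complex R)) cabs_real ger0_norm. Qed.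

Lemma fcoef_le nu b : rint per (cumul nu) -> (forall t, per t -> `|cumul nu t| <= b) ->
  forall k, cabs (fcoef nu k) <= 4 * pi * b.
Proof.
move=> ui ub k.
have tp := @twopi_gt0 R.
have b0 : 0 <= b by apply: le_trans (normr_ge0 _) (ub 0 _); rewrite /per/= lexx tp.
have bnd (f : R -> R) : rint per (fun t => cumul nu t * f t) -> (forall t, `|f t| <= 1) ->
    `|J (fun t => cumul nu t * f t)| <= 2 * pi * b.
  move=> fi f1.
  have := Rintegral_close (k := 0) (e := b) measurable_per leb_per_fin fi.
  have lper : fine (leb R per) = 2 * pi by exact: (congr1 fine leb_per).
  rewrite lper mul0r subr0 mulrC; apply => t tt.
  by rewrite subr0 normrM -[leRHS]mulr1 ler_pM// ub.
rewrite /fcoef; case: eqP => _; first by rewrite cabs0 mulr_ge0// mulr_ge0// pi_ge0.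
apply: le_trans (cabs_le_ReIm _) _ => /=.
have -> : 4 * pi * b = 2 * pi * b + 2 * pi * b by ring.
apply: lerD; apply: bnd.
- exact: rint_mul_trigp (Trigp_sin k).
- by move=> t; exact: sin_max.
- exact: rint_mul_trigp (Trigp_cos k).
- by move=> t; exact: cos_max.
Qed.

Lemma npow_cvg r b : 0 <= r < 1 -> 0 <= b -> cvgn (series (fun k => k%:R * b * r ^+ k : R)).
Proof.
move=> /andP[r0 r1] b0.
have [s [s0 s1 rE]] : exists s, [/\ 0 <= s, s < 1 & r = s ^+ 2].
  exists (Num.sqrt r); rewrite sqrtr_ge0 sqr_sqrtr//; split => //.
  by rewrite -sqrtr1 ltr_sqrt.
have s01 : 0 <= s < 1 by rewrite s0.
apply: (@series_le_cvg _ _ (fun k => b / (1 - s) * s ^+ k)).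
- by move=> k; rewrite !mulr_ge0// exprn_ge0.
- by move=> k; rewrite !mulr_ge0// ?exprn_ge0// invr_ge0 subr_ge0 ltW.
- move=> k; rewrite rE -exprM mulnC exprM expr2.
  have := nexp_bound k s01; rewrite -ler_pdivlMr ?subr_gt0// div1r => h.
  have := ler_wpM2l (mulr_ge0 b0 (exprn_ge0 k s0)) h.
  by rewrite (_ : k%:R * b * (s ^+ k * s ^+ k) = b * s ^+ k * (k%:R * s ^+ k))// 1?(_ : b / (1 - s) * s ^+ k = b * s ^+ k / (1 - s))//; ring.
- by apply: is_cvg_seriesZ; exact: geo_cvg.
Qed.

Lemma series_tail_le (u : nat -> Cx R) (b : nat -> R) (l : Cx R) n :
  (forall k, cabs (u k) <= b k) -> cvgn (series b) -> series u @ \oo --> l ->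
  cabs (series u n - l) <= limn (series b) - series b n.
Proof.
move=> ub cb ul; rewrite cabsC.
have h : (fun m => series u (n + m)%N - series u n) @ \oo --> l - series u n.
  by apply: cvgB; [exact: cvgn_addn|exact: cvg_cst].
have nd : nondecreasing_seq (series b).
  by apply: nondecreasing_series => k _ _; exact: le_trans (cabs_ge0 _) (ub k).
apply: (cvg_cabs_le h) => m.
rewrite lerBrDr (le_trans _ (nondecreasing_cvgn_le nd cb (n + m)%N))//.
rewrite /series/= (big_cat_nat (n := n) (p := (n + m)%N))//= ?leq_addr//.
rewrite addrAC subrr add0r [leRHS](big_cat_nat (n := n))//= ?leq_addr// [leRHS]addrC lerD2r.
by apply: le_trans (cabs_sum _ _ _) _; apply: ler_sum => k _.
Qed.

Lemma series_tail_cvg0 (b : nat -> R) : cvgn (series b) ->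
  (fun n => limn (series b) - series b n) @ \oo --> (0 : R).
Proof.
by move=> cb; rewrite -[X in _ --> X](subrr (limn (series b))); apply: cvgB => //; exact: cvg_cst.
Qed.

Lemma herglotzE nu z (l : Cx R) : rint per (cumul nu) ->
  series (fun k => k%:R * fcoef nu k * z ^+ k) @ \oo --> l -> herglotz nu z = 2 * l.
Proof.
move=> ui hl; rewrite /herglotz fourierE// mul0r add0r; congr (_ * _); apply: limC.
have -> : (fun n => \sum_(1 <= k < n) fourier (dist_of nu) k * z ^+ k) =
    series (fun k => k%:R * fcoef nu k * z ^+ k).
  apply/funext => -[|n]; rewrite /series/=; first by rewrite !big_geq.
  rewrite [RHS]big_ltn// mul0r mul0r add0r; apply: eq_bigr => k _.
  by rewrite fourierE.
exact: hl.
Qed.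

End Transforms.


(** * Integration of the Herglotz series along a ray *)

Section GTransform.
Context {R : realType}.
Implicit Types (a b c d s t e r x y : R) (z w : Cx R) (A : set (Cx R)) (D : set R).
Implicit Types (nu : premeasure R) (phi : R -> R).

Local Notation Re := (@complex.Re R).
Local Notation Im := (@complex.Im R).

(** L stands for the real or the imaginary part. The series is integrated term by term in s; its
    convergence is uniform because the terms are dominated by those at s = 1. The point s = 0, at
    which the integrand is a division by 0, is left out as a null set. *)
Let ray_integral (L : Cx R -> R) (g : nat -> Cx R) (b : nat -> R) z (Dl : Cx R)
    (f : R -> Cx R) :
  (forall u v, L (u + v) = L u + L v) -> (forall x w, L (x%:C * w) = x * L w) ->
  (forall w, `|L w| <= cabs w) -> g 0%N = 0 ->
  (forall k, cabs (k.+1%:R * g k.+1 * z ^+ k.+1) <= b k) -> cvgn (series b) ->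
  series (fun k => g k * z ^+ k) @ \oo --> Dl ->
  (forall s, 0 < s <= 1 ->
    series (fun k => k.+1%:R * g k.+1 * (s ^+ k)%:C * z ^+ k.+1) @ \oo --> f s) ->
  \int[leb R]_(s in [set s : R | (0 <= s <= 1)%R]) L (f s) = L Dl.
Proof.
move=> LD LZ Lle g0 gb cb gD hf.
have L0 : L 0 = 0 by have := LZ 0 0; rewrite !mul0r.
have LB u v : L (u - v) = L u - L v.
  rewrite LD; congr (_ + _); have := LZ (-1) v; rewrite !mulN1r => <-.
  by rewrite (_ : (-1)%:C = -1 :> Cx R) ?mulN1r// rmorphN1.
have Lsum (I : Type) (r : seq I) (F : I -> Cx R) : L (\sum_(i <- r) F i) = \sum_(i <- r) L (F i).
  by elim/big_ind2 : _ => // u1 u2 v1 v2; rewrite LD => -> ->.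
pose p k := L (g k * z ^+ k).
pose fn n s := \sum_(0 <= k < n) k.+1%:R * p k.+1 * s ^+ k.
have fnE n s : fn n s = L (series (fun k => k.+1%:R * g k.+1 * (s ^+ k)%:C * z ^+ k.+1) n).
  rewrite /series/= Lsum /fn; apply: eq_bigr => k _.
  have -> : k.+1%:R * g k.+1 * (s ^+ k)%:C * z ^+ k.+1 =
     (k.+1%:R * s ^+ k)%:C * (g k.+1 * z ^+ k.+1).
    by rewrite rmorphM rmorph_nat; ring.
  by rewrite LZ /p; ring.
have cfn n : continuous (fn n).
  move=> s; have := is_derive_psum (fun k => k.+1%:R * p k.+1) n s.
  case: n => [|n] H.
    rewrite (_ : fn 0%N = fun=> 0); first exact: cvg_cst.
    by apply/funext => u; rewrite /fn big_geq.
  have := is_derive_psum (fun k => k.+1%:R * p k.+1) n s.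
  exact: is_derive_cont.
have F2 n : \int[leb R]_(s in `[0, 1]) fn n s = L (series (fun k => g k * z ^+ k) n.+1).
  rewrite (FTC2 ler01 (cfn n) (is_derive_psum p n)).
  have -> : \sum_(0 <= k < n.+1) p k * 0 ^+ k = 0.
    rewrite big_nat_recl// big1 => [|k _]; last by rewrite expr0n mulr0.
    by rewrite /p g0 mul0r L0 mul0r addr0.
  rewrite subr0 /series/= Lsum; apply: eq_bigr => k _.
  by rewrite expr1n mulr1.
have mI : measurable (`]0%R, 1%R]%classic : set R) by [].
have lI : (leb R `]0%R, 1%R]%classic < +oo)%E.
  by rewrite lebesgue_measure_itv/=; case: ifPn => _; rewrite ?ltry// -EFinB ltry.
have rfn n : rint `]0%R, 1%R]%classic (fn n).
  apply: rint_sub (rint_cont 0 1 (cfn n)) => //.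
  by apply: subset_itv; rewrite bnd_simp.
have [|rf cf] := @Rintegral_unif R `]0%R, 1%R]%classic fn (fun s => L (f s))
    (fun n => limn (series b) - series b n) mI lI rfn (series_tail_cvg0 cb).
  move=> n s; rewrite /= in_itv/= => s01; rewrite fnE -LB; apply: le_trans (Lle _) _.
  have bb k : cabs (k.+1%:R * g k.+1 * (s ^+ k)%:C * z ^+ k.+1) <= b k.
    have /andP[s0 s1] := s01.
    have sk0 : 0 <= s ^+ k by rewrite exprn_ge0// ltW.
    have sk1 : s ^+ k <= 1 by rewrite exprn_ile1// ltW.
    apply: le_trans (gb k).
    have -> : k.+1%:R * g k.+1 * (s ^+ k)%:C * z ^+ k.+1 = (k.+1%:R * g k.+1 * z ^+ k.+1) * (s ^+ k)%:C by ring.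
    by rewrite cabsM cabs_real (ger0_norm sk0) ler_piMr ?cabs_ge0.
  exact: (series_tail_le n bb cb (hf s s01)).
rewrite (_ : [set s : R | (0 <= s <= 1)%R] = `[0, 1]%classic); last first.
  by apply/seteqP; split => s /=; rewrite in_itv.
rewrite -(Rintegral_itv_obnd_cbnd rf).
apply: (cvg_unique _ cf) => //.
have -> : (fun n => \int[leb R]_(x in `]0%R, 1%R]%classic) fn n x) =
    (fun n => L (series (fun k => g k * z ^+ k) n.+1)).
  by apply/funext => n; rewrite -F2 (Rintegral_itv_obnd_cbnd (rfn n)).
apply/(cvgn_shift (fun n => L (series (fun k => g k * z ^+ k) n))).
apply/cvgrPdist_lt => e e0; have /cvgCP/(_ _ e0) := gD; apply: filterS => n h.
by rewrite -LB (le_lt_trans (Lle _))// cabsC.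
Qed.

(** The Herglotz transform is 2 sum k c_k z^k with c_k = [fcoef nu k]. Dividing by t and integrating
    removes the factor k, and the constants combine so that - pi i G is - sum c_k z^k. *)
Lemma wtransformE nu b z : rint per (cumul nu) ->
  (forall t, per t -> `|cumul nu t| <= b) -> disc R z ->
  exists2 Dl : Cx R, series (fun k => fcoef nu k * z ^+ k) @ \oo --> Dl &
    wtransform nu z = cexp (- Dl).
Proof.
move=> ui ub zD; have r01 : 0 <= cabs z < 1 by rewrite cabs_ge0.
have /andP[r0 r1] := r01.
pose B := 4 * pi * b.
have gB := fcoef_le ui ub; rewrite -/B in gB.
have B0 : 0 <= B by apply: le_trans (cabs_ge0 _) (gB 0%N).
have cnp := npow_cvg r01 B0.
pose bk k := k.+1%:R * B * cabs z ^+ k.+1.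
have cbk : cvgn (series bk).
  have /cvg_ex[/= l hl] := cnp.
  apply/cvg_ex; exists l; rewrite /bk.
  have /(cvgn_shift (series (fun k => k%:R * B * cabs z ^+ k))) := hl.
  suff -> : (fun n => series (fun k => k%:R * B * cabs z ^+ k) n.+1) =
    series (fun k => k.+1%:R * B * cabs z ^+ k.+1) by [].
  apply/funext => n; rewrite /series/= big_nat_recl//.
  by rewrite mul0r mul0r add0r.
have bk_le k : cabs (k.+1%:R * fcoef nu k.+1 * z ^+ k.+1) <= bk k.
  rewrite !cabsM cabs_nat cabsX /bk ler_wpM2r ?exprn_ge0//.
  by rewrite ler_wpM2l.
have [Dl hD] : exists Dl : Cx R, series (fun k => fcoef nu k * z ^+ k) @ \oo --> Dl.
  apply: (@seriesC_cvg R _ (fun k => B * cabs z ^+ k)).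
    by move=> k; rewrite cabsM cabsX ler_wpM2r ?exprn_ge0.
  by apply: is_cvg_seriesZ; exact: geo_cvg.
exists Dl => //.
pose f s : Cx R := limn (series (fun k => k.+1%:R * fcoef nu k.+1 * (s ^+ k)%:C * z ^+ k.+1)).
have hf s : 0 < s <= 1 ->
    series (fun k => k.+1%:R * fcoef nu k.+1 * (s ^+ k)%:C * z ^+ k.+1) @ \oo --> f s.
  move=> /andP[s0 s1].
  have [|l hl] := @seriesC_cvg R (fun k => k.+1%:R * fcoef nu k.+1 * (s ^+ k)%:C * z ^+ k.+1) bk _ cbk.
    move=> k; apply: le_trans (bk_le k).
    have sk0 : 0 <= s ^+ k by rewrite exprn_ge0// ltW.
    have sk1 : s ^+ k <= 1 by rewrite exprn_ile1// ltW.
    have -> : k.+1%:R * fcoef nu k.+1 * (s ^+ k)%:C * z ^+ k.+1 =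
        (k.+1%:R * fcoef nu k.+1 * z ^+ k.+1) * (s ^+ k)%:C by rewrite -!mulrA; congr (_ * (_ * _)); rewrite mulrC.
    by rewrite cabsM cabs_real (ger0_norm sk0) ler_piMr ?cabs_ge0.
  by rewrite /f (limC hl).
have hE s : 0 < s <= 1 -> herglotz nu (s%:C * z) / s%:C = 2 * f s.
  move=> s01; have /andP[s0 s1] := s01.
  have sn0 : (s%:C : Cx R) != 0 by rewrite -cabs_eq0 cabs_real normr_eq0 gt_eqF.
  rewrite (@herglotzE R nu _ (s%:C * f s) ui).
    by rewrite mulrCA mulrAC mulfV// mul1r.
  apply/(cvgn_shift (series (fun k => k%:R * fcoef nu k * (s%:C * z) ^+ k))).
  have -> : (fun n => series (fun k => k%:R * fcoef nu k * (s%:C * z) ^+ k) n.+1) =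
     (fun n => s%:C * series (fun k => k.+1%:R * fcoef nu k.+1 * (s ^+ k)%:C * z ^+ k.+1) n).
    apply/funext => n; rewrite /series/= big_nat_recl// mul0r mul0r add0r mulr_sumr.
    by apply: eq_bigr => k _; rewrite exprMn rmorphXn/= !exprS; ring.
  by apply: cvgMl_tmp; exact: hf.
have c0 : fcoef nu 0 = 0 by [].
have two : (2 : Cx R) = (2 : R)%:C by rewrite rmorph_nat.
have int_eq (L : Cx R -> R) :
    (forall u v, L (u + v) = L u + L v) -> (forall x w, L (x%:C * w) = x * L w) ->
    (forall w, `|L w| <= cabs w) ->
  \int[leb R]_(s in [set s : R | (0 <= s <= 1)%R]) L (herglotz nu (s%:C * z) / s%:C) = 2 * L Dl.
  move=> LD LZ Lle.
  have hg k : cabs (k.+1%:R * (2 * fcoef nu k.+1) * z ^+ k.+1) <= 2 * bk k.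
    by rewrite mulrCA -mulrA cabsM cabs_nat ler_wpM2l.
  have := @ray_integral L (fun k => 2 * fcoef nu k) (fun k => 2 * bk k) z (2 * Dl)
    (fun s => herglotz nu (s%:C * z) / s%:C) LD LZ Lle.
  have -> : L (2 * Dl) = 2 * L Dl by rewrite two LZ.
  apply.
  - by rewrite c0 mulr0.
  - exact: hg.
  - by apply: is_cvg_seriesZ; exact: cbk.
  - have -> : series (fun k => 2 * fcoef nu k * z ^+ k) = (fun n => 2 * series (fun k => fcoef nu k * z ^+ k) n).
      by apply/funext => n; rewrite /series/= mulr_sumr; apply: eq_bigr => k _; rewrite mulrA.
    exact: cvgMl_tmp.
  - move=> s s01; rewrite (hE s s01).
    have E : series (fun k => k.+1%:R * (2 * fcoef nu k.+1) * (s ^+ k)%:C * z ^+ k.+1) =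
       (fun n => 2 * series (fun k => k.+1%:R * fcoef nu k.+1 * (s ^+ k)%:C * z ^+ k.+1) n).
      apply/funext => n; rewrite /series/= mulr_sumr; apply: eq_bigr => k _.
      by rewrite (mulrCA k.+1%:R 2) -!mulrA.
    rewrite E.
    by apply: cvgMl_tmp; exact: hf.
have cE : cintegral [set s : R | (0 <= s <= 1)%R] (fun s => herglotz nu (s%:C * z) / s%:C) = 2 * Dl.
  rewrite /cintegral; apply: Cx_eq => /=.
    rewrite int_eq; [|exact: cReD| |exact: norm_Re_le].
      by rewrite two cReM/= mul0r subr0.
    by move=> x w; rewrite cReM/= mul0r subr0.
  rewrite int_eq; [|exact: cImD| |exact: norm_Im_le].
    by rewrite two cImM/= mul0r addr0.
  by move=> x w; rewrite cImM/= mul0r addr0.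
rewrite /wtransform /gtransform cE; congr (cexp (- _)).
have pn0 : (pi%:C : Cx R) != 0 by rewrite -cabs_eq0 cabs_real normr_eq0 gt_eqF// pi_gt0.
have in0 : (Num.imaginary : R[i]) != 0 by exact: neq0Ci.
have alg (p i y : Cx R) : p != 0 -> i != 0 -> p * i * ((2 * p * i)^-1 * (2 * y)) = y.
  move=> p0 i0; have cn0 : p * i != 0 by rewrite mulf_neq0.
  rewrite -(mulrA 2 p i) invfM (mulrC 2^-1) -(mulrA (p * i)^-1) mulVKf//.
  by rewrite mulKf// pnatr_eq0.
exact: alg pn0 in0.
Qed.

End GTransform.


(** * The transforms of the constructed premeasure *)

Section WpmTransforms.
Context {R : realType}.
Variable N : nat.
Hypothesis N1 : (1 < N)%N.
Implicit Types (a b c d s t e r x y : R) (z w : Cx R).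

Local Notation mu := (@wpm R N N1).
Local Notation wei := (@wei R N).
Local Notation weil := (@weil R N).

Lemma rint_weil : rint per weil.
Proof.
apply: (Rintegral_unif (fn := wei) (e := fun n => 4 * 2^-1 ^+ n) (f := weil) _ leb_per_fin _ _ _).1.
- exact: measurable_per.
- by move=> n; exact/trigp_rint/trigp_wei.
- exact: half_cvg0.
- by move=> n x _; rewrite distrC weil_close.
Qed.

Lemma J_weil_mul (g : R -> R) M : continuous g -> (forall t, per t -> `|g t| <= M) ->
  (fun n => J (fun t => wei n t * g t)) @ \oo --> J (fun t => weil t * g t).
Proof.
move=> cg gM.
have M0 : 0 <= M by apply: le_trans (normr_ge0 _) (gM 0 _); rewrite /per/= lexx twopi_gt0.
apply: (Rintegral_unif (fn := fun n t => wei n t * g t) (e := fun n => (4 * M) * 2^-1 ^+ n)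
  (f := fun t => weil t * g t) measurable_per leb_per_fin _ _ _).2.
- move=> n; apply: rint_per_cont => t.
  by apply: cvgM; [exact/trigp_cont/trigp_wei|exact: cg].
- exact: half_cvg0.
- move=> n x px; rewrite distrC -mulrBl normrM [leRHS](_ : _ = 4 * 2^-1 ^+ n * M); last by ring.
  by apply: ler_pM; rewrite ?weil_close ?gM.
Qed.

Lemma rint_cumul_wpm : rint per (cumul mu).
Proof.
apply: eq_integrable rint_weil; first exact: measurable_per.
by move=> t; rewrite inE /comp => pt; rewrite cumul_wpm.
Qed.

Lemma cumul_wpm_le t : per t -> `|cumul mu t| <= 4.
Proof.
move=> pt; rewrite cumul_wpm//; have := weil_close N1 0 t.
by rewrite /wei big_geq// mulr0 oppr0 subr0 expr0 mulr1.
Qed.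

(** This is N^-j at k = N^j and 0 elsewhere, in the shape used by [EN]. *)
Definition wcoef k : R := \sum_(j < k.+1 | k == (N ^ j)%N) N%:R ^- j.

Lemma wcoefE k n : (k < n)%N -> wcoef k = \sum_(0 <= j < n | k == (N ^ j)%N) N%:R ^- j.
Proof.
move=> kn; rewrite /wcoef -(big_mkord (fun j => k == (N ^ j)%N) (fun j => N%:R ^- j)).
rewrite [RHS](big_cat_nat (n := k.+1))//= [X in _ = _ + X]big1_seq ?addr0// => j.
rewrite mem_index_iota => /andP[/eqP kE /andP[kj _]].
by have := ltn_expl j N1; rewrite -kE ltnNge (ltnW kj).
Qed.

Lemma wcoef_exp j : wcoef (N ^ j) = N%:R ^- j.
Proof.
rewrite (wcoefE (ltnSn _)).
under eq_bigl => i do rewrite eqn_exp2l// eq_sym.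
by rewrite big_nat1_eq/= ltnS (ltnW (ltn_expl j N1)).
Qed.

Lemma wcoef_cases k : wcoef k = 0 \/ exists j, k = (N ^ j)%N.
Proof.
have [[j kj]|H] := pselect (exists j, k = (N ^ j)%N); first by right; exists j.
left; rewrite /wcoef big1// => j /eqP kj.
by case: H; exists j.
Qed.

Lemma wcoef_ge0 k : 0 <= wcoef k.
Proof. by rewrite /wcoef sumr_ge0// => j _; rewrite invr_ge0 exprn_ge0. Qed.

Let N0 j : (N%:R ^+ j : R) != 0.
Proof. by rewrite expf_neq0// pnatr_eq0; case: (N) N1. Qed.

Lemma mul_wcoef_le k : k%:R * wcoef k <= 1.
Proof.
have [->|[j ->]] := wcoef_cases k; first by rewrite mulr0.
by rewrite wcoef_exp natrX divff.
Qed.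

Lemma wcoef0 : wcoef 0 = 0.
Proof.
by have [//|[j /esym/eqP]] := wcoef_cases 0; rewrite expn_eq0; case: (N) N1.
Qed.

Lemma wcoef_le1 k : wcoef k <= 1.
Proof.
have [->|k0] := posnP k; first by rewrite wcoef0.
apply: le_trans (mul_wcoef_le k); rewrite ler_peMl ?wcoef_ge0//.
by rewrite ler1n.
Qed.

Lemma J_wei_cos n k : J (fun t => wei n t * cos (k%:R * t)) = 0.
Proof.
have -> : J (fun t => wei n t * cos (k%:R * t)) =
    J (fun t => \sum_(0 <= j < n) (- (pi^-1 * N%:R ^- j)) * (sin ((N ^ j)%:R * t) * cos (k%:R * t))).
  apply: eq_J => t; rewrite /wei mulNr -mulrA mulr_suml mulr_sumr -sumrN.
  by apply: eq_bigr => j _; rewrite mulNr !mulrA.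
have ti j : trigp (fun t => sin ((N ^ j)%:R * t) * cos (k%:R * t) : R).
  by apply: trigp_mul; [exact: Trigp_sin|exact: Trigp_cos].
rewrite /J Rintegral_sum; [|exact: measurable_per|].
  by rewrite big1// => j _; rewrite -/(J _) JZ ?J_sin_cos ?mulr0//; exact/trigp_rint/ti.
by move=> j; exact/(rintZ _ measurable_per)/trigp_rint/ti.
Qed.

(** The condition k < n guarantees that a frequency k = N^j already occurs in [wei n], since j <
    N^j. *)
Lemma J_wei_sin n k : (0 < k)%N -> (k < n)%N ->
  J (fun t => wei n t * sin (k%:R * t)) = - wcoef k.
Proof.
move=> k0 kn.
have -> : J (fun t => wei n t * sin (k%:R * t)) =
    J (fun t => \sum_(0 <= j < n) (- (pi^-1 * N%:R ^- j)) * (sin ((N ^ j)%:R * t) * sin (k%:R * t))).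
  apply: eq_J => t; rewrite /wei mulNr -mulrA mulr_suml mulr_sumr -sumrN.
  by apply: eq_bigr => j _; rewrite mulNr !mulrA.
have ti j : trigp (fun t => sin ((N ^ j)%:R * t) * sin (k%:R * t) : R).
  by apply: trigp_mul; exact: Trigp_sin.
rewrite /J Rintegral_sum; [|exact: measurable_per|].
  rewrite (wcoefE kn) [in RHS]big_mkcond -sumrN; apply: eq_bigr => j _; rewrite -/(J _) JZ; last exact/trigp_rint/ti.
  rewrite J_sin_mul// eq_sym; case: ifP => _; last by rewrite mulr0 oppr0.
  by rewrite mulNr mulrAC mulVf ?mul1r// gt_eqF// pi_gt0.
by move=> j; exact/(rintZ _ measurable_per)/trigp_rint/ti.
Qed.

Lemma fcoef_wpm k : fcoef mu k = - (wcoef k)%:C.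
Proof.
rewrite /fcoef; case: eqP => [->|/eqP]; first by rewrite wcoef0 oppr0.
rewrite -lt0n => k0.
have cumE (g : R -> R) : J (fun t => cumul mu t * g t) = J (fun t => weil t * g t).
  by apply: eq_in_J => t pt; rewrite cumul_wpm.
apply: Cx_eq => /=; rewrite cumE.
  apply: (cvg_unique _ (J_weil_mul (M := 1) (@continuous_sinM R _) _)) => //.
    by move=> t _; exact: sin_max.
  apply/cvgrPdist_lt => e e0; exists k.+1 => // n /= kn.
  by rewrite J_wei_sin// subrr normr0.
rewrite oppr0; apply: (cvg_unique _ (J_weil_mul (M := 1) (@continuous_cosM R _) _)) => //.
  by move=> t _; exact: cos_max.
rewrite (_ : (fun n => _) = fun=> 0); first exact: cvg_cst.
by apply/funext => n; exact: J_wei_cos.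
Qed.

(** The powers of N below N^m are the N^j with j < m. The lacunary partial sums are thus a
    subsequence of the partial sums of the power series. *)
Lemma series_wcoef_pow z m :
  series (fun k => k%:R * (wcoef k)%:C * z ^+ k) (N ^ m)%N = lacS N m z.
Proof.
rewrite /series/= /lacS.
transitivity (\sum_(0 <= k < N ^ m) \sum_(0 <= j < N ^ m | k == (N ^ j)%N) z ^+ (N ^ j)).
  rewrite !big_mkord; apply: eq_bigr => k _; rewrite (wcoefE (ltn_ord k)).
  rewrite rmorph_sum mulr_sumr mulr_suml. apply: eq_bigr => j /eqP ->.
  by rewrite natrX fmorphV rmorphXn rmorph_nat mulfV ?mul1r// expf_neq0// pnatr_eq0; case: (N) N1.
rewrite (exchange_big_dep xpredT)//=.
rewrite [LHS](big_cat_nat (n := m))//= ?(ltnW (ltn_expl m N1))// [X in _ + X = _]big1_seq ?addr0.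
  by apply: eq_big_nat => j /andP[_ jm]; rewrite big_nat1_eq/= ltn_exp2l// jm.
move=> j; rewrite mem_index_iota => /andP[_ /andP[mj _]].
by rewrite big_nat1_eq/= ltn_exp2l// ltnNge mj.
Qed.

Lemma series_wcoef z : disc R z ->
  series (fun k => k%:R * (wcoef k)%:C * z ^+ k) @ \oo --> Lac N z.
Proof.
move=> zD; have r01 : 0 <= cabs z < 1 by rewrite cabs_ge0.
have [|l hl] := @seriesC_cvg R (fun k => k%:R * (wcoef k)%:C * z ^+ k) _ _ (geo_cvg r01).
  move=> k; rewrite !cabsM cabs_nat cabsX cabs_real (ger0_norm (wcoef_ge0 k)).
  by rewrite ler_piMl ?exprn_ge0 ?cabs_ge0// mul_wcoef_le.
have Ny : (fun m => (N ^ m)%N) @ \oo --> \oo.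
  by move=> P [n0 _ H]; exists n0 => // m /= nm; apply: H => /=; apply: leq_trans nm (expn_geid N1 m).
have : (fun m => series (fun k => k%:R * (wcoef k)%:C * z ^+ k) (N ^ m)%N) @ \oo --> l.
  exact: cvg_comp Ny hl.
rewrite (_ : (fun m => _) = (lacS N)^~ z); last by apply/funext => m; rewrite series_wcoef_pow.
by move=> /limC lE; rewrite /Lac lE.
Qed.

Lemma herglotz_wpm z : disc R z -> herglotz mu z = - (2 * Lac N z).
Proof.
move=> zD; rewrite (@herglotzE _ _ _ (- Lac N z) rint_cumul_wpm) ?mulrN//.
have -> : series (fun k => k%:R * fcoef mu k * z ^+ k) =
    (fun n => - series (fun k => k%:R * (wcoef k)%:C * z ^+ k) n).
  apply/funext => n; rewrite /series/= -sumrN; apply: eq_bigr => k _.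
  by rewrite fcoef_wpm mulrN mulNr.
by apply: cvgN; exact: series_wcoef.
Qed.

Lemma fpm_wpm z : disc R z -> fpm mu z = cexp (2 * Lac N z).
Proof. by move=> zD; rewrite /fpm herglotz_wpm// opprK. Qed.

Lemma herglotz_wpm_cvg z : disc R z ->
  (fun n : nat => - (2 * \sum_(0 <= k < n) z ^+ (N ^ k))) @ \oo --> herglotz mu z.
Proof.
move=> zD; rewrite herglotz_wpm//; apply: cvgN; apply: cvgMl_tmp.
exact: (Lac_cvg N1 zD).
Qed.

Lemma fpm_wpm_cvg z : disc R z ->
  (fun n : nat => \prod_(0 <= k < n) cexp (2 * z ^+ (N ^ k))) @ \oo --> fpm mu z.
Proof.
move=> zD; rewrite fpm_wpm//.
have -> : (fun n : nat => \prod_(0 <= k < n) cexp (2 * z ^+ (N ^ k))) =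
    (fun n => cexp (2 * lacS N n z)).
  apply/funext => n; rewrite /lacS mulr_sumr.
  elim: n => [|n IH]; first by rewrite !big_geq// cexp0.
  by rewrite !big_nat_recr//= IH cexpD.
apply: (cvg_comp (fun n => 2 * lacS N n z) (@cexp R)); last exact: continuous_cexp.
apply: cvgMl_tmp; exact: (Lac_cvg N1 zD).
Qed.

Lemma power_series_wpm : has_power_series (wtransform mu) (EN R N).
Proof.
move=> z zD; have r01 : 0 <= cabs z < 1 by rewrite cabs_ge0.
have [Dl hD ->] := wtransformE rint_cumul_wpm cumul_wpm_le zD.
have -> : EN R N = fps_exp (fun k => (wcoef k)%:C).
  rewrite /EN; congr fps_exp; apply/funext => k; rewrite /wcoef rmorph_sum.
  by apply: eq_bigr => j _; rewrite fmorphV rmorphXn rmorph_nat.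
have bnd w k : cabs w = cabs z -> cabs ((wcoef k)%:C * w ^+ k) <= cabs z ^+ k.
  move=> wz; rewrite cabsM cabsX wz cabs_real (ger0_norm (wcoef_ge0 k)).
  by rewrite ler_piMl ?exprn_ge0 ?cabs_ge0 ?wcoef_le1.
have [|Gr hGr] := @seriesC_cvg R (fun k => (wcoef k)%:C * `|z| ^+ k) _ _ (geo_cvg r01).
  by move=> k; apply: bnd; rewrite /cabs normr_id.
have w0 : ((wcoef 0)%:C : Cx R) = 0 by rewrite wcoef0.
have wge k : 0 <= ((wcoef k)%:C : Cx R) by rewrite ler0c wcoef_ge0.
refine (fps_exp_cvg (a := fun k => (wcoef k)%:C) w0 wge _ hGr).
have -> : series (fun k => (wcoef k)%:C * z ^+ k) = (fun n => - series (fun k => fcoef mu k * z ^+ k) n).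
  apply/funext => n; rewrite /series/= -sumrN; apply: eq_bigr => k _.
  by rewrite fcoef_wpm mulNr opprK.
by apply: cvgN; exact: hD.
Qed.

End WpmTransforms.


(** * Regularity of the cumulative mass function of a premeasure *)

Section Premeasures.
Context {R : realType}.
Implicit Types (a b c d s t e r x y : R) (z w : Cx R) (A : set (Cx R)) (I K : set R).
Implicit Types (nu : premeasure R) (Q : R -> Prop).

(** Each point is chosen beyond both its predecessor and t - 1/n. Together with [right_seq] this
    turns the failure of a one-sided limit into a monotone sequence of arcs, to which the continuity
    axiom applies. *)
Lemma left_seq Q t : (forall s, s < t -> exists2 s', s < s' < t & Q s') ->
  exists u : nat -> R, [/\ forall n, u n < t, forall n, u n <= u n.+1,
    u @ \oo --> t & forall n, Q (u n)].
Proof.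
move=> H; have /choice[g gP] s : exists s', s < t -> s < s' < t /\ Q s'.
  have [st|] := boolP (s < t); last by exists 0.
  by have [s' h q] := H s st; exists s'.
pose fix u n : R := match n with 0%N => g (t - 1) | n'.+1 => g (Num.max (u n') (t - n'.+1%:R^-1)) end.
have invp n : 0 < n.+1%:R^-1 :> R by rewrite invr_gt0.
have ut n : u n < t /\ Q (u n).
  elim: n => [|n [IH _]] /=.
    by have /gP[/andP[_ ->]] : t - 1 < t by rewrite ltrBlDr ltrDl.
  have /gP[/andP[_ ->]//] : Num.max (u n) (t - n.+1%:R^-1) < t.
  by rewrite gt_max IH ltrBlDr ltrDl invp.
have ustep n : Num.max (u n) (t - n.+1%:R^-1) < u n.+1.
  have /gP[/andP[-> _]//] : Num.max (u n) (t - n.+1%:R^-1) < t.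
  by rewrite gt_max (ut n).1 ltrBlDr ltrDl invp.
exists u; split=> [n|n||n]; [exact: (ut n).1| | |exact: (ut n).2].
  by apply: ltW; apply: le_lt_trans (ustep n); rewrite le_max lexx.
apply/(cvgn_shift u).
apply: (@squeeze_cvgr _ _ _ _ (fun n => t - n.+1%:R^-1) (fun=> t)).
- apply: nearW => n; rewrite (ltW (ut n.+1).1) andbT ltW//.
  by apply: le_lt_trans (ustep n); rewrite le_max lexx orbT.
- rewrite -[X in _ --> X]subr0; apply: cvgB; first exact: cvg_cst.
  exact: cvg_harmonic.
- exact: cvg_cst.
Qed.

Lemma right_seq Q t : (forall s, t < s -> exists2 s', t < s' < s & Q s') ->
  exists u : nat -> R, [/\ forall n, t < u n, forall n, u n.+1 <= u n,
    u @ \oo --> t & forall n, Q (u n)].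
Proof.
move=> H; have [|u [u1 u2 u3 u4]] := @left_seq (fun s => Q (- s)) (- t).
  move=> s; rewrite ltrNr => /H[s' /andP[h1 h2] q]; exists (- s'); rewrite ?opprK//.
  by rewrite ltrNr h2 ltrNl opprK h1.
exists (fun n => - u n); split=> [n|n||n].
- by have := u1 n; rewrite ltrNr.
- by rewrite lerN2; exact: u2.
- by rewrite -[X in _ --> X]opprK; exact: cvgN.
- exact: u4.
Qed.

Lemma pm_image_add nu I I' K : is_interval I -> is_interval I' -> is_interval K ->
  K = I `|` I' -> I `&` I' = set0 -> K `<=` per ->
  nu (cis (R := R) @` K) = nu (cis (R := R) @` I) + nu (cis (R := R) @` I').
Proof.
move=> iI iI' iK KE I0 Kper; rewrite KE image_setU.
apply: pm_additive; [exact: is_arc_cis|exact: is_arc_cis| |].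
  by rewrite -image_setU -KE; exact: is_arc_cis.
apply/seteqP; split => // z [[x Ix <-] [y Iy /cis_inj yx]].
have /andP[x0 x2] : 0 <= x < 2 * pi by apply: Kper; rewrite KE; left.
have /andP[y0 y2] : 0 <= y < 2 * pi by apply: Kper; rewrite KE; right.
have yE : y = x by apply: yx; rewrite ltr_norml; apply/andP; split; lra.
by rewrite yE in Iy; have : (I `&` I') x by []; rewrite I0.
Qed.

Lemma pm_image_cvg nu (I : nat -> set R) : (forall n, is_interval (I n)) ->
  (forall n, I n.+1 `<=` I n) -> \bigcap_n I n = set0 -> I 0%N `<=` per ->
  (fun n => nu (cis (R := R) @` I n)) @ \oo --> (0 : R).
Proof.
move=> iI dI I0 Iper; apply: pm_continuous.
- by move=> n; exact: is_arc_cis.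
- by move=> n; apply: image_subset; exact: dI.
have dI0 n : I n `<=` I 0%N by elim: n => // n IH; exact: subset_trans (dI n) IH.
apply/seteqP; split => // z zI.
have [x Ix xz] := zI 0%N Logic.I.
have : (\bigcap_n I n) x.
  move=> n _; have [y Iy yz] := zI n Logic.I.
  have /andP[x0 x2] := Iper _ Ix; have /andP[y0 y2] := Iper _ (dI0 n _ Iy).
  have -> : x = y; last by [].
  by apply: cis_inj; rewrite ?xz// ltr_norml; apply/andP; split; lra.
by rewrite I0.
Qed.

Let itv_co a b : is_interval [set t : R | a <= t < b].
Proof.
move=> x y /= /andP[ax _] /andP[_ yb] u /andP[xu uy].
by rewrite (le_trans ax xu) (le_lt_trans uy yb).
Qed.

Let itv_oo a b : is_interval [set t : R | a < t < b].
Proof.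
move=> x y /= /andP[ax _] /andP[_ yb] u /andP[xu uy].
by rewrite (lt_le_trans ax xu) (le_lt_trans uy yb).
Qed.

Let itv_1 a : is_interval [set a].
Proof. by move=> x y /= -> -> u /andP[h1 h2]; apply/eqP; rewrite eq_le h1 h2. Qed.

Lemma cumul_split nu a b : 0 <= a -> a <= b -> b <= 2 * pi ->
  cumul nu b = cumul nu a + nu (cis (R := R) @` [set t | a <= t < b]).
Proof.
move=> a0 ab b2; rewrite /cumul; apply: pm_image_add; try exact: itv_co.
- apply/seteqP; split => t /=.
    by move=> /andP[t0 tb]; case: (ltP t a) => ta; [left|right]; rewrite ?t0 ?tb.
  move=> [|] /andP[h1 h2]; first by rewrite h1 (lt_le_trans h2).
  by rewrite h2 (le_trans a0).
- apply/seteqP; split => // t [/= /andP[_ h1] /andP[h2 _]].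
  by have := lt_le_trans h1 h2; rewrite ltxx.
- by move=> t /= /andP[t0 tb]; rewrite /per/= t0 (lt_le_trans tb).
Qed.

Lemma pm_co_split nu a b : 0 <= a -> a < b -> b <= 2 * pi ->
  nu (cis (R := R) @` [set t | a <= t < b]) =
  nu [set cis a] + nu (cis (R := R) @` [set t | a < t < b]).
Proof.
move=> a0 ab b2; rewrite -image_set1; apply: pm_image_add.
- exact: itv_1.
- exact: itv_oo.
- exact: itv_co.
- apply/seteqP; split => t /=.
    rewrite le_eqVlt => /andP[/orP[/eqP->|h1] h2]; [by left|by right; rewrite h1 h2].
  by move=> [->|/andP[/ltW -> ->]//]; rewrite lexx ab.
- by apply/seteqP; split => // t [/= ->]; rewrite ltxx.
- by move=> t /= /andP[h1 h2]; rewrite /per/= (le_trans a0 h1) (lt_le_trans h2 b2).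
Qed.

(** Otherwise arcs [u n, t[ with u n increasing to t would all have mass at least e in absolute
    value, although they decrease to the empty set. *)
Lemma cumul_left nu t e : 0 < t -> t <= 2 * pi -> 0 < e ->
  exists2 s, 0 <= s < t & forall s', s < s' < t -> `|cumul nu t - cumul nu s'| < e.
Proof.
move=> t0 t2 e0; apply: contrapT => H.
have [|u [u1 u2 u3 u4]] := @left_seq (fun s => 0 <= s /\ e <= `|cumul nu t - cumul nu s|) t.
  move=> s st; apply: contrapT => H'; apply: H; exists (Num.max s 0).
    by rewrite le_max lexx orbT gt_max st t0.
  move=> s' /andP[]; rewrite gt_max => /andP[ss s0] s't; rewrite ltNge; apply/negP => h.
  by apply: H'; exists s'; rewrite ?ss ?s't//; split => //; exact: ltW.
have h : (fun n => nu (cis (R := R) @` [set x | u n <= x < t])) @ \oo --> (0 : R).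
  apply: pm_image_cvg => [n|n x /= /andP[h ->]||x /= /andP[h h']].
  - exact: itv_co.
  - by rewrite (le_trans (u2 n) h).
  - apply/seteqP; split => // x H'.
    have /andP[_ xt] := H' 0%N Logic.I.
    have /cvgrPdist_lt/(_ (t - x)) := u3; rewrite subr_gt0 => /(_ xt)[n _ /(_ n (leqnn n))].
    have /andP[ux _] := H' n Logic.I.
    by rewrite ger0_norm ?subr_ge0 ?(ltW (u1 n))// ltrD2l ltrN2 ltNge ux.
  - by rewrite /per/= (le_trans (u4 0%N).1 h) (lt_le_trans h' t2).
have /cvgrPdist_lt/(_ _ e0)[n _ /(_ n (leqnn n))] := h.
have [un0 un] := u4 n.
move: un; rewrite (cumul_split nu un0 (ltW (u1 n)) t2) addrAC subrr add0r => un.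
by rewrite sub0r normrN ltNge un.
Qed.

(** The same argument with the arcs ]t, u n[; the point t is excluded because it may carry an
    atom. *)
Lemma pm_right nu t e : 0 <= t < 2 * pi -> 0 < e ->
  exists2 s, t < s <= 2 * pi & forall s', t < s' < s ->
    `|nu (cis (R := R) @` [set x | t < x < s'])| < e.
Proof.
move=> /andP[t0 t2] e0; apply: contrapT => H.
have [|u [u1 u2 u3 u4]] := @right_seq (fun s => s <= 2 * pi /\ e <= `|nu (cis (R := R) @` [set x | t < x < s])|) t.
  move=> s st; apply: contrapT => H'; apply: H; exists (Num.min s (2 * pi)).
    by rewrite ge_min lexx orbT lt_min st t2.
  move=> s' /andP[ts']; rewrite lt_min => /andP[ss s0]; rewrite ltNge; apply/negP => h.
  by apply: H'; exists s'; rewrite ?ss ?ts'//; split => //; exact: ltW.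
have h : (fun n => nu (cis (R := R) @` [set x | t < x < u n])) @ \oo --> (0 : R).
  apply: pm_image_cvg => [n|n x /= /andP[-> h]||x /= /andP[h h']].
  - exact: itv_oo.
  - by rewrite (lt_le_trans h (u2 n)).
  - apply/seteqP; split => // x H'.
    have /andP[tx _] := H' 0%N Logic.I.
    have /cvgrPdist_lt/(_ (x - t)) := u3; rewrite subr_gt0 => /(_ tx)[n _ /(_ n (leqnn n))].
    have /andP[_ ux] := H' n Logic.I.
    by rewrite distrC ger0_norm ?subr_ge0 ?(ltW (u1 n))// ltrD2r ltNge (ltW ux).
  - by rewrite /per/= (le_trans t0 (ltW h)) (lt_le_trans h' (u4 0%N).1).
have /cvgrPdist_lt/(_ _ e0)[n _ /(_ n (leqnn n))] := h.
by rewrite sub0r normrN ltNge (u4 n).2.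
Qed.

Lemma cumul0 nu : cumul nu 0 = 0.
Proof.
rewrite /cumul (_ : [set t | _] = set0) ?image_set0 ?pm_set0//.
by apply/seteqP; split => // t /= /andP[h1 /(le_lt_trans h1)]; rewrite ltxx.
Qed.

Lemma cumul_2pi nu : cumul nu (2 * pi) = 0.
Proof.
transitivity (nu (circle R)); last exact: pm_circle.
rewrite /cumul; congr (nu _); apply/seteqP; split.
  by move=> _ [t _ <-]; exact: circle_cis.
by move=> z /circleP[t t1 ->]; exists t.
Qed.

Lemma cumul_local_bound nu t : 0 <= t <= 2 * pi ->
  exists e M : R, 0 < e /\ forall s, 0 <= s <= 2 * pi -> `|t - s| < e -> `|cumul nu s| <= M.
Proof.
move=> /andP[t0 t2].
have [eL [ML [eL0 HL]]] : exists e M : R, 0 < e /\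
    forall s, 0 <= s <= 2 * pi -> s < t -> t - s < e -> `|cumul nu s| <= M.
  move: t0; rewrite le_eqVlt => /orP[/eqP t0|t0].
    by exists 1, 0; split => // s /andP[s0 _]; rewrite -t0 ltNge s0.
  have [s /andP[s0 st] H] := cumul_left nu t0 t2 ltr01.
  exists (t - s), (`|cumul nu t| + 1); rewrite subr_gt0; split => // s' _ s't.
  rewrite ltrD2l ltrN2 => ss'.
  have -> : cumul nu s' = cumul nu t - (cumul nu t - cumul nu s') by rewrite opprB addrC subrK.
  by rewrite (le_trans (ler_normB _ _))// lerD2l ltW// H// ss'.
have [eR [MR [eR0 HR]]] : exists e M : R, 0 < e /\
    forall s, 0 <= s <= 2 * pi -> t < s -> s - t < e -> `|cumul nu s| <= M.
  move: t2; rewrite le_eqVlt => /orP[/eqP t2|t2].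
    by exists 1, 0; split => // s /andP[_ s2]; rewrite t2 ltNge s2.
  have tin : 0 <= t < 2 * pi by rewrite t0 t2.
  have [s /andP[ts s2] H] := pm_right nu tin ltr01.
  exists (s - t), (`|cumul nu t| + `|nu [set cis t]| + 1); rewrite subr_gt0; split => // s' /andP[_ s'2] s't.
  rewrite ltrD2r => ss'.
  rewrite (cumul_split nu t0 (ltW s't) s'2) pm_co_split// addrA.
  rewrite (le_trans (ler_normD _ _))// lerD ?ler_normD//.
  by rewrite ltW// H// s't.
exists (Num.min eL eR), (`|cumul nu t| + `|ML| + `|MR|); rewrite lt_min eL0 eR0; split => // s s02.
rewrite lt_min => /andP[hL hR]; case: (ltgtP s t) => st.
- rewrite -addrA addrCA ler_wpDr ?addr_ge0// (le_trans _ (ler_norm _))// HL//.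
  by rewrite (le_lt_trans (ler_norm _)).
- rewrite ler_wpDl ?addr_ge0// (le_trans _ (ler_norm _))// HR//.
  by rewrite distrC in hR; rewrite (le_lt_trans (ler_norm _)).
- by rewrite st -addrA lerDl addr_ge0.
Qed.

(** The one-sided limits give a bound near each point, and compactness of [[0, 2 pi]] makes it
    global. *)
Lemma cumul_bounded nu : exists M, forall s, 0 <= s <= 2 * pi -> `|cumul nu s| <= M.
Proof.
have := @segment_compact R 0 (2 * pi) => /compact_near_coveringP.
move=> /(_ _ (pinfty_nbhs R) (fun M s => 0 <= s <= 2 * pi -> `|cumul nu s| <= M)) H.
have [|M [_ HM]] := H _.
  move=> t; rewrite /= in_itv/= => t02.
  have [e [M [e0 eM]]] := cumul_local_bound nu t02.
  exists (ball t e, [set x | M <= x]) => /=; first split.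
  - by apply: nbhsx_ballx.
  - by apply: nbhs_pinfty_ge; exact: num_real.
  - by move=> [s M'] [/= se MM'] s02; rewrite (le_trans _ MM')// eM.
exists (M + 1) => s s02; apply: (HM (M + 1)); rewrite ?ltrDl//.
Qed.

Lemma grid_approx n t : per t -> exists2 j, (j < n.+1)%N &
  forall k : nat, ((2 * pi / n.+1%:R) * k%:R <= t < (2 * pi / n.+1%:R) * k.+1%:R) = (k == j).
Proof.
move=> /andP[t0 t2]; have n0 : 0 < n.+1%:R :> R by [].
have tp := @twopi_gt0 R.
have [h [h0 hE]] : exists h, 0 < h /\ h = 2 * pi / n.+1%:R :> R by exists (2 * pi / n.+1%:R); rewrite divr_gt0.
rewrite -hE; have th : 0 <= t / h by rewrite divr_ge0// ltW.
have /andP[j1 j2] := truncn_itv th.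
rewrite ler_pdivlMr// in j1; rewrite ltr_pdivrMr// in j2.
exists (Num.Def.trunc (t / h)).
  rewrite -(@ltr_nat R) -(@ltr_pM2r _ h)// (le_lt_trans j1)//.
  by rewrite hE mulrC divfK// gt_eqF.
move: j1 j2; move: (Num.Def.trunc _) => j j1 j2 k.
apply/idP/eqP => [/andP[k1 k2]|->]; last by rewrite mulrC j1 mulrC j2.
apply/eqP; rewrite eqn_leq -ltnS -[X in _ && X]ltnS -!(@ltr_nat R).
rewrite -(ltr_pM2r h0) -[X in _ && X](ltr_pM2r h0) -!(mulrC h) in j1 j2 *.
by rewrite (le_lt_trans k1 j2) (le_lt_trans j1 k2).
Qed.

(** By left continuity the function is the pointwise limit of the step functions that take, on each
    cell of a grid, the value at the left end. *)
Lemma measurable_cumul nu : measurable_fun per (cumul nu).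
Proof.
have tp := @twopi_gt0 R.
pose h n : R := 2 * pi / n.+1%:R.
pose g n t := \sum_(j < n.+1) cumul nu (h n * j%:R) * \1_([set x | h n * j%:R <= x < h n * j.+1%:R]) t.
apply: (measurable_fun_cvg (h := g)).
  move=> n; apply: measurable_sum => j; apply: measurable_funM; first exact: measurable_cst.
  apply: measurable_indic; rewrite (_ : [set x | _] = `[h n * j%:R, h n * j.+1%:R[%classic).
    exact: measurable_itv.
  by apply/seteqP; split => x /=; rewrite in_itv.
move=> t pt; have /andP[t0 t2] := pt.
have gE n : exists2 d, [/\ 0 <= d, d <= t & t < d + h n] & g n t = cumul nu d.
  have [j jn jP] := grid_approx n pt.
  have /andP[h1 h2] : h n * j%:R <= t < h n * j.+1%:R by rewrite /h jP.
  exists (h n * j%:R).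
    split => //; first by rewrite mulr_ge0// divr_ge0// ltW.
    by move: h2; rewrite -natr1 mulrDr mulr1.
  rewrite /g (bigD1 (Ordinal jn))//= indicE mem_set ?mulr1; last by rewrite /= h1 h2.
  rewrite big1 ?addr0// => k kj; rewrite indicE memNset ?mulr0//=.
  rewrite /h jP; apply/negP; apply: contra kj => /eqP kE; exact/eqP/val_inj.
apply/cvgrPdist_lt => e e0.
move: t0; rewrite le_eqVlt => /orP[/eqP t0|t0].
  apply: nearW => n; have [d [d0 dt _] ->] := gE n.
  by have -> : d = t; [apply/eqP; rewrite eq_le dt -t0 d0|rewrite subrr normr0].
have [s /andP[s0 st] H] := cumul_left nu t0 (ltW t2) e0.
have hc : h @ \oo --> (0 : R).
  rewrite -[X in _ --> X](mulr0 (2 * pi)); apply: cvgMl_tmp; exact: cvg_harmonic.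
have /cvgrPdist_lt/(_ (t - s)) := hc; rewrite subr_gt0 => /(_ st); apply: filterS => n.
rewrite sub0r normrN ger0_norm; last by rewrite divr_ge0// ltW.
move=> hn; have [d [d0 dt td] ->] := gE n.
move: dt; rewrite le_eqVlt => /orP[/eqP ->|dt]; first by rewrite subrr normr0.
by apply: H; rewrite dt andbT; move: td hn; lra.
Qed.

Lemma rint_cumul nu : rint per (cumul nu).
Proof.
have [M HM] := cumul_bounded nu.
apply: (@rint_bnd _ _ _ M) => [|||t /andP[t0 t2]].
- exact: measurable_per.
- exact: leb_per_fin.
- exact: measurable_cumul.
- by apply: HM; rewrite t0 ltW.
Qed.

End Premeasures.


(** * Vanishing of power series and of functions with zero Fourier coefficients *)

Section Uniqueness.
Context {R : realType}.
Implicit Types (a b c d s t e r x y : R) (z w : Cx R) (A : set (Cx R)) (I K : set R).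
Implicit Types (nu : premeasure R) (f g : R -> R).

Local Notation Re := (@complex.Re R).
Local Notation Im := (@complex.Im R).

Lemma cexp_eq1 w : cabs w <= 1 -> cexp w = 1 -> w = 0.
Proof.
move=> w1 we; have rw : Re w = 0.
  have : cabs (cexp w) = 1 by rewrite we cabs1.
  by rewrite cabs_cexp -[X in _ = X]expR0 => /expR_inj.
have iw : Im w = 0.
  apply: sin_eq0_small.
    have := le_trans (norm_Im_le w) w1; rewrite ler_norml => /andP[h1 h2].
    have := @pi_ge2 R => p2; apply/andP; split; lra.
  have := congr1 Im we; rewrite Im_cexp/= rw expR0 mul1r; exact.
by apply: Cx_eq.
Qed.

(** If c k is the first nonzero coefficient, the vanishing of the sum forces |c k| r^k <= B r^(k+1)
    / (1 - r), which fails for small r. *)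
Lemma pseries_coef0 (c : nat -> Cx R) B r0 : 0 < r0 -> (forall k, cabs (c k) <= B) ->
  (forall r, 0 < r < r0 -> series (fun k => c k * (r%:C) ^+ k) @ \oo --> (0 : Cx R)) ->
  forall k, c k = 0.
Proof.
move=> r00 cB H; elim/ltn_ind => k IH.
have B0 : 0 <= B by apply: le_trans (cabs_ge0 _) (cB 0%N).
apply/eqP; rewrite -cabs_eq0; apply/negPn/negP => ck0.
have ckp : 0 < cabs (c k) by rewrite lt_def ck0 cabs_ge0.
(* Since r <= 1/2 the factor 1 / (1 - r) is at most 2, so 2 B r < |c k| is the contradiction aimed
   at. *)
have [r [r1 r2 r3 r4]] : exists r, [/\ 0 < r, r < r0, r <= 2^-1 & 2 * B * r < cabs (c k)].
  have [q [q0 qE]] : exists q, 0 < q /\ q = cabs (c k) / (2 * B + 1).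
    by exists (cabs (c k) / (2 * B + 1)); rewrite divr_gt0// ltr_wpDl// mulr_ge0.
  exists (Num.min (r0 / 2) (Num.min 2^-1 q)).
  rewrite !lt_min !gt_min !ge_min q0 divr_gt0// invr_gt0 ltr0n lexx orbT/=.
  rewrite (_ : r0 / 2 < r0) ?orbT; last by rewrite ltr_pdivrMr// ltr_pMr// ltr1n.
  split => //; apply: (@le_lt_trans _ _ (2 * B * q)).
    by apply: ler_wpM2l; [rewrite mulr_ge0|rewrite !ge_min lexx !orbT].
  have -> : cabs (c k) = q * (2 * B + 1) by rewrite qE divfK// gt_eqF// ltr_wpDl// mulr_ge0.
  by rewrite mulrC ltr_pM2l// ltrDl.
have r01 : 0 <= r < 1 by rewrite ltW//=; apply: le_lt_trans r3 _; rewrite invf_lt1// ltr1n.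
have Hr : series (fun j => c j * (r%:C) ^+ j) @ \oo --> (0 : Cx R) by apply: H; rewrite r1.
have bnd j : cabs (c j * (r%:C) ^+ j) <= B * r ^+ j.
  by rewrite cabsM cabsX cabs_real (gtr0_norm r1) ler_wpM2r// exprn_ge0// ltW.
have h : (fun m => series (fun j => c j * (r%:C) ^+ j) (k.+1 + m)%N) @ \oo --> (0 : Cx R).
  exact: cvgn_addn.
have h2 : (fun m => c k * (r%:C) ^+ k - series (fun j => c j * (r%:C) ^+ j) (k.+1 + m)%N) @ \oo --> c k * (r%:C) ^+ k - 0.
  by apply: cvgB; [exact: cvg_cst|exact: h].
rewrite subr0 in h2.
have key m : cabs (c k * (r%:C) ^+ k - series (fun j => c j * (r%:C) ^+ j) (k.+1 + m)%N) <= B * r ^+ k.+1 * (1 - r)^-1.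
  rewrite /series/= (big_cat_nat (n := k.+1))//= ?leq_addr// big_nat_recr//= big1_seq ?add0r; last first.
    by move=> j; rewrite mem_index_iota => /andP[_ /andP[_ jk]]; rewrite IH ?mul0r.
  rewrite opprD addrA subrr add0r cabsN -{1}[k.+1]add0n big_addn addKn.
  apply: le_trans (cabs_sum _ _ _) _.
  apply: (@le_trans _ _ (\sum_(0 <= i < m) B * r ^+ k.+1 * r ^+ i)).
    by apply: ler_sum => i _; apply: le_trans (bnd _) _; rewrite exprD -mulrA [r ^+ i * _]mulrC.
  rewrite -mulr_sumr; apply: ler_wpM2l; last exact: geo_le.
  by apply: mulr_ge0 => //; rewrite exprn_ge0// ltW.
have := cvg_cabs_le h2 key; rewrite cabsM cabsX cabs_real (gtr0_norm r1).
have rk0 : 0 < r ^+ k by rewrite exprn_gt0.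
rewrite exprS mulrA -(mulrA _ (r ^+ k)) (mulrC (r ^+ k)) mulrA ler_pM2r//.
apply/negP; rewrite -ltNge; apply: le_lt_trans r4.
have r5 : (1 - r)^-1 <= 2.
  by rewrite -[leRHS]invrK lef_pV2 ?posrE ?invr_gt0 ?subr_gt0//; [lra|case/andP: r01].
rewrite (_ : 2 * B * r = B * r * 2); last by ring.
by apply: ler_wpM2l => //; apply: mulr_ge0 => //; exact: ltW.
Qed.

(* Expanding a trigonometric polynomial reduces this to the case of a single frequency. *)
Lemma J_orth f : rint per f ->
  (forall k, (0 < k)%N -> J (fun t => f t * cos (k%:R * t)) = 0) ->
  (forall k, (0 < k)%N -> J (fun t => f t * sin (k%:R * t)) = 0) ->
  forall g, trigp g -> J (fun t => (f t - J f / (2 * pi)) * g t) = 0.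
Proof.
move=> fi fc fs.
have tp : 2 * pi != 0 :> R by rewrite gt_eqF// twopi_gt0.
have [m mE] : exists m, m = J f / (2 * pi) by eexists.
rewrite -mE.
have fmi g : trigp g -> rint per (fun t => (f t - m) * g t).
  move=> tg; have := rintB measurable_per (rint_mul_trigp fi tg) (trigp_rint (Trigp_scale m tg)).
  by under eq_fun do rewrite -mulrBl.
have E g : trigp g -> J (fun t => (f t - m) * g t) = J (fun t => f t * g t) - m * J g.
  move=> tg; rewrite -JZ; last exact: trigp_rint.
  rewrite -JB; [|exact: rint_mul_trigp|exact/trigp_rint/Trigp_scale].
  by apply: eq_J => t; rewrite mulrBl.
move=> g; elim=> [k|k|{}g h tg IHg th IHh|c {}g tg IH].
- rewrite E; last exact: Trigp_cos.
  rewrite J_cos; have [->|k0] := posnP k; last by rewrite mulr0 subr0 fc.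
  rewrite (_ : J (fun t => f t * cos (0%:R * t)) = J f); last first.
    by apply: eq_J => t; rewrite mul0r cos0 mulr1.
  by rewrite mE divfK// subrr.
- rewrite E; last exact: Trigp_sin.
  rewrite J_sin mulr0 subr0; have [->|k0] := posnP k; last by rewrite fs.
  transitivity (J (fun _ : R => 0 : R)); last by rewrite J_cst mulr0.
  by apply: eq_J => t; rewrite mul0r sin0 mulr0.
- rewrite -[RHS](addr0 0) -{1}IHg -IHh -JD; [|exact: fmi|exact: fmi].
  by apply: eq_J => t; rewrite mulrDr.
- rewrite -[RHS](mulr0 c) -IH -JZ; last exact: fmi.
  by apply: eq_J => t; rewrite mulrCA.
Qed.

Lemma le_in_J f g : rint per f -> rint per g -> (forall t, per t -> f t <= g t) -> J f <= J g.
Proof. by move=> fi gi fg; apply: le_Rintegral => //; exact: measurable_per. Qed.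

Lemma rint_indic a b : rint per (\1_`[a, b]).
Proof.
apply: (@rint_bnd _ _ _ 1); [exact: measurable_per|exact: leb_per_fin| |].
  by apply: measurable_indic; exact: measurable_itv.
by move=> t _; rewrite indicE; case: (_ \in _); rewrite ?normr1 ?normr0.
Qed.

Lemma J_indic a b : 0 <= a -> a <= b -> b < 2 * pi -> J (\1_`[a, b]) = b - a.
Proof.
move=> a0 ab b2; rewrite /J /Rintegral.
rewrite (@integral_indic _ _ _ (leb R) per measurable_per); last exact: measurable_itv.
rewrite (_ : _ `&` per = `[a, b]%classic).
  have := @lebesgue_measure_itv R `[a, b]; rewrite /= lte_fin => ->.
  by case: ltP => //= ba; apply/eqP; rewrite eq_sym subr_eq0 eq_le ba ab.
apply/seteqP; split => [t []//|t /=]; rewrite in_itv/= => /andP[h1 h2].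
split; first by rewrite h1 h2.
by rewrite /per/= (le_trans a0 h1) (le_lt_trans h2 b2).
Qed.

Lemma ler_cos x y : 0 <= x -> x <= y -> y <= pi -> cos y <= cos x.
Proof.
move=> x0; rewrite le_eqVlt => /orP[/eqP ->//|xy] yp.
by apply: ltW; rewrite ltr_cos// in_itv/= ?x0 ?yp ?(le_trans x0 (ltW xy))// (le_trans (ltW xy) yp).
Qed.

(* The trigonometric polynomials [(1 + cos (t - m) - cos delta) ^+ k] concentrate on the interval. *)
Lemma trigp_orth_pos f a b c M : rint per f -> (forall t, per t -> `|f t| <= M) ->
  (forall g, trigp g -> J (fun t => f t * g t) = 0) ->
  0 <= a -> a < b -> b <= 2 * pi -> 0 < c -> (forall t, a < t < b -> c <= f t) -> False.
Proof.
move=> fi fM fo a0 ab b2 c0 fc.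
(* The midpoint m and the half-length d of the interval. *)
have [m [d [mE dE]]] : exists m d, a = m - d /\ b = m + d.
  by exists ((a + b) / 2), ((b - a) / 2); split; lra.
have d0 : 0 < d by move: ab; rewrite mE dE; lra.
have dpi : d <= pi by move: a0 b2; rewrite mE dE; lra.
have [e [e0 eE]] : exists e, 0 < e /\ e = cos (d / 2) - cos d.
  exists (cos (d / 2) - cos d); rewrite subr_gt0; split => //.
  by rewrite ltr_cos ?in_itv/=; [lra|apply/andP; split; lra|apply/andP; split; lra].
pose K t := 1 + cos (t - m) - cos d : R.
have tK : trigp K.
  have h : trigp (fun t => cos (1%:R * (- m + t)) : R).
    by have := trigp_shift (- m) (Trigp_cos 1).
  apply: (trigp_eq (f := fun t => (1 - cos d) + cos (1%:R * (- m + t)))).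
    by move=> t; rewrite /K mul1r (addrC (- m)) addrAC.
  by apply: Trigp_add => //; exact: trigp_cst.
have Kout t : per t -> ~~ (a < t < b) -> `|K t| <= 1.
  move=> /andP[t0 t2] tab; have := @cos_geN1 R (t - m); have := @cos_le1 R d.
  suff : cos (t - m) <= cos d by rewrite /K ler_norml => *; apply/andP; split; lra.
  have [u [uE u1 u2]] : exists u, [/\ cos (t - m) = cos u, d <= u & u <= 2 * pi - d].
    exists `|t - m|; rewrite cos_norm; split => //.
      by move: tab; rewrite negb_and -!leNgt mE dE ler_normr => /orP[h|h]; apply/orP; [right|left]; lra.
    by rewrite ler_norml; move: a0 b2; rewrite mE dE => *; apply/andP; split; lra.
  rewrite uE; have [up|up] := leP u pi; first by apply: ler_cos => //; exact: ltW.
  have -> : cos u = cos (2 * pi - u).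
    by rewrite [2 * pi]mulr_natl cosB cos2pi sin2pi mul1r mul0r addr0.
  by apply: ler_cos; [exact: ltW| |]; lra.
have Kin t : a < t < b -> 1 <= K t.
  move=> /andP[h1 h2]; rewrite /K -addrA lerDl subr_ge0 -(cos_norm (t - m)).
  by apply: ler_cos => //; rewrite ler_norml; apply/andP; split; move: h1 h2; rewrite mE dE; lra.
have Kmid t : m - d / 2 <= t <= m + d / 2 -> 1 + e <= K t.
  move=> /andP[h1 h2]; rewrite /K eE -[leRHS]addrA lerD2l lerD2r -(cos_norm (t - m)).
  by apply: ler_cos => //; [rewrite ler_norml; apply/andP; split; lra|lra].
have M0 : 0 <= M by apply: le_trans (normr_ge0 _) (fM 0 _); rewrite /per/= lexx twopi_gt0.
have K1e k : 1 + e *+ k <= (1 + e) ^+ k.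
  elim: k => [|k IH]; first by rewrite mulr0n addr0.
  rewrite exprS; have e1 : 0 <= 1 + e by rewrite addr_ge0// ltW.
  apply: le_trans (ler_wpM2l e1 IH); rewrite mulrDl mul1r mulrDr mulr1 mulrS.
  have := mulrn_wge0 k (mulr_ge0 (ltW e0) (ltW e0)); rewrite -mulrnAr; lra.
have low k t : per t -> c * (1 + e) ^+ k * \1_`[m - d / 2, m + d / 2] t - M <= f t * K t ^+ k.
  move=> pt; have c1 : 0 <= c * (1 + e) ^+ k by rewrite mulr_ge0 ?exprn_ge0 ?addr_ge0// ltW.
  have [tab|tab] := boolP (a < t < b).
    have ft := fc t tab; have Kt := Kin t tab.
    have f0 : 0 <= f t * K t ^+ k.
      by rewrite mulr_ge0 ?exprn_ge0// ?(le_trans _ Kt)// (le_trans (ltW c0) ft).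
    rewrite lerBlDr ler_wpDr// indicE; case: (boolP (_ \in _)) => [tin|_]; last by rewrite mulr0.
    move: tin; rewrite mulr1 inE/= in_itv/= => /Kmid Ke; apply: ler_pM => //; first exact: ltW.
      by rewrite exprn_ge0// addr_ge0// ltW.
    by apply: lerXn2r => //; rewrite nnegrE ?(le_trans ler01 Kt)// addr_ge0// ltW.
  rewrite indicE memNset; last first.
    rewrite /= in_itv/= => /andP[h1 h2]; move/negP: tab; apply.
    by rewrite mE dE; apply/andP; split; lra.
  rewrite mulr0 add0r; suff : `|f t * K t ^+ k| <= M by rewrite ler_norml => /andP[].
  by rewrite normrM normrX -[leRHS]mulr1 ler_pM ?fM// exprn_ile1// Kout.
(* The left side grows linearly in k by Bernoulli's inequality, the right side is fixed. *)
have main k : (c * (1 + e *+ k)) * d <= 2 * pi * M.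
  have fK := fo _ (trigp_exp k tK).
  have i1 : rint per (fun t => c * (1 + e) ^+ k * \1_`[m - d / 2, m + d / 2] t).
    by apply: (rintZ _ measurable_per); exact: rint_indic.
  have i2 : rint per (fun _ : R => M) by exact/trigp_rint/trigp_cst.
  have := le_in_J (rintB measurable_per i1 i2) (rint_mul_trigp fi (trigp_exp k tK)) (low k).
  rewrite fK JB// J_cst subr_le0 JZ; last exact: rint_indic.
  rewrite J_indic; [|move: a0; rewrite mE; lra|lra|move: b2; rewrite dE; lra].
  apply: le_trans; rewrite (_ : m + d / 2 - (m - d / 2) = d); last by lra.
  by apply: ler_wpM2r; [exact: ltW|apply: ler_wpM2l; [exact: ltW|exact: K1e]].
have p0 : 0 < c * e * d by rewrite !mulr_gt0.
have /andP[_ ] := truncn_itv (divr_ge0 (mulr_ge0 (ltW (@twopi_gt0 R)) M0) (ltW p0)).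
rewrite ltr_pdivrMr//; move: (Num.Def.trunc _).+1 => k; apply/negP; rewrite -leNgt.
apply: le_trans (main k); rewrite -[e *+ k]mulr_natr.
have cd0 : 0 <= c * d by rewrite mulr_ge0// ltW.
have -> : k%:R * (c * e * d) = c * (e * k%:R) * d by ring.
by rewrite mulrDr mulr1 mulrDl lerDr.
Qed.

End Uniqueness.


(** * A premeasure is determined by its w-transform *)

Section Determination.
Context {R : realType}.
Implicit Types (a b c d s t e r x y : R) (z w : Cx R) (A : set (Cx R)) (I K : set R).
Implicit Types (nu : premeasure R) (f g : R -> R).

Let per_cumul_bound nu : exists M, forall t, per t -> `|cumul nu t| <= M.
Proof.
have [M HM] := cumul_bounded nu; exists M => t /andP[t0 t2].
by apply: HM; rewrite t0 ltW.
Qed.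

(** At a small radius r let D and D' be the sums of the two coefficient series. Equality of the
    transforms gives exp (D - D') = 1. For r below 1 / (2 (B + 1)) the modulus of D - D' is at most
    1, because the k = 0 term is 0; hence D = D' on an interval of radii, and [pseries_coef0]
    applies. *)
Lemma fcoef_eq nu nu' (a : nat -> Cx R) : has_power_series (wtransform nu) a ->
  has_power_series (wtransform nu') a -> forall k, fcoef nu k = fcoef nu' k.
Proof.
move=> ha ha' k; apply/eqP; rewrite -subr_eq0; apply/eqP; move: k.
have [M HM] := per_cumul_bound nu; have [M' HM'] := per_cumul_bound nu'.
have cB k := fcoef_le (rint_cumul nu) HM k; have cB' k := fcoef_le (rint_cumul nu') HM' k.
have [B [B0 BE]] : exists B, 0 <= B /\ forall k, cabs (fcoef nu k - fcoef nu' k) <= B.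
  exists (4 * pi * M + 4 * pi * M'); split.
    by apply: addr_ge0; [apply: le_trans (cabs_ge0 _) (cB 0%N)|apply: le_trans (cabs_ge0 _) (cB' 0%N)].
  by move=> k; rewrite (le_trans (cabsB _ _))// lerD.
have r00 : 0 < (2 * (B + 1))^-1 by rewrite invr_gt0 mulr_gt0// ltr_wpDl.
apply: (pseries_coef0 r00 BE) => r /andP[r0 r1].
have B1 : 0 < 2 * (B + 1) by rewrite mulr_gt0// ltr_wpDl.
have rB : r * (2 * (B + 1)) < 1 by rewrite -ltr_pdivlMr// div1r.
have Br : 0 <= r * B by rewrite mulr_ge0// ltW.
have r2 : r < 2^-1 by lra.
have zD : disc R r%:C.
  by rewrite /disc/= cabs_real gtr0_norm//; lra.
have [D hD DE] := wtransformE (rint_cumul nu) HM zD.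
have [D' hD' DE'] := wtransformE (rint_cumul nu') HM' zD.
have hs : series (fun k => (fcoef nu k - fcoef nu' k) * r%:C ^+ k) @ \oo --> D - D'.
  have -> : series (fun k => (fcoef nu k - fcoef nu' k) * r%:C ^+ k) =
    (fun n => series (fun k => fcoef nu k * r%:C ^+ k) n - series (fun k => fcoef nu' k * r%:C ^+ k) n).
    by apply/funext => n; rewrite /series/= -sumrB; apply: eq_bigr => k _; rewrite mulrBl.
  by apply: cvgB; [exact: hD|exact: hD'].
suff <- : D - D' = 0 by [].
have EE : cexp (D - D') = 1.
  have : wtransform nu r%:C = wtransform nu' r%:C.
    by rewrite -(limC (ha _ zD)) -(limC (ha' _ zD)).
  by rewrite DE DE' => e; rewrite cexpD -e cexpN.
apply: cexp_eq1 => //.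
have r01 : 0 <= r < 1 by rewrite ltW//=; lra.
apply: (cvg_cabs_le hs) => n; rewrite /series/=.
apply: le_trans (cabs_sum _ _ _) _.
apply: (@le_trans _ _ (\sum_(0 <= k < n) B * r * r ^+ k)).
  case: n => [|n]; first by rewrite !big_geq.
  rewrite big_nat_recl// expr0 mulr1 subrr cabs0 add0r.
  rewrite big_nat_recr//= ler_wpDr ?mulr_ge0 ?exprn_ge0// ?(ltW r0)//.
  apply: ler_sum => k _; rewrite cabsM cabsX cabs_real gtr0_norm// -mulrA -exprS.
  by rewrite ler_wpM2r// exprn_ge0// ltW.
rewrite -mulr_sumr; apply: (@le_trans _ _ (B * r * (1 - r)^-1)).
  by apply: ler_wpM2l; [rewrite mulrC|exact: geo_le].
by rewrite ler_pdivrMr; lra.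
Qed.

(** The function f minus its mean is orthogonal to all trigonometric polynomials. If f t exceeded
    the mean, left continuity would keep f above it by a fixed amount on an interval to the left of
    t, against [trigp_orth_pos]. *)
Let cumul_le_mean nu nu' : (forall k, fcoef nu k = fcoef nu' k) ->
  let f := fun t => cumul nu t - cumul nu' t in
  forall t, 0 < t < 2 * pi -> f t <= J f / (2 * pi).
Proof.
move=> fE f t /andP[t0 t2]; have tp := @twopi_gt0 R.
have fi : rint per f by exact: (rintB measurable_per (rint_cumul nu) (rint_cumul nu')).
have fm g : trigp g -> J (fun t => f t * g t) = J (fun t => cumul nu t * g t) - J (fun t => cumul nu' t * g t).
  move=> tg; rewrite -JB; [|exact: rint_mul_trigp (rint_cumul nu) tg|exact: rint_mul_trigp (rint_cumul nu') tg].
  by apply: eq_J => x; rewrite /f mulrBl.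
have fc k : (0 < k)%N -> J (fun t => f t * cos (k%:R * t)) = 0.
  move=> k0; rewrite fm; last exact: Trigp_cos.
  have := fE k; rewrite /fcoef eqn0Ngt k0/= => /(congr1 (@complex.Im R))/= ->.
  by rewrite subrr.
have fs k : (0 < k)%N -> J (fun t => f t * sin (k%:R * t)) = 0.
  move=> k0; rewrite fm; last exact: Trigp_sin.
  have := fE k; rewrite /fcoef eqn0Ngt k0/= => /(congr1 (@complex.Re R))/= ->.
  by rewrite subrr.
have orth := J_orth fi fc fs.
rewrite leNgt; apply/negP => ft.
move: orth ft; move: (J f / (2 * pi)) => m orth ft.
have e0 : 0 < (f t - m) / 4 by rewrite divr_gt0// subr_gt0.
have [s /andP[s0 st] H] := cumul_left nu t0 (ltW t2) e0.
have [s' /andP[s'0 s't] H'] := cumul_left nu' t0 (ltW t2) e0.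
have [M HM] := per_cumul_bound nu; have [M' HM'] := per_cumul_bound nu'.
have gi : rint per (fun t => f t - m).
  by apply: (rintB measurable_per fi); exact/trigp_rint/trigp_cst.
apply: (@trigp_orth_pos R (fun t => f t - m) (Num.max s s') t ((f t - m) / 2) (M + M' + `|m|)) => //.
- move=> x px; rewrite (le_trans (ler_normB _ _))// lerD2r /f (le_trans (ler_normB _ _))// lerD//.
    exact: HM.
  exact: HM'.
- by rewrite le_max s0.
- by rewrite gt_max st s't.
- exact: ltW.
- by rewrite divr_gt0// subr_gt0.
- move=> x /andP[]; rewrite gt_max => /andP[sx s'x] xt.
  have := H x; have := H' x; rewrite sx s'x xt => /(_ isT) h' /(_ isT) h.
  move: h' h; rewrite !ltr_norml /f => /andP[h1 h2] /andP[h3 h4]; lra.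
Qed.

(** Exchanging the two premeasures shows that the difference equals its mean on ]0, 2 pi[; the mean
    is 0 by left continuity at 2 pi, where both functions vanish. *)
Lemma cumul_eq nu nu' : (forall k, fcoef nu k = fcoef nu' k) ->
  forall t, 0 <= t <= 2 * pi -> cumul nu t = cumul nu' t.
Proof.
move=> fE t /andP[t0 t2]; have tp := @twopi_gt0 R.
pose f t := cumul nu t - cumul nu' t; pose m := J f / (2 * pi).
have fi : rint per f by exact: (rintB measurable_per (rint_cumul nu) (rint_cumul nu')).
have fm x : 0 < x < 2 * pi -> f x = m.
  move=> xp; apply/eqP; rewrite eq_le (cumul_le_mean fE xp)/=.
  have := cumul_le_mean (fun k => esym (fE k)) xp.
  have -> : J (fun t => cumul nu' t - cumul nu t) = - J f.
    rewrite -mulN1r -JZ//; apply: eq_J => y; rewrite /f; ring.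
  by rewrite mulNr -/m lerNr opprB.
have m0 : m = 0.
  apply/eqP; rewrite -normr_le0; apply/ler_addgt0Pr => e e0; rewrite add0r.
  have e2 : 0 < e / 2 by rewrite divr_gt0.
  have [s /andP[s0 st] H] := cumul_left nu tp (lexx _) e2.
  have [s' /andP[s'0 s't] H'] := cumul_left nu' tp (lexx _) e2.
  have [x [x1 x2 x3]] : exists x, [/\ s < x, s' < x & x < 2 * pi].
    exists ((Num.max s s' + 2 * pi) / 2).
    by split; [have : s <= Num.max s s' by rewrite le_max lexx|
      have : s' <= Num.max s s' by rewrite le_max lexx orbT|
      have : Num.max s s' < 2 * pi by rewrite gt_max st]; lra.
  rewrite -(fm x) ?x3 ?(le_lt_trans s0 x1)// /f.
  have := H x; have := H' x; rewrite !cumul_2pi !sub0r !normrN x1 x2 x3 => /(_ isT) h' /(_ isT) h.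
  by rewrite (le_trans (ler_normB _ _))//; lra.
have ft : f t = 0.
  move: t0; rewrite le_eqVlt => /orP[/eqP <-|t0]; first by rewrite /f !cumul0 subrr.
  move: t2; rewrite le_eqVlt => /orP[/eqP ->|t2]; first by rewrite /f !cumul_2pi subrr.
  by rewrite fm ?m0// t0.
by apply/eqP; rewrite -subr_eq0; apply/eqP.
Qed.

Section FromCumul.
Variables nu nu' : premeasure R.
Hypothesis cE : forall t, 0 <= t <= 2 * pi -> cumul nu t = cumul nu' t.

Let co_eq a b : 0 <= a -> a <= b -> b <= 2 * pi ->
  nu (cis (R := R) @` [set t | a <= t < b]) = nu' (cis (R := R) @` [set t | a <= t < b]).
Proof.
move=> a0 ab b2; apply: (addrI (cumul nu a)).
rewrite -(cumul_split nu a0 ab b2) !cE ?a0 ?(le_trans ab b2) ?(le_trans a0 ab)//.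
exact: cumul_split.
Qed.

(** The arcs [a, x[ have equal masses, and the masses of ]a, x[ tend to 0 as x decreases to a; the
    difference of the atoms is therefore arbitrarily small. *)
Lemma pm_point_eq a : 0 <= a < 2 * pi -> nu [set cis a] = nu' [set cis a].
Proof.
move=> aper; have /andP[a0 a2] := aper.
apply/eqP; rewrite -subr_eq0 -normr_le0; apply/ler_addgt0Pr => e e0; rewrite add0r.
have e2 : 0 < e / 2 by rewrite divr_gt0.
have [s /andP[s0 st] H] := pm_right nu aper e2.
have [s' /andP[s'0 s't] H'] := pm_right nu' aper e2.
have [x [x1 x2 x3]] : exists x, [/\ a < x, x < s & x < s'].
  exists ((a + Num.min s s') / 2).
  by split; [have : a < Num.min s s' by rewrite lt_min s0|
     have : a < Num.min s s' by rewrite lt_min s0|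
     have : a < Num.min s s' by rewrite lt_min s0];
   have : Num.min s s' <= s by [rewrite ge_min lexx|rewrite ge_min lexx|rewrite ge_min lexx];
   have : Num.min s s' <= s' by [rewrite ge_min lexx orbT|rewrite ge_min lexx orbT|rewrite ge_min lexx orbT]; lra.
have x4 : x <= 2 * pi by rewrite ltW// (lt_le_trans x2).
have := co_eq a0 (ltW x1) x4; rewrite !(pm_co_split _ a0 x1 x4) => E.
have := H x; have := H' x; rewrite x1 x2 x3 => /(_ isT) h' /(_ isT) h.
move: h h' E; move: (nu [set _]) (nu' [set _]) (nu _) (nu' _) => p p' q q'.
rewrite !ltr_norml ler_norml => /andP[h1 h2] /andP[h3 h4] E; apply/andP; split; lra.
Qed.

(** A set of this kind is [0, sup K[, possibly with its supremum added, so half-open arcs and points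
    suffice. *)
Let lower_eq K : K `<=` per -> (forall x y, K y -> 0 <= x -> x <= y -> K x) ->
  nu (cis (R := R) @` K) = nu' (cis (R := R) @` K).
Proof.
move=> Kper Kd.
have [K0|nK0] := pselect (K !=set0); last first.
  have -> : K = set0 by apply/seteqP; split => // x Kx; case: nK0; exists x.
  by rewrite image_set0 !pm_set0.
have Kub : has_ubound K by exists (2 * pi) => x /Kper/andP[_ /ltW].
have hs : has_sup K by [].
have [x0 Kx0] := K0.
have s0 : 0 <= sup K by have /andP[h _] := Kper _ Kx0; rewrite (le_trans h)// ub_le_sup.
have s2 : sup K <= 2 * pi by apply: ge_sup => // x /Kper/andP[_ /ltW].
have below x : 0 <= x -> x < sup K -> K x.
  move=> x0' xs; have [y Ky xy] := sup_gt K0 xs.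
  exact: Kd Ky x0' (ltW xy).
have KE1 : [set t | 0 <= t < sup K] `<=` K by move=> x /= /andP[h1 h2]; exact: below.
have [Ks|nKs] := pselect (K (sup K)); last first.
  have -> : K = [set t | 0 <= t < sup K].
    apply/seteqP; split => // x Kx /=; have /andP[-> _] := Kper _ Kx.
    rewrite lt_neqAle ub_le_sup// andbT; apply/eqP => xE; apply: nKs; rewrite -xE; exact: Kx.
  exact: co_eq.
have /andP[_ s2'] := Kper _ Ks.
have i1 : is_interval [set t : R | 0 <= t < sup K].
  move=> x y /= /andP[ax _] /andP[_ yb] u /andP[xu uy].
  by rewrite (le_trans ax xu) (le_lt_trans uy yb).
have i2 : is_interval [set sup K].
  by move=> x y /= -> -> u /andP[h1 h2]; apply/eqP; rewrite eq_le h1 h2.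
have iK : is_interval K.
  move=> x y Kx Ky u /andP[xu uy]; apply: Kd Ky _ uy.
  by have /andP[h _] := Kper _ Kx; exact: le_trans xu.
have KU : K = [set t : R | 0 <= t < sup K] `|` [set sup K].
  apply/seteqP; split => [x Kx|x [/KE1//|->//]].
  have /andP[x0' _] := Kper _ Kx; have : x <= sup K by rewrite ub_le_sup.
  by rewrite le_eqVlt => /orP[/eqP ->|xs]; [right|left; rewrite /= x0' xs].
have Kd0 : [set t : R | 0 <= t < sup K] `&` [set sup K] = set0.
  by apply/seteqP; split => // x [/= /andP[_ h] xE]; rewrite xE ltxx in h.
rewrite !(pm_image_add _ i1 i2 iK KU Kd0 Kper) image_set1 pm_point_eq ?s0//.
by rewrite co_eq.
Qed.

(** The set [L] of points strictly below K and its union with K are both covered by [lower_eq]; K is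
    their difference. *)
Let itv_eq K : K `<=` per -> is_interval K -> nu (cis (R := R) @` K) = nu' (cis (R := R) @` K).
Proof.
move=> Kper iK.
pose L := [set x : R | 0 <= x /\ ~ K x /\ exists2 y, K y & x <= y].
pose L' := L `|` K.
have Lper : L `<=` per.
  by move=> x [x0 [_ [y /Kper/andP[_ y2] xy]]]; rewrite /per/= x0 (le_lt_trans xy).
have Ld x y : L y -> 0 <= x -> x <= y -> L x.
  move=> [y0 [nKy [v Kv yv]]] x0 xy; split => //; split.
    by move=> Kx; apply: nKy; apply: (iK x v) => //; rewrite xy yv.
  by exists v => //; exact: le_trans yv.
have L'per : L' `<=` per by move=> x [/Lper|/Kper].
have L'd x y : L' y -> 0 <= x -> x <= y -> L' x.
  move=> [Ly|Ky] x0 xy; first by left; exact: Ld Ly x0 xy.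
  have [Kx|nKx] := pselect (K x); first by right.
  by left; split => //; split => //; exists y.
have down_itv (M : set R) : M `<=` per -> (forall x y, M y -> 0 <= x -> x <= y -> M x) -> is_interval M.
  move=> Mper Md x y Mx My u /andP[xu uy]; apply: Md My _ uy.
  by have /andP[h _] := Mper _ Mx; exact: le_trans xu.
have d0 : L `&` K = set0 by apply/seteqP; split => // x [[_ [nK _]] Kx].
have add n := pm_image_add n (down_itv _ Lper Ld) iK (down_itv _ L'per L'd) (erefl L') d0 L'per.
apply: (addrI (nu (cis (R := R) @` L))); rewrite -add (lower_eq Lper Ld) -add.
exact: lower_eq.
Qed.

Lemma pm_arc_eq A : is_arc A -> nu A = nu' A.
Proof.
move=> aA; have [a [b [[ab ba r1 r2] /andP[a0 a2]]]] := arc_rep_exists aA.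
pose T := [set t : R | 0 <= t < 2 * pi /\ A (cis t)].
have AT : A = cis (R := R) @` T.
  apply/seteqP; split => [z Az|_ [t [_ At] <-]//].
  by have [t t1 zE] := circleP (aA.1 _ Az); exists t => //; split => //; rewrite -zE.
have Tper : T `<=` per by move=> t [].
have tp := @twopi_gt0 R.
have [b2|b2] := ltP b (2 * pi).
  rewrite AT; apply: itv_eq => //.
  have Tab t : T t -> a <= t <= b.
    move=> [/andP[t0 t2] At]; apply/andP; split; rewrite leNgt; apply/negP => h.
      by apply: (r2 (t + 2 * pi)); [apply/andP; split; lra|rewrite cisD2pi].
    by apply: (r2 t) => //; apply/andP; split; lra.
  move=> x y Tx Ty u /andP[xu uy].
  have [->//|ux] := eqVneq u x; have [->//|uy'] := eqVneq u y.
  have [/andP[x0 x2] _] := Tx; have [/andP[y0 y2] _] := Ty.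
  have /andP[x3 x4] := Tab _ Tx; have /andP[y3 y4] := Tab _ Ty.
  have xu' : x < u by rewrite lt_def ux.
  have uy2 : u < y by rewrite lt_def eq_sym uy'.
  split; first by apply/andP; split; lra.
  by apply: r1; apply/andP; split; lra.
(* When the arc passes through the angle 0 its angles in [0, 2 pi[ form two intervals, separated at
   a. *)
pose T1 := T `&` [set t | t < a]; pose T2 := T `&` [set t | a <= t].
have T1b t : T1 t -> t <= b - 2 * pi.
  move=> [[/andP[t0 t2] At] /= ta]; rewrite leNgt; apply/negP => h.
  by apply: (r2 (t + 2 * pi)); [apply/andP; split; lra|rewrite cisD2pi].
have i1 : is_interval T1.
  move=> x y Tx Ty u /andP[xu uy].
  have [->//|ux] := eqVneq u x; have [->//|uy'] := eqVneq u y.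
  have [[/andP[x0 x2] _] /= x3] := Tx; have [[/andP[y0 y2] _] /= y3] := Ty.
  have y4 := T1b _ Ty.
  have xu' : x < u by rewrite lt_def ux.
  have uy2 : u < y by rewrite lt_def eq_sym uy'.
  split; last by rewrite /=; lra.
  split; first by apply/andP; split; lra.
  by rewrite -cisD2pi; apply: r1; apply/andP; split; lra.
have i2 : is_interval T2.
  move=> x y Tx Ty u /andP[xu uy].
  have [->//|ux] := eqVneq u x.
  have [[/andP[x0 x2] _] /= x3] := Tx; have [[/andP[y0 y2] _] /= y3] := Ty.
  have xu' : x < u by rewrite lt_def ux.
  split; last by rewrite /=; lra.
  split; first by apply/andP; split; lra.
  by apply: r1; apply/andP; split; lra.
have TU : T = T1 `|` T2.
  rewrite /T1 /T2 -setIUr (_ : _ `|` _ = setT) ?setIT//.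
  by apply/seteqP; split => // t _; case: (ltP t a) => h; [left|right].
have dis : (cis (R := R) @` T1) `&` (cis (R := R) @` T2) = set0.
  apply/seteqP; split => // z [[x [[/andP[x0 x2] _] /= xa] <-] [y [[/andP[y0 y2] _] /= ya] /cis_inj yx]].
  by have : y = x; [apply: yx; rewrite ltr_norml; apply/andP; split; lra|lra].
have AU : A = (cis (R := R) @` T1) `|` (cis (R := R) @` T2) by rewrite AT TU image_setU.
rewrite AU !pm_additive -?AU//; try exact: is_arc_cis.
by congr (_ + _); apply: itv_eq => // t [/Tper].
Qed.

End FromCumul.

Lemma premeasure_eq nu nu' : (forall A, is_arc A -> nu A = nu' A) -> nu = nu'.
Proof.
move=> H; have : pm_val nu = pm_val nu'.
  apply/funext => A; have [/H//|nA] := pselect (is_arc A).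
  by rewrite !pm_off_arcs.
case: nu H => v ? ? ? ? ? _; case: nu' => v' ? ? ? ? ? /= E.
by subst v'; congr Premeasure; exact: Prop_irrelevance.
Qed.

Theorem power_series_inj nu nu' (a : nat -> Cx R) : has_power_series (wtransform nu) a ->
  has_power_series (wtransform nu') a -> nu = nu'.
Proof.
by move=> h h'; apply: premeasure_eq; apply: pm_arc_eq; apply: cumul_eq; exact: fcoef_eq h h'.
Qed.

End Determination.


(** * Infinite variation: the premeasure is not a signed measure *)

Section ChargeVariation.
Context {R : realType}.
Implicit Types (a b c d s t e r x y : R) (z w : Cx R).
Local Open Scope ereal_scope.

(** V is the total variation of nu, obtained from a Hahn decomposition. *)
Lemma charge_sum_bounded (disp : measure_display) (T : measurableType disp) (nu : {charge set T -> \bar R}) :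
  exists V : R, forall k (I : 'I_k -> set T), (forall i, measurable (I i)) ->
    trivIset setT I -> \sum_(i < k) `|nu (I i)| <= V%:E.
Proof.
have [P [Q PQ]] := Hahn_decomposition nu.
pose m : {measure set T -> \bar R} := charge_variation PQ.
have mfin : m setT \is a fin_num by rewrite /m/= /charge_variation fin_numD !fin_num_measure.
exists (fine (m setT)) => k I mI tI.
rewrite fineK//.
apply: (@le_trans _ _ (\sum_(i < k) m (I i))).
  by apply: lee_sum => i _; exact: abse_charge_variation.
rewrite -(@measure_bigsetU_ord _ _ _ m k xpredT I)//.
by apply: le_measure; rewrite ?inE//; exact: bigsetU_measurable.
Qed.

End ChargeVariation.

Section NotMeasure.
Context {R : realType}.
Variable N : nat.
Hypothesis N1 : (1 < N)%N.
Implicit Types (a b c d s t e r x y : R) (z w : Cx R).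

Local Notation mu := (@wpm R N N1).
Local Notation wei := (@wei R N).
Local Notation weil := (@weil R N).

Lemma measurable_co a b : a <= b -> b < a + 2 * pi ->
  measurable (cis (R := R) @` [set t | a <= t < b] : set (borelC R)).
Proof.
move=> ab ba; have mclosed (A : set (Cx R)) : closed A -> measurable (A : set (borelC R)).
  move=> cA; rewrite -[A]setCK; apply: measurableC; apply: sub_sigma_algebra.
  exact: closed_openC.
have ccis : closed (cis (R := R) @` [set` `[a, b]]).
  apply: compact_closed; first exact: norm_hausdorff.
  apply: continuous_compact; last exact: segment_compact.
  by apply: continuous_subspaceT; exact: continuous_cis.
have c1 : closed [set cis b : Cx R].
  by apply: compact_closed; [exact: norm_hausdorff|exact: compact_set1].
rewrite (_ : _ @` _ = (cis (R := R) @` [set` `[a, b]]) `\` [set cis b]).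
  by apply: measurableD; exact: mclosed.
apply/seteqP; split => [_ [t /= /andP[at_ tb] <-]|z [[t /=]]].
  split; first by exists t => //=; rewrite in_itv/= at_ ltW.
  move=> /= /cis_inj tE; suff : t = b by move=> tb'; rewrite tb' ltxx in tb.
  by apply: tE; rewrite ltr_norml; apply/andP; split; lra.
rewrite in_itv/= => /andP[h1 h2] <- tb; exists t => //=.
by rewrite h1 lt_neqAle h2 andbT; apply/eqP => tE; apply: tb; rewrite tE.
Qed.

Let step n : R := 2 * pi / (N ^ n)%:R.

Let NX k : 0 < (N ^ k)%:R :> R.
Proof. by rewrite ltr0n expn_gt0 (ltnW N1). Qed.

Let step_gt0 n : 0 < step n.
Proof. by rewrite divr_gt0// twopi_gt0. Qed.

(* The terms of index at least [n] have period [2 pi / N ^ n]. *)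
Lemma weil_step n x : weil (x + step n) - weil x = wei n (x + step n) - wei n x.
Proof.
suff H m : (n <= m)%N -> wei m (x + step n) - wei m x = wei n (x + step n) - wei n x.
  have c : (fun m => wei m (x + step n) - wei m x) @ \oo --> weil (x + step n) - weil x.
    by apply: cvgB; exact: wei_cvg.
  apply: (cvg_unique _ c) => //; apply/cvgrPdist_lt => e e0; exists n => // m /= nm.
  by rewrite H// subrr normr0.
move=> nm; suff : wei m (x + step n) - wei n (x + step n) = wei m x - wei n x by lra.
rewrite !weiB//; congr (- (_ * _)); apply: eq_big_nat => k /andP[nk _].
congr (_ * _); rewrite mulrDr -(sinDn (N ^ (k - n)) ((N ^ k)%:R * x)); congr (sin (_ + _)).
rewrite /step -[in (N ^ k)%:R](subnK nk) expnD natrM; field; exact: lt0r_neq0.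
Qed.

Let osc n t := `|wei n (t + step n) - wei n t|.

Let cont_osc n : continuous (osc n).
Proof.
have tw : trigp (fun t => wei n (step n + t) - wei n t).
  by apply: trigp_sub; [exact/trigp_shift/trigp_wei|exact: trigp_wei].
move=> t; rewrite /osc.
have -> : (fun t => `|wei n (t + step n) - wei n t|) = (fun t => `|wei n (step n + t) - wei n t|).
  by apply/funext => u; rewrite (addrC u).
exact: (continuous_comp (trigp_cont tw (x := t)) (@norm_continuous _ _ _)).
Qed.

(** For each t the N^n consecutive arcs of angular length [step n] from t on are disjoint, so the
    absolute values of their masses sum to at most V. Integrating over t gives the same integral for
    each arc, by translation invariance. *)
Lemma signed_measure_osc : is_signed_measure mu ->
  exists V, forall n, (0 < n)%N -> (N ^ n)%:R * J (osc n) <= 2 * pi * V.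
Proof.
move=> [nu nuE]; have [V HV] := charge_sum_bounded nu.
exists V => n n0.
have tp := @twopi_gt0 R.
have st : (N ^ n)%:R * step n = 2 * pi by rewrite /step mulrC divfK// gt_eqF.
have Nn1 : 1 < (N ^ n)%:R :> R by rewrite ltr1n -(expn0 N) ltn_exp2l.
have s1 : step n < 2 * pi by rewrite /step ltr_pdivrMr// ltr_pMr.
have main t : per t -> \sum_(0 <= j < N ^ n) osc n (step n * j%:R + t) <= V.
  move=> /andP[t0 t2]; rewrite big_mkord.
  pose I (j : 'I_(N ^ n)) : set (borelC R) :=
    cis (R := R) @` [set x | step n * j%:R + t <= x < step n * j%:R + t + step n].
  have jb (j : 'I_(N ^ n)) : 0 <= step n * j%:R /\ step n * j%:R + step n <= 2 * pi.
    split; first by rewrite mulr_ge0// ltW.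
    rewrite -st mulrC -[X in _ + X]mul1r -mulrDl; apply: ler_wpM2r; first exact: ltW.
    by rewrite natr1 ler_nat.
  have mI j : measurable (I j).
    by apply: measurable_co; [rewrite lerDl ltW|rewrite ltrD2l].
  have tI : trivIset setT I.
    move=> i j _ _ [z [[x /= /andP[x1 x2] <-] [y /= /andP[y1 y2] /cis_inj yx]]].
    have [i1 i2] := jb i; have [j1 j2] := jb j.
    have yE : y = x by apply: yx; rewrite ltr_norml; apply/andP; split; lra.
    move: yE y1 y2 => -> y1 y2.
    have a1 : step n * i%:R < step n * j.+1%:R by rewrite -[j.+1%:R]natr1 mulrDr mulr1; lra.
    have a2 : step n * j%:R < step n * i.+1%:R by rewrite -[i.+1%:R]natr1 mulrDr mulr1; lra.
    rewrite !ltr_pM2l// !ltr_nat !ltnS in a1 a2.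
    by apply/val_inj/eqP; rewrite eqn_leq a1.
  rewrite -lee_fin; apply: le_trans (HV _ I mI tI).
  rewrite -sumEFin; apply: lee_sum => j _.
  have [j1 j2] := jb j; have sn0 := step_gt0 n.
  rewrite /I nuE; last exact: is_arc_co.
  rewrite wpm_co; [|by rewrite lerDl ltW|by rewrite lerD2l ltW|by apply/andP; split; lra].
  by rewrite /osc weil_step.
have ti j : rint per (fun t => osc n (step n * j%:R + t)).
  apply: rint_per_cont => t; apply: (@continuous_comp _ _ _ (fun t => step n * j%:R + t) (osc n)); last exact: cont_osc.
  by apply: (@continuousD _ _ _ (fun=> step n * j%:R) id) => //; exact: cst_continuous.
have := le_in_J (rint_sum (index_iota 0 (N ^ n)) measurable_per ti) (trigp_rint (trigp_cst V)) main.
rewrite J_cst; apply: le_trans; rewrite /J Rintegral_sum//; last exact: measurable_per.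
rewrite (eq_bigr (fun=> J (osc n))); last first.
  move=> j _; apply: J_shift; first exact: cont_osc.
  by move=> x; rewrite /osc addrAC !(trigp_per _ (trigp_wei N n)).
by rewrite sumr_const_nat subn0 mulr_natl.
Qed.

(** With a symmetric increment, sin (u + v) - sin (u - v) = 2 cos u sin v turns the difference into
    a lacunary cosine sum, to which [J_norm_lac] applies. *)
Let half_osc n t : wei n (t + step n / 2) - wei n (t - step n / 2) =
  lac N (mkseq (fun k => - (2 * pi^-1 * N%:R ^- k * sin ((N ^ k)%:R * (step n / 2)))) n) t.
Proof.
rewrite lacE /wei opprK addrC -mulrBr -sumrB mulr_sumr; apply: eq_bigr => k _.
by rewrite -mulrBr (mulrBr (N ^ k)%:R) (mulrDr (N ^ k)%:R) sinB sinD; ring.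
Qed.

Let J_half_osc n : J (osc n) = J (fun t => `|lac N (mkseq (fun k => - (2 * pi^-1 * N%:R ^- k * sin ((N ^ k)%:R * (step n / 2)))) n) t|).
Proof.
rewrite -(J_shift (- (step n / 2)) (cont_osc (n := n))); last first.
  by move=> x; rewrite /osc addrAC !(trigp_per _ (trigp_wei N n)).
apply: eq_J => t; rewrite /osc -half_osc; congr (`|wei n _ - wei n _|).
  by rewrite addrAC addrC; congr (_ + _); lra.
by rewrite addrC.
Qed.

Lemma sin_ge_cos1 x : 0 <= x <= 1 -> cos 1 * x <= sin x.
Proof.
move=> /andP[x0 x1].
have [c cI sc] := MVT_segment x0 (fun s _ => is_derive_sin s)
  (continuous_subspaceT (@continuous_sin R)).
move: sc; rewrite sin0 !subr0 => ->; apply: ler_wpM2r => //.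
move: cI; rewrite in_itv/= => /andP[c0 cx].
apply: ler_cos => //; first exact: le_trans x1.
by apply: le_trans (@pi_ge2 R); rewrite ler1n.
Qed.

(** For k < n the k-th coefficient of the increment over [step n.+1] is at least 2 cos 1 / N^(n+1)
    in absolute value. With more than m^2 such terms the L^2 norm, and by [J_norm_lac] the L^1 norm,
    is at least a constant times m / N^(n+1). *)
Lemma J_osc_ge m n : (m ^ 2 < n)%N -> m%:R * (2 * cos 1 / 9 * pi) <= (N ^ n.+1)%:R * J (osc n.+1).
Proof.
move=> mn; rewrite J_half_osc.
set c := fun k => - _; set q := sqsum (mkseq c n.+1).
have c1 := @cos1_gt0 R; have p0 := @pi_gt0 R.
have ck k : (k < n)%N -> (2 * cos 1 / (N ^ n.+1)%:R) ^+ 2 <= c k ^+ 2.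
  move=> kn; have Nk := NX k; have Nn := NX n.+1.
  (* At least two factors N separate N^k from N^(n+1); the resulting 4 exceeds pi and keeps the
     argument of the sine in [0, 1]. *)
  have Nkn : 4 * (N ^ k)%:R <= (N ^ n.+1)%:R :> R.
    rewrite -natrM ler_nat -(subnK (ltnW (leqW kn))) expnD leq_mul2r; apply/orP; right.
    apply: (@leq_trans (N ^ 2)); first by rewrite (@leq_exp2r 2 N 2).
    by rewrite leq_exp2l//; lia.
  have [x [x0 x1 xE]] : exists x, [/\ 0 <= x, x <= 1 & x = pi * ((N ^ k)%:R / (N ^ n.+1)%:R)].
    exists (pi * ((N ^ k)%:R / (N ^ n.+1)%:R)); split => //.
      by rewrite !mulr_ge0// ltW// ?invr_gt0.
    rewrite mulrA ler_pdivrMr// mul1r; apply: le_trans Nkn; apply: ler_wpM2r; first exact: ltW.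
    by have := @pihalf_lt2 R; lra.
  have xE' : (N ^ k)%:R * (step n.+1 / 2) = x.
    by rewrite xE /step; field; exact: lt0r_neq0.
  have sx : cos 1 * x <= sin x by apply: sin_ge_cos1; rewrite x0.
  rewrite /c sqrrN xE' -natrX; apply: lerXn2r; rewrite ?nnegrE.
  - by rewrite divr_ge0// mulr_ge0// ltW.
  - apply: mulr_ge0; last by apply: le_trans sx; rewrite mulr_ge0// ltW.
    by rewrite !mulr_ge0// ?invr_ge0 ltW.
  - have -> : 2 * cos 1 / (N ^ n.+1)%:R = 2 * pi^-1 * (N ^ k)%:R^-1 * (cos 1 * x).
      rewrite xE; move: Nk Nn p0; move: (N ^ k)%:R (N ^ n.+1)%:R (pi : R) (cos 1 : R).
      by move=> u v p w /lt0r_neq0 u0 /lt0r_neq0 v0 /lt0r_neq0 p0; field; rewrite u0 v0 p0.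
    by apply: ler_wpM2l => //; rewrite !mulr_ge0// ?invr_ge0 ltW.
have qge : (m%:R * (2 * cos 1 / (N ^ n.+1)%:R)) ^+ 2 <= q.
  rewrite /q sqsum_mkseq big_nat_recr//= ler_wpDr ?sqr_ge0// exprMn.
  apply: (@le_trans _ _ (\sum_(0 <= k < n) (2 * cos 1 / (N ^ n.+1)%:R) ^+ 2)).
    rewrite sumr_const_nat subn0 -[leRHS]mulr_natl -natrX; apply: ler_wpM2r; first exact: sqr_ge0.
    by rewrite ler_nat ltnW.
  by apply: ler_sum_nat => k /andP[_ kn]; exact: ck.
have u0 : 0 < 2 * cos 1 / (N ^ n.+1)%:R :> R by apply: divr_gt0 => //; rewrite mulr_gt0.
have q0 : 0 < q.
  rewrite /q sqsum_mkseq big_nat_recl//; apply: ltr_pwDl; last by apply: sumr_ge0 => k _; exact: sqr_ge0.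
  by apply: lt_le_trans (ck 0%N _); [rewrite exprn_gt0|lia].
have [r [r0 rq]] : exists r, 0 < r /\ q = r ^+ 2.
  by exists (Num.sqrt q); rewrite sqrtr_gt0 sqr_sqrtr// ltW.
have rge : m%:R * (2 * cos 1 / (N ^ n.+1)%:R) <= r.
  move: qge; rewrite rq ler_pXn2r// nnegrE; last exact: ltW.
  by apply: mulr_ge0 => //; exact: ltW.
(* The choice s = 3 r turns the lower bound of [J_norm_lac] into pi r / 9. *)
have s0 : 0 < 3 * r by rewrite mulr_gt0.
have := J_norm_lac N1 (mkseq c n.+1) s0; rewrite -/q rq.
have -> : pi * r ^+ 2 / (3 * r) - 6 * pi * (r ^+ 2) ^+ 2 / (3 * r) ^+ 3 = pi * r / 9.
  by field; rewrite lt0r_neq0.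
move=> h; apply: (@le_trans _ _ ((N ^ n.+1)%:R * (pi * r / 9))); last first.
  by apply: ler_wpM2l => //; exact: ltW.
have E (u : R) : 0 < u -> m%:R * (2 * cos 1 / 9 * pi) = u * (pi * (m%:R * (2 * cos 1 / u)) / 9).
  by move=> /lt0r_neq0 un; field.
rewrite (E _ (NX n.+1)).
apply: ler_wpM2l; first exact: ltW.
by apply: ler_wpM2r => //; apply: ler_wpM2l => //; exact: ltW.
Qed.

Lemma not_signed_measure_wpm : ~ is_signed_measure mu.
Proof.
move=> /signed_measure_osc[V HV].
have K0 : 0 < 2 * cos 1 / 9 * pi :> R by rewrite mulr_gt0 ?pi_gt0// divr_gt0// mulr_gt0// cos1_gt0.
have V0 : 0 <= 2 * pi * V.
  apply: le_trans (HV 1%N isT); rewrite mulr_ge0//.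
  have i0 : rint per (fun _ : R => 0 : R) by exact/trigp_rint/trigp_cst.
  have i1 : rint per (osc 1) by exact/rint_per_cont/cont_osc.
  have := le_J i0 i1; rewrite J_cst mulr0; apply => t; exact: normr_ge0.
have /andP[_ ] := truncn_itv (divr_ge0 V0 (ltW K0)).
rewrite ltr_pdivrMr//; move: (Num.Def.trunc _).+1 => k; apply/negP; rewrite -leNgt.
apply: le_trans (J_osc_ge (ltnSn (k ^ 2))) _.
exact: HV.
Qed.

End NotMeasure.


(** * The convolution square *)

Section Convolution.
Context {R : realType}.
Variable N : nat.
Hypothesis N1 : (1 < N)%N.
Implicit Types (a b c d s t e r x y h : R) (f g phi : R -> R).

Local Notation mu := (@wpm R N N1).
Local Notation wei := (@wei R N).
Local Notation dwei := (@dwei R N).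
Local Notation weil := (@weil R N).

Lemma cont_bounded f a b : continuous f -> exists2 M, 0 <= M & forall x, a <= x <= b -> `|f x| <= M.
Proof.
move=> cf; have [ab|ba] := leP a b; last first.
  by exists 0 => // x /andP[h1 h2]; have := le_lt_trans (le_trans h1 h2) ba; rewrite ltxx.
have cn : {within `[a, b], continuous (fun x => `|f x|)}.
  apply: continuous_subspaceT => x.
  exact: (continuous_comp (cf x) (@norm_continuous _ _ _)).
have [c _ cM] := EVT_max ab cn.
by exists `|f c| => // x xab; apply: cM; rewrite in_itv.
Qed.

Lemma is_derive_quad f x d C : 0 <= C ->
  (forall h, `|h| <= 1 -> `|f (x + h) - f x - h * d| <= C * h ^+ 2) -> is_derive x 1 f d.
Proof.
move=> C0 H.
have lim : (fun h => h^-1 *: (f (h *: 1 + x) - f x)) @ 0^' --> d.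
  apply/cvgrPdist_le => e e0.
  near=> h.
  have h0 : h != 0 by near: h; exact: nbhs_dnbhs_neq.
  have h1 : `|h| <= 1.
    near: h; apply: dnbhs0_le; exact: ltr01.
  have h2 : `|h| <= e / (C + 1).
    near: h; apply: dnbhs0_le; rewrite divr_gt0// ltr_wpDl//.
  rewrite [h *: 1]mulr1 -[_ *: _]/(h^-1 * _) (addrC h).
  have hp : 0 < `|h| by rewrite normr_gt0.
  rewrite -(ler_pM2l hp) -normrM mulrBr mulVKf// distrC.
  apply: le_trans (H h h1) _; rewrite -[h ^+ 2]real_normK ?num_real// expr2.
  rewrite mulrCA ler_pM2l//; move: h2; rewrite ler_pdivlMr ?ltr_wpDl// => h2.
  by apply: le_trans h2; rewrite mulrC ler_wpM2l// lerDl.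
split; first by apply/cvg_ex; exists d.
exact: cvg_lim lim.
Unshelve. all: by end_near. Qed.

Lemma taylor2 f (f' f'' : R -> R) x h (C : R) : (forall u : R, is_derive u 1 f (f' u)) ->
  (forall u : R, is_derive u 1 f' (f'' u)) ->
  (forall u : R, `|u - x| <= `|h| -> `|f'' u| <= C) ->
  `|f (x + h) - f x - h * f' x| <= C * h ^+ 2.
Proof.
move=> df df' fC.
have mvt (g g' : R -> R) y z : (forall u : R, is_derive u 1 g (g' u)) ->
    exists2 c, `|c - y| <= `|z - y| & g z - g y = g' c * (z - y).
  move=> dg; have cg u : {for u, continuous g} by exact: is_derive_cont (dg u).
  have [yz|/ltW zy] := leP y z.
    have [c] := MVT_segment yz (fun s _ => dg s) (continuous_subspaceT cg).
    rewrite in_itv/= => /andP[h1 h2] E; exists c => //.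
    by rewrite !ger0_norm ?subr_ge0// lerD2r.
  have [c] := MVT_segment zy (fun s _ => dg s) (continuous_subspaceT cg).
  rewrite in_itv/= => /andP[h1 h2] E; exists c; last by rewrite -opprB E -mulrN opprB.
  by rewrite !ler0_norm ?subr_le0// lerN2 lerD2r.
have [c ch E] := mvt f f' x (x + h) df.
have [c2 c2h E2] := mvt f' f'' x c df'.
have xh : x + h - x = h by rewrite addrAC subrr add0r.
rewrite xh in ch E; rewrite E -[h * f' x]mulrC -mulrBl E2 !normrM.
have -> : C * h ^+ 2 = C * `|h| * `|h| by rewrite -mulrA -expr2 real_normK ?num_real.
apply: ler_wpM2r => //; apply: ler_pM => //.
by apply: fC; apply: le_trans ch.
Qed.

Lemma J_wei_parts n (g g' : R -> R) : (forall x, is_derive x 1 g (g' x)) -> continuous g' ->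
  (forall x, g (x + 2 * pi) = g x) -> J (fun t => wei n t * g' t) = - J (fun t => dwei n t * g t).
Proof.
move=> dg cg' pg.
have cg : continuous g by move=> x; exact: is_derive_cont (dg x).
have cw : continuous (wei n) by exact/trigp_cont/trigp_wei.
have cdw : continuous (dwei n) by exact/trigp_cont/trigp_dwei.
have c1 : continuous (fun t => wei n t * g' t) by move=> t; apply: cvgM; [exact: cw|exact: cg'].
have c2 : continuous (fun t => dwei n t * g t) by move=> t; apply: cvgM; [exact: cdw|exact: cg].
apply/eqP; rewrite -addr_eq0 -JD; [|exact: rint_per_cont|exact: rint_per_cont].
have dwg x : is_derive x 1 (fun t => wei n t * g t) (wei n x * g' x + dwei n x * g x).
  have H := is_deriveM (is_derive_wei N1 n x) (dg x).
  by apply: (is_derive_eq H); rewrite /GRing.scale/= (mulrC (g x)).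
have c3 : continuous (fun t => wei n t * g' t + dwei n t * g t).
  by move=> t; apply: cvgD; [exact: c1|exact: c2].
rewrite (J_FTC c3 dwg).
by rewrite -[2 * pi]add0r (trigp_per _ (trigp_wei N n)) pg subrr.
Qed.

Lemma J_dwei_cvg (g g' : R -> R) : (forall x, is_derive x 1 g (g' x)) -> continuous g' ->
  (forall x, g (x + 2 * pi) = g x) ->
  (fun n => J (fun t => dwei n t * g t)) @ \oo --> - J (fun t => weil t * g' t).
Proof.
move=> dg cg' pg; have [M M0 HM] := cont_bounded 0 (2 * pi) cg'.
have -> : (fun n => J (fun t => dwei n t * g t)) = (fun n => - J (fun t => wei n t * g' t)).
  by apply/funext => n; rewrite (J_wei_parts n dg cg' pg) opprK.
apply: cvgN; apply: (J_weil_mul N1 (M := M)) => // t /andP[t0 t2].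
by apply: HM; rewrite t0 ltW.
Qed.

Lemma dist_of_wpm phi : dist_of mu phi = - J (fun t => weil t * derive1 phi t).
Proof.
rewrite /dist_of /dist_deriv /dist_mul_haar mulrN mulVKf//; last by rewrite gt_eqF// twopi_gt0.
by congr (- _); apply: eq_in_J => t pt; rewrite cumul_wpm.
Qed.

Lemma J_norm_le f M : rint per f -> (forall t, per t -> `|f t| <= M) -> `|J f| <= 2 * pi * M.
Proof.
move=> fi fM; have := Rintegral_close (k := 0) (e := M) measurable_per leb_per_fin fi.
have lper : fine (leb R per) = 2 * pi by exact: (congr1 fine leb_per).
by rewrite lper mul0r subr0 mulrC; apply => t pt; rewrite subr0 fM.
Qed.

Lemma weil_le4 t : `|weil t| <= 4.
Proof.
by have := weil_close N1 0 t; rewrite /wei big_geq// mulr0 oppr0 subr0 expr0 mulr1.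
Qed.

Lemma rint_weil_mul g : continuous g -> rint per (fun t => weil t * g t).
Proof.
move=> cg; have [M M0 HM] := cont_bounded 0 (2 * pi) cg.
apply: (@rint_mul_bnd _ _ _ _ M) => [||| t /andP[t0 t2]].
- exact: measurable_per.
- exact: rint_weil.
- by apply: measurable_funTS; apply: continuous_measurable_fun.
- by apply: HM; rewrite t0 ltW.
Qed.

Let continuous_shift (g : R -> R) x : continuous g -> continuous (fun t => g (x + t)).
Proof.
move=> cg t; apply: (@continuous_comp _ _ _ (fun t => x + t) g); last exact: cg.
by apply: (@continuousD _ _ _ (fun=> x) id) => //; exact: cst_continuous.
Qed.

(** Differentiation under the integral sign: the second-order remainder is uniform in t, since q''
    is bounded on a compact interval that contains all the arguments. *)
Lemma is_derive_J_weil (q q' q'' : R -> R) x : (forall u : R, is_derive u 1 q (q' u)) ->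
  (forall u : R, is_derive u 1 q' (q'' u)) -> continuous q'' ->
  is_derive x 1 (fun x => J (fun t => weil t * q (x + t))) (J (fun t => weil t * q' (x + t))).
Proof.
move=> dq dq' cq''; have tp := @twopi_gt0 R.
have cq : continuous q by move=> u; exact: is_derive_cont (dq u).
have cq' : continuous q' by move=> u; exact: is_derive_cont (dq' u).
have [C C0 HC] := cont_bounded (x - 1) (x + 2 * pi + 1) cq''.
have wi y : rint per (fun t => weil t * q (y + t)) by apply: rint_weil_mul; exact: continuous_shift.
have wi' y : rint per (fun t => weil t * q' (y + t)) by apply: rint_weil_mul; exact: continuous_shift.
apply: (@is_derive_quad _ _ _ (2 * pi * (4 * C))); first by apply: mulr_ge0; [exact: ltW|exact: mulr_ge0].
move=> h h1; rewrite -JZ// -JB// -JB; last first.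
- exact: (rintZ h measurable_per (wi' x)).
- exact: (rintB measurable_per (wi _) (wi _)).
rewrite (_ : 2 * pi * (4 * C) * h ^+ 2 = 2 * pi * (4 * (C * h ^+ 2))); last by ring.
apply: J_norm_le.
  apply: (rintB measurable_per); last exact: (rintZ h measurable_per (wi' x)).
  exact: (rintB measurable_per (wi _) (wi _)).
move=> t /andP[t0 t2].
have -> : weil t * q (x + h + t) - weil t * q (x + t) - h * (weil t * q' (x + t)) =
    weil t * (q ((x + t) + h) - q (x + t) - h * q' (x + t)).
  by rewrite (addrAC x h t); ring.
rewrite normrM; apply: ler_pM => //; first exact: weil_le4.
apply: taylor2 dq dq' _ => u uh; apply: HC.
by move: (le_trans uh h1); rewrite ler_norml => /andP[u1 u2]; apply/andP; split; lra.
Qed.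

Section Kernel.
Variables p0 p1 p2 p3 p4 : R -> R.
Hypothesis d0 : forall u : R, is_derive u 1 p0 (p1 u).
Hypothesis d1 : forall u : R, is_derive u 1 p1 (p2 u).
Hypothesis d2 : forall u : R, is_derive u 1 p2 (p3 u).
Hypothesis d3 : forall u : R, is_derive u 1 p3 (p4 u).
Hypothesis cp4 : continuous p4.
Hypothesis per0 : forall x, p0 (x + 2 * pi) = p0 x.
Hypothesis per1 : forall x, p1 (x + 2 * pi) = p1 x.

Let cp0 : continuous p0. Proof. by move=> u; exact: is_derive_cont (d0 u). Qed.
Let cp1 : continuous p1. Proof. by move=> u; exact: is_derive_cont (d1 u). Qed.
Let cp3 : continuous p3. Proof. by move=> u; exact: is_derive_cont (d3 u). Qed.

Let a k := J (fun t => cos ((N ^ k)%:R * t) * p0 t).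
Let b k := J (fun t => sin ((N ^ k)%:R * t) * p0 t).

Let rint_p0 f : trigp f -> rint per (fun t => f t * p0 t).
Proof.
move=> tf; apply: rint_per_cont => t.
by apply: cvgM; [exact: (trigp_cont tf)|exact: cp0].
Qed.

(** For a test function p0, [psi] x is the distribution of mu applied to the translate p0 (x + .),
    so that applying the distribution to [psi] is the convolution square; [psin] is the same with
    [wei n] in place of [weil]. *)
Let psi x := - J (fun t => weil t * p1 (x + t)).
Let psi' x := - J (fun t => weil t * p2 (x + t)).
Let psin n x := - J (fun t => wei n t * p1 (x + t)).

Let dpsi x : is_derive x 1 psi (psi' x).
Proof. by apply: is_deriveN; exact: is_derive_J_weil d1 d2 cp3. Qed.

Let cpsi' : continuous psi'.
Proof.
move=> x; have H : is_derive x 1 psi' (- J (fun t => weil t * p3 (x + t))).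
  by apply: is_deriveN; exact: is_derive_J_weil d2 d3 cp4.
exact: is_derive_cont H.
Qed.

Let psi_per x : psi (x + 2 * pi) = psi x.
Proof. by congr (- _); apply: eq_J => t; rewrite addrAC per1. Qed.

(** Integration by parts moves the derivative onto [wei n], and a translation brings out the cosine
    and sine coefficients of p0 at the frequencies N^k. *)
Let psinE n x : psin n x =
  - (pi^-1 * \sum_(0 <= k < n) (a k * cos ((N ^ k)%:R * x) + b k * sin ((N ^ k)%:R * x))).
Proof.
have dp x0 : is_derive x0 1 (fun t => p0 (x + t)) (p1 (x + x0)).
  exact: (is_derive_translate (d0 (x + x0))).
rewrite /psin (J_wei_parts n dp) ?opprK; [|exact: continuous_shift|by move=> y; rewrite addrA per0].
have tcos k y : trigp (fun t => cos ((N ^ k)%:R * (y + t)) : R) by exact: trigp_shift (Trigp_cos (N ^ k)).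
have ti k : rint per (fun t => cos ((N ^ k)%:R * t) * p0 (x + t)).
  apply: rint_per_cont => t; apply: cvgM; first exact: (trigp_cont (Trigp_cos (N ^ k))).
  exact: continuous_shift.
transitivity (J (fun t => - pi^-1 * \sum_(0 <= k < n) (cos ((N ^ k)%:R * t) * p0 (x + t)))).
  by apply: eq_J => t; rewrite /dwei mulNr mulNr -mulrA mulr_suml.
rewrite JZ; last exact: (rint_sum _ measurable_per ti).
rewrite mulNr; congr (- (_ * _)); rewrite /J Rintegral_sum//; last exact: measurable_per.
apply: eq_bigr => k _; rewrite -/(J _).
have tk : trigp (fun t => cos ((N ^ k)%:R * (- x + t)) : R) by exact: tcos.
transitivity (J (fun t => cos ((N ^ k)%:R * (- x + t)) * p0 t)).
  have := J_shift x (f := fun t => cos ((N ^ k)%:R * (- x + t)) * p0 t).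
  have H1 : continuous (fun t => cos ((N ^ k)%:R * (- x + t)) * p0 t).
    by move=> t; apply: cvgM; [exact: (trigp_cont tk)|exact: cp0].
  move=> /(_ H1) <-; last by move=> y; rewrite per0; congr (_ * _); exact: (trigp_per y tk).
  by apply: eq_J => t; rewrite addKr.
transitivity (J (fun t => cos ((N ^ k)%:R * x) * (cos ((N ^ k)%:R * t) * p0 t) +
   sin ((N ^ k)%:R * x) * (sin ((N ^ k)%:R * t) * p0 t))).
  by apply: eq_J => t; rewrite addrC mulrBr cosB; ring.
have i1 := rint_p0 (Trigp_cos (N ^ k)); have i2 := rint_p0 (Trigp_sin (N ^ k)).
rewrite JD; [|exact: rintZ measurable_per i1|exact: rintZ measurable_per i2].
by rewrite !JZ// mulrC [X in _ + X]mulrC.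
Qed.

Let J_cos_psin k n : (k < n)%N -> J (fun x => cos ((N ^ k)%:R * x) * psin n x) = - a k.
Proof.
move=> kn.
have t1 j : trigp (fun t => cos ((N ^ k)%:R * t) * cos ((N ^ j)%:R * t) : R).
  by apply: trigp_mul; exact: Trigp_cos.
have t2 j : trigp (fun t => sin ((N ^ j)%:R * t) * cos ((N ^ k)%:R * t) : R).
  by apply: trigp_mul; [exact: Trigp_sin|exact: Trigp_cos].
have tj j := Trigp_add (Trigp_scale (a j) (t1 j)) (Trigp_scale (b j) (t2 j)).
transitivity (J (fun t => - pi^-1 * \sum_(0 <= j < n) (a j * (cos ((N ^ k)%:R * t) * cos ((N ^ j)%:R * t))
   + b j * (sin ((N ^ j)%:R * t) * cos ((N ^ k)%:R * t))))).
  apply: eq_J => t; rewrite psinE mulrN mulNr mulrCA mulr_sumr; congr (- (_ * _)).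
  by apply: eq_bigr => j _; ring.
rewrite JZ; last by apply: (rint_sum _ measurable_per) => j; exact/trigp_rint/tj.
rewrite /J Rintegral_sum; [|exact: measurable_per|by move=> j; exact/trigp_rint/tj].
rewrite (eq_bigr (fun j => if j == k then pi * a k else 0)); last first.
  move=> j _; rewrite -/(J _) JD; [|exact/trigp_rint/Trigp_scale|exact/trigp_rint/Trigp_scale].
  rewrite !JZ; [|exact/trigp_rint|exact/trigp_rint].
  have Nj0 : ((N ^ j)%N == 0)%N = false by apply/negbTE; rewrite -lt0n expn_gt0 (ltnW N1).
  rewrite J_sin_cos mulr0 addr0 J_cos_mul Nj0 eqn_exp2l// eq_sym.
  by have [->|_] := eqVneq j k; [rewrite mulrC|rewrite mulr0].
rewrite -big_mkcond big_nat1_eq/= kn mulNr mulKf//.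
by rewrite gt_eqF// pi_gt0.
Qed.

(** Applying mu multiplies the coefficient at N^k by -1; this is exact for [psin n] as soon as k < n
    and passes to the uniform limit. *)
Let J_cos_psi k : J (fun x => cos ((N ^ k)%:R * x) * psi x) = - a k.
Proof.
have [M M0 HM] := cont_bounded 0 (4 * pi) cp1.
have tps n : trigp (psin n).
  apply: (trigp_eq (f := fun x => - pi^-1 * \sum_(0 <= k < n) (a k * cos ((N ^ k)%:R * x) + b k * sin ((N ^ k)%:R * x)))).
    by move=> x; rewrite psinE mulNr.
  apply: Trigp_scale; apply: trigp_sum => j.
  by apply: Trigp_add; apply: Trigp_scale; [exact: Trigp_cos|exact: Trigp_sin].
have c := (Rintegral_unif (D := per) (fn := fun n x => cos ((N ^ k)%:R * x) * psin n x)
  (f := fun x => cos ((N ^ k)%:R * x) * psi x)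
  (e := fun n => (2 * pi * (4 * M)) * 2^-1 ^+ n) measurable_per leb_per_fin _ (half_cvg0 _) _).2.
apply: (cvg_unique _ (c _ _)) => //; last first.
- apply/cvgrPdist_lt => e e0; exists k.+1 => // n /= kn.
  by rewrite -/(J _) J_cos_psin// subrr normr0.
- move=> n x /andP[x0 x2]; rewrite -mulrBr normrM -[leRHS]mul1r.
  apply: ler_pM => //; first exact: cos_max.
  have cp : continuous (fun t => p1 (x + t)) by exact: continuous_shift.
  have wi : rint per (fun t => wei n t * p1 (x + t)).
    apply: rint_per_cont => t; apply: cvgM; last exact: cp.
    exact: (trigp_cont (trigp_wei N n)).
  rewrite /psin /psi opprK addrC -JB//; last exact: rint_weil_mul.
  rewrite (_ : 2 * pi * (4 * M) * 2^-1 ^+ n = 2 * pi * (4 * 2^-1 ^+ n * M)); last by ring.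
  apply: J_norm_le; first exact: (rintB measurable_per (rint_weil_mul cp) wi).
  move=> t /andP[t0 t2]; rewrite -mulrBl normrM; apply: ler_pM => //; first exact: weil_close.
  by apply: HM; apply/andP; split; lra.
- move=> n; apply/trigp_rint/trigp_mul => //; exact: Trigp_cos.
Qed.

(** Integrals against [dwei n] involve only the cosine coefficients at N^k, and these are opposite
    for [psi] and p0. After an integration by parts both limits in n are known. *)
Lemma J_weil_conv : - J (fun x => weil x * psi' x) = J (fun t => weil t * p1 t).
Proof.
have h1 := J_dwei_cvg dpsi cpsi' psi_per.
have h0 := J_dwei_cvg d0 cp1 per0.
have cpsi : continuous psi by move=> u; exact: is_derive_cont (dpsi u).
have E (q : R -> R) n : continuous q -> J (fun t => dwei n t * q t) =
    - pi^-1 * \sum_(0 <= k < n) J (fun t => cos ((N ^ k)%:R * t) * q t).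
  move=> cq; have ti k : rint per (fun t => cos ((N ^ k)%:R * t) * q t).
    apply: rint_per_cont => t; apply: cvgM; last exact: cq.
    exact: (trigp_cont (Trigp_cos (N ^ k))).
  rewrite {2}/J -Rintegral_sum//; last exact: measurable_per.
  rewrite -/(J _) -JZ; last exact: (rint_sum _ measurable_per ti).
  by apply: eq_J => t; rewrite /dwei mulNr mulNr -mulrA mulr_suml.
have h2 : (fun n => J (fun t => dwei n t * psi t)) @ \oo --> J (fun t => weil t * p1 t).
  rewrite (_ : (fun n => _) = (fun n => - J (fun t => dwei n t * p0 t))).
    by rewrite -[X in _ --> X]opprK; exact: cvgN.
  apply/funext => n; rewrite !E// -mulrN -sumrN; congr (_ * _).
  by apply: eq_bigr => k _; rewrite J_cos_psi.
exact: (cvg_unique _ h1 h2).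
Qed.

End Kernel.

Lemma dist_conv_wpm phi : test_function phi ->
  dist_conv (dist_of mu) (dist_of mu) phi = - dist_of mu phi.
Proof.
move=> [smooth pphi].
pose p n := derive1n n phi.
have dp n (u : R) : is_derive u 1 (p n) (p n.+1 u).
  by rewrite /p derive1nS derive1E; exact/derivableP.
have cp n : continuous (p n) by move=> u; exact: is_derive_cont (dp n u).
have per1 x : p 1%N (x + 2 * pi) = p 1%N x.
  have H : is_derive x 1 (fun t => phi (2 * pi + t)) (p 1%N (2 * pi + x)).
    exact: (is_derive_translate (dp 0%N (2 * pi + x))).
  have E : (fun t => phi (2 * pi + t)) = phi by apply/funext => t; rewrite addrC pphi.
  rewrite E in H; rewrite addrC -(@derive_val _ _ _ _ _ _ _ H).
  by rewrite (@derive_val _ _ _ _ _ _ _ (dp 0%N x)).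
pose psi x := - J (fun t => weil t * p 1%N (x + t)).
have dpsi x : is_derive x 1 psi (- J (fun t => weil t * p 2%N (x + t))).
  by apply: is_deriveN; exact: is_derive_J_weil (dp 1%N) (dp 2%N) (cp 3%N).
rewrite /dist_conv.
have -> : (fun x => dist_of mu (fun y => phi (x + y))) = psi.
  apply/funext => x; rewrite dist_of_wpm /psi.
  suff -> : derive1 (fun y => phi (x + y)) = (fun t => p 1%N (x + t)) by [].
  apply/funext => t.
  rewrite derive1E.
  exact: (@derive_val _ _ _ _ _ _ _ (is_derive_translate (dp 0%N (x + t)))).
rewrite !dist_of_wpm opprK -(J_weil_conv (dp 0%N) (dp 1%N) (dp 2%N) (dp 3%N) (cp 4%N) pphi per1).
suff -> : derive1 psi = (fun x => - J (fun t => weil t * p 2%N (x + t))) by [].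
apply/funext => x; rewrite derive1E.
exact: (@derive_val _ _ _ _ _ _ _ (dpsi x)).
Qed.

End Convolution.


(** * Absolutely convergent sums over families of arcs *)

Section FiniteSums.
Context {R : realType} {T : choiceType}.
Implicit Types (S : set T) (a k f : T -> R) (s : seq T) (e p K C : R).

Lemma esum_ge_seq S f s : uniq s -> (forall x, x \in s -> S x) ->
  ((\sum_(x <- s) f x)%:E <= \esum_(x in S) (f x)%:E)%E.
Proof.
move=> us sS; apply: esum_ge; exists [set` s]; last by rewrite -fsbig_seq// sumEFin.
by split; [exact: finite_seq|exact: sS].
Qed.

Lemma esum_le_seq S f K : (forall s, uniq s -> (forall x, x \in s -> S x) ->
  \sum_(x <- s) f x <= K) -> (\esum_(x in S) (f x)%:E <= K%:E)%E.
Proof.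
move=> H; apply: ge_ereal_sup => _ [X [Xfin XS] <-].
rewrite fsbig_finite// sumEFin lee_fin; apply: H; first exact: finmap.fset_uniq.
by move=> x; rewrite in_fset_set// inE => /XS.
Qed.

Lemma sum_subseq_le f s s' : (forall x, 0 <= f x) -> uniq s -> {subset s <= s'} ->
  \sum_(x <- s) f x <= \sum_(x <- s') f x.
Proof.
move=> f0 us ss.
have h : \sum_(x <- s) f x <= \sum_(x <- undup s') f x.
  rewrite [leRHS](bigID (mem s))/= -[X in X + _]big_filter.
  have pe : perm_eq [seq x <- undup s' | x \in s] s.
    apply: uniq_perm => //; first by rewrite filter_uniq// undup_uniq.
    move=> x; rewrite mem_filter mem_undup; apply/andP/idP => [[]//|xs].
    by split => //; exact: ss.
  by rewrite (perm_big _ pe) lerDl sumr_ge0.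
apply: le_trans h _; elim: s' {ss} => //= x s' IH.
case: ifP => _; last by rewrite !big_cons lerD2l.
by rewrite big_cons ler_wpDl.
Qed.

Lemma esum_approx S f K : (forall x, 0 <= f x) ->
  (forall s, uniq s -> (forall x, x \in s -> S x) -> \sum_(x <- s) f x <= K) ->
  exists p, [/\ \esum_(x in S) (f x)%:E = p%:E,
    forall s, uniq s -> (forall x, x \in s -> S x) -> \sum_(x <- s) f x <= p &
    forall e, 0 < e -> exists s, [/\ uniq s, (forall x, x \in s -> S x) & p - e < \sum_(x <- s) f x]].
Proof.
move=> f0 fK; have E0 : (0 <= \esum_(x in S) (f x)%:E)%E by apply: esum_ge0 => x _; rewrite lee_fin.
have EK := esum_le_seq fK.
have Efin : (\esum_(x in S) (f x)%:E)%E \is a fin_num.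
  by rewrite ge0_fin_numE// (le_lt_trans EK)// ltry.
exists (fine (\esum_(x in S) (f x)%:E)); rewrite fineK//; split => // [s us sS|e e0].
  by rewrite -lee_fin fineK//; exact: esum_ge_seq.
apply: contrapT => H.
have : (\esum_(x in S) (f x)%:E <= (fine (\esum_(x in S) (f x)%:E) - e)%:E)%E.
  apply: esum_le_seq => s us sS; rewrite leNgt; apply/negP => h; apply: H.
  by exists s.
rewrite -{1}[X in (X <= _)%E]fineK// lee_fin lerBrDl gerDr leNgt e0; exact: notF.
Qed.

End FiniteSums.

Section AbsSum.
Context {R : realType}.
Implicit Types (S : set (set (Cx R))) (a k : set (Cx R) -> R).

(** Take s so large that it nearly exhausts the positive part, the negative part and the sum of k.
    An extension s ++ t as in the last hypothesis then has a small sum, since the sum of k over t is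
    small, and this sum is close to the full one. *)
Lemma abs_sum_eq0 S a k C K : 0 <= C -> (forall J, 0 <= k J) ->
  (forall J, S J -> `|a J| <= C * k J) ->
  (forall s, uniq s -> (forall J, J \in s -> S J) -> \sum_(J <- s) k J <= K) ->
  (forall s e, uniq s -> (forall J, J \in s -> S J) -> 0 < e ->
     exists t, [/\ uniq (s ++ t), (forall J, J \in s ++ t -> S J) &
       `|\sum_(J <- s ++ t) a J| <= e + C * \sum_(J <- t) k J]) ->
  abs_sum S a = 0.
Proof.
move=> C0 k0 ak kK H.
have CK (f : set (Cx R) -> R) : (forall J, f J <= `|a J|) ->
    forall s, uniq s -> (forall J, J \in s -> S J) -> \sum_(J <- s) f J <= C * K.
  move=> fa s us sS; apply: (@le_trans _ _ (\sum_(J <- s) C * k J)).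
    rewrite !big_seq; apply: ler_sum => J Js; apply: le_trans (fa J) _; exact/ak/sS.
  by rewrite -mulr_sumr; apply: ler_wpM2l => //; exact: kK.
have f1 J : Num.max (a J) 0 <= `|a J| by rewrite ge_max ler_norm normr_ge0.
have f2 J : Num.max (- a J) 0 <= `|a J| by rewrite ge_max -normrN ler_norm normr_ge0.
have g1 J : 0 <= Num.max (a J) 0 by rewrite le_max lexx orbT.
have g2 J : 0 <= Num.max (- a J) 0 by rewrite le_max lexx orbT.
have [p [pE pge papp]] := esum_approx g1 (CK _ f1).
have [q [qE qge qapp]] := esum_approx g2 (CK _ f2).
have [r [rE rge rapp]] := esum_approx k0 kK.
rewrite /abs_sum pE qE /=; apply/eqP; rewrite -normr_le0; apply/ler_addgt0Pr => e e0; rewrite add0r.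
have [d d0 dE] : exists2 d, 0 < d & e = (C + 3) * d.
  have C3 : 0 < C + 3 by rewrite ltr_wpDl.
  exists (e / (C + 3)); first exact: divr_gt0.
  by rewrite mulrC divfK// gt_eqF.
have [s1 [u1 S1 h1]] := papp d d0.
have [s2 [u2 S2 h2]] := qapp d d0.
have [s3 [u3 S3 h3]] := rapp d d0.
have u0 := undup_uniq (s1 ++ s2 ++ s3).
have S0 J : J \in undup (s1 ++ s2 ++ s3) -> S J.
  by rewrite mem_undup !mem_cat => /or3P[/S1|/S2|/S3].
have sub1 : {subset s1 <= undup (s1 ++ s2 ++ s3)} by move=> J; rewrite mem_undup !mem_cat => ->.
have sub2 : {subset s2 <= undup (s1 ++ s2 ++ s3)} by move=> J; rewrite mem_undup !mem_cat => ->; rewrite orbT.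
have sub3 : {subset s3 <= undup (s1 ++ s2 ++ s3)} by move=> J; rewrite mem_undup !mem_cat => ->; rewrite !orbT.
move: (undup _) u0 S0 sub1 sub2 sub3 => s0 u0 S0 sub1 sub2 sub3.
have [t [ut St ht]] := H s0 d u0 S0 d0.
have catsub (s : seq (set (Cx R))) : {subset s <= s0} -> {subset s <= s0 ++ t}.
  by move=> h J /h; rewrite mem_cat => ->.
have P1 := pge _ ut St; have Q1 := qge _ ut St; have R1 := rge _ ut St.
have P2 := lt_le_trans h1 (sum_subseq_le g1 u1 (catsub _ sub1)).
have Q2 := lt_le_trans h2 (sum_subseq_le g2 u2 (catsub _ sub2)).
have R2 := lt_le_trans h3 (sum_subseq_le k0 u3 sub3).
rewrite [X in X <= _]big_cat/= in R1.
have aE : \sum_(J <- s0 ++ t) a J = \sum_(J <- s0 ++ t) Num.max (a J) 0 - \sum_(J <- s0 ++ t) Num.max (- a J) 0.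
  rewrite -sumrB; apply: eq_bigr => J _; have [aJ|aJ] := leP (a J) 0.
    have aJ' : 0 <= - a J by rewrite oppr_ge0.
    by rewrite (max_l aJ') opprK add0r.
  have aJ' : - a J <= 0 by rewrite oppr_le0 ltW.
  by rewrite (max_r aJ') subr0.
have kt : C * \sum_(J <- t) k J <= C * d by apply: ler_wpM2l => //; lra.
move: ht; rewrite aE; move: P1 Q1 P2 Q2.
move: (\sum_(J <- s0 ++ t) Num.max (a J) 0) (\sum_(J <- s0 ++ t) Num.max (- a J) 0) => x y.
move: kt; move: (C * \sum_(J <- t) k J) => z kt P1 Q1 P2 Q2.
rewrite dE !ler_norml => /andP[]; lra.
Qed.

End AbsSum.

(** * Components of the complement of a closed subset of the circle *)

Section Components.
Context {R : realType}.
Implicit Types (a b c t : R) (z : Cx R) (E F J : set (Cx R)).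

Lemma cis_oo_arc a b : is_arc (cis (R := R) @` [set t | a < t < b]).
Proof.
apply: is_arc_cis => x y /= /andP[ax _] /andP[_ yb] u /andP[xu uy].
by rewrite (lt_le_trans ax xu) (le_lt_trans uy yb).
Qed.

(** The open arc is connected and misses E. A point of the component beyond it would, by
    [arc_convex], force the component to contain cis b or cis a, which are in E. *)
Lemma component_gap E a b z : a < b -> b <= a + 2 * pi -> E (cis a) -> E (cis b) ->
  (forall t, a < t < b -> ~ E (cis t)) -> (cis (R := R) @` [set t | a < t < b]) z ->
  connected_component (circle R `\` E) z = cis (R := R) @` [set t | a < t < b].
Proof.
move=> ab ba Ea Eb nE zJ.
have Jsub : cis (R := R) @` [set t | a < t < b] `<=` circle R `\` E.
  by move=> _ [t tab <-]; split; [exact: circle_cis|exact: nE].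
have zA := Jsub _ zJ.
apply/seteqP; split; last first.
  by apply: connected_component_max => //; exact: (cis_oo_arc a b).2.
move=> w wC.
have Csub := @connected_component_sub _ (circle R `\` E) z.
have Carc : is_arc (connected_component (circle R `\` E) z).
  by split; [move=> v /Csub[]|exact: component_connected].
have [wc wE] := Csub _ wC.
have [t /andP[at_ ta] wt] := circle_from a wc.
have nCa : ~ connected_component (circle R `\` E) z (cis a) by move=> /Csub[_].
have nCb : ~ connected_component (circle R `\` E) z (cis b) by move=> /Csub[_].
have at' : a < t.
  by rewrite lt_neqAle at_ andbT; apply/eqP => tE; apply: wE; rewrite wt -tE.
exists t => //=; rewrite at'/= ltNge; apply/negP => bt.
have bt' : b < t.
  by rewrite lt_neqAle bt andbT; apply/eqP => tE; apply: wE; rewrite wt -tE.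
have [s /= /andP[as_ sb] sz] := zJ.
apply: nCb; apply: (arc_convex Carc nCa as_ sb bt' ta); last by rewrite -wt.
by rewrite sz; apply: connected_component_refl.
Qed.

Lemma closed_cis_preimage F : closed F -> closed (cis (R := R) @^-1` F).
Proof. by move=> cF; apply: closed_comp => // t _; exact: continuous_cis. Qed.

Lemma closed_max (G : set R) : closed G -> G !=set0 -> has_ubound G ->
  exists2 m, G m & forall x, G x -> x <= m.
Proof.
move=> cG G0 uG; exists (sup G); last by move=> x Gx; rewrite ub_le_sup.
by have := closure_sup G0 uG; rewrite -(closure_id _).1.
Qed.

Lemma closed_min (G : set R) : closed G -> G !=set0 -> has_lbound G ->
  exists2 m, G m & forall x, G x -> m <= x.
Proof.
move=> cG [g Gg] [l Gl].
have [|||m Gm mmax] := @closed_max ((fun x => - x) @^-1` G).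
- by apply: closed_comp => // t _; exact: opp_continuous.
- by exists (- g); rewrite /= opprK.
- by exists (- l) => x /= /Gl; rewrite lerNr.
by exists (- m) => // x Gx; rewrite lerNl mmax//= opprK.
Qed.

(* The two points of [F] nearest to [z] on either side bound its component. *)
Lemma component_ends F z : closed F -> F `<=` circle R -> F !=set0 -> (circle R `\` F) z ->
  exists a b, [/\ a < b, b <= a + 2 * pi, F (cis a), F (cis b) &
   (forall t, a < t < b -> ~ F (cis t)) /\ (cis (R := R) @` [set t | a < t < b]) z].
Proof.
move=> cF Fc [p Fp] [zc nFz]; have tp := @twopi_gt0 R.
have [al _ pE] := circleP (Fc _ Fp).
have [t0 /andP[at0 t0a] zE] := circle_from al zc.
have cG := closed_cis_preimage cF.
have [|||b [b1 b2] bmin] := @closed_min ([set t | t0 <= t] `&` cis (R := R) @^-1` F).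
- by apply: closedI cG; exact: closed_ge.
- by exists (al + 2 * pi); split; [exact: ltW|rewrite /= cisD2pi -pE].
- by exists t0 => t [].
have [|||a [a1 a2] amax] := @closed_max ([set t | t <= t0] `&` cis (R := R) @^-1` F).
- by apply: closedI cG; exact: closed_le.
- by exists al; split => //; rewrite /= -pE.
- by exists t0 => t [].
have nt0 : ~ F (cis t0) by rewrite -zE.
have at0' : a < t0 by rewrite lt_neqAle a1 andbT; apply/eqP => tE; apply: nt0; rewrite -tE.
have bt0' : t0 < b by rewrite lt_neqAle b1 andbT; apply/eqP => tE; apply: nt0; rewrite tE.
exists a, b; split => //; first exact: lt_trans bt0'.
  have h1 : b <= al + 2 * pi by apply: bmin; split; [exact: ltW|rewrite /= cisD2pi -pE].
  have h2 : al <= a by apply: amax; split => //; rewrite /= -pE.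
  by lra.
split; last by exists t0 => //=; rewrite at0'.
move=> t /andP[h1 h2] Ft; have [tt|tt] := leP t t0.
  by have := amax t (conj tt Ft); rewrite leNgt h1.
by have := bmin t (conj (ltW tt) Ft); rewrite leNgt h2.
Qed.

(** The end points of the given components form a finite subset of F, and by [component_gap] each of
    these components is also a component of the complement of that finite set. *)
Lemma components_sum_le F s : closed F -> F `<=` circle R -> F !=set0 ->
  uniq s -> (forall J, J \in s -> components (circle R `\` F) J) ->
  ((\sum_(J <- s) kappa1 (arc_length J))%:E <= kappa_set F)%E.
Proof.
move=> cF Fc F0 us sS.
have /choice[f fP] J : exists ab : R * R, J \in s -> [/\ ab.1 < ab.2, ab.2 <= ab.1 + 2 * pi,
    F (cis ab.1), F (cis ab.2) & (forall t, ab.1 < t < ab.2 -> ~ F (cis t)) /\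
    J = cis (R := R) @` [set t | ab.1 < t < ab.2]].
  have [Js|] := boolP (J \in s); last by exists (0, 0).
  have [z zA <-] := sS _ Js.
  have [a [b [ab ba Fa Fb [nF zJ]]]] := component_ends cF Fc F0 zA.
  exists (a, b) => _; split => //=; split => //.
  exact: component_gap.
pose E1 : set (Cx R) := [set` [seq cis (f J).1 | J <- s] ++ [seq cis (f J).2 | J <- s]].
have E1F : E1 `<=` F.
  move=> z; rewrite /E1/= mem_cat => /orP[/mapP[J Js ->]|/mapP[J Js ->]].
    by have [] := fP _ Js.
  by have [] := fP _ Js.
have kle : (kappa_fin E1 <= kappa_set F)%E.
  by apply: ereal_sup_ubound; exists E1 => //; split => //; exact: finite_seq.
apply: le_trans kle; rewrite /kappa_fin; case: pselect => [E10|nE10].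
  case: s us sS fP @E1 E1F E10 => [|J s] us sS fP E1 E1F E10; first by rewrite big_nil.
  have h : E1 (cis (f J).1) by rewrite /E1 /= inE eqxx.
  by exfalso; move: h; rewrite E10.
apply: esum_ge_seq => // J Js.
have [ab ba Fa Fb [nF JE]] := fP _ Js.
have Ja : E1 (cis (f J).1) by rewrite /E1/= mem_cat (map_f (fun J => cis (f J).1) Js).
have Jb : E1 (cis (f J).2) by rewrite /E1/= mem_cat (map_f (fun J => cis (f J).2) Js) orbT.
have m12 : (f J).1 < ((f J).1 + (f J).2) / 2 < (f J).2 by apply/andP; split; lra.
exists (cis (((f J).1 + (f J).2) / 2)).
  by split; [exact: circle_cis|move=> /E1F; exact: nF].
have nE1 t : (f J).1 < t < (f J).2 -> ~ E1 (cis t) by move=> tab /E1F; exact: nF.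
rewrite (component_gap ab ba Ja Jb nE1)//.
Qed.

End Components.


(** * The mass of a Carleson set *)

Section SingularPart.
Context {R : realType}.
Variable N : nat.
Hypothesis N1 : (1 < N)%N.
Implicit Types (a b c t e : R) (z : Cx R) (E F J : set (Cx R)) (s : seq (set (Cx R))).

Local Notation mu := (@wpm R N N1).
Local Notation massn := (@massn R N).
Local Notation dwei := (@dwei R N).

Lemma component_arc E J : E `<=` circle R -> components E J -> is_arc J.
Proof.
move=> Ec [z _ <-]; split; last exact: component_connected.
by move=> w /connected_component_sub/Ec.
Qed.

Lemma component_disjoint E J J' : components E J -> components E J' -> J `&` J' !=set0 -> J = J'.
Proof.
move=> [z _ <-] [z' _ <-] [w [h h']].
by rewrite (same_connected_component h) (same_connected_component h').
Qed.

(** The constant does not depend on n, so n may be fixed by the finite family s before the further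
    components t are chosen. *)
Lemma mass_tail_kappa n J : is_arc J ->
  `|mu J - massn n J| <= (4 * pi + 4) * kappa1 (arc_length J).
Proof.
move=> aJ; have [a [b [rJ a0]]] := arc_rep_exists aJ.
rewrite (wpm_rep N1 aJ rJ a0) (massn_rep N1 n rJ a0) (arc_length_rep rJ a0).
have [ab ba _ _] := rJ; have := weil_osc_kappa N1 n ab ba.
by move: (weil N b) (weil N a) (wei N n b) (wei N n a) => x y u v; rewrite (_ : x - y - (u - v) = x - u - (y - v)) //; ring.
Qed.

Lemma measurable_cset_seq s : (forall J, J \in s -> is_arc J) ->
  measurable (cset (\bigcup_(J in [set` s]) J)).
Proof.
move=> sa; rewrite (_ : cset _ = \bigcup_(J in [set` s]) cset J).
  by apply: fin_bigcup_measurable => [|J /sa]; [exact: finite_seq|exact: measurable_cset].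
apply/seteqP; split => [t [pt [J Js Jt]]|t [J Js [pt Jt]]]; first by exists J.
by split => //; exists J.
Qed.

(* Every component of the complement contains [cis q] for some rational [q]. *)
Lemma components_exhaust F e : closed F -> F `<=` circle R -> haar F = 0%E -> 0 < e ->
  exists s, [/\ uniq s, forall J, J \in s -> components (circle R `\` F) J &
    (leb R (per `\` cset (\bigcup_(J in [set` s]) J)) < e%:E)%E].
Proof.
move=> cF Fc F0 e0; have tp := @twopi_gt0 R.
pose A := circle R `\` F.
pose C i := if @unpickle rat i is Some q then connected_component A (cis (ratr q)) else set0.
have aC i : is_arc (C i).
  rewrite /C; case: unpickle => [q|]; last exact: is_arc0.
  split; last exact: component_connected.
  by move=> w /connected_component_sub[].
have mC i : measurable (cset (C i)) by exact: measurable_cset.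
pose rest n : set R := per `\` \bigcup_(i < n) cset (C i).
have mrest n : measurable (rest n).
  apply: measurableD; first exact: measurable_per.
  by apply: bigcup_measurable => i _; exact: mC.
have csetF : leb R (cset F) = 0%E.
  move: F0 => /eqP; rewrite /haar mule_eq0 => /orP[|/eqP //].
  by rewrite eqe invr_eq0 gt_eqF.
have mF : measurable (cset F).
  apply: measurableI; first exact: measurable_per.
  by apply: closed_measurable; exact: closed_cis_preimage.
have capF : \bigcap_n rest n `<=` cset F.
  move=> t ht; have [pt _] := ht 0%N Logic.I; split => //=; apply: contrapT => nFt.
  have : nbhs t (~` (cis (R := R) @^-1` F)).
    by apply: open_nbhs_nbhs; split => //; apply: closed_openC; exact: closed_cis_preimage.
  move=> /nbhs_ballP[d /= d0 dF].
  have td : t < t + d by rewrite ltrDl.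
  have [q /andP[tq qd]] : exists q, t < ratr q < t + d.
    by have [q] := rat_in_itvoo td; rewrite in_itv/= => h; exists q.
  pose I := [set x : R | t - d < x < t + d].
  have IA : cis (R := R) @` I `<=` A.
    move=> _ [x /= /andP[x1 x2] <-]; split; first exact: circle_cis.
    apply: dF; rewrite /ball/= ltr_norml; apply/andP; split; lra.
  have qI : (cis (R := R) @` I) (cis (ratr q)) by exists (ratr q) => //=; apply/andP; split; lra.
  have tI : (cis (R := R) @` I) (cis t) by exists t => //=; apply/andP; split; lra.
  have tC : connected_component A (cis (ratr q)) (cis t).
    exact: (connected_component_max qI IA (cis_oo_arc (t - d) (t + d)).2 tI).
  have CE : C (pickle q) = connected_component A (cis (ratr q)) by rewrite /C pickleK.
  case: (ht (pickle q).+1 Logic.I) => _ nU; apply: nU; exists (pickle q); first exact: ltnSn.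
  have Ct : C (pickle q) (cis t) by rewrite CE.
  exact: conj pt Ct.
have decr : nonincreasing_seq rest.
  apply/nonincreasing_seqP => n; apply/subsetPset => t [pt nt]; split => // -[i /= i_n it].
  by apply: nt; exists i => //=; rewrite ltnS ltnW.
have mcap : measurable (\bigcap_n rest n) by apply: bigcapT_measurable.
have r0fin : (leb R (rest 0%N) < +oo)%E.
  apply: (le_lt_trans _ leb_per_fin).
  by apply: le_measure; rewrite ?inE; [exact: mrest|exact: measurable_per|move=> t []].
have cap0 : leb R (\bigcap_n rest n) = 0%E.
  apply/eqP; rewrite eq_le measure_ge0 andbT -csetF.
  by apply: le_measure; rewrite ?inE.
have h : (leb R \o rest) @ \oo --> 0%E.
  by rewrite -cap0; exact: (@nonincreasing_cvg_mu _ _ _ (leb R) rest r0fin mrest mcap decr).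
have lfin n : leb R (rest n) \is a fin_num.
  rewrite ge0_fin_numE//; apply: (le_lt_trans _ leb_per_fin).
  by apply: le_measure; rewrite ?inE; [exact: mrest|exact: measurable_per|move=> t []].
have h' : (fun n => fine (leb R (rest n))) @ \oo --> (0 : R) by exact: fine_cvg h.
have [n hn] : exists n, (leb R (rest n) < e%:E)%E.
  have /cvgrPdist_lt/(_ _ e0)[n _ /(_ n (leqnn n))] := h'.
  rewrite sub0r normrN => hn; exists n; rewrite -(fineK (lfin n)) lte_fin.
  exact: le_lt_trans (ler_norm _) hn.
pose s := [seq J <- undup [seq C i | i <- iota 0 n] | J != set0].
have sA J : J \in s -> components A J.
  rewrite mem_filter mem_undup => /andP[J0 /mapP[i _ JE]].
  move: J0; rewrite JE /C; case: unpickle => [q|]; last by rewrite eqxx.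
  have [Aq _|nAq] := pselect (A (cis (ratr q))); first by exists (cis (ratr q)).
  by rewrite connected_component_out// eqxx.
exists s; split => //; first by rewrite filter_uniq// undup_uniq.
apply: le_lt_trans hn; apply: le_measure; rewrite ?inE.
- apply: measurableD; first exact: measurable_per.
  by apply: measurable_cset_seq => J /sA; apply: component_arc => z [].
- exact: mrest.
move=> t [pt nU]; split => // -[i /= i_n [_ Cit]]; apply: nU; split => //.
exists (C i) => //=; rewrite mem_filter mem_undup map_f ?mem_iota// andbT.
by apply/eqP => C0; move: Cit; rewrite /preimage/= C0.
Qed.

Lemma massn_circle n : J (dwei n) = 0.
Proof.
rewrite (J_FTC (trigp_cont (trigp_dwei N n)) (is_derive_wei N1 n)).
by rewrite -[2 * pi]add0r weiD2pi subrr.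
Qed.

Lemma massn_seq F n s : uniq s -> (forall J, J \in s -> components (circle R `\` F) J) ->
  \sum_(J <- s) massn n J = massn n (\bigcup_(J in [set` s]) J).
Proof.
move=> us sS.
have sarc J : J \in s -> is_arc J.
  by move=> /sS; apply: component_arc => z [].
pose K (i : 'I_(size s)) := nth set0 s i.
have Iin i : K i \in s by exact: mem_nth.
have := @massn_sum R N n (size s) K (fun i => sarc _ (Iin i)).
rewrite (_ : \bigcup_i K i = \bigcup_(J in [set` s]) J); last first.
  apply/seteqP; split => z; case=> i.
    by move=> _ Iz; exists (K i) => //; exact: Iin.
  move=> /= iS iz; have si : (index i s < size s)%N by rewrite index_mem.
  by exists (Ordinal si) => //; rewrite /K/= nth_index.
move=> <-; first by rewrite (big_nth set0) big_mkord.
move=> i j _ _ /(component_disjoint (sS _ (Iin i)) (sS _ (Iin j))).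
move=> /eqP; rewrite nth_uniq// => /eqP; exact: val_inj.
Qed.

(** By [abs_sum_eq0] it suffices to extend a finite family s. First n is chosen so that mu is close
    to [massn n] on s; then t is chosen so that s ++ t leaves a set so small that the bounded
    density [dwei n] has little mass on it. As the circle has [massn n] equal to 0, the union of s
    ++ t nearly does too, and on t the error is controlled by [mass_tail_kappa]. *)
Lemma pm_closed_wpm F : carleson F -> pm_closed mu F = 0.
Proof.
move=> [cF Fc F0 Fk].
suff : abs_sum (components (circle R `\` F)) mu = 0 by rewrite /pm_closed => ->; rewrite oppr0.
have tp := @twopi_gt0 R.
have C0 : 0 <= 4 * pi + 4 :> R by rewrite addr_ge0// mulr_ge0// pi_ge0.
have Acirc : circle R `\` F `<=` circle R by move=> z [].
(* For F empty the circle is the only component, and its mass is 0 by definition. *)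
have [Fne|/set0P/negP/negPn/eqP FE] := pselect (F !=set0); last first.
  have c1 z : circle R z -> connected_component (circle R) z = circle R.
    by move=> zc; apply: connected_component_id => //; exact: (@circle_arc R).2.
  have mu0 J : components (circle R `\` F) J -> mu J = 0.
    by rewrite FE setD0 => -[z zc <-]; rewrite c1// pm_circle.
  apply: (@abs_sum_eq0 R _ _ (fun=> 0) 0 0) => //.
  - by move=> J /mu0 ->; rewrite normr0 mul0r.
  - by move=> s _ _; rewrite big1.
  - move=> s e us sS e0; exists [::]; rewrite cats0 big_nil mulr0 addr0; split => //.
    by rewrite big_seq big1 ?normr0 ?ltW// => J /sS/mu0.
have kge0 J : 0 <= kappa1 (arc_length J) by apply: kappa1_ge0; exact: arc_length_ge0.
have kfin : kappa_set F \is a fin_num.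
  rewrite ge0_fin_numE//; have := @components_sum_le R F [::] cF Fc Fne.
  by rewrite big_nil; apply.
apply: (@abs_sum_eq0 R _ _ (fun J => kappa1 (arc_length J)) (4 * pi + 4) (fine (kappa_set F))) => //.
- by move=> J /(component_arc Acirc)/(mass_kappa N1).
- by move=> s us sS; rewrite -lee_fin fineK//; exact: components_sum_le.
move=> s e us sS e0.
have e2 : 0 < e / 2 by rewrite divr_gt0.
have sarc J : J \in s -> is_arc J by move=> /sS/(component_arc Acirc).
have [n hn] : exists n, \sum_(J <- s) `|mu J - massn n J| < e / 2.
  have cJ J : (fun n => if J \in s then `|mu J - massn n J| else 0) @ \oo --> (0 : R).
    have [Js|_] := boolP (J \in s); last exact: cvg_cst.
    rewrite -[X in _ --> X](@normr0 _ R) -(subrr (mu J)); apply: cvg_norm.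
    by apply: cvgB; [exact: cvg_cst|exact: (mass_cvg N1 (sarc _ Js))].
  have := cvg_bigsum (s := s) cJ; rewrite big1// => /cvgrPdist_lt/(_ _ e2)[n _ /(_ n (leqnn n))].
  rewrite sub0r normrN => h; exists n; apply: le_lt_trans h.
  rewrite (le_trans _ (ler_norm _))//; rewrite big_seq [leRHS]big_seq; apply: ler_sum => J Js.
  by rewrite Js.
have [M M0 HM] := cont_bounded 0 (2 * pi) (trigp_cont (@trigp_dwei R N n)).
(* With M a bound for the density, a leftover set of this measure has mass at most e / 2; the + 1
   avoids division by 0. *)
have d0 : 0 < e / 2 / (M + 1) by rewrite divr_gt0// ltr_wpDl.
have [u [uu uS hu]] := components_exhaust cF Fc F0 d0.
pose t := [seq J <- u | J \notin s].
have ut : uniq (s ++ t).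
  rewrite cat_uniq us filter_uniq// andbT/=; apply/hasPn => J; rewrite mem_filter.
  by case/andP.
have tS J : J \in s ++ t -> components (circle R `\` F) J.
  by rewrite mem_cat mem_filter => /orP[/sS|/andP[_ /uS]].
exists t; split => //.
have tarc J : J \in s ++ t -> is_arc J by move=> /tS/(component_arc Acirc).
have -> : \sum_(J <- s ++ t) mu J = \sum_(J <- s ++ t) massn n J +
    (\sum_(J <- s) (mu J - massn n J) + \sum_(J <- t) (mu J - massn n J)).
  rewrite -big_cat -big_split; apply: eq_bigr => J _ /=; ring.
have b1 : `|\sum_(J <- s ++ t) massn n J| <= e / 2.
  rewrite (massn_seq n ut tS).
  pose U := \bigcup_(J in [set` s ++ t]) J.
  have mU : measurable (cset U) by exact: measurable_cset_seq.
  have mD : measurable (per `\` cset U) by apply: measurableD => //; exact: measurable_per.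
  have Uper : cset U `<=` per by move=> x [].
  have lD : (leb R (per `\` cset U) < (e / 2 / (M + 1))%:E)%E.
    apply: le_lt_trans hu; apply: le_measure; rewrite ?inE//.
      apply: measurableD; first exact: measurable_per.
      by apply: measurable_cset_seq => J /uS/(component_arc Acirc).
    move=> x [px nU]; split => // -[_ [J Ju Jx]]; apply: nU; split => //.
    by exists J => //=; rewrite mem_cat mem_filter; move: Ju => /= ->; rewrite andbT orbN.
  have ri (D : set R) : measurable D -> D `<=` per -> rint D (dwei n).
    by move=> mD' Dp; apply: rint_dwei.
  have split_int : J (dwei n) = massn n U + \int[leb R]_(x in per `\` cset U) dwei n x.
    rewrite /J /massn -(@Rintegral_setU _ _ _ (leb R))//.
    - by rewrite setDUK.
    - by rewrite setDUK//; apply: ri => //; exact: measurable_per.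
    - by rewrite disj_set2E; apply/eqP/seteqP; split => // x [h [_ h2]].
  have -> : massn n U = - \int[leb R]_(x in per `\` cset U) dwei n x.
    by apply/eqP; rewrite -addr_eq0 -split_int massn_circle.
  rewrite normrN.
  have := Rintegral_close (k := 0) (e := M) mD (lt_trans lD (ltry _)) (ri _ mD (@subDsetl _ _ _)).
  rewrite mul0r subr0 => /(_ _)/le_trans; apply.
    by move=> x [/andP[x0 x2] _]; rewrite subr0; apply: HM; rewrite x0 ltW.
  have lf : fine (leb R (per `\` cset U)) <= e / 2 / (M + 1).
    rewrite -lee_fin fineK ?ltW// ge0_fin_numE//; exact: lt_trans lD (ltry _).
  apply: (@le_trans _ _ (M * (e / 2 / (M + 1)))); first by apply: ler_wpM2l.
  rewrite mulrCA ger_pMr// ler_pdivrMr ?ltr_wpDl// mul1r; lra.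
have b2 : `|\sum_(J <- s) (mu J - massn n J)| <= e / 2.
  by apply: le_trans (ler_norm_sum _ _ _) _; exact: ltW.
have b3 : `|\sum_(J <- t) (mu J - massn n J)| <= (4 * pi + 4) * \sum_(J <- t) kappa1 (arc_length J).
  rewrite mulr_sumr; apply: le_trans (ler_norm_sum _ _ _) _.
  rewrite big_seq [leRHS]big_seq; apply: ler_sum => J Jt; apply: mass_tail_kappa.
  by apply: tarc; rewrite mem_cat Jt orbT.
rewrite addrA; apply: le_trans (ler_normD _ _) _; apply: lerD => //.
by apply: le_trans (ler_normD _ _) _; rewrite (splitr e); exact: lerD.
Qed.

End SingularPart.


(** * From closed sets to Borel sets *)

Section SingularMeasure.
Context {R : realType}.
Implicit Types (z : Cx R) (E F B : set (Cx R)).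

Lemma carleson_sub E F : carleson F -> closed E -> E `<=` F -> carleson E.
Proof.
move=> [cF Fc F0 Fk] cE EF; split => //; first exact: subset_trans EF Fc.
  have mper G : closed G -> measurable (per `&` cis (R := R) @^-1` G).
    move=> cG; apply: measurableI; first exact: measurable_per.
    by apply: closed_measurable; exact: closed_cis_preimage.
  apply/eqP; rewrite eq_le; apply/andP; split; last first.
    by apply: mule_ge0; [rewrite lee_fin invr_ge0 ltW// twopi_gt0|exact: measure_ge0].
  rewrite -F0 /haar; apply: lee_wpmul2l; first by rewrite lee_fin invr_ge0 ltW// twopi_gt0.
  by apply: le_measure; rewrite ?inE; [exact: mper|exact: mper|apply: setIS; exact: preimage_subset].
apply: le_lt_trans Fk; apply: le_ereal_sup => _ [E1 [E1fin E1E] <-].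
by exists E1 => //; split => //; exact: subset_trans EF.
Qed.

(* Closed sets determine a charge, by Dynkin's pi-lambda theorem. *)
Lemma charge_closed_eq0 (nu : {charge set (borelC R) -> \bar R}) F : closed F ->
  (forall E, closed E -> E `<=` F -> nu E = 0%E) ->
  forall B : set (borelC R), measurable B -> B `<=` F -> nu B = 0%E.
Proof.
move=> cF nu0 B mB BF.
have mclosed E : closed E -> measurable (E : set (borelC R)).
  move=> cE; rewrite -[E]setCK; apply: measurableC; apply: sub_sigma_algebra.
  exact: closed_openC.
have mF := mclosed _ cF.
have split_eq0 (A : set (borelC R)) : measurable A -> nu (F `\` A) = 0%E -> nu (F `&` A) = 0%E.
  move=> mA A0; have := chargeDI nu mF mA.
  by rewrite A0 add0e (nu0 _ cF (@subset_refl _ F)) => <-.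
suff : nu (F `&` B) = 0%E by rewrite setIidr.
have dyn := @dynkin_induction _ (borelC R) (@open (Cx R)) (fun B => nu (F `&` B) = 0%E)
  (erefl _) (@openI (Cx R)).
refine (dyn _ _ _ _ B mB).
- by rewrite setIT; exact: nu0.
- move=> U oU; apply: split_eq0; first exact: sub_sigma_algebra.
  by apply: nu0; [apply: closedI => //; exact: open_closedC|exact: subDsetl].
- by move=> A mA A0; apply: split_eq0; [exact: measurableC|rewrite setDE setCK].
move=> A mA tA A0; rewrite setI_bigcupr.
have h : (fun n => \sum_(0 <= i < n) nu (F `&` A i))%E @ \oo --> nu (\bigcup_k (F `&` A k)).
  apply: charge_semi_sigma_additive.
  - by move=> k; exact: measurableI.
  - exact: trivIset_setIl.
  - by apply: bigcup_measurable => k _; exact: measurableI.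
have h0 : (fun n => \sum_(0 <= i < n) nu (F `&` A i))%E @ \oo --> (0 : \bar R).
  rewrite (_ : (fun n => _) = fun=> 0%E); first exact: cvg_cst.
  by apply/funext => n; rewrite big1.
exact: (cvg_unique _ h h0).
Qed.

End SingularMeasure.

(** * The singular measure and the theorem *)

Section SingularPartVanishes.
Context {R : realType}.
Variable N : nat.
Hypothesis N1 : (1 < N)%N.

Local Notation mu := (@wpm R N N1).

Lemma singular_measure_exists_wpm : exists ms, is_singular_measure mu ms.
Proof.
exists (fun=> 0); split => F cF; last by rewrite pm_closed_wpm.
by exists czero.
Qed.

(** Closed subsets of the closure of B are again Carleson sets, so the charge that represents [ms]
    there vanishes on them by [pm_closed_wpm], and then on B by [charge_closed_eq0]. *)
Lemma singular_measure_wpm ms B : is_singular_measure mu ms -> singular_domain B -> ms B = 0.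
Proof.
move=> [msnu msF] [mB cB]; have [nu nuE] := msnu _ cB.
have cF := cB; have [closedF _ _ _] := cF.
have mclosed E : closed E -> measurable (E : set (borelC R)).
  move=> cE; rewrite -[E]setCK; apply: measurableC; apply: sub_sigma_algebra.
  exact: closed_openC.
have nuB : nu B = 0%E.
  apply: (charge_closed_eq0 closedF) => // [E cE EF|]; last exact: subset_closure.
  rewrite nuE//; last exact: mclosed.
  have carE := carleson_sub cF cE EF.
  by rewrite (msF _ carE) pm_closed_wpm.
by have := nuE B mB (@subset_closure _ B); rewrite nuB => -[].
Qed.

End SingularPartVanishes.

Theorem proposition60 (R : realType) (N : nat) (hN : (2 <= N)%N) :
  exists mu : premeasure R,
    unique (fun nu : premeasure R =>
              has_power_series (wtransform nu) (EN R N)) mu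
    /\ kappa_plus mu /\ kappa_minus mu
    /\ (forall A, is_arc A -> pm_push N mu A = mu A)
    (* With the stated normalizations the Fourier coefficient of mu at N ^ k is
       -1, so mu * mu = - mu. *)
    /\ (forall phi : R -> R, test_function phi ->
          dist_conv (dist_of mu) (dist_of mu) phi = - dist_of mu phi)
    /\ atomless mu
    /\ ~ is_signed_measure mu
    /\ (forall theta : R, 0 <= theta < 2 * pi ->
          (fun n : nat => - (pi^-1 *
             \sum_(0 <= k < n) N%:R ^- k * sin ((N ^ k)%:R * theta)))
            @ \oo --> cumul mu theta)
    /\ (forall z : Cx R, disc R z ->
          (fun n : nat => - (2 * \sum_(0 <= k < n) z ^+ (N ^ k)))
            @ \oo --> herglotz mu z)
    /\ (forall z : Cx R, disc R z ->
          (fun n : nat => \prod_(0 <= k < n) cexp (2 * z ^+ (N ^ k)))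
            @ \oo --> fpm mu z)
    /\ unit_A1 (fpm mu)
    /\ ~ nevanlinna (fpm mu)
    /\ (exists ms, is_singular_measure mu ms)
    /\ (forall ms, is_singular_measure mu ms ->
          forall B, singular_domain B -> ms B = 0).
Proof.
have fE z : disc R z -> fpm (wpm hN) z = cexp (2 * Lac N z) by exact: fpm_wpm.
exists (@wpm R N hN); split.
  split; first exact: power_series_wpm.
  by move=> nu hnu; apply: (@power_series_inj R _ _ (EN R N)) hnu; exact: power_series_wpm.
split; first exact: wpm_kappa_plus.
split; first exact: wpm_kappa_minus.
split; first exact: wpm_push.
split; first exact: dist_conv_wpm.
split; first exact: wpm_atomless.
split; first exact: not_signed_measure_wpm.
split; first exact: cumul_wpm_cvg.
split; first exact: herglotz_wpm_cvg.
split; first exact: fpm_wpm_cvg.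
split; first exact: unit_A1_exp fE.
split; first exact: not_nevanlinna_exp fE.
split; first exact: singular_measure_exists_wpm.
move=> ms hms B hB; exact: (singular_measure_wpm hms hB).
Qed.
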